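(* Let $a,b$ be positive integers and write $\zeta_b:=e^{2\pi i/b}$. \begin{enumerate} \item If $2\pi\frac{a}{b}\in(0,\theta_{13})$, then as $n\to\infty$, $$Q_n(\zeta_b^a)\sim \frac{\sqrt{1-\zeta_b^a}\,\mathrm{Li}_2(\zeta_b^a)^{\frac14}}{2\sqrt{\pi}\,n^{\frac34}}\exp\left(2\sqrt{\mathrm{Li}_2(\zeta_b^a)}\sqrt{n}\right).$$ \item If $2\pi\frac{a}{b}\in(\theta_{23},\pi)$, then as $n\to\infty$, $$Q_n(\zeta_b^a)\sim \frac{(-1)^n\sqrt{1-\zeta_b^a}\,\mathrm{Li}_2(\zeta_b^{2a})^{\frac14}}{2\sqrt{2\pi}\,n^{\frac34}}\exp\left(\sqrt{\mathrm{Li}_2(\zeta_b^{2a})}\sqrt{n}\right).$$ \item If $2\pi\frac{a}{b}\in(\theta_{13},\theta_{23})\setminus\{\frac{2\pi}{3}\}$, then as $n\to\infty$, $$Q_n(\zeta_b^a)\sim\left(\zeta_3^{-n}\omega_{1,3}(\zeta_b^a)+\zeta_3^{-2n}\omega_{2,3}(\zeta_b^a)\right)\frac{\mathrm{Li}_2(\zeta_b^{3a})^{\frac14}}{2\sqrt{3\pi}\,n^{\frac34}}\exp\left(\frac23\sqrt{\mathrm{Li}_2(\zeta_b^{3a})}\sqrt{n}\right).$$ \item As $n\to\infty$, $$Q_n(\zeta_3)\sim\frac{\zeta_3^{-2n}(1-\zeta_3^2)^{\frac16}(1-\zeta_3)^{\frac12}\,\Gamma\left(\frac13\right)}{2(6\pi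 n)^{\frac23}}\exp\left(\frac{2\pi}{3}\sqrt{\frac{n}{6}}\right).$$ \end{enumerate}
   Context: $\zeta_m:=e^{2\pi i/m}$. For a complex number $\zeta$, the numbers $Q_n(\zeta)$ are defined by $\sum_{n\ge0}Q_n(\zeta)q^n=\frac{1}{(\zeta q;q)_\infty}$, where $(x;q)_\infty:=\prod_{m\ge0}(1-xq^m)$. Equivalently, $Q_n(\zeta)=\sum_{\lambda\vdash n}\zeta^{\ell(\lambda)}$, where $\ell(\lambda)$ is the number of parts of the partition $\lambda$. $\mathrm{Li}_2(z):=\sum_{n\ge1}z^n/n^2$ for $|z|\le1$. Principal branches of square roots, fourth roots, complex powers and logarithms are used throughout. For $0\le\theta\le\pi$ and $k\ge1$ set $\Psi_k(\theta):=\mathrm{Re}\left(\sqrt{\mathrm{Li}_2(e^{ik\theta})}/k\right)$. The constant $\theta_{13}=2.06672\ldots\in(0,\frac{2\pi}{3})$ is the solution of $\Psi_1(\theta)=\Psi_3(\theta)$, and $\theta_{23}=2.36170\ldots\in(\frac{2\pi}{3},\pi)$ is the solution of $\Psi_2(\theta)=\Psi_3(\theta)$. For integers $h,k\ge1$ and complex $z$, set $\omega_{h,k}(z):=\prod_{j=1}^k(1-z\zeta_k^{jh})^{\frac jk-\frac12}$. *)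

(* Defs.v *)
From Stdlib Require Import Reals Lra Lia Arith.
From Coquelicot Require Import Coquelicot.
From Stdlib Require Import List Sorted.
Import ListNotations.

Definition is_partition (n : nat) (l : list nat) : Prop :=
  Sorted ge l /\ Forall (lt 0) l /\ list_sum l = n.

(* Partitions of [n] with at most [len] parts, all of them at most [m]; [k]
   runs over the largest part. *)
Fixpoint partitions_aux (len m n : nat) : list (list nat) :=
  match n, len with
  | O, _ => [[]]
  | S _, O => []
  | S _, S len' =>
      flat_map (fun k => map (cons k) (partitions_aux len' k (n - k)))
               (seq 1 (Nat.min m n))
  end.

Definition partitions (n : nat) : list (list nat) := partitions_aux n n n.

Lemma in_partitions_aux len m n l :
  In l (partitions_aux len m n) <->
  Sorted ge (m :: l) /\ Forall (lt 0) l /\ list_sum l = n /\ (length l <= len)%nat.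
Proof.
revert m n l; induction len as [|len IH]; intros m n l.
- destruct n as [|n]; simpl; split.
  + intros [<-|[]]; repeat split; repeat constructor.
  + intros (_ & _ & _ & Hl); left; destruct l; simpl in *; [easy | lia].
  + easy.
  + intros (_ & _ & Hs & Hl); destruct l; simpl in *; lia.
- destruct n as [|n].
  + simpl; split.
    * intros [<-|[]]; repeat split; repeat constructor; simpl; lia.
    * intros (_ & Hp & Hs & _); left; destruct l as [|x l]; [easy|].
      inversion Hp; subst; simpl in Hs; lia.
  + cbn [partitions_aux]; rewrite in_flat_map; split.
    * intros (k & Hk & Hl); apply in_seq in Hk.
      apply in_map_iff in Hl; destruct Hl as (l' & <- & Hl').
      apply IH in Hl'; destruct Hl' as (H1 & H2 & H3 & H4).
      repeat split; [constructor; [exact H1 | constructor; lia]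
                    | constructor; [lia | exact H2] | simpl; lia | simpl; lia].
    * intros (H1 & H2 & H3 & H4); destruct l as [|k l]; [discriminate|].
      simpl in H3, H4.
      inversion H1 as [|? ? Hs Hd]; inversion Hd; inversion H2; subst.
      exists k; split; [apply in_seq; lia|].
      apply in_map, IH; repeat split; [easy | easy | lia | lia].
Qed.

Lemma partitions_spec n l : In l (partitions n) <-> is_partition n l.
Proof.
unfold partitions, is_partition; rewrite in_partitions_aux; split.
- intros (H1 & H2 & H3 & _); inversion H1; easy.
- intros (H1 & H2 & H3); repeat split; auto.
  + constructor; [exact H1|].
    destruct l; constructor; simpl in H3; lia.
  + clear H1; revert n H3; induction H2 as [|x l Hx Hl IH]; simpl.
    * lia.
    * intros n H; specialize (IH _ eq_refl); lia.
Qed.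

Lemma partitions_NoDup n : NoDup (partitions n).
Proof.
unfold partitions; generalize n at 1 2 as len; intros len.
assert (H : forall m, NoDup (partitions_aux len m n)); [|apply H].
revert n; induction len as [|len IH]; intros [|n] m; cbn [partitions_aux];
  try (repeat constructor; easy).
generalize (seq_NoDup (Nat.min m (S n)) 1).
generalize (seq 1 (Nat.min m (S n))); intros s Hs.
induction Hs as [|k s Hk Hs IHs]; [constructor|].
cbn [flat_map]; apply NoDup_app.
- apply NoDup_map_NoDup_ForallPairs; [|apply IH].
  intros ? ? _ _ E; now injection E.
- exact IHs.
- intros l H1 H2; apply in_map_iff in H1; destruct H1 as (l1 & <- & _).
  apply in_flat_map in H2; destruct H2 as (k' & Hk' & H2).
  apply in_map_iff in H2; destruct H2 as (l2 & E & _).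
  injection E; intros _ ->; easy.
Qed.

Open Scope C_scope.

Definition Csum (l : list C) : C := fold_right Cplus 0 l.
Definition Cprod (l : list C) : C := fold_right Cmult 1 l.

Definition Q (n : nat) (zeta : C) : C :=
  Csum (map (fun lambda => zeta ^ length lambda) (partitions n)).

Definition Cexp (z : C) : C :=
  RtoC (exp (Re z)) * (cos (Im z), sin (Im z)).

(* The argument lies in (-PI, PI]; the value at 0 is irrelevant. *)
Definition Carg (z : C) : R :=
  if Rle_dec 0 (Im z)
  then acos (Re z / Cmod z)
  else (- acos (Re z / Cmod z))%R.

Definition Clog (z : C) : C := (ln (Cmod z), Carg z).

Definition Cpower (z w : C) : C :=
  if Ceq_dec z 0 then (if Ceq_dec w 0 then 1 else 0) else Cexp (w * Clog z).

Definition Csqrt (z : C) : C := Cpower z (RtoC (1 / 2)).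
Definition Croot4 (z : C) : C := Cpower z (RtoC (1 / 4)).

Definition zeta (m : nat) : C := Cexp (0%R, (2 * PI / INR m)%R).

(* Only meaningful where the series converges, i.e. for [Cmod z <= 1]. *)
Definition Li2 (z : C) : C :=
  @iota C_CompleteNormedModule
    (fun s : C => is_series (V := C_NormedModule)
       (fun n => z ^ (S n) / RtoC (INR (S n) ^ 2)) s).

(* Euler's integral, for [0 < x]. *)
Definition Gamma (x : R) : R :=
  RInt_gen (fun t => Rpower t (x - 1) * exp (- t))%R
           (at_right 0) (Rbar_locally p_infty).

Definition omega (h k : nat) (z : C) : C :=
  Cprod (map (fun j => Cpower (1 - z * zeta k ^ (j * h))
                              (RtoC (INR j / INR k - 1 / 2)))
             (seq 1 k)).

Definition Psi (k : nat) (theta : R) : R :=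
  Re (Csqrt (Li2 (Cexp (0%R, (INR k * theta)%R))) / RtoC (INR k)).

(* [iota] is definite description: the unique [t] with the given property
   (2.06672... here, 2.36170... below). *)
Definition theta13 : R :=
  @iota R_CompleteNormedModule
    (fun t : R => (0 < t < 2 * PI / 3)%R /\ Psi 1 t = Psi 3 t).

Definition theta23 : R :=
  @iota R_CompleteNormedModule
    (fun t : R => (2 * PI / 3 < t < PI)%R /\ Psi 2 t = Psi 3 t).

(* [f = g (1 + o(1))] at infinity, i.e. [f n / g n] tends to 1 wherever the
   sequences do not vanish. *)
Definition asymp (f g : nat -> C) : Prop :=
  is_equiv (V := C_NormedModule) eventually f g.

(* Main.v *)
(* The generating function [1/(z q; q)] is integrated over a circle of radius
   [exp(-eta)], [eta] of order [n^(-1/2)].  Writing [q = exp(2 pi i h/k - t)] and sorting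
   the factors [1 - z q^m] by the residue of [m] modulo [k], its logarithm is
   [Li2(z^k)/(k^2 t)] plus a bounded term, so the arcs around fractions of denominator
   [k] contribute [exp(2 Re(sqrt(Li2(z^k))/k) sqrt n)]: the denominator with the largest
   [Psi k] wins, and Laplace's method on its arcs gives the main term, whose constant
   is the exponential of [sum_j (j/k - 1/2) log(1 - z zeta_k^(jh))].  For [z = zeta 3] one of
   these logarithms is singular and is replaced by the behaviour of
   [sum_(l >= 0) log(1 - exp(-s(l + x)))] as [s] tends to 0, which is obtained from the
   Bohr-Mollerup characterization of [Gamma] and a duplication formula.

   The comparison of the [Psi k] rests on [Re Li2(e^(it)) = pi^2/6 - t(2 pi - t)/4] and
   on the derivative [- ln(2 sin(t/2))] of the imaginary part: the square of
   [Re(sqrt(Li2(e^(it))))] is strictly decreasing on [[0, pi]], and the function itself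
   stays above [0.385 (pi - t)] on [[0, 1]] and below it on [[2 pi/3, pi]]. *)
Require Import Defs.
From Stdlib Require Import Reals ZArith Lra Lia List Znumtheory Machin Ranalysis5.
From Coquelicot Require Import Coquelicot.
Open Scope R_scope.

(** * Complex exponential and differentiation along the real line *)

(** No contour is deformed: complex functions are differentiated only along real parameters, and the
    mean value inequality [Cmvt] takes the place of analytic arguments. The circle has radius
    [exp (- Re sg / sqrt n)] with [sg ^ 2] equal to [Li2(z^k)/k^2], so that it passes through the
    saddle [t = sg / sqrt n], in general off the centre of its arc. No Farey dissection is needed
    either. For given [eps], either the numbers [1 - q^r] with [r] below a bound are all at least of
    order [eta], and then the logarithm is at most [eps / eta], or [q] lies within [O(eta)] of a
    root of unity of bounded order. Hence only sectors [|Im t| <= M Re t] occur, and a positive gap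
    between the largest [Psi k ^ 2] and all others makes everything away from the saddles
    exponentially small. An equivalence also requires the main term to stay away from 0. With
    denominator 3 two arcs compete; they cannot cancel because their coefficients have different
    moduli. At [zeta 3] these two arcs carry different powers of [eta], and only one survives. *)

Lemma Ceq_ReIm (a b : C) : Re a = Re b -> Im a = Im b -> a = b.
Proof. destruct a, b; simpl; intros -> ->; reflexivity. Qed.

Lemma Re_plus (a b : C) : Re (a + b)%C = Re a + Re b. Proof. reflexivity. Qed.
Lemma Im_plus (a b : C) : Im (a + b)%C = Im a + Im b. Proof. reflexivity. Qed.
Lemma Re_minus (a b : C) : Re (a - b)%C = Re a - Re b. Proof. reflexivity. Qed.
Lemma Im_minus (a b : C) : Im (a - b)%C = Im a - Im b. Proof. reflexivity. Qed.
Lemma Re_opp (a : C) : Re (- a)%C = - Re a. Proof. reflexivity. Qed.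
Lemma Im_opp (a : C) : Im (- a)%C = - Im a. Proof. reflexivity. Qed.
Lemma Re_mult (a b : C) : Re (a * b)%C = Re a * Re b - Im a * Im b. Proof. reflexivity. Qed.
Lemma Im_mult (a b : C) : Im (a * b)%C = Re a * Im b + Im a * Re b. Proof. reflexivity. Qed.
Lemma Re_RtoC (a : R) : Re (RtoC a) = a. Proof. reflexivity. Qed.
Lemma Im_RtoC (a : R) : Im (RtoC a) = 0. Proof. reflexivity. Qed.

Lemma Cmod_sqr (z : C) : Cmod z * Cmod z = Re z * Re z + Im z * Im z.
Proof.
unfold Cmod; rewrite sqrt_sqrt; [unfold Re, Im; simpl; ring|].
destruct z; simpl; nra.
Qed.

Lemma Re_le_Cmod (z : C) : Rabs (Re z) <= Cmod z.
Proof. eapply Rle_trans; [apply Rmax_l|apply Rmax_Cmod]. Qed.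
Lemma Im_le_Cmod (z : C) : Rabs (Im z) <= Cmod z.
Proof. eapply Rle_trans; [apply Rmax_r|apply Rmax_Cmod]. Qed.
Lemma Cmod_le_ReIm (z : C) : Cmod z <= Rabs (Re z) + Rabs (Im z).
Proof.
apply Rsqr_incr_0_var; [|apply Rplus_le_le_0_compat; apply Rabs_pos].
unfold Rsqr; rewrite Cmod_sqr.
pose proof (Rabs_pos (Re z)); pose proof (Rabs_pos (Im z)).
pose proof (Rsqr_abs (Re z)); pose proof (Rsqr_abs (Im z)); unfold Rsqr in *; nra.
Qed.
Lemma Re_le (z : C) : Re z <= Cmod z.
Proof. eapply Rle_trans; [apply Rle_abs|apply Re_le_Cmod]. Qed.

Lemma Cmod_RtoC_pos (r : R) : 0 <= r -> Cmod (RtoC r) = r.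
Proof. intros H; rewrite Cmod_R; apply Rabs_pos_eq; exact H. Qed.

Lemma Cmod_minus_sym (a b : C) : Cmod (a - b)%C = Cmod (b - a)%C.
Proof. rewrite <- Cmod_opp; f_equal; ring. Qed.

Lemma Cmod_triangle_minus (a b : C) : Cmod (a - b)%C <= Cmod a + Cmod b.
Proof. unfold Cminus; eapply Rle_trans; [apply Cmod_triangle|rewrite Cmod_opp; lra]. Qed.

Lemma Cmod_minus_ge (a b : C) : Cmod a - Cmod b <= Cmod (a - b)%C.
Proof.
pose proof (Cmod_triangle (a - b) b) as H.
replace (a - b + b)%C with a in H by ring; lra.
Qed.

(** Cauchy-Schwarz in the plane. Applied with a fixed direction [a], it reduces bounds on moduli of
    increments, sums and integrals to the real case. *)
Lemma Cdot_le (a b : C) : Re a * Re b + Im a * Im b <= Cmod a * Cmod b.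
Proof.
pose proof (Cmod_sqr a); pose proof (Cmod_sqr b).
pose proof (Cmod_ge_0 a); pose proof (Cmod_ge_0 b).
destruct (Rle_or_lt (Re a * Re b + Im a * Im b) 0); [nra|].
apply Rsqr_incr_0_var; [unfold Rsqr|nra].
replace (Cmod a * Cmod b * (Cmod a * Cmod b)) with ((Cmod a * Cmod a) * (Cmod b * Cmod b)) by ring.
rewrite H, H0.
pose proof (Rle_0_sqr (Re a * Im b - Im a * Re b)); unfold Rsqr in *; nra.
Qed.

Lemma C_neq0_Re (z : C) : Re z <> 0 -> z <> 0%C.
Proof. intros H ->; apply H; reflexivity. Qed.
Lemma C_neq0_Im (z : C) : Im z <> 0 -> z <> 0%C.
Proof. intros H ->; apply H; reflexivity. Qed.

Lemma RtoC_neq0 (r : R) : r <> 0 -> RtoC r <> 0%C.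
Proof. intros H; apply C_neq0_Re; exact H. Qed.

Lemma exp_mono (x y : R) : x <= y -> exp x <= exp y.
Proof. intros [H| ->]; [left; apply exp_increasing; exact H|right; reflexivity]. Qed.

Lemma Cexp_plus (a b : C) : Cexp (a + b)%C = (Cexp a * Cexp b)%C.
Proof.
unfold Cexp; rewrite Re_plus, Im_plus, exp_plus, cos_plus, sin_plus.
apply Ceq_ReIm; unfold Re, Im; simpl; ring.
Qed.

Lemma Cexp_0 : Cexp 0%C = 1%C.
Proof. unfold Cexp; simpl; rewrite exp_0, cos_0, sin_0; apply Ceq_ReIm; simpl; ring. Qed.

Lemma Re_Cexp (z : C) : Re (Cexp z) = exp (Re z) * cos (Im z).
Proof. unfold Cexp, Re, Im; simpl; ring. Qed.
Lemma Im_Cexp (z : C) : Im (Cexp z) = exp (Re z) * sin (Im z).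
Proof. unfold Cexp, Re, Im; simpl; ring. Qed.

Lemma Cmod_Cexp (z : C) : Cmod (Cexp z) = exp (Re z).
Proof.
apply Rsqr_inj; [apply Cmod_ge_0|left; apply exp_pos|].
unfold Rsqr; rewrite Cmod_sqr, Re_Cexp, Im_Cexp.
pose proof (sin2_cos2 (Im z)) as H; unfold Rsqr in H.
replace (exp (Re z) * exp (Re z)) with (exp (Re z) * exp (Re z) * (sin (Im z) * sin (Im z) + cos (Im z) * cos (Im z))) by (rewrite H; ring).
ring.
Qed.

Lemma Cexp_neq0 (z : C) : Cexp z <> 0%C.
Proof. apply Cmod_gt_0; rewrite Cmod_Cexp; apply exp_pos. Qed.

Lemma Cexp_opp (z : C) : Cexp (- z)%C = (/ Cexp z)%C.
Proof.
assert (H : (Cexp (- z) * Cexp z)%C = 1%C).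
{ rewrite <- Cexp_plus; replace (- z + z)%C with (RtoC 0) by ring; apply Cexp_0. }
replace (/ Cexp z)%C with ((Cexp (- z) * Cexp z) * / Cexp z)%C by (rewrite H; ring).
field; apply Cexp_neq0.
Qed.

Lemma Cexp_minus (a b : C) : Cexp (a - b)%C = (Cexp a / Cexp b)%C.
Proof. unfold Cminus; rewrite Cexp_plus, Cexp_opp; reflexivity. Qed.

Lemma Cexp_RtoC (r : R) : Cexp (RtoC r) = RtoC (exp r).
Proof. apply Ceq_ReIm; [rewrite Re_Cexp|rewrite Im_Cexp]; simpl; rewrite ?cos_0, ?sin_0; ring. Qed.

Lemma Cexp_pow (z : C) (n : nat) : (Cexp z ^ n)%C = Cexp (RtoC (INR n) * z)%C.
Proof.
induction n as [|n IH].
- simpl Cpow; replace (RtoC (INR 0) * z)%C with (RtoC 0) by (simpl; ring); rewrite Cexp_0; reflexivity.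
- rewrite Cpow_S, IH, <- Cexp_plus, S_INR, RtoC_plus; f_equal; ring.
Qed.

Lemma Cexp_2PI (k : Z) : Cexp (0, 2 * PI * IZR k)%R = 1%C.
Proof.
apply Ceq_ReIm; [rewrite Re_Cexp|rewrite Im_Cexp]; simpl; rewrite exp_0.
- replace (2 * PI * IZR k) with (2 * IZR k * PI) by ring.
  destruct (Z.lt_ge_cases k 0).
  + rewrite <- cos_neg. replace (- (2 * IZR k * PI)) with (0 + 2 * INR (Z.to_nat (- k)) * PI).
    2:{ rewrite INR_IZR_INZ, Z2Nat.id, opp_IZR by lia; ring. }
    rewrite cos_period, cos_0; ring.
  + replace (2 * IZR k * PI) with (0 + 2 * INR (Z.to_nat k) * PI).
    2:{ rewrite INR_IZR_INZ, Z2Nat.id by lia; ring. }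
    rewrite cos_period, cos_0; ring.
- replace (2 * PI * IZR k) with (2 * IZR k * PI) by ring.
  rewrite sin_eq_0_1; [ring|]; exists (2 * k)%Z; rewrite mult_IZR; ring.
Qed.

Lemma Cexp_Im_period (a b : R) (k : Z) : Cexp (a, b + 2 * PI * IZR k)%R = Cexp (a, b).
Proof.
replace (a, b + 2 * PI * IZR k)%R with ((a, b) + (0%R, (2 * PI * IZR k)%R))%C
  by (apply Ceq_ReIm; simpl; ring).
rewrite Cexp_plus, Cexp_2PI; ring.
Qed.

Definition is_Cderive (f : R -> C) (t : R) (d : C) : Prop :=
  is_derive (fun u => Re (f u)) t (Re d) /\ is_derive (fun u => Im (f u)) t (Im d).

Definition Ccontinuous (f : R -> C) (t : R) : Prop :=
  continuous (fun u => Re (f u)) t /\ continuous (fun u => Im (f u)) t.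

(* MVT for the projection of [f] onto the direction of [f b - f a]. *)
Lemma Cmvt_dom (f df : R -> C) (M dM : R -> R) (a b : R) : a <= b ->
  (forall t, a <= t <= b -> is_Cderive f t (df t)) ->
  (forall t, a <= t <= b -> is_derive M t (dM t)) ->
  (forall t, a <= t <= b -> Cmod (df t) <= dM t) ->
  Cmod (f b - f a)%C <= M b - M a.
Proof.
intros Hab Hd HM HdM.
set (D := (f b - f a)%C).
pose proof (Cmod_ge_0 D) as HD.
assert (Hder : forall t, a <= t <= b -> is_derive
  (fun t => Re D * Re (f t) + Im D * Im (f t) - Cmod D * M t) t
  (Re D * Re (df t) + Im D * Im (df t) - Cmod D * dM t)).
{ intros t Ht; destruct (Hd t Ht) as [H1 H2].
  exact (is_derive_minus _ _ t _ _
    (is_derive_plus _ _ t _ _ (is_derive_scal _ t (Re D) _ H1) (is_derive_scal _ t (Im D) _ H2))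
    (is_derive_scal _ t (Cmod D) _ (HM t Ht))). }
assert (HMab : 0 <= M b - M a).
{ destruct (MVT_gen M a b dM) as (c & Hc & ->).
  - intros t Ht; rewrite Rmin_left, Rmax_right in Ht by lra; apply HM; lra.
  - intros t Ht; rewrite Rmin_left, Rmax_right in Ht by lra.
    apply derivable_continuous_pt; eexists; apply is_derive_Reals, HM; lra.
  - rewrite Rmin_left, Rmax_right in Hc by lra.
    apply Rmult_le_pos; [|lra]; eapply Rle_trans; [apply Cmod_ge_0|apply HdM; lra]. }
destruct (Req_dec (Cmod D) 0) as [E|E]; [rewrite E; lra|].
destruct (MVT_gen (fun t => Re D * Re (f t) + Im D * Im (f t) - Cmod D * M t) a b
  (fun t => Re D * Re (df t) + Im D * Im (df t) - Cmod D * dM t)) as (c & Hc & Heq).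
- intros t Ht; rewrite Rmin_left, Rmax_right in Ht by lra; apply Hder; lra.
- intros t Ht; rewrite Rmin_left, Rmax_right in Ht by lra.
  apply derivable_continuous_pt; eexists; apply is_derive_Reals, Hder; lra.
- rewrite Rmin_left, Rmax_right in Hc by lra.
  assert (E2 : Cmod D * Cmod D = Re D * Re (f b) + Im D * Im (f b) - (Re D * Re (f a) + Im D * Im (f a))).
  { rewrite Cmod_sqr; unfold D; rewrite Re_minus, Im_minus; ring. }
  pose proof (Cdot_le D (df c)); pose proof (HdM c Hc).
  apply Rmult_le_reg_l with (Cmod D); [lra|].
  assert (Re D * Re (df c) + Im D * Im (df c) - Cmod D * dM c <= 0) by nra.
  assert ((Re D * Re (df c) + Im D * Im (df c) - Cmod D * dM c) * (b - a) <= 0) by nra.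
  lra.
Qed.

Lemma Cmvt (f df : R -> C) (a b M : R) : a <= b ->
  (forall t, a <= t <= b -> is_Cderive f t (df t)) ->
  (forall t, a <= t <= b -> Cmod (df t) <= M) ->
  Cmod (f b - f a)%C <= M * (b - a).
Proof.
intros Hab Hd HM.
replace (M * (b - a)) with (M * b - M * a) by ring.
apply (Cmvt_dom f df (fun t => M * t) (fun _ => M)); try assumption.
intros t _; auto_derive; [trivial|ring].
Qed.

Lemma is_Cderive_ext (f g : R -> C) t d : (forall u, f u = g u) -> is_Cderive f t d -> is_Cderive g t d.
Proof.
intros H [H1 H2]; split; (eapply is_derive_ext; [|eassumption]); intros u; simpl; rewrite H; reflexivity.
Qed.

Lemma is_Cderive_const (c : C) t : is_Cderive (fun _ => c) t 0%C.
Proof. split; simpl; apply @is_derive_const. Qed.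

Lemma is_Cderive_plus f g t a b : is_Cderive f t a -> is_Cderive g t b ->
  is_Cderive (fun u => f u + g u)%C t (a + b)%C.
Proof.
intros [H1 H2] [H3 H4]; split.
- exact (is_derive_plus (fun u => Re (f u)) (fun u => Re (g u)) t _ _ H1 H3).
- exact (is_derive_plus (fun u => Im (f u)) (fun u => Im (g u)) t _ _ H2 H4).
Qed.

Lemma is_Cderive_opp f t a : is_Cderive f t a -> is_Cderive (fun u => - f u)%C t (- a)%C.
Proof.
intros [H1 H2]; split.
- exact (is_derive_opp (fun u => Re (f u)) t (Re a) H1).
- exact (is_derive_opp (fun u => Im (f u)) t (Im a) H2).
Qed.

Lemma is_Cderive_minus f g t a b : is_Cderive f t a -> is_Cderive g t b ->
  is_Cderive (fun u => f u - g u)%C t (a - b)%C.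
Proof. intros; apply is_Cderive_plus; [assumption|apply is_Cderive_opp; assumption]. Qed.

Lemma is_derive_Rmult (f g : R -> R) t a b : is_derive f t a -> is_derive g t b ->
  is_derive (fun u => f u * g u) t (a * g t + f t * b).
Proof.
intros H1 H2; apply is_derive_Reals.
apply is_derive_Reals in H1; apply is_derive_Reals in H2.
apply (derivable_pt_lim_mult f g); assumption.
Qed.

Lemma is_Cderive_mult f g t a b : is_Cderive f t a -> is_Cderive g t b ->
  is_Cderive (fun u => f u * g u)%C t (a * g t + f t * b)%C.
Proof.
intros [H1 H2] [H3 H4]; split.
- replace (Re (a * g t + f t * b)%C) with
   ((Re a * Re (g t) + Re (f t) * Re b) - (Im a * Im (g t) + Im (f t) * Im b))
   by (rewrite Re_plus, !Re_mult; ring).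
  exact (is_derive_minus _ _ t _ _ (is_derive_Rmult _ _ t _ _ H1 H3) (is_derive_Rmult _ _ t _ _ H2 H4)).
- replace (Im (a * g t + f t * b)%C) with
   ((Re a * Im (g t) + Re (f t) * Im b) + (Im a * Re (g t) + Im (f t) * Re b))
   by (rewrite Im_plus, !Im_mult; ring).
  exact (is_derive_plus _ _ t _ _ (is_derive_Rmult _ _ t _ _ H1 H4) (is_derive_Rmult _ _ t _ _ H2 H3)).
Qed.

Lemma is_Cderive_Cexp f t a : is_Cderive f t a ->
  is_Cderive (fun u => Cexp (f u)) t (a * Cexp (f t))%C.
Proof.
intros [H1 H2]; split.
- apply is_derive_ext with (fun u => exp (Re (f u)) * cos (Im (f u))).
  { intros u; rewrite Re_Cexp; reflexivity. }
  rewrite Re_mult, Re_Cexp, Im_Cexp.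
  replace (Re a * (exp (Re (f t)) * cos (Im (f t))) - Im a * (exp (Re (f t)) * sin (Im (f t))))
   with ((Re a * exp (Re (f t))) * cos (Im (f t)) + exp (Re (f t)) * (Im a * - sin (Im (f t)))) by ring.
  apply (is_derive_Rmult (fun u => exp (Re (f u))) (fun u => cos (Im (f u)))).
  + apply (is_derive_comp exp (fun u => Re (f u))); [apply is_derive_exp|assumption].
  + apply (is_derive_comp cos (fun u => Im (f u))); [apply is_derive_cos|assumption].
- apply is_derive_ext with (fun u => exp (Re (f u)) * sin (Im (f u))).
  { intros u; rewrite Im_Cexp; reflexivity. }
  rewrite Im_mult, Re_Cexp, Im_Cexp.
  replace (Re a * (exp (Re (f t)) * sin (Im (f t))) + Im a * (exp (Re (f t)) * cos (Im (f t))))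
   with ((Re a * exp (Re (f t))) * sin (Im (f t)) + exp (Re (f t)) * (Im a * cos (Im (f t)))) by ring.
  apply (is_derive_Rmult (fun u => exp (Re (f u))) (fun u => sin (Im (f u)))).
  + apply (is_derive_comp exp (fun u => Re (f u))); [apply is_derive_exp|assumption].
  + apply (is_derive_comp sin (fun u => Im (f u))); [apply is_derive_sin|assumption].
Qed.

Lemma is_Cderive_line (a b : C) t : is_Cderive (fun u => a + RtoC u * b)%C t b.
Proof.
split.
- apply is_derive_ext with (fun u => Re a + u * Re b); [intros u; simpl; unfold Re, Im; simpl; ring|].
  auto_derive; [trivial|unfold Re, Im; ring].
- apply is_derive_ext with (fun u => Im a + u * Im b); [intros u; simpl; unfold Re, Im; simpl; ring|].
  auto_derive; [trivial|unfold Re, Im; ring].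
Qed.

Lemma is_Cderive_RtoC (f : R -> R) t d : is_derive f t d -> is_Cderive (fun u => RtoC (f u)) t (RtoC d).
Proof. intros H; split; simpl; [exact H|apply @is_derive_const]. Qed.

Lemma is_derive_continuous_R (f : R -> R) t d : is_derive f t d -> continuous f t.
Proof. intros H; apply @ex_derive_continuous; exists d; exact H. Qed.

Lemma is_Cderive_continuous f t d : is_Cderive f t d -> Ccontinuous f t.
Proof. intros [H1 H2]; split; eapply is_derive_continuous_R; eassumption. Qed.

Lemma is_Cderive_inv f t a : is_Cderive f t a -> f t <> 0%C ->
  is_Cderive (fun u => / f u)%C t (- a / (f t * f t))%C.
Proof.
intros [H1 H2] H0.
assert (HN : Re (f t) * Re (f t) + Im (f t) * Im (f t) <> 0).
{ rewrite <- Cmod_sqr; apply Cmod_gt_0 in H0; nra. }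
assert (HD : is_derive (fun u => / (Re (f u) * Re (f u) + Im (f u) * Im (f u))) t
  (- ((Re a * Re (f t) + Re (f t) * Re a) + (Im a * Im (f t) + Im (f t) * Im a))
    / (Re (f t) * Re (f t) + Im (f t) * Im (f t)) ^ 2)).
{ apply (is_derive_inv (fun u => Re (f u) * Re (f u) + Im (f u) * Im (f u))); [|assumption].
  exact (is_derive_plus _ _ t _ _ (is_derive_Rmult _ _ t _ _ H1 H1) (is_derive_Rmult _ _ t _ _ H2 H2)). }
set (x := Re (f t)) in *; set (y := Im (f t)) in *.
assert (E : (- a / (f t * f t))%C =
   ((- Re a * (x * x - y * y) - Im a * (2 * x * y)) / (x * x + y * y) ^ 2,
    (- Im a * (x * x - y * y) + Re a * (2 * x * y)) / (x * x + y * y) ^ 2)).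
{ assert (Ef : f t = (x, y)) by (unfold x, y; destruct (f t); reflexivity).
  apply Ceq_ReIm; rewrite Ef; destruct a as [a1 a2]; unfold Re, Im; simpl; field; split; try assumption;
  intros E; apply HN; nra. }
rewrite E; split.
- apply is_derive_ext with (fun u => Re (f u) * / (Re (f u) * Re (f u) + Im (f u) * Im (f u))).
  { intros u; destruct (f u) as [p q]; unfold Re, Im; simpl. unfold Rdiv; f_equal; f_equal; ring. }
  evar_last; [exact (is_derive_Rmult _ _ t _ _ H1 HD)|].
  fold x y; match goal with |- _ = Re (?u, ?v) => change (Re (u, v)) with u end.
  cbv beta; fold x y; field; assumption.
- apply is_derive_ext with (fun u => - (Im (f u) * / (Re (f u) * Re (f u) + Im (f u) * Im (f u)))).
  { intros u; destruct (f u) as [p q]; unfold Re, Im; simpl. unfold Rdiv. 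
    rewrite <- Ropp_mult_distr_l; f_equal; f_equal; f_equal; ring. }
  evar_last; [exact (is_derive_opp _ t _ (is_derive_Rmult _ _ t _ _ H2 HD))|].
  fold x y; match goal with |- _ = Im (?u, ?v) => change (Im (u, v)) with v end.
  cbv beta; unfold opp; simpl; fold x y; field; assumption.
Qed.

Lemma Cexp_bound1 (y : C) : Cmod (Cexp y - 1)%C <= Cmod y * exp (Cmod y).
Proof.
pose proof (Cmvt (fun t => Cexp (0 + RtoC t * y)) (fun t => y * Cexp (0 + RtoC t * y))%C 0 1
  (Cmod y * exp (Cmod y)) ltac:(lra)) as H; cbv beta in H.
replace (Cexp (0 + RtoC 1 * y)) with (Cexp y) in H by (f_equal; ring).
replace (Cexp (0 + RtoC 0 * y)) with (RtoC 1) in H by (rewrite <- Cexp_0; f_equal; ring).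
rewrite Rminus_0_r, Rmult_1_r in H; apply H.
- intros t _; apply is_Cderive_Cexp, is_Cderive_line.
- intros t Ht; rewrite Cmod_mult, Cmod_Cexp.
  apply Rmult_le_compat_l; [apply Cmod_ge_0|].
  assert (Re (0 + RtoC t * y) <= Cmod y).
  { eapply Rle_trans; [apply Re_le|]. rewrite Cplus_0_l, Cmod_mult, Cmod_RtoC_pos by lra.
    pose proof (Cmod_ge_0 y); nra. }
  apply exp_mono; assumption.
Qed.

Lemma Re_seg_le (t : R) (y : C) : 0 <= t <= 1 -> Re (RtoC t * y)%C <= Cmod y.
Proof.
intros Ht; eapply Rle_trans; [apply Re_le|]; rewrite Cmod_mult, Cmod_RtoC_pos by lra.
pose proof (Cmod_ge_0 y); nra.
Qed.

Lemma Cmod_seg_le (t : R) (y : C) : 0 <= t <= 1 -> Cmod (RtoC t * y)%C <= Cmod y.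
Proof.
intros Ht; rewrite Cmod_mult, Cmod_RtoC_pos by lra; pose proof (Cmod_ge_0 y); nra.
Qed.

(** Along the segment [t * y] the derivative of a Taylor remainder is [y] times the remainder of the
    previous order, so each bound follows from the preceding one by [Cmvt]. *)
Lemma Cexp_bound2 (y : C) : Cmod (Cexp y - 1 - y)%C <= Cmod y ^ 2 * exp (Cmod y).
Proof.
pose proof (Cmvt (fun t => Cexp (0 + RtoC t * y) - (1 + RtoC t * y))%C
  (fun t => y * Cexp (0 + RtoC t * y) - y)%C 0 1
  (Cmod y ^ 2 * exp (Cmod y)) ltac:(lra)) as H; cbv beta in H.
replace (Cexp (0 + RtoC 1 * y)) with (Cexp y) in H by (f_equal; ring).
replace (Cexp (0 + RtoC 0 * y)) with (RtoC 1) in H by (rewrite <- Cexp_0; f_equal; ring).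
rewrite Rminus_0_r, Rmult_1_r in H.
replace (Cexp y - 1 - y)%C with (Cexp y - (1 + RtoC 1 * y) - (1 - (1 + RtoC 0 * y)))%C by ring.
apply H.
- intros t _; apply is_Cderive_minus; [apply is_Cderive_Cexp|]; apply is_Cderive_line.
- intros t Ht.
  replace (y * Cexp (0 + RtoC t * y) - y)%C with (y * (Cexp (RtoC t * y) - 1))%C
    by (rewrite Cplus_0_l; ring).
  rewrite Cmod_mult; simpl; rewrite Rmult_1_r, Rmult_assoc.
  apply Rmult_le_compat_l; [apply Cmod_ge_0|].
  eapply Rle_trans; [apply Cexp_bound1|].
  pose proof (Cmod_seg_le t y Ht).
  apply Rmult_le_compat; try apply Cmod_ge_0; [left; apply exp_pos|assumption|apply exp_mono; assumption].
Qed.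

Lemma Cexp_bound3 (y : C) : Cmod (Cexp y - 1 - y - y * y / 2)%C <= Cmod y ^ 3 * exp (Cmod y).
Proof.
pose proof (Cmvt (fun t => Cexp (0 + RtoC t * y) - (1 + RtoC t * y) - RtoC (t * t / 2) * (y * y))%C
  (fun t => y * Cexp (0 + RtoC t * y) - y - (RtoC t * (y * y) + RtoC (t * t / 2) * 0))%C 0 1
  (Cmod y ^ 3 * exp (Cmod y)) ltac:(lra)) as H; cbv beta in H.
replace (Cexp (0 + RtoC 1 * y)) with (Cexp y) in H by (f_equal; ring).
replace (Cexp (0 + RtoC 0 * y)) with (RtoC 1) in H by (rewrite <- Cexp_0; f_equal; ring).
rewrite Rminus_0_r, (Rmult_1_r (Cmod y ^ 3 * exp (Cmod y))) in H.
replace (Cexp y - 1 - y - y * y / 2)%C with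
  (Cexp y - (1 + RtoC 1 * y) - RtoC (1 * 1 / 2) * (y * y)
    - (1 - (1 + RtoC 0 * y) - RtoC (0 * 0 / 2) * (y * y)))%C.
2:{ rewrite !RtoC_div, !RtoC_mult by lra; field; apply RtoC_neq0; lra. }
apply H.
- intros t _; apply is_Cderive_minus; [apply is_Cderive_minus; [apply is_Cderive_Cexp|]; apply is_Cderive_line|].
  apply (is_Cderive_mult (fun t => RtoC (t * t / 2)) (fun _ => y * y)%C); [|apply is_Cderive_const].
  apply is_Cderive_RtoC; auto_derive; [trivial|field].
- intros t Ht.
  replace (y * Cexp (0 + RtoC t * y) - y - (RtoC t * (y * y) + RtoC (t * t / 2) * 0))%C
   with (y * (Cexp (RtoC t * y) - 1 - RtoC t * y))%C by (rewrite Cplus_0_l; ring).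
  rewrite Cmod_mult. change (Cmod y ^ 3) with (Cmod y * Cmod y ^ 2); rewrite Rmult_assoc.
  apply Rmult_le_compat_l; [apply Cmod_ge_0|].
  eapply Rle_trans; [apply Cexp_bound2|].
  pose proof (Cmod_seg_le t y Ht); pose proof (Cmod_ge_0 (RtoC t * y)).
  apply Rmult_le_compat; [apply pow2_ge_0|left; apply exp_pos|apply pow_incr; lra|apply exp_mono; assumption].
Qed.

Lemma Cexp_diff_le (a b : C) :
  Cmod (Cexp a - Cexp b)%C <= exp (Re b) * (Cmod (a - b)%C * exp (Cmod (a - b)%C)).
Proof.
replace (Cexp a - Cexp b)%C with (Cexp b * (Cexp (a - b) - 1))%C.
- rewrite Cmod_mult, Cmod_Cexp; apply Rmult_le_compat_l; [left; apply exp_pos|apply Cexp_bound1].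
- rewrite Cexp_minus; field; apply Cexp_neq0.
Qed.

(** * Complex series *)

Fixpoint Csumn (f : nat -> C) (n : nat) : C :=
  match n with O => 0%C | S m => (Csumn f m + f m)%C end.

Fixpoint Rsumn (f : nat -> R) (n : nat) : R :=
  match n with O => 0 | S m => Rsumn f m + f m end.

(** Componentwise, so that the theory of real series applies directly; [is_Cseries_Csumn] recovers
    convergence in modulus. *)
Definition is_Cseries (f : nat -> C) (l : C) : Prop :=
  is_series (fun n => Re (f n)) (Re l) /\ is_series (fun n => Im (f n)) (Im l).

Definition ex_Cseries (f : nat -> C) : Prop := exists l, is_Cseries f l.

Definition CSeries (f : nat -> C) : C :=
  (Series (fun n => Re (f n)), Series (fun n => Im (f n))).

Lemma Rsumn_sum_n (f : nat -> R) n : Rsumn f (S n) = sum_n f n.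
Proof.
induction n as [|n IH]; [rewrite sum_O; simpl; ring|].
rewrite sum_Sn, <- IH; reflexivity.
Qed.

Lemma Re_Csumn f n : Re (Csumn f n) = Rsumn (fun i => Re (f i)) n.
Proof. induction n as [|n IH]; [reflexivity|]; change (Csumn f (S n)) with (Csumn f n + f n)%C; rewrite Re_plus, IH; reflexivity. Qed.
Lemma Im_Csumn f n : Im (Csumn f n) = Rsumn (fun i => Im (f i)) n.
Proof. induction n as [|n IH]; [reflexivity|]; change (Csumn f (S n)) with (Csumn f n + f n)%C; rewrite Im_plus, IH; reflexivity. Qed.

Lemma is_series_Rsumn (a : nat -> R) (l : R) :
  is_series a l <-> forall eps : R, 0 < eps -> exists N, forall n, (N <= n)%nat -> Rabs (Rsumn a n - l) < eps.
Proof.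
split.
- intros H eps He.
  apply (is_lim_seq_spec (sum_n a) l) in H; destruct (H (mkposreal eps He)) as (N & HN).
  exists (S N); intros n Hn; destruct n as [|n]; [lia|].
  rewrite Rsumn_sum_n; apply HN; lia.
- intros H; apply (is_lim_seq_spec (sum_n a) l); intros eps.
  destruct (H eps (cond_pos eps)) as (N & HN); exists N; intros n Hn.
  rewrite <- Rsumn_sum_n; apply HN; lia.
Qed.

Lemma is_Cseries_Csumn f l :
  is_Cseries f l <-> forall eps : R, 0 < eps -> exists N, forall n, (N <= n)%nat -> Cmod (Csumn f n - l)%C < eps.
Proof.
split.
- intros [H1 H2] eps He.
  rewrite is_series_Rsumn in H1, H2.
  destruct (H1 (eps / 2)) as (N1 & HN1); [lra|]; destruct (H2 (eps / 2)) as (N2 & HN2); [lra|].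
  exists (max N1 N2); intros n Hn.
  eapply Rle_lt_trans; [apply Cmod_le_ReIm|].
  rewrite Re_minus, Im_minus, Re_Csumn, Im_Csumn.
  pose proof (HN1 n ltac:(lia)); pose proof (HN2 n ltac:(lia)); lra.
- intros H; split; apply is_series_Rsumn; intros eps He; destruct (H eps He) as (N & HN);
  exists N; intros n Hn; eapply Rle_lt_trans; [|apply (HN n Hn)| |apply (HN n Hn)].
  + rewrite <- Re_Csumn, <- Re_minus; apply Re_le_Cmod.
  + rewrite <- Im_Csumn, <- Im_minus; apply Im_le_Cmod.
Qed.

Lemma is_Cseries_unique f l : is_Cseries f l -> CSeries f = l.
Proof.
intros [H1 H2]; unfold CSeries.
apply Ceq_ReIm; [exact (is_series_unique _ _ H1)|exact (is_series_unique _ _ H2)].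
Qed.

Lemma CSeries_correct f : ex_Cseries f -> is_Cseries f (CSeries f).
Proof. intros (l & H); rewrite (is_Cseries_unique f l H); exact H. Qed.

Lemma is_Cseries_ext f g l : (forall n, f n = g n) -> is_Cseries f l -> is_Cseries g l.
Proof.
intros H [H1 H2]; split; (eapply is_series_ext; [|eassumption]); intros n; simpl; rewrite H; reflexivity.
Qed.

Lemma is_Cseries_plus f g a b : is_Cseries f a -> is_Cseries g b ->
  is_Cseries (fun n => f n + g n)%C (a + b)%C.
Proof. 
intros [H1 H2] [H3 H4]; split.
- exact (is_series_plus _ _ _ _ H1 H3).
- exact (is_series_plus _ _ _ _ H2 H4).
Qed.

Lemma is_Cseries_scal c f a : is_Cseries f a -> is_Cseries (fun n => c * f n)%C (c * a)%C.
Proof.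
intros [H1 H2]; split.
- exact (is_series_minus _ _ _ _ (is_series_scal (Re c) _ _ H1) (is_series_scal (Im c) _ _ H2)).
- exact (is_series_plus _ _ _ _ (is_series_scal (Re c) _ _ H2) (is_series_scal (Im c) _ _ H1)).
Qed.

Lemma is_Cseries_minus f g a b : is_Cseries f a -> is_Cseries g b ->
  is_Cseries (fun n => f n - g n)%C (a - b)%C.
Proof. 
intros [H1 H2] [H3 H4]; split.
- exact (is_series_minus _ _ _ _ H1 H3).
- exact (is_series_minus _ _ _ _ H2 H4).
Qed.

Lemma is_Cseries_RtoC f a : is_series f a -> is_Cseries (fun n => RtoC (f n)) (RtoC a).
Proof.
intros H; split; [exact H|].
apply is_series_Rsumn; intros eps He; exists O; intros n _.
replace (Rsumn (fun n0 => Im (RtoC (f n0))) n) with 0.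
- rewrite Im_RtoC, Rminus_0_r, Rabs_R0; exact He.
- induction n as [|n IH]; [reflexivity|].
  change (0 = Rsumn (fun n0 => Im (RtoC (f n0))) n + 0); rewrite <- IH; ring.
Qed.

Lemma ex_Cseries_abs f : ex_series (fun n => Cmod (f n)) -> ex_Cseries f.
Proof.
intros H.
assert (H1 : ex_series (fun n => Re (f n))).
{ apply (@ex_series_le R_AbsRing R_CompleteNormedModule) with (fun n => Cmod (f n)); [|exact H].
  intros n; apply Re_le_Cmod. }
assert (H2 : ex_series (fun n => Im (f n))).
{ apply (@ex_series_le R_AbsRing R_CompleteNormedModule) with (fun n => Cmod (f n)); [|exact H].
  intros n; apply Im_le_Cmod. }
exists (CSeries f); split; apply Series_correct; assumption.
Qed.

Lemma ex_series_dom (a b : nat -> R) : (forall n, Rabs (a n) <= b n) -> ex_series b -> ex_series a.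
Proof. intros H; apply (@ex_series_le R_AbsRing R_CompleteNormedModule); exact H. Qed.

Lemma ex_Cseries_dom f (b : nat -> R) : (forall n, Cmod (f n) <= b n) -> ex_series b -> ex_Cseries f.
Proof.
intros H Hb; apply ex_Cseries_abs, ex_series_dom with b; [|exact Hb].
intros n; rewrite Rabs_pos_eq; [apply H|apply Cmod_ge_0].
Qed.

Lemma is_series_le (a b : nat -> R) la lb : (forall n, a n <= b n) -> is_series a la -> is_series b lb -> la <= lb.
Proof.
intros H Ha Hb.
apply (is_lim_seq_le (sum_n a) (sum_n b) la lb); [|exact Ha|exact Hb].
intros n; apply sum_n_m_le; exact H.
Qed.

(** Projecting the terms onto the direction of the sum [l] reduces the bound to a comparison of two
    real series, as in [Cmvt_dom]. *)
Lemma Cmod_Cseries_le f l (b : nat -> R) lb : (forall n, Cmod (f n) <= b n) ->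
  is_Cseries f l -> is_series b lb -> Cmod l <= lb.
Proof.
intros H [H1 H2] Hb.
assert (Hlb : 0 <= lb).
{ apply (is_series_le (fun _ => 0) b); [intros n; eapply Rle_trans; [apply Cmod_ge_0|apply H]| |exact Hb].
  apply is_series_Rsumn; intros eps He; exists O; intros n _.
  replace (Rsumn (fun _ => 0) n) with 0 by (induction n; simpl; lra).
  rewrite Rminus_0_r, Rabs_R0; exact He. }
destruct (Req_dec (Cmod l) 0) as [E|E]; [rewrite E; exact Hlb|].
pose proof (Cmod_ge_0 l).
apply Rmult_le_reg_l with (Cmod l); [lra|].
rewrite Cmod_sqr.
apply (is_series_le (fun n => Re l * Re (f n) + Im l * Im (f n)) (fun n => Cmod l * b n)).
- intros n; eapply Rle_trans; [apply Cdot_le|]; apply Rmult_le_compat_l; [lra|apply H].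
- exact (is_series_plus _ _ _ _ (is_series_scal (Re l) _ _ H1) (is_series_scal (Im l) _ _ H2)).
- exact (is_series_scal (Cmod l) _ _ Hb).
Qed.

(** [Li2] is a definite description, so its value is accessible only through existence and
    uniqueness of the limit in the normed module of complex numbers. *)
Lemma Li2_is_Cseries z l : is_Cseries (fun n => z ^ S n / RtoC (INR (S n) ^ 2))%C l -> Li2 z = l.
Proof.
intros H; unfold Li2.
assert (Hs : @is_series C_AbsRing C_NormedModule (fun n => z ^ S n / RtoC (INR (S n) ^ 2))%C l).
{ apply (proj2 (@filterlim_locally_ball_norm C_AbsRing nat C_NormedModule eventually _ _ l)).
  rewrite is_Cseries_Csumn in H.
  intros eps; destruct (H eps (cond_pos eps)) as (N & HN); exists N; intros n Hn.
  change (Cmod (sum_n (G := C_AbelianGroup) (fun n => z ^ S n / RtoC (INR (S n) ^ 2))%C n - l)%C < eps).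
  replace (sum_n (G := C_AbelianGroup) (fun n => z ^ S n / RtoC (INR (S n) ^ 2))%C n)
    with (Csumn (fun n => z ^ S n / RtoC (INR (S n) ^ 2))%C (S n)); [apply HN; lia|].
  clear. induction n as [|n IH]; [rewrite sum_O; simpl Csumn; rewrite Cplus_0_l; reflexivity|].
  rewrite sum_Sn, <- IH; reflexivity. }
apply (@iota_unique C_AbsRing C_CompleteNormedModule); [|exact Hs].
intros y Hy.
exact (@filterlim_locally_unique _ C_AbsRing C_NormedModule _ (Proper_StrongProper _ eventually_filter) _ y l Hy Hs).
Qed.

Lemma Csumn_ext f g n : (forall i, (i < n)%nat -> f i = g i) -> Csumn f n = Csumn g n.
Proof.
induction n as [|n IH]; intros H; [reflexivity|]; simpl; rewrite IH by (intros; apply H; lia).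
rewrite H by lia; reflexivity.
Qed.
Lemma Csumn_scal c f n : Csumn (fun i => c * f i)%C n = (c * Csumn f n)%C.
Proof. induction n as [|n IH]; simpl; [ring|rewrite IH; ring]. Qed.
Lemma Cmod_Csumn_le f b n : (forall i, (i < n)%nat -> Cmod (f i) <= b i) -> Cmod (Csumn f n) <= Rsumn b n.
Proof.
induction n as [|n IH]; intros H; simpl; [rewrite Cmod_0; lra|].
eapply Rle_trans; [apply Cmod_triangle|]; apply Rplus_le_compat; [apply IH; intros; apply H; lia|apply H; lia].
Qed.

Lemma Csumn_geom w n : ((1 - w) * Csumn (fun i => w ^ i) n)%C = (1 - w ^ n)%C.
Proof.
induction n as [|n IH]; [simpl; ring|]; simpl Csumn.
replace ((1 - w) * (Csumn (fun i => w ^ i) n + w ^ n))%C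
  with ((1 - w) * Csumn (fun i => w ^ i) n + (1 - w) * w ^ n)%C by ring.
rewrite IH, Cpow_S; ring.
Qed.

Lemma Csumn_Abel w c m :
  ((1 - w) * Csumn (fun i => w ^ i * c i) m
   = c O - w ^ m * c m + Csumn (fun i => w ^ S i * (c (S i) - c i)) m)%C.
Proof.
induction m as [|m IH]; [cbn [Csumn]; change (w ^ 0)%C with (RtoC 1); ring|].
cbn [Csumn]. rewrite Cmult_plus_distr_l, IH. rewrite !Cpow_S; ring.
Qed.

(** Summation by parts: the partial sums of [w ^ i] are bounded by a multiple of [1 / |1 - w|], so
    the sum is controlled by the total variation of [c] instead of its absolute sum. This is where
    the oscillation of [w <> 1] is exploited. *)
Lemma Abel_bound w c l V : Cmod w = 1 -> is_Cseries (fun i => w ^ S i * c i)%C l ->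
  (forall m, Cmod (c O) + Cmod (c m) + Rsumn (fun i => Cmod (c (S i) - c i)%C) m <= V) ->
  Cmod (1 - w)%C * Cmod l <= V.
Proof.
intros Hw Hl HV.
apply Rnot_lt_le; intros Hlt.
pose proof (Cmod_ge_0 (1 - w)).
assert (Hd : 0 < Cmod (1 - w)%C * Cmod l - V) by lra.
rewrite is_Cseries_Csumn in Hl.
destruct (Hl ((Cmod (1 - w)%C * Cmod l - V) / (Cmod (1 - w)%C + 1))) as (N & HN).
{ apply Rdiv_lt_0_compat; lra. }
specialize (HN N ltac:(lia)).
set (sN := Csumn (fun i => w ^ S i * c i)%C N) in *.
assert (Hs : Cmod (1 - w)%C * Cmod sN <= V).
{ rewrite <- Cmod_mult.
  replace ((1 - w) * sN)%C with (w * ((1 - w) * Csumn (fun i => w ^ i * c i) N))%C.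
  2:{ unfold sN. rewrite (Csumn_ext (fun i => w ^ S i * c i)%C (fun i => w * (w ^ i * c i))%C) by (intros; rewrite Cpow_S; ring).
      rewrite Csumn_scal; ring. }
  rewrite Csumn_Abel, Cmod_mult, Hw, Rmult_1_l.
  eapply Rle_trans; [|apply (HV N)].
  eapply Rle_trans; [apply Cmod_triangle|]; apply Rplus_le_compat.
  - eapply Rle_trans; [apply Cmod_triangle_minus|].
    rewrite Cmod_mult, Cmod_pow, Hw, pow1; lra.
  - apply Cmod_Csumn_le; intros i _; rewrite Cmod_mult, Cmod_pow, Hw, pow1; lra. }
assert (Hb : Cmod l <= Cmod sN + Cmod (sN - l)%C).
{ replace l with (sN - (sN - l))%C at 1 by ring; apply Cmod_triangle_minus. }
assert (HN2 : Cmod (sN - l)%C * (Cmod (1 - w)%C + 1) < Cmod (1 - w)%C * Cmod l - V).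
{ apply Rmult_lt_compat_r with (r := Cmod (1 - w)%C + 1) in HN; [|lra].
  unfold Rdiv in HN; rewrite Rmult_assoc, Rinv_l, Rmult_1_r in HN by lra; exact HN. }
pose proof (Cmod_ge_0 (sN - l)).
nra.
Qed.

(** * The logarithm series *)

Lemma RtoC_Cpow (x : R) n : RtoC (x ^ n) = (RtoC x ^ n)%C.
Proof. induction n as [|n IH]; [reflexivity|]; rewrite Cpow_S, <- IH, <- RtoC_mult; reflexivity. Qed.

Lemma INR_S_neq0 n : INR (S n) <> 0.
Proof. apply not_0_INR; lia. Qed.
Lemma INR_S_pos n : 0 < INR (S n).
Proof. apply lt_0_INR; lia. Qed.

Definition logterm (v : C) (n : nat) : C := (v ^ S n / RtoC (INR (S n)))%C.

(* The branch of [log (1 - v)] that is continuous on the half plane [Re v < 1]. *)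
Definition Clog1m (v : C) : C := (ln (Cmod (1 - v)), atan (Im (1 - v)%C / Re (1 - v)%C)).

(** It holds at 0 as well, by the default value [ln 0 = 0]; this lets the real part of [Clog1m] be
    rewritten at every point before differentiating. *)
Lemma ln_sqrt_gen (s : R) : 0 <= s -> ln (sqrt s) = / 2 * ln s.
Proof.
intros [H| <-].
- rewrite <- (sqrt_sqrt s) at 2 by lra.
  rewrite ln_mult by (apply sqrt_lt_R0; exact H); field.
- rewrite sqrt_0; unfold ln; destruct (Rlt_dec 0 0); [exfalso; lra|ring].
Qed.

Lemma Clog1m_derive (v : C) t : 0 < 1 - t * Re v ->
  is_Cderive (fun u => Clog1m (RtoC u * v)) t (- v / (1 - RtoC t * v))%C.
Proof.
intros H; destruct v as [a b]; unfold Re in H; simpl in H.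
assert (HN : 0 < (1 - t * a) * (1 - t * a) + t * b * (t * b)) by nra.
assert (E : (- (a, b) / (1 - RtoC t * (a, b)))%C =
  (((- a * (1 - t * a) + b * (t * b)) / ((1 - t * a) * (1 - t * a) + t * b * (t * b))),
   ((- b * (1 - t * a) - a * (t * b)) / ((1 - t * a) * (1 - t * a) + t * b * (t * b))))).
{ apply Ceq_ReIm; unfold Re, Im; simpl; field; repeat split; nra. }
rewrite E; clear E; split.
- apply is_derive_ext with (fun u => / 2 * ln ((1 - u * a) * (1 - u * a) + u * b * (u * b))).
  { intros u; unfold Clog1m, Re; simpl fst.
    unfold Cmod; simpl; rewrite !Rmult_1_r.
    rewrite ln_sqrt_gen by (apply Rplus_le_le_0_compat; apply Rle_0_sqr).
    f_equal; f_equal; ring. }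
  auto_derive; [exact HN|]. unfold Re; simpl; field; lra.
- apply is_derive_ext with (fun u => atan ((0 - u * b) / (1 - u * a))).
  { intros u; unfold Clog1m, Re, Im; simpl. f_equal; f_equal; ring. }
  auto_derive; [lra|]. unfold Im; simpl; field; repeat split; nra.
Qed.

Lemma is_derive_pow_div N (c t : R) : c <> 0 ->
  is_derive (fun u => u ^ S N / c) t (INR (S N) * t ^ N / c).
Proof.
intros Hc; apply is_derive_ext with (fun u => / c * u ^ S N); [intros u; apply Rmult_comm|].
replace (INR (S N) * t ^ N / c) with (/ c * (INR (S N) * 1 * t ^ pred (S N))) by (simpl pred; field; exact Hc).
apply is_derive_scal, is_derive_pow, @is_derive_id.
Qed.

Lemma Csumn_logterm_derive (v : C) N t :
  is_Cderive (fun u => Csumn (logterm (RtoC u * v)) N) t (v * Csumn (fun i => (RtoC t * v) ^ i)%C N)%C.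
Proof.
induction N as [|N IH].
- simpl. replace (v * 0)%C with (RtoC 0) by ring; apply is_Cderive_const.
- cbn [Csumn]. rewrite Cmult_plus_distr_l; apply is_Cderive_plus; [exact IH|].
  apply is_Cderive_ext with (fun u => RtoC (u ^ S N / INR (S N)) * v ^ S N)%C.
  { intros u; unfold logterm. rewrite RtoC_div by apply INR_S_neq0.
    rewrite Cpow_mult_l, RtoC_Cpow; field; apply RtoC_neq0, INR_S_neq0. }
  replace (v * (RtoC t * v) ^ N)%C with (RtoC (t ^ N) * v ^ S N + RtoC (t ^ S N / INR (S N)) * 0)%C
    by (rewrite Cpow_mult_l, RtoC_Cpow, Cpow_S; ring).
  apply (is_Cderive_mult (fun u => RtoC (u ^ S N / INR (S N))) (fun _ => v ^ S N)%C); [|apply is_Cderive_const].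
  apply is_Cderive_RtoC; evar_last; [apply (is_derive_pow_div N (INR (S N)) t (INR_S_neq0 N))|].
  field; apply INR_S_neq0.
Qed.

Lemma Clog1m_0 : Clog1m 0 = 0%C.
Proof.
unfold Clog1m; apply Ceq_ReIm; unfold Re, Im; simpl.
- replace (1 - 0)%C with (RtoC 1) by ring; rewrite Cmod_1; apply ln_1.
- replace ((0 + - 0) / (1 + - 0)) with 0 by field; apply atan_0.
Qed.

(* Both sides vanish at [u = 0] along [u v], and their derivatives differ by
   [v (u v)^N / (1 - u v)]. *)
Lemma log_partial_sum (v : C) c N : Cmod v <= 1 -> 0 < c ->
  (forall t, 0 <= t <= 1 -> c <= 1 - t * Re v) ->
  Cmod (Csumn (logterm v) N + Clog1m v)%C <= / (c * INR (S N)).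
Proof.
intros Hv Hc Hcv.
pose proof (Cmvt_dom
  (fun u => Csumn (logterm (RtoC u * v)) N + Clog1m (RtoC u * v))%C
  (fun t => v * Csumn (fun i => (RtoC t * v) ^ i)%C N + - v / (1 - RtoC t * v))%C
  (fun u => u ^ S N / (c * INR (S N))) (fun u => u ^ N / c) 0 1 ltac:(lra)) as H; cbv beta in H.
replace (RtoC 1 * v)%C with v in H by ring.
replace (RtoC 0 * v)%C with (RtoC 0) in H by ring.
rewrite Clog1m_0 in H.
replace (Csumn (logterm 0) N) with (RtoC 0) in H.
2:{ clear; induction N as [|N IH]; [reflexivity|]; simpl Csumn; rewrite <- IH.
    unfold logterm; rewrite Cpow_S; unfold Cdiv; ring. }
replace (Csumn (logterm v) N + Clog1m v - (0 + 0))%C with (Csumn (logterm v) N + Clog1m v)%C in H by ring.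
pose proof (INR_S_pos N).
replace (/ (c * INR (S N))) with (1 ^ S N / (c * INR (S N)) - 0 ^ S N / (c * INR (S N))).
2:{ rewrite pow1, pow_ne_zero by lia; field; split; lra. }
apply H; clear H.
- intros t Ht; apply is_Cderive_plus; [apply Csumn_logterm_derive|apply Clog1m_derive].
  specialize (Hcv t Ht); lra.
- intros t Ht; evar_last; [apply (is_derive_pow_div N (c * INR (S N)) t); apply Rgt_not_eq; nra|]; field; split; lra.
- intros t Ht; specialize (Hcv t Ht).
  assert (Hre : Re (1 - RtoC t * v)%C = 1 - t * Re v).
  { rewrite Re_minus, Re_mult; simpl; ring. }
  assert (Hd : (1 - RtoC t * v)%C <> 0%C) by (apply C_neq0_Re; rewrite Hre; lra).
  assert (Hcm : c <= Cmod (1 - RtoC t * v)%C) by (pose proof (Re_le (1 - RtoC t * v)%C); lra).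
  replace (v * Csumn (fun i => (RtoC t * v) ^ i)%C N + - v / (1 - RtoC t * v))%C
    with (- v * (RtoC t * v) ^ N / (1 - RtoC t * v))%C.
  2:{ pose proof (Csumn_geom (RtoC t * v) N) as G.
      replace (Csumn (fun i => (RtoC t * v) ^ i)%C N) with ((1 - (RtoC t * v) ^ N) / (1 - RtoC t * v))%C.
      - field; exact Hd.
      - rewrite <- G; field; exact Hd. }
  rewrite Cmod_div, Cmod_mult, Cmod_opp, Cmod_pow, Cmod_mult, Cmod_RtoC_pos by (assumption || lra).
  unfold Rdiv. pose proof (Cmod_ge_0 v).
  apply Rmult_le_compat.
  + apply Rmult_le_pos; [lra|apply pow_le; nra].
  + left; apply Rinv_0_lt_compat; lra.
  + assert ((t * Cmod v) ^ N <= t ^ N) by (apply pow_incr; nra).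
    assert (0 <= (t * Cmod v) ^ N) by (apply pow_le; nra). nra.
  + apply Rinv_le_contravar; lra.
Qed.

Lemma Cmod1_Re_lt (v : C) : Cmod v <= 1 -> v <> 1%C -> Re v < 1.
Proof.
intros Hv H.
assert (Hr : Re v <= 1) by (pose proof (Re_le v); lra).
destruct Hr as [Hr|Hr]; [exact Hr|exfalso; apply H].
pose proof (Cmod_sqr v); pose proof (Cmod_ge_0 v).
apply Ceq_ReIm; [exact Hr|simpl; nra].
Qed.

Lemma log_radius (v : C) : Re v < 1 -> 0 < Rmin 1 (1 - Re v) /\
  forall t, 0 <= t <= 1 -> Rmin 1 (1 - Re v) <= 1 - t * Re v.
Proof.
intros H; split; [apply Rmin_glb_lt; lra|].
intros t Ht; destruct (Rle_or_lt 0 (Re v)).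
- eapply Rle_trans; [apply Rmin_r|nra].
- eapply Rle_trans; [apply Rmin_l|nra].
Qed.

Lemma inv_INR_lt (c eps : R) : 0 < c -> 0 < eps -> exists N, forall n, (N <= n)%nat -> / (c * INR (S n)) < eps.
Proof.
intros Hc He; destruct (INR_unbounded (/ (c * eps))) as (N & HN).
exists N; intros n Hn.
assert (INR N < INR (S n)) by (apply lt_INR; lia).
apply Rmult_lt_reg_r with (c * INR (S n)); [pose proof (INR_S_pos n); nra|].
rewrite Rinv_l by (pose proof (INR_S_pos n); apply Rgt_not_eq; nra).
assert (Hce : 0 < c * eps) by (apply Rmult_lt_0_compat; assumption).
apply Rmult_gt_compat_r with (r := c * eps) in HN; [|exact Hce].
rewrite Rinv_l in HN by lra.
assert (INR N * (c * eps) < INR (S n) * (c * eps)) by (apply Rmult_lt_compat_r; assumption).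
lra.
Qed.

(** The boundary [Cmod v = 1] is included, where convergence is only conditional: the error bound of
    [log_partial_sum] uses just the distance of the segment from 0 to [v] from the point 1. *)
Lemma is_Cseries_log (v : C) : Cmod v <= 1 -> v <> 1%C -> is_Cseries (logterm v) (- Clog1m v)%C.
Proof.
intros Hv H1; destruct (log_radius v (Cmod1_Re_lt v Hv H1)) as [Hc Hcv].
apply is_Cseries_Csumn; intros eps He.
destruct (inv_INR_lt _ eps Hc He) as (N & HN); exists N; intros n Hn.
replace (Csumn (logterm v) n - - Clog1m v)%C with (Csumn (logterm v) n + Clog1m v)%C by ring.
eapply Rle_lt_trans; [apply (log_partial_sum v _ n Hv Hc Hcv)|apply HN; exact Hn].
Qed.

Lemma sqrt_1_minus_cos (z : C) : 0 < Cmod z ->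
  sqrt (1 - (Re z / Cmod z)²) = Rabs (Im z) / Cmod z.
Proof.
intros Hm; pose proof (Cmod_sqr z) as Hs.
assert (E : 1 - (Re z / Cmod z)² = (Im z / Cmod z)²).
{ unfold Rsqr, Rdiv; apply Rmult_eq_reg_r with (Cmod z * Cmod z); [|apply Rgt_not_eq; nra].
  transitivity (Cmod z * Cmod z - Re z * Re z); [field; lra|].
  transitivity (Im z * Im z); [lra|field; lra]. }
rewrite E, sqrt_Rsqr_abs, Rabs_div by lra.
rewrite (Rabs_pos_eq (Cmod z)) by lra; reflexivity.
Qed.

Lemma Cexp_Clog (z : C) : z <> 0%C -> Cexp (Clog z) = z.
Proof.
intros Hz; assert (Hm : 0 < Cmod z) by (apply Cmod_gt_0; exact Hz).
pose proof (Cmod_sqr z) as Hs.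
assert (Hcos : -1 <= Re z / Cmod z <= 1).
{ pose proof (Re_le_Cmod z) as Hr; apply Rabs_le_between in Hr; split.
  - apply Rmult_le_reg_r with (Cmod z); [exact Hm|]; unfold Rdiv; rewrite Rmult_assoc, Rinv_l by lra; lra.
  - apply Rmult_le_reg_r with (Cmod z); [exact Hm|]; unfold Rdiv; rewrite Rmult_assoc, Rinv_l by lra; lra. }
pose proof (sqrt_1_minus_cos z Hm) as Hsin.
assert (Hc : cos (Carg z) = Re z / Cmod z).
{ unfold Carg; destruct (Rle_dec 0 (Im z)); rewrite ?cos_neg; apply cos_acos; exact Hcos. }
assert (Hsn : sin (Carg z) = Im z / Cmod z).
{ unfold Carg; destruct (Rle_dec 0 (Im z)) as [Hi|Hi]; rewrite ?sin_neg, sin_acos, Hsin by exact Hcos.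
  - rewrite Rabs_pos_eq by exact Hi; reflexivity.
  - rewrite Rabs_left by lra; unfold Rdiv; ring. }
apply Ceq_ReIm; [rewrite Re_Cexp|rewrite Im_Cexp]; unfold Clog.
- change (Re (ln (Cmod z), Carg z)) with (ln (Cmod z)); change (Im (ln (Cmod z), Carg z)) with (Carg z).
  rewrite Hc, exp_ln by exact Hm; field; lra.
- change (Re (ln (Cmod z), Carg z)) with (ln (Cmod z)); change (Im (ln (Cmod z), Carg z)) with (Carg z).
  rewrite Hsn, exp_ln by exact Hm; field; lra.
Qed.

Lemma Carg_Re_pos (z : C) : 0 < Re z -> Carg z = atan (Im z / Re z).
Proof.
intros Hr.
assert (Hm : 0 < Cmod z) by (pose proof (Re_le z); lra).
pose proof (Cmod_sqr z) as Hs.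
assert (Ha : acos (Re z / Cmod z) = atan (Rabs (Im z) / Re z)).
{ rewrite acos_atan by (apply Rdiv_lt_0_compat; assumption).
  f_equal.
  pose proof (sqrt_1_minus_cos z Hm) as Hsin.
  rewrite Hsin; field; split; lra. }
unfold Carg; destruct (Rle_dec 0 (Im z)) as [Hi|Hi]; rewrite Ha.
- rewrite Rabs_pos_eq by exact Hi; reflexivity.
- rewrite Rabs_left by lra; rewrite <- atan_opp; f_equal; field; lra.
Qed.

Lemma Clog1m_Clog (v : C) : Re v < 1 -> Clog1m v = Clog (1 - v).
Proof.
intros H; unfold Clog1m, Clog; rewrite Carg_Re_pos; [reflexivity|].
rewrite Re_minus; simpl; lra.
Qed.

Lemma Cexp_Clog1m (v : C) : Re v < 1 -> Cexp (Clog1m v) = (1 - v)%C.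
Proof.
intros H; rewrite Clog1m_Clog by exact H; apply Cexp_Clog, C_neq0_Re; rewrite Re_minus; simpl; lra.
Qed.

(** * Complex-valued integrals *)

Lemma Ccontinuous_ext f g t : (forall u, f u = g u) -> Ccontinuous f t -> Ccontinuous g t.
Proof.
intros H [H1 H2]; split.
- apply (continuous_ext (fun u => Re (f u))); [intros u; rewrite H; reflexivity|exact H1].
- apply (continuous_ext (fun u => Im (f u))); [intros u; rewrite H; reflexivity|exact H2].
Qed.

Lemma Ccontinuous_const c t : Ccontinuous (fun _ => c) t.
Proof. split; apply continuous_const. Qed.

Lemma Ccontinuous_plus f g t : Ccontinuous f t -> Ccontinuous g t -> Ccontinuous (fun u => f u + g u)%C t.
Proof.
intros [H1 H2] [H3 H4]; split.
- exact (continuous_plus _ _ t H1 H3).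
- exact (continuous_plus _ _ t H2 H4).
Qed.

Lemma continuous_Rmult (f g : R -> R) t : continuous f t -> continuous g t -> continuous (fun u => f u * g u) t.
Proof. intros H1 H2; exact (continuous_mult f g t H1 H2). Qed.

Lemma Ccontinuous_mult f g t : Ccontinuous f t -> Ccontinuous g t -> Ccontinuous (fun u => f u * g u)%C t.
Proof.
intros [H1 H2] [H3 H4]; split.
- exact (continuous_minus _ _ t (continuous_Rmult _ _ t H1 H3) (continuous_Rmult _ _ t H2 H4)).
- exact (continuous_plus _ _ t (continuous_Rmult _ _ t H1 H4) (continuous_Rmult _ _ t H2 H3)).
Qed.

Lemma Ccontinuous_opp f t : Ccontinuous f t -> Ccontinuous (fun u => - f u)%C t.
Proof.
intros [H1 H2]; split.
- exact (continuous_opp _ t H1).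
- exact (continuous_opp _ t H2).
Qed.

Lemma Ccontinuous_minus f g t : Ccontinuous f t -> Ccontinuous g t -> Ccontinuous (fun u => f u - g u)%C t.
Proof. intros H1 H2; apply Ccontinuous_plus; [|apply Ccontinuous_opp]; assumption. Qed.

Lemma Ccontinuous_inv f t : Ccontinuous f t -> f t <> 0%C -> Ccontinuous (fun u => / f u)%C t.
Proof.
intros [H1 H2] H0.
assert (HN : Re (f t) * Re (f t) + Im (f t) * Im (f t) <> 0).
{ rewrite <- Cmod_sqr; apply Cmod_gt_0 in H0; apply Rgt_not_eq; nra. }
assert (HD : continuous (fun u => / (Re (f u) * Re (f u) + Im (f u) * Im (f u))) t).
{ apply (continuous_Rinv_comp (fun u => Re (f u) * Re (f u) + Im (f u) * Im (f u))); [|exact HN].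
  exact (continuous_plus _ _ t (continuous_Rmult _ _ t H1 H1) (continuous_Rmult _ _ t H2 H2)). }
split.
- apply continuous_ext with (fun u => Re (f u) * / (Re (f u) * Re (f u) + Im (f u) * Im (f u))).
  { intros u; destruct (f u) as [p q]; unfold Re, Im; simpl. unfold Rdiv; f_equal; f_equal; ring. }
  exact (continuous_Rmult _ _ t H1 HD).
- apply continuous_ext with (fun u => - (Im (f u) * / (Re (f u) * Re (f u) + Im (f u) * Im (f u)))).
  { intros u; destruct (f u) as [p q]; unfold Re, Im; simpl. unfold Rdiv.
    rewrite <- Ropp_mult_distr_l; f_equal; f_equal; f_equal; ring. }
  exact (continuous_opp _ t (continuous_Rmult _ _ t H2 HD)).
Qed.

Lemma Ccontinuous_Cexp f t : Ccontinuous f t -> Ccontinuous (fun u => Cexp (f u)) t.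
Proof.
intros [H1 H2]; split.
- apply continuous_ext with (fun u => exp (Re (f u)) * cos (Im (f u))).
  { intros u; rewrite Re_Cexp; reflexivity. }
  apply (continuous_Rmult (fun u => exp (Re (f u))) (fun u => cos (Im (f u)))).
  + apply (continuous_comp (fun u => Re (f u)) exp); [exact H1|apply continuous_exp].
  + apply (continuous_comp (fun u => Im (f u)) cos); [exact H2|apply continuous_cos].
- apply continuous_ext with (fun u => exp (Re (f u)) * sin (Im (f u))).
  { intros u; rewrite Im_Cexp; reflexivity. }
  apply (continuous_Rmult (fun u => exp (Re (f u))) (fun u => sin (Im (f u)))).
  + apply (continuous_comp (fun u => Re (f u)) exp); [exact H1|apply continuous_exp].
  + apply (continuous_comp (fun u => Im (f u)) sin); [exact H2|apply continuous_sin].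
Qed.

Lemma Ccontinuous_pow f n t : Ccontinuous f t -> Ccontinuous (fun u => f u ^ n)%C t.
Proof.
intros H; induction n as [|n IH]; [apply Ccontinuous_const|].
apply Ccontinuous_ext with (fun u => f u * f u ^ n)%C; [intros; rewrite Cpow_S; reflexivity|].
apply Ccontinuous_mult; assumption.
Qed.

(** A uniform limit of continuous functions is continuous; the approximant may depend on [eps], as
    the finite products [genfun_upto] will. *)
Lemma Ccontinuous_unif f t :
  (forall eps : R, 0 < eps -> exists g, Ccontinuous g t /\ forall y, Cmod (f y - g y)%C <= eps) -> Ccontinuous f t.
Proof.
intros H; split; apply (proj2 (filterlim_locally _ _)); intros eps;
destruct (H (eps / 4)) as (g & [Hg1 Hg2] & Hfg); try (destruct eps; simpl; lra).
- assert (He : 0 < eps / 4) by (destruct eps; simpl; lra).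
  apply filter_imp with (2 := proj1 (filterlim_locally _ _) Hg1 (mkposreal _ He)).
  intros y Hy. 
  change (Rabs (Re (g y) - Re (g t)) < eps / 4) in Hy.
  change (Rabs (Re (f y) - Re (f t)) < eps).
  pose proof (Hfg y); pose proof (Hfg t).
  pose proof (Re_le_Cmod (f y - g y)%C) as A1; pose proof (Re_le_Cmod (f t - g t)%C) as A2.
  rewrite Re_minus in A1, A2.
  replace (Re (f y) - Re (f t)) with ((Re (f y) - Re (g y)) + (Re (g y) - Re (g t)) - (Re (f t) - Re (g t))) by ring.
  apply Rabs_def2 in Hy. pose proof (proj1 (Rabs_le_between _ _) A1); pose proof (proj1 (Rabs_le_between _ _) A2).
  apply Rabs_def1; lra.
- assert (He : 0 < eps / 4) by (destruct eps; simpl; lra).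
  apply filter_imp with (2 := proj1 (filterlim_locally _ _) Hg2 (mkposreal _ He)).
  intros y Hy.
  change (Rabs (Im (g y) - Im (g t)) < eps / 4) in Hy.
  change (Rabs (Im (f y) - Im (f t)) < eps).
  pose proof (Hfg y); pose proof (Hfg t).
  pose proof (Im_le_Cmod (f y - g y)%C) as A1; pose proof (Im_le_Cmod (f t - g t)%C) as A2.
  rewrite Im_minus in A1, A2.
  replace (Im (f y) - Im (f t)) with ((Im (f y) - Im (g y)) + (Im (g y) - Im (g t)) - (Im (f t) - Im (g t))) by ring.
  apply Rabs_def2 in Hy. pose proof (proj1 (Rabs_le_between _ _) A1); pose proof (proj1 (Rabs_le_between _ _) A2).
  apply Rabs_def1; lra.
Qed.

Definition CInt (f : R -> C) (a b : R) : C :=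
  (RInt (fun x => Re (f x)) a b, RInt (fun x => Im (f x)) a b).

Definition ex_CInt (f : R -> C) (a b : R) : Prop :=
  ex_RInt (fun x => Re (f x)) a b /\ ex_RInt (fun x => Im (f x)) a b.

Lemma ex_CInt_continuous f a b : (forall x, Ccontinuous f x) -> ex_CInt f a b.
Proof.
intros H; split; apply @ex_RInt_continuous; intros x _; apply H.
Qed.

Lemma CInt_ext f g a b : (forall x, f x = g x) -> CInt f a b = CInt g a b.
Proof. intros H; unfold CInt; f_equal; apply RInt_ext; intros x _; rewrite H; reflexivity. Qed.

Lemma CInt_plus f g a b : ex_CInt f a b -> ex_CInt g a b ->
  CInt (fun x => f x + g x)%C a b = (CInt f a b + CInt g a b)%C.
Proof.
intros [H1 H2] [H3 H4]; apply Ceq_ReIm.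
- exact (RInt_plus _ _ a b H1 H3).
- exact (RInt_plus _ _ a b H2 H4).
Qed.

Lemma RInt_Rscal (f : R -> R) a b k : ex_RInt f a b -> RInt (fun x => k * f x) a b = k * RInt f a b.
Proof. intros H; exact (RInt_scal f a b k H). Qed.

Lemma CInt_scal c f a b : ex_CInt f a b -> CInt (fun x => c * f x)%C a b = (c * CInt f a b)%C.
Proof.
intros [H1 H2]; apply Ceq_ReIm.
- change (RInt (fun x => Re c * Re (f x) - Im c * Im (f x)) a b
    = Re c * RInt (fun x => Re (f x)) a b - Im c * RInt (fun x => Im (f x)) a b).
  rewrite <- (RInt_Rscal (fun x => Re (f x)) a b (Re c) H1), <- (RInt_Rscal (fun x => Im (f x)) a b (Im c) H2).
  exact (RInt_minus _ _ a b (ex_RInt_scal _ a b (Re c) H1) (ex_RInt_scal _ a b (Im c) H2)).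
- change (RInt (fun x => Re c * Im (f x) + Im c * Re (f x)) a b
    = Re c * RInt (fun x => Im (f x)) a b + Im c * RInt (fun x => Re (f x)) a b).
  rewrite <- (RInt_Rscal (fun x => Re (f x)) a b (Im c) H1), <- (RInt_Rscal (fun x => Im (f x)) a b (Re c) H2).
  exact (RInt_plus _ _ a b (ex_RInt_scal _ a b (Re c) H2) (ex_RInt_scal _ a b (Im c) H1)).
Qed.

Lemma ex_CInt_scal c f a b : ex_CInt f a b -> ex_CInt (fun x => c * f x)%C a b.
Proof.
intros [H1 H2]; split.
- exact (ex_RInt_minus _ _ a b (ex_RInt_scal _ a b (Re c) H1) (ex_RInt_scal _ a b (Im c) H2)).
- exact (ex_RInt_plus _ _ a b (ex_RInt_scal _ a b (Re c) H2) (ex_RInt_scal _ a b (Im c) H1)).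
Qed.

Lemma CInt_minus f g a b : ex_CInt f a b -> ex_CInt g a b ->
  CInt (fun x => f x - g x)%C a b = (CInt f a b - CInt g a b)%C.
Proof.
intros [H1 H2] [H3 H4]; apply Ceq_ReIm.
- exact (RInt_minus _ _ a b H1 H3).
- exact (RInt_minus _ _ a b H2 H4).
Qed.

Lemma CInt_Chasles f a b c : ex_CInt f a b -> ex_CInt f b c ->
  (CInt f a b + CInt f b c)%C = CInt f a c.
Proof.
intros [H1 H2] [H3 H4]; apply Ceq_ReIm.
- exact (RInt_Chasles _ a b c H1 H3).
- exact (RInt_Chasles _ a b c H2 H4).
Qed.

Lemma CInt_comp_lin f (u v a b : R) : (forall x, Ccontinuous f x) ->
  CInt (fun y => RtoC u * f (u * y + v)%R)%C a b = CInt f (u * a + v) (u * b + v).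
Proof.
intros H; destruct (ex_CInt_continuous f (u * a + v) (u * b + v) H) as [H1 H2].
apply Ceq_ReIm.
- change (RInt (fun y => Re (RtoC u * f (u * y + v)%R)%C) a b = RInt (fun x => Re (f x)) (u * a + v) (u * b + v)).
  rewrite <- (RInt_comp_lin (fun x => Re (f x)) u v a b H1).
  apply RInt_ext; intros x _; rewrite Re_mult, Im_RtoC; unfold scal; simpl; unfold mult; simpl.
  rewrite ?Re_RtoC; ring.
- change (RInt (fun y => Im (RtoC u * f (u * y + v)%R)%C) a b = RInt (fun x => Im (f x)) (u * a + v) (u * b + v)).
  rewrite <- (RInt_comp_lin (fun x => Im (f x)) u v a b H2).
  apply RInt_ext; intros x _; rewrite Im_mult, Im_RtoC; unfold scal; simpl; unfold mult; simpl.
  rewrite ?Re_RtoC; ring.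
Qed.

(** With the integral taken componentwise, the triangle inequality comes from projecting the
    integrand onto the direction of the integral. *)
Lemma Cmod_CInt_le f (g : R -> R) a b : a <= b -> ex_CInt f a b -> ex_RInt g a b ->
  (forall x, a <= x <= b -> Cmod (f x) <= g x) -> Cmod (CInt f a b) <= RInt g a b.
Proof.
intros Hab [H1 H2] Hg H.
assert (H0 : 0 <= RInt g a b).
{ replace 0 with (RInt (fun _ => 0) a b) by (rewrite RInt_const; unfold scal; simpl; unfold mult; simpl; ring).
  apply RInt_le; [exact Hab|apply ex_RInt_const|exact Hg|].
  intros x Hx; eapply Rle_trans; [apply Cmod_ge_0|apply H; lra]. }
set (l := CInt f a b); destruct (Req_dec (Cmod l) 0) as [E|E]; [rewrite E; exact H0|].
pose proof (Cmod_ge_0 l); apply Rmult_le_reg_l with (Cmod l); [lra|].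
rewrite Cmod_sqr.
rewrite <- (RInt_Rscal g a b (Cmod l) Hg).
replace (Re l * Re l + Im l * Im l) with (RInt (fun x => plus (scal (Re l) (Re (f x))) (scal (Im l) (Im (f x)))) a b).
- apply RInt_le; [exact Hab| | |].
  + exact (ex_RInt_plus _ _ a b (ex_RInt_scal _ a b (Re l) H1) (ex_RInt_scal _ a b (Im l) H2)).
  + exact (ex_RInt_scal _ a b (Cmod l) Hg).
  + intros x Hx; eapply Rle_trans; [apply Cdot_le|].
    apply Rmult_le_compat_l; [lra|apply H; lra].
- transitivity (RInt (fun x => Re l * Re (f x)) a b + RInt (fun x => Im l * Im (f x)) a b).
  + exact (RInt_plus _ _ a b (ex_RInt_scal _ a b (Re l) H1) (ex_RInt_scal _ a b (Im l) H2)).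
  + rewrite (RInt_Rscal _ a b _ H1), (RInt_Rscal _ a b _ H2); reflexivity.
Qed.

Lemma Cmod_CInt_le_const f M a b : a <= b -> ex_CInt f a b ->
  (forall x, a <= x <= b -> Cmod (f x) <= M) -> Cmod (CInt f a b) <= (b - a) * M.
Proof.
intros Hab Hf H.
replace ((b - a) * M) with (RInt (fun _ => M) a b) by (rewrite RInt_const; reflexivity).
apply Cmod_CInt_le; [exact Hab|exact Hf|apply ex_RInt_const|exact H].
Qed.

Lemma CInt_derive (f df : R -> C) a b : (forall x, is_Cderive f x (df x)) -> (forall x, Ccontinuous df x) ->
  CInt df a b = (f b - f a)%C.
Proof.
intros Hd Hc; apply Ceq_ReIm; apply is_RInt_unique.
- apply (is_RInt_derive (fun x => Re (f x)) (fun x => Re (df x))); intros x _; [apply (Hd x)|apply (Hc x)].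
- apply (is_RInt_derive (fun x => Im (f x)) (fun x => Im (df x))); intros x _; [apply (Hd x)|apply (Hc x)].
Qed.

Lemma CInt_const c a b : CInt (fun _ => c) a b = (RtoC (b - a) * c)%C.
Proof.
apply Ceq_ReIm; unfold CInt; [change (RInt (fun _ => Re c) a b = Re (RtoC (b - a) * c)%C)|change (RInt (fun _ => Im c) a b = Im (RtoC (b - a) * c)%C)];
rewrite RInt_const; rewrite ?Re_mult, ?Im_mult; unfold scal; simpl; unfold mult; simpl; rewrite ?Re_RtoC; ring.
Qed.

(** * Partitions and Cauchy's integral *)

Definition pcoef (z : C) (m n : nat) : C :=
  Csum (map (fun l => z ^ length l)%C (partitions_aux n m n)).

Lemma partitions_aux_fuel len len' m n : (n <= len)%nat -> (n <= len')%nat ->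
  partitions_aux len m n = partitions_aux len' m n.
Proof.
revert len' m n; induction len as [|len IH]; intros len' m n H1 H2.
- replace n with O by lia; destruct len'; reflexivity.
- destruct n as [|n]; [destruct len'; reflexivity|].
  destruct len' as [|len']; [lia|]; cbn [partitions_aux].
  rewrite !flat_map_concat_map; f_equal; apply map_ext_in; intros k Hk.
  apply in_seq in Hk; f_equal; apply IH; lia.
Qed.

Lemma Csum_app l1 l2 : Csum (l1 ++ l2) = (Csum l1 + Csum l2)%C.
Proof.
induction l1 as [|x l IH]; simpl; [rewrite Cplus_0_l; reflexivity|].
change (x + Csum (l ++ l2) = x + Csum l + Csum l2)%C; rewrite IH; ring.
Qed.

Lemma Csum_pow_cons z k (L : list (list nat)) :
  Csum (map (fun l => z ^ length l)%C (map (cons k) L)) = (z * Csum (map (fun l => z ^ length l)%C L))%C.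
Proof.
induction L as [|x L IH]; simpl; [rewrite Cmult_0_r; reflexivity|].
change (z * z ^ length x + Csum (map (fun l => z ^ length l) (map (cons k) L))
  = z * (z ^ length x + Csum (map (fun l => z ^ length l) L)))%C.
rewrite IH; ring.
Qed.

(** Partitions whose largest part is [S m] lose that part and one factor [z]; the remaining ones
    have parts at most [m]. Fuel independence makes the shortened list comparable. *)
Lemma pcoef_S z m n : pcoef z (S m) n =
  (pcoef z m n + (if le_dec (S m) n then z * pcoef z (S m) (n - S m) else 0))%C.
Proof.
unfold pcoef; destruct n as [|n].
- destruct (le_dec (S m) 0); [lia|]; simpl; ring.
- cbn [partitions_aux]; destruct (le_dec (S m) (S n)) as [H|H].
  + rewrite !Nat.min_l by lia. rewrite seq_S, flat_map_app, map_app, Csum_app; f_equal.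
    cbn [flat_map]; rewrite app_nil_r, Csum_pow_cons; change (1 + m)%nat with (S m).
    rewrite (partitions_aux_fuel n (S n - S m) (S m) (S n - S m)) by lia; reflexivity.
  + rewrite !Nat.min_r by lia; ring.
Qed.

Lemma pcoef_0 z n : pcoef z 0 n = match n with O => 1%C | _ => 0%C end.
Proof. unfold pcoef; destruct n as [|n]; cbn; [ring|reflexivity]. Qed.

Lemma pcoef_Q z m n : (n <= m)%nat -> pcoef z m n = Q n z.
Proof.
intros H; unfold pcoef, Q, partitions; f_equal; f_equal.
destruct n as [|n]; [reflexivity|]; cbn [partitions_aux].
rewrite Nat.min_r, Nat.min_id by lia; reflexivity.
Qed.

(* The generating function of partitions into parts at most [m]. *)
Fixpoint genfun_upto (z : C) (m : nat) (q : C) : C :=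
  match m with O => 1%C | S k => (genfun_upto z k q / (1 - z * q ^ S k))%C end.

Lemma Cmod_zq z q k : Cmod z <= 1 -> Cmod q < 1 -> Cmod (z * q ^ S k)%C <= Cmod q.
Proof.
intros Hz Hq; rewrite Cmod_mult, Cmod_pow; simpl.
assert (0 <= Cmod q ^ k <= 1).
{ split; [apply pow_le, Cmod_ge_0|]. rewrite <- (pow1 k); apply pow_incr; split; [apply Cmod_ge_0|lra]. }
pose proof (Cmod_ge_0 z); pose proof (Cmod_ge_0 q).
assert (Cmod q * Cmod q ^ k <= Cmod q) by nra.
assert (0 <= Cmod q * Cmod q ^ k) by nra. nra.
Qed.

Lemma Cmod_one_minus_ge v r : Cmod v <= r -> 1 - r <= Cmod (1 - v)%C.
Proof. intros H; pose proof (Cmod_minus_ge 1 v) as H1; rewrite Cmod_1 in H1; lra. Qed.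

Lemma one_minus_neq0 v : Cmod v < 1 -> (1 - v)%C <> 0%C.
Proof. intros H; apply Cmod_gt_0; pose proof (Cmod_one_minus_ge v (Cmod v)); lra. Qed.

Lemma genfun_upto_bound z m q : Cmod z <= 1 -> Cmod q < 1 -> Cmod (genfun_upto z m q) <= (/ (1 - Cmod q)) ^ m.
Proof.
intros Hz Hq; induction m as [|m IH]; [simpl; rewrite Cmod_1; lra|].
pose proof (Cmod_zq z q m Hz Hq) as Hk.
cbn [genfun_upto]; rewrite Cmod_div by (apply one_minus_neq0; lra).
simpl pow; rewrite (Rmult_comm (/ (1 - Cmod q))).
apply Rmult_le_compat; [apply Cmod_ge_0| |exact IH|].
- left; apply Rinv_0_lt_compat; pose proof (Cmod_one_minus_ge _ _ Hk); lra.
- apply Rinv_le_contravar; [lra|]; apply Cmod_one_minus_ge, Hk.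
Qed.

Definition circ (eta x : R) : C := Cexp (- eta, x)%R.

Lemma Cmod_circ eta x : Cmod (circ eta x) = exp (- eta).
Proof. unfold circ; rewrite Cmod_Cexp; reflexivity. Qed.

Lemma Cmod_circ_lt1 eta x : 0 < eta -> Cmod (circ eta x) < 1.
Proof. intros H; rewrite Cmod_circ, <- exp_0; apply exp_increasing; lra. Qed.

Lemma Ccontinuous_pair (f g : R -> R) t : continuous f t -> continuous g t -> Ccontinuous (fun u => (f u, g u)) t.
Proof. intros H1 H2; split; assumption. Qed.

Lemma continuous_lin (a b t : R) : continuous (fun u => a * u + b) t.
Proof. apply @ex_derive_continuous; auto_derive; trivial. Qed.

Lemma Ccontinuous_Cexp_lin (a b c d t : R) : Ccontinuous (fun x => Cexp (a * x + b, c * x + d)%R) t.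
Proof. apply Ccontinuous_Cexp, Ccontinuous_pair; apply continuous_lin. Qed.

Lemma circ_continuous eta t : Ccontinuous (circ eta) t.
Proof.
apply Ccontinuous_ext with (fun x => Cexp (0 * x + - eta, 1 * x + 0)%R); [|apply Ccontinuous_Cexp_lin].
intros u; unfold circ; f_equal; f_equal; ring.
Qed.

(* [q^(-n)] at [q = circ eta x]. *)
Definition circ_negpow (n : Z) (eta x : R) : C := Cexp (IZR n * eta, - IZR n * x)%R.

Lemma circ_negpow_continuous n eta t : Ccontinuous (circ_negpow n eta) t.
Proof.
apply Ccontinuous_ext with (fun x => Cexp (0 * x + IZR n * eta, - IZR n * x + 0)%R); [|apply Ccontinuous_Cexp_lin].
intros u; unfold circ_negpow; f_equal; f_equal; ring.
Qed.

Lemma circ_negpow_mul n k eta x :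
  (circ eta x ^ k * circ_negpow n eta x)%C = circ_negpow (n - Z.of_nat k) eta x.
Proof.
unfold circ, circ_negpow; rewrite Cexp_pow, <- Cexp_plus; f_equal.
rewrite minus_IZR, <- INR_IZR_INZ; apply Ceq_ReIm; unfold Re, Im; simpl; ring.
Qed.

Lemma genfun_upto_continuous z m eta t : Cmod z <= 1 -> 0 < eta ->
  Ccontinuous (fun x => genfun_upto z m (circ eta x)) t.
Proof.
intros Hz He; induction m as [|m IH]; [apply Ccontinuous_const|].
cbn [genfun_upto]; apply Ccontinuous_mult; [exact IH|]. 
apply (Ccontinuous_inv (fun u => 1 - z * circ eta u ^ S m)%C).
- apply Ccontinuous_minus; [apply Ccontinuous_const|].
  apply Ccontinuous_mult; [apply Ccontinuous_const|].
  apply Ccontinuous_pow, circ_continuous.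
- pose proof (Cmod_circ_lt1 eta t He) as H1.
  apply one_minus_neq0; eapply Rle_lt_trans; [apply Cmod_zq; assumption|exact H1].
Qed.

Lemma CInt_circ_negpow n eta a :
  CInt (circ_negpow n eta) a (a + 2 * PI) = if Z.eq_dec n 0 then RtoC (2 * PI) else 0%C.
Proof.
destruct (Z.eq_dec n 0) as [->|Hn].
- rewrite (CInt_ext _ (fun _ => 1%C)).
  + rewrite CInt_const; replace (a + 2 * PI - a) with (2 * PI) by ring; ring.
  + intros x; unfold circ_negpow; rewrite <- Cexp_0; f_equal; apply Ceq_ReIm; simpl; ring.
- assert (Hn0 : (0, - IZR n)%R <> RtoC 0).
  { apply C_neq0_Im; unfold Im; simpl; intros E; apply Hn, eq_IZR; lra. }
  rewrite (CInt_derive (fun x => / (0, - IZR n)%R * circ_negpow n eta x)%C).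
  + replace (circ_negpow n eta (a + 2 * PI)) with (circ_negpow n eta a); [ring|].
    unfold circ_negpow. rewrite <- (Cexp_Im_period _ _ (- n)); f_equal; rewrite opp_IZR.
    apply Ceq_ReIm; unfold Re, Im; simpl; ring.
  + intros x.
    replace (circ_negpow n eta x) with
      (0 * circ_negpow n eta x + / (0, - IZR n)%R * ((0, - IZR n)%R * circ_negpow n eta x))%C by (field; exact Hn0).
    apply (is_Cderive_mult (fun _ => / (0, - IZR n)%R)%C (circ_negpow n eta)); [apply is_Cderive_const|].
    apply is_Cderive_Cexp; split; unfold Re, Im; simpl; auto_derive; trivial; ring.
  + intros x; apply circ_negpow_continuous.
Qed.

(** [2 PI] times the [n]-th power series coefficient of the finite product. The index ranges over
    all integers so that the recurrence can be iterated below 0. *)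
Definition circ_coef (z : C) (eta a : R) (m : nat) (n : Z) : C :=
  CInt (fun x => genfun_upto z m (circ eta x) * circ_negpow n eta x)%C a (a + 2 * PI).

Lemma circ_coef_continuous z eta m n t : Cmod z <= 1 -> 0 < eta ->
  Ccontinuous (fun x => genfun_upto z m (circ eta x) * circ_negpow n eta x)%C t.
Proof.
intros; apply Ccontinuous_mult; [apply genfun_upto_continuous; assumption|apply circ_negpow_continuous].
Qed.

(** Multiplication by [1 - z q^(m+1)] turns the product of length [S m] into the one of length [m],
    and a factor [q^(m+1)] lowers the index of the coefficient. *)
Lemma circ_coef_S z eta a m n : Cmod z <= 1 -> 0 < eta ->
  circ_coef z eta a (S m) n = (circ_coef z eta a m n + z * circ_coef z eta a (S m) (n - Z.of_nat (S m)))%C.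
Proof.
intros Hz He; unfold circ_coef.
set (f := fun m n x => (genfun_upto z m (circ eta x) * circ_negpow n eta x)%C).
assert (Hc : forall m n, ex_CInt (f m n) a (a + 2 * PI)).
{ intros; apply ex_CInt_continuous; intros; apply circ_coef_continuous; assumption. }
change (CInt (f (S m) n) a (a + 2 * PI) = (CInt (f m n) a (a + 2 * PI)
  + z * CInt (f (S m) (n - Z.of_nat (S m))%Z) a (a + 2 * PI))%C).
rewrite <- (CInt_scal z _ _ _ (Hc _ _)).
rewrite <- (CInt_plus (f m n) (fun x => z * f (S m) (n - Z.of_nat (S m))%Z x)%C _ _ (Hc _ _) (ex_CInt_scal _ _ _ _ (Hc _ _))).
apply CInt_ext; intros x; unfold f; rewrite <- circ_negpow_mul.
cbn [genfun_upto].
pose proof (Cmod_circ_lt1 eta x He) as H1.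
assert (H2 : (1 - z * circ eta x ^ S m)%C <> 0%C).
{ apply one_minus_neq0; eapply Rle_lt_trans; [apply Cmod_zq; assumption|exact H1]. }
set (G := genfun_upto z m (circ eta x)); set (w := (circ eta x ^ S m)%C) in *; set (p := circ_negpow n eta x).
replace (G * p + z * (G / (1 - z * w) * (w * p)))%C with (G * p * ((1 - z * w) + z * w) / (1 - z * w))%C
  by (field; exact H2).
field; exact H2.
Qed.

Lemma circ_coef_bound z eta a m n : Cmod z <= 1 -> 0 < eta ->
  Cmod (circ_coef z eta a m n) <= 2 * PI * ((/ (1 - exp (- eta))) ^ m * exp (IZR n * eta)).
Proof.
intros Hz He; unfold circ_coef.
replace (2 * PI) with (a + 2 * PI - a) at 2 by ring.
pose proof PI_RGT_0.
apply Cmod_CInt_le_const; [lra|apply ex_CInt_continuous; intros; apply circ_coef_continuous; assumption|].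
intros x _; rewrite Cmod_mult; unfold circ_negpow; rewrite Cmod_Cexp; simpl Re.
apply Rmult_le_compat_r; [left; apply exp_pos|].
rewrite <- (Cmod_circ eta x); apply genfun_upto_bound; [exact Hz|apply Cmod_circ_lt1, He].
Qed.

(** Both sides obey the recurrence of [pcoef_S]. The starting values, namely the vanishing at
    negative indices, follow from the geometric bound [circ_coef_bound], so Cauchy's formula is
    obtained without any power series theory. *)
Lemma circ_coef_pcoef z eta a m : Cmod z <= 1 -> 0 < eta ->
  (forall n : Z, (n < 0)%Z -> circ_coef z eta a m n = 0%C) /\
  (forall n : nat, circ_coef z eta a m (Z.of_nat n) = (RtoC (2 * PI) * pcoef z m n)%C).
Proof.
intros Hz He; induction m as [|m [IH1 IH2]].
- assert (H : forall n, circ_coef z eta a 0 n = if Z.eq_dec n 0 then RtoC (2 * PI) else 0%C).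
  { intros n; unfold circ_coef; rewrite <- (CInt_circ_negpow n eta a); apply CInt_ext; intros x; simpl; ring. }
  split; intros n; [intros Hn|]; rewrite H.
  + destruct (Z.eq_dec n 0); [lia|reflexivity].
  + rewrite pcoef_0; destruct n as [|n]; destruct (Z.eq_dec _ _); try lia; ring.
- assert (Hneg : forall n : Z, (n < 0)%Z -> circ_coef z eta a (S m) n = 0%C).
  { intros n Hn.
    (* At negative indices the level [m] term is 0, so each use of the recurrence lowers the index
       by [S m] and multiplies by [z], whose modulus is at most 1. *)
    assert (Hit : forall K : nat, Cmod (circ_coef z eta a (S m) n)
       <= Cmod (circ_coef z eta a (S m) (n - Z.of_nat K * Z.of_nat (S m)))).
    { induction K as [|K IHK]; [replace (n - Z.of_nat 0 * Z.of_nat (S m))%Z with n by lia; lra|].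
      eapply Rle_trans; [exact IHK|]; rewrite circ_coef_S, IH1 by (assumption || lia).
      replace (n - Z.of_nat K * Z.of_nat (S m) - Z.of_nat (S m))%Z with (n - Z.of_nat (S K) * Z.of_nat (S m))%Z by lia.
      rewrite Cplus_0_l, Cmod_mult.
      match goal with |- _ * ?x <= _ => pose proof (Cmod_ge_0 z); assert (0 <= x) by apply Cmod_ge_0; nra end. }
    apply Cmod_eq_0, Rle_antisym; [|apply Cmod_ge_0].
    apply Rnot_lt_le; intros Hpos.
    set (B := 2 * PI * (/ (1 - exp (- eta))) ^ S m).
    assert (He1 : exp (- eta) < 1) by (rewrite <- exp_0; apply exp_increasing; lra).
    assert (HB : 0 < B).
    { unfold B; pose proof PI_RGT_0; apply Rmult_lt_0_compat; [lra|]; apply pow_lt, Rinv_0_lt_compat; lra. }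
    destruct (INR_unbounded (B / (Cmod (circ_coef z eta a (S m) n) * eta))) as (K & HK).
    pose proof (Rle_trans _ _ _ (Hit K) (circ_coef_bound z eta a (S m) _ Hz He)) as Hb.
    rewrite <- Rmult_assoc in Hb; fold B in Hb.
    set (c := Cmod (circ_coef z eta a (S m) n)) in *.
    (* The bound at index [n - K (m+1)] tends to 0 with [K], while the modulus under consideration
       is fixed. *)
    assert (Hexp : exp (IZR (n - Z.of_nat K * Z.of_nat (S m)) * eta) <= / (1 + INR K * eta)).
    { rewrite <- (Rinv_inv (exp _)); apply Rinv_le_contravar; [pose proof (pos_INR K); nra|].
      rewrite <- exp_Ropp. eapply Rle_trans; [apply exp_ineq1_le|]; apply exp_mono.
      rewrite INR_IZR_INZ.
      assert (IZR (Z.of_nat K) <= - IZR (n - Z.of_nat K * Z.of_nat (S m))).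
      { rewrite <- opp_IZR; apply IZR_le; nia. }
      nra. }
    assert (HK0 : 0 < 1 + INR K * eta) by (pose proof (pos_INR K); nra).
    assert (Hc2 : c * (1 + INR K * eta) <= B).
    { apply Rle_trans with (B * / (1 + INR K * eta) * (1 + INR K * eta)).
      - apply Rmult_le_compat_r; [lra|]. eapply Rle_trans; [exact Hb|]; apply Rmult_le_compat_l; lra.
      - right; field; lra. }
    assert (Hc3 : B < INR K * (c * eta)).
    { apply Rmult_gt_compat_r with (r := c * eta) in HK; [|apply Rmult_lt_0_compat; assumption].
      unfold Rdiv in HK; rewrite Rmult_assoc, Rinv_l, Rmult_1_r in HK; [exact HK|].
      apply Rgt_not_eq, Rmult_lt_0_compat; assumption. }
    nra. }
  split; [exact Hneg|].
  intros n; induction n as [n IHn] using (well_founded_induction Wf_nat.lt_wf).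
  rewrite circ_coef_S, IH2, pcoef_S by assumption.
  destruct (le_dec (S m) n) as [Hle|Hle].
  + replace (Z.of_nat n - Z.of_nat (S m))%Z with (Z.of_nat (n - S m)) by lia.
    rewrite IHn by lia; ring.
  + rewrite Hneg by lia; ring.
Qed.

(* [loggen_tail z M q] is [- sum_(m > M) log (1 - z q^m)], expanded in powers of [z]. *)
Definition loggen_term (z : C) (M : nat) (q : C) (r : nat) : C :=
  (z ^ S r / RtoC (INR (S r)) * ((q ^ S r) ^ S M / (1 - q ^ S r)))%C.

Definition loggen_tail (z : C) (M : nat) (q : C) : C := CSeries (loggen_term z M q).

(** The infinite product is introduced as the exponential of its logarithm, the form in which its
    asymptotics are computed; [genfun_split] relates it to the finite products. *)
Definition genfun (z q : C) : C := Cexp (loggen_tail z 0 q).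

Lemma pow_le_1 x n : 0 <= x <= 1 -> 0 <= x ^ n <= 1.
Proof.
intros H; split; [apply pow_le; lra|]. rewrite <- (pow1 n); apply pow_incr; lra.
Qed.

Lemma pow_S_le x n : 0 <= x <= 1 -> x ^ S n <= x.
Proof. intros H; simpl; pose proof (pow_le_1 x n H); nra. Qed.

Lemma Cmod_pow_S_lt1 q r : Cmod q < 1 -> Cmod (q ^ S r) <= Cmod q.
Proof. intros H; rewrite Cmod_pow; apply pow_S_le; split; [apply Cmod_ge_0|lra]. Qed.

Lemma Cmod_div_INR_le w r : Cmod (w / RtoC (INR (S r)))%C <= Cmod w.
Proof.
rewrite Cmod_div by apply RtoC_neq0, INR_S_neq0.
rewrite Cmod_RtoC_pos by (left; apply INR_S_pos).
assert (1 <= INR (S r)) by (rewrite S_INR; pose proof (pos_INR r); lra).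
assert (/ INR (S r) <= 1) by (rewrite <- Rinv_1; apply Rinv_le_contravar; lra).
unfold Rdiv; pose proof (Cmod_ge_0 w); nra.
Qed.

Lemma loggen_term_bound z M q r : Cmod z <= 1 -> Cmod q < 1 ->
  Cmod (loggen_term z M q r) <= Cmod q ^ M * / (1 - Cmod q) * (Cmod q * Cmod q ^ r).
Proof.
intros Hz Hq; unfold loggen_term.
pose proof (Cmod_pow_S_lt1 q r Hq) as Hr; pose proof (Cmod_ge_0 q) as Hq0.
pose proof (Cmod_one_minus_ge _ _ Hr) as Hd.
rewrite Cmod_mult, (Cmod_div ((q ^ S r) ^ S M)) by (apply one_minus_neq0; lra).
rewrite (Cmod_pow (q ^ S r) (S M)).
assert (H1 : Cmod (z ^ S r / RtoC (INR (S r)))%C <= 1).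
{ eapply Rle_trans; [apply Cmod_div_INR_le|]; rewrite Cmod_pow; apply pow_le_1; split; [apply Cmod_ge_0|exact Hz]. }
assert (H2 : Cmod (q ^ S r) ^ S M <= Cmod q ^ M * (Cmod q * Cmod q ^ r)).
{ simpl pow. rewrite (Cmod_pow q (S r)) at 1. simpl pow. rewrite Rmult_comm.
  apply Rmult_le_compat_r; [apply Rmult_le_pos; [exact Hq0|apply pow_le, Hq0]|].
  apply pow_incr; split; [apply Cmod_ge_0|exact Hr]. }
assert (H3 : / Cmod (1 - q ^ S r)%C <= / (1 - Cmod q)) by (apply Rinv_le_contravar; lra).
assert (H4 : 0 <= Cmod (q ^ S r) ^ S M) by (apply pow_le, Cmod_ge_0).
assert (H5 : 0 < / Cmod (1 - q ^ S r)%C) by (apply Rinv_0_lt_compat; lra).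
rewrite <- (Rmult_1_l (Cmod q ^ M * / (1 - Cmod q) * (Cmod q * Cmod q ^ r))).
apply Rmult_le_compat; [apply Cmod_ge_0|unfold Rdiv; nra|exact H1|].
unfold Rdiv; replace (Cmod q ^ M * / (1 - Cmod q) * (Cmod q * Cmod q ^ r))
  with (Cmod q ^ M * (Cmod q * Cmod q ^ r) * / (1 - Cmod q)) by ring.
apply Rmult_le_compat; lra.
Qed.

Lemma is_series_geom_scal k x : 0 <= x < 1 -> is_series (fun r => k * (x * x ^ r)) (k * (x * / (1 - x))).
Proof.
intros H; apply (is_series_scal k (fun r => x * x ^ r)), (is_series_scal x (fun r => x ^ r)), is_series_geom.
rewrite Rabs_pos_eq; lra.
Qed.

Lemma loggen_tail_correct z M q : Cmod z <= 1 -> Cmod q < 1 ->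
  is_Cseries (loggen_term z M q) (loggen_tail z M q).
Proof.
intros Hz Hq; apply CSeries_correct.
apply ex_Cseries_dom with (fun r => Cmod q ^ M * / (1 - Cmod q) * (Cmod q * Cmod q ^ r)).
- intros r; apply loggen_term_bound; assumption.
- eexists; apply is_series_geom_scal; split; [apply Cmod_ge_0|exact Hq].
Qed.

Lemma loggen_tail_bound z M q : Cmod z <= 1 -> Cmod q < 1 ->
  Cmod (loggen_tail z M q) <= Cmod q ^ M * / (1 - Cmod q) * (Cmod q * / (1 - Cmod q)).
Proof.
intros Hz Hq.
apply (Cmod_Cseries_le (loggen_term z M q) _ (fun r => Cmod q ^ M * / (1 - Cmod q) * (Cmod q * Cmod q ^ r))).
- intros r; apply loggen_term_bound; assumption.
- apply loggen_tail_correct; assumption.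
- apply is_series_geom_scal; split; [apply Cmod_ge_0|exact Hq].
Qed.

(** Termwise, [(q^r)^(M+1) / (1 - q^r)] exceeds [(q^r)^(M+2) / (1 - q^r)] by [(q^(M+1))^r], which
    sums to the logarithm of the split factor. *)
Lemma loggen_tail_S z M q : Cmod z <= 1 -> Cmod q < 1 ->
  Cexp (loggen_tail z M q) = (Cexp (loggen_tail z (S M) q) / (1 - z * q ^ S M))%C.
Proof.
intros Hz Hq.
pose proof (Cmod_zq z q M Hz Hq) as Hv.
assert (Hre : Re (z * q ^ S M)%C < 1) by (pose proof (Re_le (z * q ^ S M)%C); lra).
rewrite <- Cexp_Clog1m by exact Hre.
rewrite <- Cexp_minus; f_equal.
rewrite <- (is_Cseries_unique (loggen_term z M q) (loggen_tail z (S M) q - Clog1m (z * q ^ S M))%C); [reflexivity|].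
apply is_Cseries_ext with (fun r => loggen_term z (S M) q r + logterm (z * q ^ S M) r)%C.
- intros r; unfold loggen_term, logterm.
  pose proof (Cmod_pow_S_lt1 q r Hq) as Hr.
  assert (H1 : (1 - q ^ S r)%C <> 0%C) by (apply one_minus_neq0; lra).
  pose proof (RtoC_neq0 _ (INR_S_neq0 r)) as H2.
  rewrite Cpow_mult_l, <- (Cpow_mult_r q (S M) (S r)), (Nat.mul_comm (S M)), Cpow_mult_r.
  rewrite (Cpow_S (q ^ S r) (S M)); field; split; assumption.
- apply is_Cseries_plus; [apply loggen_tail_correct; assumption|].
  apply is_Cseries_log; [lra|]; intros E; rewrite E in Hre; simpl in Hre; lra.
Qed.

Lemma genfun_split z M q : Cmod z <= 1 -> Cmod q < 1 ->
  genfun z q = (genfun_upto z M q * Cexp (loggen_tail z M q))%C.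
Proof.
intros Hz Hq; unfold genfun; induction M as [|M IH]; [simpl; ring|].
rewrite IH, loggen_tail_S by assumption; cbn [genfun_upto]; unfold Cdiv; ring.
Qed.

(** All estimates depend only on [Cmod q = exp (- eta)], hence the convergence is uniform along the
    circle. *)
Lemma genfun_upto_limit z eta eps : Cmod z <= 1 -> 0 < eta -> 0 < eps ->
  exists M0, forall M, (M0 <= M)%nat -> forall x, Cmod (genfun z (circ eta x) - genfun_upto z M (circ eta x))%C <= eps.
Proof.
intros Hz He Heps.
set (rho := exp (- eta)).
assert (Hrho : 0 < rho < 1).
{ split; [apply exp_pos|unfold rho; rewrite <- exp_0; apply exp_increasing; lra]. }
set (K := / (1 - rho) * (rho * / (1 - rho))).
assert (HK : 0 < K).
{ unfold K; assert (0 < / (1 - rho)) by (apply Rinv_0_lt_compat; lra).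
  apply Rmult_lt_0_compat; [assumption|apply Rmult_lt_0_compat; lra]. }
assert (HKe : 0 < exp K * (K * exp K)) by (pose proof (exp_pos K); apply Rmult_lt_0_compat; [|apply Rmult_lt_0_compat]; lra).
destruct (pow_lt_1_zero rho ltac:(rewrite Rabs_pos_eq; lra) (eps / (exp K * (K * exp K)))) as (M0 & HM0).
{ apply Rdiv_lt_0_compat; assumption. }
exists M0; intros M HM x.
set (q := circ eta x).
assert (Hq : Cmod q = rho) by apply Cmod_circ.
assert (Hq1 : Cmod q < 1) by lra.
assert (Hb : Cmod (loggen_tail z M q) <= rho ^ M * K).
{ pose proof (loggen_tail_bound z M q Hz Hq1) as H; rewrite Hq in H; unfold K; rewrite <- Rmult_assoc; exact H. }
assert (HrM : 0 <= rho ^ M <= 1) by (apply pow_le_1; lra).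
assert (Hb0 : Re (loggen_tail z 0 q) <= K).
{ pose proof (loggen_tail_bound z 0 q Hz Hq1) as H; rewrite Hq in H; simpl pow in H; rewrite Rmult_1_l in H.
  pose proof (Re_le (loggen_tail z 0 q)); unfold K; lra. }
assert (E : genfun_upto z M q = (genfun z q * Cexp (- loggen_tail z M q))%C).
{ rewrite (genfun_split z M q Hz Hq1), Cexp_opp; field; apply Cexp_neq0. }
rewrite E.
replace (genfun z q - genfun z q * Cexp (- loggen_tail z M q))%C
  with (- (genfun z q * (Cexp (- loggen_tail z M q) - 1)))%C by ring.
rewrite Cmod_opp, Cmod_mult; unfold genfun at 1; rewrite Cmod_Cexp.
apply Rle_trans with (exp K * (rho ^ M * K * exp K)).
- apply Rmult_le_compat; [left; apply exp_pos|apply Cmod_ge_0|apply exp_mono, Hb0|].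
  eapply Rle_trans; [apply Cexp_bound1|]; rewrite Cmod_opp.
  apply Rmult_le_compat; [apply Cmod_ge_0|left; apply exp_pos|exact Hb|].
  apply exp_mono; nra.
- specialize (HM0 M HM); rewrite Rabs_pos_eq in HM0 by lra.
  replace (exp K * (rho ^ M * K * exp K)) with (rho ^ M * (exp K * (K * exp K))) by ring.
  apply Rmult_lt_compat_r with (r := exp K * (K * exp K)) in HM0; [|exact HKe].
  unfold Rdiv in HM0; rewrite Rmult_assoc, Rinv_l in HM0 by lra; lra.
Qed.

Lemma genfun_circ_continuous z eta t : Cmod z <= 1 -> 0 < eta -> Ccontinuous (fun x => genfun z (circ eta x)) t.
Proof.
intros Hz He; apply Ccontinuous_unif; intros eps Heps.
destruct (genfun_upto_limit z eta eps Hz He Heps) as (M & HM).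
exists (fun x => genfun_upto z M (circ eta x)); split; [apply genfun_upto_continuous; assumption|].
intros y; apply HM; lia.
Qed.

(** The integral of the finite product is already exact as soon as [M >= n]; only then is [M] sent
    to infinity, using uniform convergence on the circle. *)
Theorem Q_Cauchy z eta a n : Cmod z <= 1 -> 0 < eta ->
  (RtoC (2 * PI) * Q n z)%C =
  CInt (fun x => genfun z (circ eta x) * circ_negpow (Z.of_nat n) eta x)%C a (a + 2 * PI).
Proof.
intros Hz He.
set (I := CInt _ _ _).
apply Ceq_minus, Cmod_eq_0, Rle_antisym; [|apply Cmod_ge_0].
apply le_epsilon; intros eps Heps; rewrite Rplus_0_l.
pose proof PI_RGT_0 as Hpi.
set (A := exp (INR n * eta)).
assert (HA : 0 < A) by apply exp_pos.
destruct (genfun_upto_limit z eta (eps / (2 * PI * A)) Hz He) as (M0 & HM0).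
{ apply Rdiv_lt_0_compat; [exact Heps|apply Rmult_lt_0_compat; lra]. }
set (M := max M0 n).
rewrite <- (pcoef_Q z M n) by lia.
rewrite <- (proj2 (circ_coef_pcoef z eta a M Hz He) n).
set (f := fun x => (genfun_upto z M (circ eta x) * circ_negpow (Z.of_nat n) eta x)%C).
set (g := fun x => (genfun z (circ eta x) * circ_negpow (Z.of_nat n) eta x)%C).
assert (Hf : forall x, Ccontinuous f x) by (intros x; apply circ_coef_continuous; assumption).
assert (Hg : forall x, Ccontinuous g x).
{ intros x; apply Ccontinuous_mult; [apply genfun_circ_continuous; assumption|apply circ_negpow_continuous]. }
change (Cmod (CInt f a (a + 2 * PI) - CInt g a (a + 2 * PI))%C <= eps).
rewrite <- (CInt_minus f g a (a + 2 * PI)) by (apply ex_CInt_continuous; assumption).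
replace eps with ((a + 2 * PI - a) * (eps / (2 * PI * A) * A)) by (field; split; lra).
apply Cmod_CInt_le_const; [lra| |].
- apply ex_CInt_continuous; intros x; apply (Ccontinuous_minus f g); [apply Hf|apply Hg].
- intros x _; unfold f, g.
  replace (genfun_upto z M (circ eta x) * circ_negpow (Z.of_nat n) eta x - genfun z (circ eta x) * circ_negpow (Z.of_nat n) eta x)%C
    with ((genfun_upto z M (circ eta x) - genfun z (circ eta x)) * circ_negpow (Z.of_nat n) eta x)%C by ring.
  rewrite Cmod_mult, Cmod_minus_sym; unfold circ_negpow; rewrite Cmod_Cexp; simpl Re.
  rewrite <- INR_IZR_INZ; apply Rmult_le_compat_r; [left; apply exp_pos|].
  apply HM0; lia.
Qed.

Lemma is_series_telescope (u : nat -> R) :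
  (forall eps, 0 < eps -> exists N, forall n, (N <= n)%nat -> Rabs (u n) < eps) ->
  is_series (fun n => u n - u (S n)) (u O).
Proof.
intros H; apply is_series_Rsumn; intros eps He; destruct (H eps He) as (N & HN).
exists N; intros n Hn.
assert (E : forall m, Rsumn (fun n => u n - u (S n)) m = u O - u m).
{ induction m as [|m IH]; simpl; [ring|rewrite IH; ring]. }
rewrite E; replace (u O - u n - u O) with (- u n) by ring; rewrite Rabs_Ropp; apply HN, Hn.
Qed.

Lemma inv_affine_small (a eps : R) : 0 < a -> 0 < eps ->
  exists N, forall n, (N <= n)%nat -> Rabs (/ (1 + INR n * a)) < eps.
Proof.
intros Ha He; destruct (INR_unbounded (/ (a * eps))) as (N & HN).
assert (Hae : 0 < a * eps) by (apply Rmult_lt_0_compat; assumption).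
exists N; intros n Hn; apply le_INR in Hn; pose proof (pos_INR N).
assert (0 <= INR n * a) by nra.
rewrite Rabs_pos_eq by (left; apply Rinv_0_lt_compat; lra).
apply Rmult_lt_reg_r with (1 + INR n * a); [lra|]; rewrite Rinv_l by lra.
apply Rmult_gt_compat_r with (r := a * eps) in HN; [|exact Hae].
rewrite Rinv_l in HN by lra. nra.
Qed.

Lemma is_series_inv_affine (a : R) : 0 < a ->
  is_series (fun n => / (1 + INR n * a) - / (1 + INR (S n) * a)) 1.
Proof.
intros Ha; pose proof (is_series_telescope (fun n => / (1 + INR n * a))) as H.
cbv beta in H; simpl (INR 0) in H.
replace (/ (1 + 0 * a)) with 1 in H by (rewrite Rmult_0_l, Rplus_0_r, Rinv_1; reflexivity).
apply H; intros eps He; apply inv_affine_small; assumption.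
Qed.

(** A discrete form of the integral of [1/(1+y)^2]: after telescoping, the sum over [n] is at most 1
    whatever [a] is. This uniformity in the step size bounds [sector_rem] up to the boundary. *)
Lemma inv_affine_sqr_le (a : R) n : 0 < a ->
  0 <= a / (1 + INR (S n) * a) ^ 2 <= / (1 + INR n * a) - / (1 + INR (S n) * a).
Proof.
intros Ha; pose proof (pos_INR n); rewrite S_INR.
assert (H1 : 0 < 1 + INR n * a) by nra; assert (H2 : 0 < 1 + (INR n + 1) * a) by nra.
split; [apply Rmult_le_pos; [lra|left; apply Rinv_0_lt_compat, pow_lt; exact H2]|].
replace (/ (1 + INR n * a) - / (1 + (INR n + 1) * a)) with (a / ((1 + INR n * a) * (1 + (INR n + 1) * a)))
  by (field; split; lra).
apply Rmult_le_compat_l; [lra|]; apply Rinv_le_contravar; [apply Rmult_lt_0_compat; assumption|].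
simpl; rewrite Rmult_1_r; apply Rmult_le_compat_r; lra.
Qed.

Lemma ex_series_inv_sqr : ex_series (fun n => / INR (S n) ^ 2).
Proof.
apply ex_series_dom with (fun n => 2 * (/ (1 + INR n * 1) - / (1 + INR (S n) * 1))).
- intros n; pose proof (INR_S_pos n); pose proof (pos_INR n).
  rewrite Rabs_pos_eq by (left; apply Rinv_0_lt_compat, pow_lt; assumption).
  rewrite S_INR in *.
  replace (2 * (/ (1 + INR n * 1) - / (1 + (INR n + 1) * 1))) with (2 / ((INR n + 1) * (INR n + 2))) by (field; split; lra).
  apply Rmult_le_reg_r with ((INR n + 1) ^ 2 * (INR n + 2)); [apply Rmult_lt_0_compat; [apply pow_lt|]; lra|].
  replace (/ (INR n + 1) ^ 2 * ((INR n + 1) ^ 2 * (INR n + 2))) with (INR n + 2) by (field; lra).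
  replace (2 / ((INR n + 1) * (INR n + 2)) * ((INR n + 1) ^ 2 * (INR n + 2))) with (2 * (INR n + 1)) by (field; split; lra).
  lra.
- eexists; exact (is_series_scal 2 _ _ (is_series_inv_affine 1 Rlt_0_1)).
Qed.

Lemma is_Cseries_Li2 (w : C) : Cmod w <= 1 ->
  is_Cseries (fun n => w ^ S n / RtoC (INR (S n) ^ 2))%C (Li2 w).
Proof.
intros Hw.
assert (H : ex_Cseries (fun n => w ^ S n / RtoC (INR (S n) ^ 2))%C).
{ apply ex_Cseries_dom with (fun n => / INR (S n) ^ 2); [|apply ex_series_inv_sqr].
  intros n; pose proof (INR_S_pos n).
  rewrite Cmod_div by (apply RtoC_neq0, pow_nonzero, INR_S_neq0).
  rewrite Cmod_RtoC_pos, Cmod_pow by (apply pow_le; lra).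
  rewrite <- (Rmult_1_l (/ _)); apply Rmult_le_compat_r; [left; apply Rinv_0_lt_compat, pow_lt; assumption|].
  apply pow_le_1; split; [apply Cmod_ge_0|exact Hw]. }
destruct H as (l & H); rewrite (Li2_is_Cseries w l H); exact H.
Qed.

(** * Behaviour in a sector at the boundary *)

(* The function [e^(-xy)/(1 - e^(-y))] minus its singular part at [0], the
   constant term being cut off at infinity by [e^(-y)]. *)
Definition kernel (x : R) (y : C) : C :=
  (Cexp (- (RtoC x * y)) / (1 - Cexp (- y)) - / y - RtoC (1 / 2 - x) * Cexp (- y))%C.

Definition kernel' (x : R) (y : C) : C :=
  ((- (RtoC x * Cexp (- (RtoC x * y)) * (1 - Cexp (- y))) - Cexp (- (RtoC x * y)) * Cexp (- y))
     / ((1 - Cexp (- y)) * (1 - Cexp (- y))) + / (y * y) + RtoC (1 / 2 - x) * Cexp (- y))%C.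

Lemma one_minus_Cexp_neq0 (y : C) : 0 < Re y -> (1 - Cexp (- y))%C <> 0%C.
Proof.
intros H; apply one_minus_neq0; rewrite Cmod_Cexp, Re_opp, <- exp_0; apply exp_increasing; lra.
Qed.

Lemma kernel_derive x a b t : 0 < Re (a + RtoC t * b)%C ->
  is_Cderive (fun u => kernel x (a + RtoC u * b)) t (b * kernel' x (a + RtoC t * b))%C.
Proof.
intros H; pose proof (one_minus_Cexp_neq0 _ H) as H1.
assert (H2 : (a + RtoC t * b)%C <> 0%C) by (apply C_neq0_Re; lra).
unfold kernel; set (y := fun u => (a + RtoC u * b)%C).
assert (Hy : is_Cderive y t b) by apply is_Cderive_line.
assert (HE : is_Cderive (fun u => Cexp (- y u)) t (- b * Cexp (- y t))%C) by (apply is_Cderive_Cexp, is_Cderive_opp, Hy).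
assert (HX : is_Cderive (fun u => Cexp (- (RtoC x * y u))) t (- (0 * y t + RtoC x * b) * Cexp (- (RtoC x * y t)))%C).
{ apply is_Cderive_Cexp, is_Cderive_opp; apply (is_Cderive_mult (fun _ => RtoC x)); [apply is_Cderive_const|exact Hy]. }
assert (HI : is_Cderive (fun u => / (1 - Cexp (- y u)))%C t
   (- (0 - (- b * Cexp (- y t))) / ((1 - Cexp (- y t)) * (1 - Cexp (- y t))))%C).
{ apply (is_Cderive_inv (fun u => 1 - Cexp (- y u))%C); [|exact H1].
  apply is_Cderive_minus; [apply is_Cderive_const|exact HE]. }
pose proof (is_Cderive_mult _ _ t _ _ HX HI) as HM.
pose proof (is_Cderive_inv y t b Hy H2) as HJ.
pose proof (is_Cderive_mult (fun _ => RtoC (1 / 2 - x)) _ t _ _ (is_Cderive_const _ t) HE) as HK.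
pose proof (is_Cderive_minus _ _ t _ _ (is_Cderive_minus _ _ t _ _ HM HJ) HK) as HF.
cbv beta in HF; unfold Cdiv at 1.
match type of HF with is_Cderive _ _ ?d => replace (b * kernel' x (a + RtoC t * b))%C with d; [exact HF|] end.
unfold kernel'; change (a + RtoC t * b)%C with (y t) in *.
field; split; assumption.
Qed.

Lemma Cmod_le_quarter_exp (y : C) : Cmod y <= 1 / 4 -> exp (Cmod y) <= 2.
Proof.
intros H; apply Rle_trans with (exp (1 / 4)); [apply exp_mono, H|].
rewrite <- (Rinv_inv (exp (1 / 4))), <- exp_Ropp.
apply Rle_trans with (/ (1 / 2)); [|lra]; apply Rinv_le_contravar; [lra|].
pose proof (exp_ineq1_le (- (1 / 4))); lra.
Qed.

(* Taylor expansions [e^(-y) = 1 - y + y^2/2 + al y^3], [e^(-xy) = 1 - xy + be y^2] and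
   [1 - e^(-y) = y p]. *)
Lemma small_expansion (x : R) (y : C) : 0 <= x <= 1 -> 0 < Cmod y <= 1 / 4 ->
  exists al be p : C, Cmod al <= 2 /\ Cmod be <= 2 /\ / 2 <= Cmod p <= 2 /\
    p = (1 - y / 2 - y * y * al)%C /\
    Cexp (- y) = (1 - y * p)%C /\ Cexp (- (RtoC x * y)) = (1 - RtoC x * y + y * y * be)%C.
Proof.
intros Hx Hy.
assert (Hy0 : y <> 0%C) by (apply Cmod_gt_0; lra).
pose proof (Cmod_le_quarter_exp y ltac:(lra)) as He.
assert (Hxy : Cmod (RtoC x * y)%C <= Cmod y) by (apply Cmod_seg_le, Hx).
pose proof (Cmod_le_quarter_exp (RtoC x * y)%C ltac:(lra)) as Hex.
exists ((Cexp (- y) - 1 - (- y) - (- y) * (- y) / 2) / (y * y * y))%C,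
  ((Cexp (- (RtoC x * y)) - 1 - (- (RtoC x * y))) / (y * y))%C,
  ((1 - Cexp (- y)) / y)%C.
pose proof (pow_lt (Cmod y) 2 ltac:(lra)); pose proof (pow_lt (Cmod y) 3 ltac:(lra)).
split; [|split; [|split; [|split; [|split]]]].
- rewrite Cmod_div by (repeat apply Cmult_neq_0; exact Hy0).
  rewrite !Cmod_mult; replace (Cmod y * Cmod y * Cmod y) with (Cmod y ^ 3) by ring.
  apply Rle_div_l; [assumption|].
  eapply Rle_trans; [apply Cexp_bound3|]; rewrite Cmod_opp; nra.
- rewrite Cmod_div by (repeat apply Cmult_neq_0; exact Hy0).
  rewrite !Cmod_mult; replace (Cmod y * Cmod y) with (Cmod y ^ 2) by ring.
  apply Rle_div_l; [assumption|].
  eapply Rle_trans; [apply Cexp_bound2|]; rewrite Cmod_opp.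
  assert (Cmod (RtoC x * y) ^ 2 <= Cmod y ^ 2) by (apply pow_incr; split; [apply Cmod_ge_0|exact Hxy]).
  pose proof (pow2_ge_0 (Cmod (RtoC x * y)%C)); pose proof (exp_pos (Cmod (RtoC x * y)%C)); nra.
- rewrite Cmod_div by exact Hy0.
  pose proof (Cexp_bound2 (- y)%C) as Hb; rewrite Cmod_opp in Hb.
  replace (1 - Cexp (- y))%C with (y - (Cexp (- y) - 1 - - y))%C by ring.
  pose proof (Cmod_minus_ge y (Cexp (- y) - 1 - - y)%C) as H1.
  pose proof (Cmod_triangle_minus y (Cexp (- y) - 1 - - y)%C) as H2.
  assert (Cmod y ^ 2 * exp (Cmod y) <= Cmod y * / 2) by (simpl; nra).
  split; [apply Rle_div_r|apply Rle_div_l]; lra.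
- field; exact Hy0.
- field; exact Hy0.
- field; exact Hy0.
Qed.

Lemma Cmod_plus_le a b A B : Cmod a <= A -> Cmod b <= B -> Cmod (a + b)%C <= A + B.
Proof. intros; eapply Rle_trans; [apply Cmod_triangle|lra]. Qed.
Lemma Cmod_minus_le a b A B : Cmod a <= A -> Cmod b <= B -> Cmod (a - b)%C <= A + B.
Proof. intros; eapply Rle_trans; [apply Cmod_triangle_minus|lra]. Qed.
Lemma Cmod_mult_le a b A B : Cmod a <= A -> Cmod b <= B -> Cmod (a * b)%C <= A * B.
Proof. intros; rewrite Cmod_mult; apply Rmult_le_compat; try apply Cmod_ge_0; assumption. Qed.
Lemma Cmod_div_le a b A B : Cmod a <= A -> 0 < B -> B <= Cmod b -> Cmod (a / b)%C <= A / B.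
Proof.
intros Ha HB Hb; rewrite Cmod_div by (apply Cmod_gt_0; lra).
apply Rmult_le_compat; [apply Cmod_ge_0|left; apply Rinv_0_lt_compat; lra|exact Ha|].
apply Rinv_le_contravar; assumption.
Qed.

Ltac cmod_bound :=
  eapply Rle_trans;
  [repeat first [eassumption | apply Cmod_minus_le | apply Cmod_plus_le | apply Cmod_mult_le]|].

(** The poles at 0 cancel once the exponentials are replaced by the expansions of [small_expansion];
    what remains is a polynomial in bounded quantities divided by a power of [p]. *)
Lemma kernel_bounds_small x y : 0 <= x <= 1 -> 0 < Cmod y <= 1 / 4 ->
  Cmod (kernel x y) <= 13 * Cmod y /\ Cmod (kernel' x y) <= 53.
Proof.
intros Hx Hy.
assert (Hy0 : y <> 0%C) by (apply Cmod_gt_0; lra).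
destruct (small_expansion x y Hx Hy) as (al & be & p & Hal & Hbe & Hp & Ep & EE & EX).
assert (Hp0 : p <> 0%C) by (apply Cmod_gt_0; lra).
set (h := (RtoC (1 / 2) + y * al)%C).
assert (Eh : p = (1 - y * h)%C) by (rewrite Ep; unfold h; rewrite RtoC_div by lra; field; apply RtoC_neq0; lra).
assert (B0 : Cmod y <= 1 / 4) by lra.
assert (B1 : Cmod p <= 2) by lra. assert (B9 : / 2 <= Cmod p) by lra.
assert (B2 : Cmod (RtoC (1 / 2 - x)) <= 1 / 2) by (rewrite Cmod_R; apply Rabs_le; lra).
assert (B3 : Cmod (RtoC (1 / 2)) <= 1 / 2) by (rewrite Cmod_RtoC_pos; lra).
assert (B4 : Cmod (RtoC x) <= 1) by (rewrite Cmod_RtoC_pos; lra).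
assert (B5 : Cmod (RtoC (1 - x)) <= 1) by (rewrite Cmod_RtoC_pos; lra).
assert (B6 : Cmod 1%C <= 1) by (rewrite Cmod_1; lra).
assert (B7 : Cmod 2%C <= 2) by (rewrite Cmod_RtoC_pos; lra).
assert (B8 : Cmod h <= 1) by (unfold h; cmod_bound; lra).
split.
(* The bracket is at most [1/2 * (1 + 4) + 2 + 2 = 6.5] and [|p| >= 1/2], hence 13. For the
   derivative the numerator is at most 13.25 and [|p|^2 >= 1/4], hence 53. *)
- replace (kernel x y) with (y * ((RtoC (1 / 2 - x) * (h + p * p) + al + be) / p))%C.
  + rewrite Cmod_mult, Rmult_comm; apply Rmult_le_compat_r; [lra|].
    eapply Rle_trans; [apply Cmod_div_le with (B := / 2); [cmod_bound; apply Rle_refl|lra|lra]|lra].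
  + unfold kernel; rewrite EE, EX.
    assert (E1 : (al = (h - RtoC (1 / 2)) / y)%C) by (unfold h; field; exact Hy0).
    assert (E2 : (h = (1 - p) / y)%C) by (rewrite Eh; field; exact Hy0).
    rewrite E1, E2; rewrite RtoC_minus; replace (RtoC (1 / 2)) with (/ 2)%C by (rewrite RtoC_div by lra; field; apply RtoC_neq0; lra).
    field; repeat split; try assumption; try (apply RtoC_neq0; lra).
    intros E; apply (Cmult_neq_0 y p Hy0 Hp0); rewrite <- E; ring.
- replace (kernel' x y) with ((h * h - 2 * al - be * (1 - RtoC (1 - x) * (y * p)) - RtoC (1 - x) * h * (1 - RtoC x * y)
    - RtoC x * RtoC (1 - x) + RtoC (1 / 2 - x) * ((1 - y * p) * (p * p))) / (p * p))%C.
  + eapply Rle_trans; [apply Cmod_div_le with (B := / 4); [cmod_bound; apply Rle_refl|lra|]|lra].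
    rewrite Cmod_mult; nra.
  + unfold kernel'; rewrite EE, EX.
    assert (E1 : (al = (h - RtoC (1 / 2)) / y)%C) by (unfold h; field; exact Hy0).
    assert (E2 : (h = (1 - p) / y)%C) by (rewrite Eh; field; exact Hy0).
    rewrite E1, E2; rewrite !RtoC_minus; replace (RtoC (1 / 2)) with (/ 2)%C by (rewrite RtoC_div by lra; field; apply RtoC_neq0; lra).
    field; repeat split; try assumption; try (apply RtoC_neq0; lra).
    intros E; apply (Cmult_neq_0 y p Hy0 Hp0); rewrite <- E; ring.
Qed.

Lemma exp_neg_le_inv_sqr v : 0 < v -> exp (- v) <= 4 / v ^ 2.
Proof.
intros Hv; rewrite exp_Ropp.
assert (H : v ^ 2 / 4 <= exp v).
{ replace v with (v / 2 + v / 2) at 2 by field; rewrite exp_plus.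
  pose proof (exp_ineq1_le (v / 2)); simpl; nra. }
replace (4 / v ^ 2) with (/ (v ^ 2 / 4)) by (field; lra).
apply Rinv_le_contravar; [|exact H]; apply Rdiv_lt_0_compat; [apply pow_lt|]; lra.
Qed.

Lemma sector_Re (M : R) (y : C) : 0 <= M -> 0 < Re y -> Rabs (Im y) <= M * Re y -> Cmod y <= (1 + M) * Re y.
Proof.
intros HM Hy Hs; eapply Rle_trans; [apply Cmod_le_ReIm|]; rewrite (Rabs_pos_eq (Re y)) by lra; lra.
Qed.

(** Near 0 the kernel vanishes linearly. Far out in the sector the exponentials decay and only [1/y]
    is left, which is of size [|y| / (1 + |y|)^2] there; the derivative gains one more power. *)
Lemma kernel_bounds x M : 0 < x <= 1 -> 0 <= M -> exists K, 0 < K /\ forall y,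
  0 < Re y -> Rabs (Im y) <= M * Re y ->
  Cmod (kernel x y) <= K * (Cmod y / (1 + Cmod y) ^ 2) /\ Cmod (kernel' x y) <= K / (1 + Cmod y) ^ 2.
Proof.
intros Hx HM.
(* For [|y| > 1/4] in the sector, [k] bounds [Re y] from below, [d] bounds [|1 - e^(-y)|] from
   below, and [A / |y|^2] bounds [|e^(-xy)|] from above. *)
set (k := / (4 * (1 + M))); set (d := 1 - exp (- k)); set (A := 4 * (1 + M) ^ 2 / x ^ 2).
assert (Hk : 0 < k) by (apply Rinv_0_lt_compat; lra).
assert (Hd : 0 < d) by (unfold d; assert (exp (- k) < 1) by (rewrite <- exp_0; apply exp_increasing; lra); lra).
assert (HA : 0 < A) by (apply Rdiv_lt_0_compat; [pose proof (pow_lt (1 + M) 2 ltac:(lra)); lra|apply pow_lt; lra]).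
assert (HAd : 0 < A / d) by (apply Rdiv_lt_0_compat; assumption).
assert (HAd2 : 0 < A / (d * d)) by (apply Rdiv_lt_0_compat; [assumption|apply Rmult_lt_0_compat; assumption]).
set (K := 100 * (A / d + A / (d * d) + A + 1)).
assert (HK : 100 <= K) by (unfold K; lra).
exists K; split; [lra|].
intros y Hy Hs.
assert (Hm : 0 < Cmod y) by (pose proof (Re_le y); lra).
assert (Hy0 : y <> 0%C) by (apply Cmod_gt_0; lra).
set (m := Cmod y) in *.
assert (Hm2 : 0 < (1 + m) ^ 2) by (apply pow_lt; lra).
destruct (Rle_or_lt m (1 / 4)) as [Hsm|Hlg].
- destruct (kernel_bounds_small x y ltac:(lra) ltac:(fold m; lra)) as [H1 H2]; fold m in H1.
  assert (Hi : 64 / 100 <= / (1 + m) ^ 2).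
  { replace (64 / 100) with (/ ((1 + 1 / 4) ^ 2)) by field; apply Rinv_le_contravar; [exact Hm2|apply pow_incr; lra]. }
  split; [eapply Rle_trans; [exact H1|]|eapply Rle_trans; [exact H2|]]; unfold Rdiv.
  + assert (100 * (64 / 100) <= K * / (1 + m) ^ 2) by (apply Rmult_le_compat; lra). nra.
  + assert (100 * (64 / 100) <= K * / (1 + m) ^ 2) by (apply Rmult_le_compat; lra). lra.
- pose proof (sector_Re M y HM Hy Hs) as Hre; fold m in Hre.
  assert (Hrk : k <= Re y).
  { unfold k; apply Rmult_le_reg_l with (4 * (1 + M)); [lra|]; rewrite Rinv_r by lra; nra. }
  assert (HE1 : Cmod (Cexp (- y)) = exp (- Re y)) by (rewrite Cmod_Cexp; reflexivity).
  assert (HX1 : Cmod (Cexp (- (RtoC x * y))) = exp (- (x * Re y))).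
  { rewrite Cmod_Cexp; f_equal; rewrite Re_opp, Re_mult; simpl; ring. }
  assert (HX : exp (- (x * Re y)) <= A / m ^ 2).
  { eapply Rle_trans; [apply exp_neg_le_inv_sqr; nra|]; unfold A.
    replace (4 * (1 + M) ^ 2 / x ^ 2 / m ^ 2) with (4 / (x * m / (1 + M)) ^ 2) by (field; repeat split; lra).
    apply Rmult_le_compat_l; [lra|]; apply Rinv_le_contravar.
    - apply pow_lt, Rdiv_lt_0_compat; nra.
    - apply pow_incr; split; [apply Rmult_le_pos; [nra|left; apply Rinv_0_lt_compat; lra]|].
      apply Rle_div_l; nra. }
  assert (HE : exp (- Re y) <= A / m ^ 2) by (eapply Rle_trans; [|exact HX]; apply exp_mono; nra).
  assert (HE2 : exp (- Re y) <= exp (- k)) by (apply exp_mono; lra).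
  assert (Hdd : d <= Cmod (1 - Cexp (- y))%C) by (apply Cmod_one_minus_ge; lra).
  assert (Him : / m ^ 2 <= 25 / (1 + m) ^ 2).
  { apply Rmult_le_reg_r with (m ^ 2 * (1 + m) ^ 2); [apply Rmult_lt_0_compat; [apply pow_lt|]; lra|].
    replace (/ m ^ 2 * (m ^ 2 * (1 + m) ^ 2)) with ((1 + m) ^ 2) by (field; lra).
    replace (25 / (1 + m) ^ 2 * (m ^ 2 * (1 + m) ^ 2)) with ((5 * m) ^ 2) by (field; lra).
    apply pow_incr; lra. }
  assert (HAm : A / m ^ 2 <= 25 * A / (1 + m) ^ 2).
  { unfold Rdiv in *; nra. }
  set (J := / (1 + m) ^ 2) in *.
  assert (HJ : 0 < J) by (apply Rinv_0_lt_compat; exact Hm2).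
  assert (HX' : Cmod (Cexp (- (RtoC x * y))) <= 25 * A * J) by (rewrite HX1; unfold Rdiv in HAm; fold J in HAm; lra).
  assert (HE' : Cmod (Cexp (- y)) <= 25 * A * J) by (rewrite HE1; unfold Rdiv in HAm; fold J in HAm; lra).
  assert (HE1' : Cmod (Cexp (- y)) <= 1) by (rewrite HE1, <- exp_0; apply exp_mono; lra).
  assert (B2 : Cmod (RtoC (1 / 2 - x)) <= 1 / 2) by (rewrite Cmod_R; apply Rabs_le; lra).
  assert (B4 : Cmod (RtoC x) <= 1) by (rewrite Cmod_RtoC_pos; lra).
  assert (HXd : Cmod (Cexp (- (RtoC x * y)) / (1 - Cexp (- y)))%C <= 25 * A * J / d) by (apply Cmod_div_le; assumption).
  assert (HXd2 : Cmod (Cexp (- (RtoC x * y)) * Cexp (- y) / ((1 - Cexp (- y)) * (1 - Cexp (- y))))%C <= 25 * A * J * 1 / (d * d)).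
  { apply Cmod_div_le; [apply Cmod_mult_le; assumption|apply Rmult_lt_0_compat; assumption|].
    rewrite Cmod_mult; apply Rmult_le_compat; lra. }
  assert (E1 : 25 * A * J / d = 25 * (A / d) * J) by (field; lra).
  assert (E2 : 25 * A * J * 1 / (d * d) = 25 * (A / (d * d)) * J) by (field; lra).
  pose proof (one_minus_Cexp_neq0 y Hy) as HE0.
  split.
  + assert (Hinv : Cmod (/ y)%C <= 25 * J * m).
    { rewrite Cmod_inv by exact Hy0; fold m. replace (/ m) with (/ m ^ 2 * m) by (field; lra).
      apply Rmult_le_compat_r; [lra|exact Him]. }
    unfold kernel; eapply Rle_trans.
    * apply Cmod_minus_le; [apply Cmod_minus_le; [exact HXd|exact Hinv]|apply Cmod_mult_le; [exact B2|exact HE']].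
    * change (m / (1 + m) ^ 2) with (m * J); rewrite E1; unfold K.
      assert (0 < A * J) by (apply Rmult_lt_0_compat; assumption).
      assert (0 < A / d * J) by (apply Rmult_lt_0_compat; assumption).
      assert (0 < A / (d * d) * J) by (apply Rmult_lt_0_compat; assumption).
      assert (A * J <= 4 * (A * J * m)) by nra.
      assert (A / d * J <= 4 * (A / d * J * m)) by nra.
      assert (0 < A / (d * d) * J * m) by (apply Rmult_lt_0_compat; assumption).
      assert (0 < J * m) by (apply Rmult_lt_0_compat; assumption).
      lra.
  + assert (Hinv : Cmod (/ (y * y))%C <= 25 * J).
    { rewrite Cmod_inv, Cmod_mult by (apply Cmult_neq_0; exact Hy0); fold m.
      replace (m * m) with (m ^ 2) by ring; exact Him. }
    unfold kernel'.
    replace ((- (RtoC x * Cexp (- (RtoC x * y)) * (1 - Cexp (- y))) - Cexp (- (RtoC x * y)) * Cexp (- y))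
     / ((1 - Cexp (- y)) * (1 - Cexp (- y))))%C with
     (- RtoC x * (Cexp (- (RtoC x * y)) / (1 - Cexp (- y)))
      - Cexp (- (RtoC x * y)) * Cexp (- y) / ((1 - Cexp (- y)) * (1 - Cexp (- y))))%C by (field; exact HE0).
    eapply Rle_trans.
    * apply Cmod_plus_le; [apply Cmod_plus_le; [apply Cmod_minus_le; [apply Cmod_mult_le; [rewrite Cmod_opp; exact B4|exact HXd]|exact HXd2]|exact Hinv]|apply Cmod_mult_le; [exact B2|exact HE']].
    * change (K / (1 + m) ^ 2) with (K * J); rewrite E1, E2; unfold K.
      assert (0 < A * J) by (apply Rmult_lt_0_compat; assumption).
      assert (0 < A / d * J) by (apply Rmult_lt_0_compat; assumption).
      assert (0 < A / (d * d) * J) by (apply Rmult_lt_0_compat; assumption).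
      lra.
Qed.

Definition sector_term (w : C) (x : R) (s : C) (r : nat) : C :=
  (w ^ S r / RtoC (INR (S r)) *
    (Cexp (- (RtoC x * (RtoC (INR (S r)) * s))) / (1 - Cexp (- (RtoC (INR (S r)) * s)))))%C.

(* [- sum_(l >= 0) log (1 - w e^(-s (l + x)))], expanded in powers of [w]. *)
Definition sector_log (w : C) (x : R) (s : C) : C := CSeries (sector_term w x s).

Lemma Re_INR_mult r s : Re (RtoC (INR (S r)) * s)%C = INR (S r) * Re s.
Proof. rewrite Re_mult; rewrite Re_RtoC, Im_RtoC; ring. Qed.
Lemma Im_INR_mult r s : Im (RtoC (INR (S r)) * s)%C = INR (S r) * Im s.
Proof. rewrite Im_mult; rewrite Re_RtoC, Im_RtoC; ring. Qed.

Lemma INR_S_ge1 r : 1 <= INR (S r).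
Proof. rewrite S_INR; pose proof (pos_INR r); lra. Qed.

Lemma sector_term_bound w x s r : Cmod w <= 1 -> 0 < x -> 0 < Re s ->
  Cmod (sector_term w x s r) <= / (1 - exp (- Re s)) * (exp (- (x * Re s)) * exp (- (x * Re s)) ^ r).
Proof.
intros Hw Hx Hs; unfold sector_term.
pose proof (INR_S_ge1 r) as H1.
set (y := (RtoC (INR (S r)) * s)%C).
assert (Hy : Re y = INR (S r) * Re s) by apply Re_INR_mult.
assert (He : exp (- Re s) < 1) by (rewrite <- exp_0; apply exp_increasing; lra).
rewrite <- (Rmult_1_l (/ _ * _)).
apply Cmod_mult_le.
- eapply Rle_trans; [apply Cmod_div_INR_le|]; rewrite Cmod_pow; apply pow_le_1; split; [apply Cmod_ge_0|exact Hw].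
- rewrite (Rmult_comm (/ _)); apply Cmod_div_le; [|lra|].
  + rewrite Cmod_Cexp, Re_opp, Re_mult, Hy, Re_RtoC, Im_RtoC.
    change (exp (- (x * Re s)) * exp (- (x * Re s)) ^ r) with (exp (- (x * Re s)) ^ S r).
    rewrite <- Rpower_pow by apply exp_pos; unfold Rpower; rewrite ln_exp; apply exp_mono; right; ring.
  + apply Cmod_one_minus_ge; rewrite Cmod_Cexp, Re_opp, Hy; apply exp_mono; nra.
Qed.

Lemma is_Cseries_sector_log w x s : Cmod w <= 1 -> 0 < x -> 0 < Re s ->
  is_Cseries (sector_term w x s) (sector_log w x s).
Proof.
intros Hw Hx Hs; apply CSeries_correct.
eapply ex_Cseries_dom; [intros r; apply sector_term_bound; assumption|].
eexists; apply is_series_geom_scal; split; [left; apply exp_pos|].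
rewrite <- exp_0; apply exp_increasing; nra.
Qed.

(** The two terms subtracted in [kernel] sum in closed form: [1/y] produces [Li2 w / s], and the
    cut-off constant [(1/2 - x) e^(-y)] produces the logarithm series at [w e^(-s)]. *)
Lemma sector_log_decomp w x s : Cmod w <= 1 -> 0 < x -> 0 < Re s ->
  is_Cseries (fun r => w ^ S r * (kernel x (RtoC (INR (S r)) * s) / RtoC (INR (S r))))%C
    (sector_log w x s - Li2 w / s + RtoC (1 / 2 - x) * Clog1m (w * Cexp (- s)))%C.
Proof.
intros Hw Hx Hs.
assert (Hs0 : s <> 0%C) by (apply C_neq0_Re; lra).
assert (He : exp (- Re s) < 1) by (rewrite <- exp_0; apply exp_increasing; lra).
assert (Hv : Cmod (w * Cexp (- s))%C < 1).
{ rewrite Cmod_mult, Cmod_Cexp, Re_opp. pose proof (exp_pos (- Re s)); pose proof (Cmod_ge_0 w); nra. }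
apply is_Cseries_ext with (fun r => sector_term w x s r - / s * (w ^ S r / RtoC (INR (S r) ^ 2))
   - RtoC (1 / 2 - x) * logterm (w * Cexp (- s)) r)%C.
- intros r; unfold sector_term, logterm, kernel.
  set (k := INR (S r)); pose proof (RtoC_neq0 _ (INR_S_neq0 r)) as H1; fold k in H1.
  assert (H2 : (1 - Cexp (- (RtoC k * s)))%C <> 0%C).
  { apply one_minus_Cexp_neq0; unfold k; rewrite Re_INR_mult; pose proof (INR_S_pos r); nra. }
  rewrite Cpow_mult_l, (Cexp_pow (- s) (S r)); fold k.
  replace (RtoC k * - s)%C with (- (RtoC k * s))%C by ring.
  replace (RtoC (k ^ 2)) with (RtoC k * RtoC k)%C by (rewrite <- RtoC_mult; f_equal; ring).
  field; repeat split; assumption.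
- replace (sector_log w x s - Li2 w / s + RtoC (1 / 2 - x) * Clog1m (w * Cexp (- s)))%C
   with (sector_log w x s - / s * Li2 w - RtoC (1 / 2 - x) * (- Clog1m (w * Cexp (- s))))%C by (unfold Cdiv; ring).
  apply is_Cseries_minus; [apply is_Cseries_minus|].
  + apply is_Cseries_sector_log; assumption.
  + apply is_Cseries_scal, is_Cseries_Li2; exact Hw.
  + apply is_Cseries_scal, is_Cseries_log; [lra|].
    intros E; rewrite E, Cmod_1 in Hv; lra.
Qed.

Definition sector_rem (w : C) (x : R) (s : C) : C :=
  (sector_log w x s - Li2 w / s + RtoC (1 / 2 - x) * Clog1m (w * Cexp (- s)))%C.

Lemma Cmod_INR_mult r s : Cmod (RtoC (INR (S r)) * s)%C = INR (S r) * Cmod s.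
Proof. rewrite Cmod_mult, Cmod_RtoC_pos; [reflexivity|left; apply INR_S_pos]. Qed.

Lemma sector_scale M r s : 0 < Re s -> Rabs (Im s) <= M * Re s ->
  0 < Re (RtoC (INR (S r)) * s)%C /\ Rabs (Im (RtoC (INR (S r)) * s)%C) <= M * Re (RtoC (INR (S r)) * s)%C.
Proof.
intros H1 H2; rewrite Re_INR_mult, Im_INR_mult, Rabs_mult, (Rabs_pos_eq (INR _)) by (left; apply INR_S_pos).
pose proof (INR_S_pos r); split; nra.
Qed.

Lemma Cmod_pow_le1 w r : Cmod w <= 1 -> Cmod (w ^ r)%C <= 1.
Proof. intros H; rewrite Cmod_pow; apply pow_le_1; split; [apply Cmod_ge_0|exact H]. Qed.

Lemma kernel_div_bound x M K r s : 0 < Re s -> Rabs (Im s) <= M * Re s ->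
  (forall y, 0 < Re y -> Rabs (Im y) <= M * Re y -> Cmod (kernel x y) <= K * (Cmod y / (1 + Cmod y) ^ 2)) ->
  Cmod (kernel x (RtoC (INR (S r)) * s) / RtoC (INR (S r)))%C <= K * (Cmod s / (1 + INR (S r) * Cmod s) ^ 2).
Proof.
intros H1 H2 HK.
pose proof (INR_S_pos r); pose proof (Cmod_ge_0 s).
destruct (sector_scale M r s H1 H2) as [H3 H4].
rewrite Cmod_div by apply RtoC_neq0, INR_S_neq0.
rewrite (Cmod_RtoC_pos (INR (S r))) by lra.
apply Rle_div_l; [assumption|].
eapply Rle_trans; [apply (HK _ H3 H4)|]; rewrite Cmod_INR_mult; right; field.
apply Rgt_not_eq; nra.
Qed.

(** The constant is uniform in the whole disc, including [w = 1], where the remainder does not tend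
    to 0. *)
Lemma sector_rem_bounded x M : 0 < x <= 1 -> 0 <= M -> exists K, 0 < K /\ forall w s, Cmod w <= 1 ->
  0 < Re s -> Rabs (Im s) <= M * Re s -> Cmod (sector_rem w x s) <= K.
Proof.
intros Hx HM; destruct (kernel_bounds x M Hx HM) as (K & HK0 & HK).
exists K; split; [exact HK0|]; intros w s Hw Hs1 Hs2.
assert (Ha : 0 < Cmod s) by (pose proof (Re_le s); lra).
rewrite <- (Rmult_1_r K).
apply (Cmod_Cseries_le _ _ (fun r => K * (/ (1 + INR r * Cmod s) - / (1 + INR (S r) * Cmod s)))) with (2 := sector_log_decomp w x s Hw (proj1 Hx) Hs1).
- intros r; rewrite Cmod_mult, <- (Rmult_1_l (K * _)).
  apply Rmult_le_compat; try apply Cmod_ge_0; [apply Cmod_pow_le1, Hw|].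
  eapply Rle_trans; [apply (kernel_div_bound x M K r s Hs1 Hs2); intros; apply HK; assumption|].
  apply Rmult_le_compat_l; [lra|apply inv_affine_sqr_le, Ha].
- exact (is_series_scal K _ _ (is_series_inv_affine _ Ha)).
Qed.

(** Away from [w = 1] the remainder vanishes as [s] tends to 0: [Abel_bound] applies because the
    sequence [kernel (r s) / r] has total variation of order [sqrt |s|]. *)
Lemma sector_rem_small x M : 0 < x <= 1 -> 0 <= M -> exists K, 0 < K /\ forall w s, Cmod w = 1 ->
  0 < Re s -> Rabs (Im s) <= M * Re s -> Cmod s <= 1 ->
  Cmod (1 - w)%C * Cmod (sector_rem w x s) <= K * sqrt (Cmod s).
Proof.
intros Hx HM; destruct (kernel_bounds x M Hx HM) as (K & HK0 & HK).
exists (4 * K); split; [lra|]; intros w s Hw Hs1 Hs2 Hs3.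
set (a := Cmod s) in *.
assert (Ha : 0 < a) by (pose proof (Re_le s); unfold a; lra).
assert (Hsa : a <= sqrt a).
{ rewrite <- (sqrt_sqrt a) at 1 by lra. pose proof (sqrt_lt_R0 a Ha).
  assert (sqrt a <= 1) by (rewrite <- sqrt_1; apply sqrt_le_1; lra). nra. }
set (c := fun r => (kernel x (RtoC (INR (S r)) * s) / RtoC (INR (S r)))%C).
set (J := fun r => / (1 + INR r * a)).
assert (HJ : forall r, 0 < J r <= 1).
{ intros r; pose proof (pos_INR r); unfold J; split; [apply Rinv_0_lt_compat; nra|].
  rewrite <- Rinv_1; apply Rinv_le_contravar; nra. }
assert (Hc : forall r, Cmod (c r) <= K * (a * (J (S r) * J (S r)))).
{ intros r; eapply Rle_trans; [apply (kernel_div_bound x M K r s Hs1 Hs2); intros; apply HK; assumption|].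
  fold a; right; unfold J; pose proof (INR_S_pos r); field; apply Rgt_not_eq; nra. }
assert (Hdiff : forall r, Cmod (kernel x (RtoC (INR (S (S r))) * s) - kernel x (RtoC (INR (S r)) * s))%C
   <= a * (K * (J (S r) * J (S r)))).
(* Mean value inequality on the segment between two consecutive multiples of [s], all of whose
   points have modulus at least [INR (S r) * a]. *)
{ intros r; pose proof (INR_S_pos r) as Hr.
  assert (Hline : forall t, 0 <= t <= 1 -> 0 < Re (RtoC (INR (S r)) * s + RtoC t * s)%C /\
     Rabs (Im (RtoC (INR (S r)) * s + RtoC t * s)%C) <= M * Re (RtoC (INR (S r)) * s + RtoC t * s)%C /\
     Cmod (RtoC (INR (S r)) * s + RtoC t * s)%C = (INR (S r) + t) * a).
  { intros t Ht; replace (RtoC (INR (S r)) * s + RtoC t * s)%C with (RtoC (INR (S r) + t) * s)%C by (rewrite RtoC_plus; ring).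
    rewrite Re_mult, Im_mult, Re_RtoC, Im_RtoC, Cmod_mult, Cmod_RtoC_pos by lra; fold a.
    rewrite !Rmult_0_l, Rminus_0_r, Rplus_0_r, Rabs_mult, (Rabs_pos_eq (INR (S r) + t)) by lra.
    split; [nra|split; [nra|reflexivity]]. }
  pose proof (Cmvt (fun t => kernel x (RtoC (INR (S r)) * s + RtoC t * s)%C)
    (fun t => s * kernel' x (RtoC (INR (S r)) * s + RtoC t * s))%C 0 1 (a * (K * (J (S r) * J (S r)))) ltac:(lra)) as H.
  cbv beta in H.
  replace (RtoC (INR (S r)) * s + RtoC 1 * s)%C with (RtoC (INR (S (S r))) * s)%C in H
    by (rewrite (S_INR (S r)), RtoC_plus; ring).
  replace (RtoC (INR (S r)) * s + RtoC 0 * s)%C with (RtoC (INR (S r)) * s)%C in H by ring.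
  rewrite Rminus_0_r, (Rmult_1_r (a * _)) in H; apply H.
  - intros t Ht; apply kernel_derive, Hline, Ht.
  - intros t Ht; destruct (Hline t Ht) as (L1 & L2 & L3).
    rewrite Cmod_mult; fold a; apply Rmult_le_compat_l; [lra|].
    eapply Rle_trans; [apply (HK _ L1 L2)|]; rewrite L3; unfold Rdiv; apply Rmult_le_compat_l; [lra|].
    unfold J; rewrite <- Rinv_mult; apply Rinv_le_contravar; [nra|].
    assert (1 + INR (S r) * a <= 1 + (INR (S r) + t) * a) by nra.
    assert (0 < 1 + INR (S r) * a) by nra.
    change ((1 + (INR (S r) + t) * a) ^ 2) with ((1 + (INR (S r) + t) * a) * ((1 + (INR (S r) + t) * a) * 1)); nra. }
apply (Abel_bound w c _ _ Hw (sector_log_decomp w x s (Req_le _ _ Hw) (proj1 Hx) Hs1)).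
assert (Hstep : forall r, Cmod (c (S r) - c r)%C <=
   K * sqrt a * ((J r - J (S r)) + (/ INR (S r) - / INR (S (S r))))).
{ intros r; pose proof (INR_S_pos r) as Hr; pose proof (INR_S_pos (S r)) as Hr2.
  set (k := INR (S r)) in *; set (k2 := INR (S (S r))) in *.
  assert (Ek : k2 = k + 1) by (unfold k, k2; rewrite (S_INR (S r)); reflexivity).
  pose proof (Hc r) as Hcr; specialize (Hdiff r).
  unfold c in *; fold k k2 in Hcr, Hdiff |- *.
  set (G2 := kernel x (RtoC k2 * s)) in *; set (G1 := kernel x (RtoC k * s)) in *.
  replace (G2 / RtoC k2 - G1 / RtoC k)%C with ((G2 - G1) / RtoC k2 - G1 / RtoC k / RtoC k2)%C.
  2:{ rewrite Ek, RtoC_plus; field; split; try rewrite <- RtoC_plus; apply RtoC_neq0; lra. }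
  assert (HJ1 := HJ (S r)).
  eapply Rle_trans; [apply Cmod_minus_le; apply Cmod_div_le with (B := k2); try eassumption;
     rewrite Cmod_RtoC_pos by lra; lra|].
  assert (HJJ : a * (J (S r) * J (S r)) <= J r - J (S r)).
  { pose proof (inv_affine_sqr_le a r Ha) as [_ H].
    replace (a * (J (S r) * J (S r))) with (a / (1 + INR (S r) * a) ^ 2); [exact H|].
    unfold J; fold k; field; apply Rgt_not_eq; nra. }
  assert (Hk : / k2 ^ 2 <= / k - / k2).
  { replace (/ k - / k2) with (/ (k * k2)) by (rewrite Ek; field; lra).
    apply Rinv_le_contravar; [nra|]; rewrite Ek; nra. }
  set (b := J (S r)) in *; set (u := sqrt a).
  assert (Hu : u * u = a) by (apply sqrt_sqrt; lra).
  assert (Hu0 : 0 < u) by (apply sqrt_lt_R0, Ha).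
  replace (a * (K * (b * b)) / k2 + K * (a * (b * b)) / k2) with (K * u * (2 * (u * b * (b * / k2))))
    by (rewrite <- Hu; field; lra).
  apply Rmult_le_compat_l; [nra|].
  apply Rle_trans with (a * (b * b) + / k2 ^ 2); [|lra].
  replace (/ k2 ^ 2) with (/ k2 * / k2) by (field; lra).
  assert (Hk2 : 0 < / k2) by (apply Rinv_0_lt_compat; lra).
  assert (2 * (u * b * (b * / k2)) <= 2 * (u * b * / k2)).
  { assert (0 < u * b * / k2) by (apply Rmult_lt_0_compat; nra). nra. }
  (* By [2 u v <= u^2 + v^2] the variation, divided by [K sqrt a], splits into the two telescoping
     sequences [J] and [/ INR]. *)
  rewrite <- Hu; pose proof (Rle_0_sqr (u * b - / k2)) as Hsq; unfold Rsqr in Hsq; nra. }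
intros m.
assert (Hsum : Rsumn (fun i => Cmod (c (S i) - c i)%C) m <= K * sqrt a * ((1 - J m) + (1 - / INR (S m)))).
{ induction m as [|m IH].
  - simpl; unfold J; simpl; rewrite Rmult_0_l, Rplus_0_r, Rinv_1; lra.
  - cbn [Rsumn]; specialize (Hstep m); lra. }
pose proof (Hc O); pose proof (Hc m); pose proof (HJ 1%nat); pose proof (HJ (S m)); pose proof (HJ m).
assert (Hm : 0 < / INR (S m)) by (apply Rinv_0_lt_compat, INR_S_pos).
assert (Hg : forall b, 0 < b <= 1 -> K * (a * (b * b)) <= K * sqrt a).
{ intros b Hb; apply Rmult_le_compat_l; [lra|]; assert (b * b <= 1) by nra; nra. }
pose proof (Hg _ H1); pose proof (Hg _ H2).
assert (0 < K * sqrt a) by (apply Rmult_lt_0_compat; [lra|apply sqrt_lt_R0, Ha]).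
nra.
Qed.

(** Needed at [w = 1], where the limit of the remainder is computed only for real [s]; an imaginary
    part costs a multiple of its ratio to the real part. *)
Lemma sector_rem_real_part x : 0 < x <= 1 -> exists K, 0 < K /\ forall w s, Cmod w <= 1 ->
  0 < Re s -> Rabs (Im s) <= Re s ->
  Cmod (sector_rem w x s - sector_rem w x (RtoC (Re s)))%C <= K * (Rabs (Im s) / Re s).
Proof.
intros Hx; destruct (kernel_bounds x 1 Hx ltac:(lra)) as (K & HK0 & HK).
exists K; split; [exact HK0|]; intros w s Hw Hs1 Hs2.
set (a := Re s) in *.
pose proof (sector_log_decomp w x s Hw (proj1 Hx) Hs1) as D1.
pose proof (sector_log_decomp w x (RtoC a) Hw (proj1 Hx) Hs1) as D2.
pose proof (is_Cseries_minus _ _ _ _ D1 D2) as D; fold (sector_rem w x s) (sector_rem w x (RtoC a)) in D.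
assert (Hi0 := Rabs_pos (Im s)).
rewrite <- (Rmult_1_r (K * (Rabs (Im s) / a))).
apply (Cmod_Cseries_le _ _ (fun r => (K * (Rabs (Im s) / a)) * (/ (1 + INR r * a) - / (1 + INR (S r) * a)))) with (2 := D).
2:{ exact (is_series_scal (K * (Rabs (Im s) / a)) _ _ (is_series_inv_affine _ Hs1)). }
intros r; pose proof (INR_S_pos r) as Hr; set (k := INR (S r)) in *.
match goal with |- Cmod ?u <= _ => replace u with (w ^ S r * ((kernel x (RtoC k * s) - kernel x (RtoC k * RtoC a)) / RtoC k))%C end.
2:{ unfold Cdiv; ring. }
rewrite Cmod_mult, <- (Rmult_1_l (K * _ * _)).
apply Rmult_le_compat; try apply Cmod_ge_0; [apply Cmod_pow_le1, Hw|].
apply Rle_trans with (K * (Rabs (Im s) / a) * (a / (1 + k * a) ^ 2)).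
2:{ apply Rmult_le_compat_l; [|apply inv_affine_sqr_le, Hs1].
    apply Rmult_le_pos; [lra|]; apply Rmult_le_pos; [exact Hi0|left; apply Rinv_0_lt_compat, Hs1]. }
set (b := (0, k * Im s)%R : C).
assert (Hline : forall t, 0 <= t <= 1 -> Re (RtoC k * RtoC a + RtoC t * b)%C = k * a /\
   Im (RtoC k * RtoC a + RtoC t * b)%C = t * (k * Im s)).
{ intros t Ht; unfold b, Re, Im; simpl; split; ring. }
pose proof (Cmvt (fun t => kernel x (RtoC k * RtoC a + RtoC t * b)%C)
  (fun t => b * kernel' x (RtoC k * RtoC a + RtoC t * b))%C 0 1 (k * Rabs (Im s) * (K / (1 + k * a) ^ 2)) ltac:(lra)) as H.
cbv beta in H.
replace (RtoC k * RtoC a + RtoC 1 * b)%C with (RtoC k * s)%C in H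
  by (unfold b, a; destruct s as [s1 s2]; apply Ceq_ReIm; unfold Re, Im; simpl; ring).
replace (RtoC k * RtoC a + RtoC 0 * b)%C with (RtoC k * RtoC a)%C in H by ring.
rewrite Cmod_div by (apply RtoC_neq0; lra); rewrite (Cmod_RtoC_pos k) by lra.
apply Rle_div_l; [exact Hr|].
eapply Rle_trans; [apply H|].
- intros t Ht; apply kernel_derive; rewrite (proj1 (Hline t Ht)); nra.
- intros t Ht; destruct (Hline t Ht) as [L1 L2].
  apply Cmod_mult_le.
  + unfold b; eapply Rle_trans; [apply Cmod_le_ReIm|]; simpl. rewrite Rabs_R0, Rabs_mult, (Rabs_pos_eq k) by lra; lra.
  + eapply Rle_trans; [apply HK; rewrite L1, ?L2|].
    * nra.
    * rewrite !Rabs_mult, (Rabs_pos_eq t), (Rabs_pos_eq k) by lra.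
      assert (k * Rabs (Im s) <= k * a) by (apply Rmult_le_compat_l; lra).
      assert (0 <= k * Rabs (Im s)) by (apply Rmult_le_pos; lra). nra.
    * apply Rmult_le_compat_l; [lra|]; apply Rinv_le_contravar; [apply pow_lt; nra|].
      apply pow_incr; split; [nra|]. pose proof (Re_le (RtoC k * RtoC a + RtoC t * b)%C) as Hre; rewrite L1 in Hre; lra.
- right; field; repeat split; apply Rgt_not_eq; nra.
Qed.

(** * The generating function near roots of unity *)

Definition unit_root (k : nat) (h : Z) : C := Cexp (0, 2 * PI * (IZR h / INR k))%R.

Lemma Cmod_unit_root k h : Cmod (unit_root k h) = 1.
Proof. unfold unit_root; rewrite Cmod_Cexp; simpl; apply exp_0. Qed.

Lemma unit_root_pow k h n : (unit_root k h ^ n)%C = unit_root k (h * Z.of_nat n).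
Proof.
unfold unit_root; rewrite Cexp_pow; f_equal; rewrite mult_IZR, <- INR_IZR_INZ.
apply Ceq_ReIm; unfold Re, Im; simpl; unfold Rdiv; ring.
Qed.

Lemma unit_root_mult k h h' : (unit_root k h * unit_root k h')%C = unit_root k (h + h').
Proof.
unfold unit_root; rewrite <- Cexp_plus; f_equal; rewrite plus_IZR.
apply Ceq_ReIm; unfold Re, Im; simpl; unfold Rdiv; ring.
Qed.

Lemma unit_root_full k h : (0 < k)%nat -> unit_root k (h * Z.of_nat k) = 1%C.
Proof.
intros Hk; assert (INR k <> 0) by (apply not_0_INR; lia).
unfold unit_root; rewrite mult_IZR, <- INR_IZR_INZ.
replace (2 * PI * (IZR h * INR k / INR k)) with (2 * PI * IZR h) by (field; assumption).
apply Cexp_2PI.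
Qed.

Lemma Cexp_eq1_int y : Cexp (0, 2 * PI * y)%R = 1%C -> exists m : Z, y = IZR m.
Proof.
intros H; apply (f_equal Re) in H; rewrite Re_Cexp in H; simpl in H.
rewrite exp_0, Rmult_1_l in H.
replace (2 * PI * y) with (2 * (PI * y)) in H by ring; rewrite cos_2a_sin in H.
assert (Hs : sin (PI * y) = 0) by nra.
destruct (sin_eq_0_0 _ Hs) as (m & Hm); exists m.
pose proof PI_RGT_0; apply Rmult_eq_reg_l with PI; lra.
Qed.

Lemma unit_root_eq1 k h n : (0 < k)%nat -> Z.gcd h (Z.of_nat k) = 1%Z ->
  unit_root k (h * n) = 1%C -> (Z.of_nat k | n)%Z.
Proof.
intros Hk Hg H; destruct (Cexp_eq1_int _ H) as (m & Hm).
assert (Hk0 : INR k <> 0) by (apply not_0_INR; lia).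
apply (Gauss _ h).
- exists m; apply eq_IZR; rewrite (mult_IZR m), <- INR_IZR_INZ, <- Hm; field; exact Hk0.
- apply Zgcd_1_rel_prime; rewrite Z.gcd_comm; exact Hg.
Qed.

Lemma is_Cseries_Csumn_fin (f : nat -> nat -> C) l k : (forall j, (j < k)%nat -> is_Cseries (f j) (l j)) ->
  is_Cseries (fun r => Csumn (fun j => f j r) k) (Csumn l k).
Proof.
induction k as [|k IH]; intros H; cbn [Csumn].
- apply is_Cseries_Csumn; intros eps He; exists O; intros n _.
  replace (Csumn (fun _ => 0%C) n) with (RtoC 0) by (clear; induction n as [|n IH]; cbn [Csumn]; [|rewrite <- IH]; ring).
  replace (0 - 0)%C with (RtoC 0) by ring; rewrite Cmod_0; exact He.
- apply (is_Cseries_plus (fun r => Csumn (fun j => f j r) k) (f k)); [apply IH; intros; apply H|apply H]; lia.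
Qed.

Lemma Csumn_S_l f n : Csumn f (S n) = (f O + Csumn (fun i => f (S i)) n)%C.
Proof. induction n as [|n IH]; [simpl; ring|]. cbn [Csumn] in *; rewrite IH; ring. Qed.

Lemma Csumn_geom1 u k : ((1 - u) * Csumn (fun j => u ^ S j) k)%C = (u * (1 - u ^ k))%C.
Proof.
rewrite (Csumn_ext (fun j => u ^ S j)%C (fun j => u * u ^ j)%C) by (intros; apply Cpow_S).
rewrite (Csumn_scal u (fun i => u ^ i)%C); replace ((1 - u) * (u * Csumn (fun i => u ^ i) k))%C with (u * ((1 - u) * Csumn (fun i => u ^ i) k))%C by ring.
rewrite Csumn_geom; reflexivity.
Qed.

(* The factors [1 - z q^m] are sorted by the residue class [j] of [m] modulo [k]. *)
Lemma loggen_major z k h t : (0 < k)%nat -> Cmod z <= 1 -> 0 < Re t ->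
  loggen_tail z 0 (unit_root k h * Cexp (- t)) =
  Csumn (fun j => sector_log (z * unit_root k (h * Z.of_nat (S j))) (INR (S j) / INR k) (RtoC (INR k) * t)) k.
Proof.
intros Hk Hz Ht.
assert (HK : 0 < INR k) by (apply lt_0_INR; lia).
apply is_Cseries_unique.
apply is_Cseries_ext with (fun r => Csumn (fun j => sector_term (z * unit_root k (h * Z.of_nat (S j))) (INR (S j) / INR k) (RtoC (INR k) * t) r) k).
2:{ apply (is_Cseries_Csumn_fin (fun j => sector_term (z * unit_root k (h * Z.of_nat (S j))) (INR (S j) / INR k) (RtoC (INR k) * t))).
    intros j _; apply is_Cseries_sector_log.
    - rewrite Cmod_mult, Cmod_unit_root; lra.
    - apply Rdiv_lt_0_compat; [apply INR_S_pos|exact HK].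
    - rewrite Re_mult, Re_RtoC, Im_RtoC; nra. }
intros r; unfold loggen_term, sector_term; rewrite Cpow_1_r.
set (q := (unit_root k h * Cexp (- t))%C).
set (u := (q ^ S r)%C).
assert (Huk : (u ^ k)%C = Cexp (- (RtoC (INR (S r)) * (RtoC (INR k) * t)))).
{ unfold u, q; rewrite <- Cpow_mult_r, Cpow_mult_l, unit_root_pow, Cexp_pow.
  rewrite Nat2Z.inj_mul, Z.mul_assoc, unit_root_full by exact Hk.
  rewrite mult_INR, RtoC_mult, Cmult_1_l; f_equal; ring. }
assert (Hpos : 0 < Re (RtoC (INR (S r)) * (RtoC (INR k) * t))%C).
{ rewrite Re_INR_mult, Re_mult, Re_RtoC, Im_RtoC; apply Rmult_lt_0_compat; [apply INR_S_pos|nra]. }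
assert (Hd1 : (1 - u ^ k)%C <> 0%C) by (rewrite Huk; apply one_minus_Cexp_neq0, Hpos).
assert (Hd0 : (1 - u)%C <> 0%C).
{ intros E; apply Hd1; replace u with (RtoC 1); [rewrite Cpow_1_l; ring|].
  replace (RtoC 1) with (1 - u + u)%C by ring; rewrite E; ring. }
rewrite (Csumn_ext _ (fun j => (z ^ S r / RtoC (INR (S r)) / (1 - u ^ k)) * u ^ S j)%C).
- rewrite Csumn_scal; pose proof (Csumn_geom1 u k) as G.
  replace (Csumn (fun j => u ^ S j)%C k) with (u * (1 - u ^ k) / (1 - u))%C.
  + field; split; [|split]; try assumption; apply RtoC_neq0, INR_S_neq0.
  + rewrite <- G; field; exact Hd0.
- intros j _; rewrite Huk.
  replace (u ^ S j)%C with (unit_root k (h * Z.of_nat (S j)) ^ S r *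
     Cexp (- (RtoC (INR (S j) / INR k) * (RtoC (INR (S r)) * (RtoC (INR k) * t)))))%C.
  + rewrite Cpow_mult_l; rewrite Huk in Hd1; field; split; [apply RtoC_neq0, INR_S_neq0|exact Hd1].
  + unfold u, q; rewrite <- Cpow_mult_r, Cpow_mult_l, !unit_root_pow, Cexp_pow.
    rewrite (Nat2Z.inj_mul (S r)), mult_INR; f_equal; [f_equal; ring|].
    f_equal; rewrite RtoC_div, !RtoC_mult by lra; field; apply RtoC_neq0; lra.
Qed.

Lemma Csumn_add f n m : Csumn f (n + m) = (Csumn f n + Csumn (fun i => f (n + i)%nat) m)%C.
Proof.
induction m as [|m IH]; [rewrite Nat.add_0_r; simpl; ring|].
rewrite Nat.add_succ_r; cbn [Csumn]; rewrite IH; ring.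
Qed.

Lemma Csumn_plus f g n : (Csumn f n + Csumn g n)%C = Csumn (fun i => f i + g i)%C n.
Proof. induction n as [|n IH]; cbn [Csumn]; [|rewrite <- IH]; ring. Qed.

Lemma Csumn_blocks f k N : Csumn f (k * N) = Csumn (fun s => Csumn (fun i => f (k * s + i)%nat) k) N.
Proof.
induction N as [|N IH]; [rewrite Nat.mul_0_r; reflexivity|].
cbn [Csumn]; rewrite <- IH, Nat.mul_succ_r; apply Csumn_add.
Qed.

Lemma Csumn_const0 n : Csumn (fun _ => 0%C) n = 0%C.
Proof. induction n as [|n IH]; cbn [Csumn]; [reflexivity|rewrite IH; ring]. Qed.

Lemma Csumn_const c n : Csumn (fun _ => c) n = (RtoC (INR n) * c)%C.
Proof. induction n as [|n IH]; cbn [Csumn]; [simpl; ring|rewrite IH, S_INR, RtoC_plus; ring]. Qed.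

(** Summing [r]-th powers over the [k]-th roots of unity kills every [r] not divisible by [k].
    Grouping the convergent series into blocks of length [k] leaves one term per block. *)
Lemma Li2_distribution z k h : (0 < k)%nat -> Z.gcd h (Z.of_nat k) = 1%Z -> Cmod z <= 1 ->
  Csumn (fun j => Li2 (z * unit_root k (h * Z.of_nat (S j)))) k = (Li2 (z ^ k) / RtoC (INR k))%C.
Proof.
intros Hk Hg Hz.
assert (HK : 0 < INR k) by (apply lt_0_INR; lia).
assert (HKc : RtoC (INR k) <> 0%C) by (apply RtoC_neq0; lra).
set (f := fun r => Csumn (fun j => ((z * unit_root k (h * Z.of_nat (S j))) ^ S r / RtoC (INR (S r) ^ 2)))%C k).
assert (Hf : is_Cseries f (Csumn (fun j => Li2 (z * unit_root k (h * Z.of_nat (S j)))) k)).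
{ apply (is_Cseries_Csumn_fin (fun j r => ((z * unit_root k (h * Z.of_nat (S j))) ^ S r / RtoC (INR (S r) ^ 2)))%C).
  intros j _; apply is_Cseries_Li2; rewrite Cmod_mult, Cmod_unit_root; lra. }
set (l := Csumn (fun j => Li2 (z * unit_root k (h * Z.of_nat (S j)))) k) in *.
assert (Hfr : forall r, f r = (z ^ S r / RtoC (INR (S r) ^ 2) * Csumn (fun j => unit_root k (h * Z.of_nat (S r)) ^ S j) k)%C).
{ intros r; unfold f; rewrite <- Csumn_scal; apply Csumn_ext; intros j _.
  rewrite Cpow_mult_l, !unit_root_pow.
  replace (h * Z.of_nat (S j) * Z.of_nat (S r))%Z with (h * Z.of_nat (S r) * Z.of_nat (S j))%Z by ring.
  field; apply RtoC_neq0, pow_nonzero, INR_S_neq0. }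
assert (Hblock : forall s, Csumn (fun i => f (k * s + i)%nat) k = (/ RtoC (INR k) * ((z ^ k) ^ S s / RtoC (INR (S s) ^ 2)))%C).
{ intros s; destruct k as [|k']; [lia|]; cbn [Csumn].
  rewrite (Csumn_ext _ (fun _ => 0%C)), Csumn_const0, Cplus_0_l.
  - rewrite Hfr. replace (S (S k' * s + k')) with (S k' * S s)%nat by lia.
    rewrite (Nat2Z.inj_mul (S k')), Z.mul_assoc, (Z.mul_shuffle0 h), unit_root_full by lia.
    rewrite (Csumn_ext _ (fun _ => 1%C)) by (intros; apply Cpow_1_l).
    rewrite Csumn_const, Cpow_mult_r, mult_INR.
    replace (RtoC ((INR (S k') * INR (S s)) ^ 2)) with (RtoC (INR (S k')) * RtoC (INR (S k')) * RtoC (INR (S s) ^ 2))%C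
      by (rewrite <- !RtoC_mult; f_equal; ring).
    field; split; [apply RtoC_neq0, pow_nonzero, INR_S_neq0|exact HKc].
  - intros i Hi; rewrite Hfr; set (xi := unit_root (S k') (h * Z.of_nat (S (S k' * s + i)))).
    assert (Hxi : xi <> 1%C).
    { intros E; apply unit_root_eq1 in E; [|lia|exact Hg].
      destruct E as (m & Hm). assert ((m * Z.of_nat (S k') = Z.of_nat (S k') * Z.of_nat s + Z.of_nat (S i))%Z) by lia.
      assert ((m - Z.of_nat s) * Z.of_nat (S k') = Z.of_nat (S i))%Z by lia.
      assert (0 < m - Z.of_nat s < 1)%Z by nia. lia. }
    pose proof (Csumn_geom1 xi (S k')) as G.
    assert (Hpk : (xi ^ S k')%C = 1%C) by (unfold xi; rewrite unit_root_pow; apply unit_root_full; lia).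
    assert (Hz0 : Csumn (fun j => xi ^ S j)%C (S k') = 0%C).
    { replace (Csumn (fun j => xi ^ S j)%C (S k')) with (xi * (1 - xi ^ S k') / (1 - xi))%C.
      - rewrite Hpk; unfold Cdiv; ring.
      - rewrite <- G; field; intros E; apply Hxi; replace xi with (1 - (1 - xi))%C by ring; rewrite E; ring. }
    rewrite Hz0; ring. }
assert (Hl : is_Cseries (fun s => / RtoC (INR k) * ((z ^ k) ^ S s / RtoC (INR (S s) ^ 2)))%C l).
{ apply is_Cseries_ext with (1 := Hblock); rewrite is_Cseries_Csumn in Hf |- *.
  intros eps He; destruct (Hf eps He) as (N & HN); exists N; intros n Hn.
  rewrite <- Csumn_blocks; apply HN; nia. }
rewrite <- (is_Cseries_unique _ _ Hl).
rewrite (is_Cseries_unique _ (/ RtoC (INR k) * Li2 (z ^ k))%C); [unfold Cdiv; ring|].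
apply is_Cseries_scal, is_Cseries_Li2, Cmod_pow_le1, Hz.
Qed.

(** The [k] singular parts, one for each residue class, merge by [Li2_distribution] into a single
    pole in [t]. *)
Lemma loggen_major_rem z k h t : (0 < k)%nat -> Z.gcd h (Z.of_nat k) = 1%Z -> Cmod z <= 1 -> 0 < Re t ->
  loggen_tail z 0 (unit_root k h * Cexp (- t)) =
  (Li2 (z ^ k) / RtoC (INR k ^ 2) / t +
   Csumn (fun j => sector_rem (z * unit_root k (h * Z.of_nat (S j))) (INR (S j) / INR k) (RtoC (INR k) * t)
     + RtoC (INR (S j) / INR k - 1 / 2) * Clog1m (z * unit_root k (h * Z.of_nat (S j)) * Cexp (- (RtoC (INR k) * t)))) k)%C.
Proof.
intros Hk Hg Hz Ht; rewrite loggen_major by assumption.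
assert (HK : 0 < INR k) by (apply lt_0_INR; lia).
assert (HKc : RtoC (INR k) <> 0%C) by (apply RtoC_neq0; lra).
assert (Ht0 : t <> 0%C) by (apply C_neq0_Re; lra).
pose proof (Li2_distribution z k h Hk Hg Hz) as D.
replace (Li2 (z ^ k) / RtoC (INR k ^ 2) / t)%C with (/ (RtoC (INR k) * t) * (Li2 (z ^ k) / RtoC (INR k)))%C.
2:{ replace (RtoC (INR k ^ 2)) with (RtoC (INR k) * RtoC (INR k))%C by (rewrite <- RtoC_mult; f_equal; ring).
    field; split; assumption. }
rewrite <- D, <- Csumn_scal.
rewrite Csumn_plus; apply Csumn_ext; intros j _; unfold sector_rem.
replace (RtoC (1 / 2 - INR (S j) / INR k)) with (- RtoC (INR (S j) / INR k - 1 / 2))%C by (rewrite <- RtoC_opp; f_equal; ring).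
field; split; assumption.
Qed.

Lemma finite_uniform (P : nat -> R -> Prop) k :
  (forall j a b, P j a -> 0 < b <= a -> P j b) ->
  (forall j, (j < k)%nat -> exists a, 0 < a /\ P j a) ->
  exists a, 0 < a /\ forall j, (j < k)%nat -> P j a.
Proof.
intros Hm; induction k as [|k IH]; intros H.
- exists 1; split; [lra|intros; lia].
- destruct IH as (a & Ha & HPa); [intros; apply H; lia|].
  destruct (H k ltac:(lia)) as (b & Hb & HPb).
  exists (Rmin a b); split; [apply Rmin_glb_lt; assumption|].
  assert (0 < Rmin a b) by (apply Rmin_glb_lt; assumption).
  intros j Hj; destruct (Nat.eq_dec j k) as [->|].
  + apply Hm with b; [exact HPb|split; [assumption|apply Rmin_r]].
  + apply Hm with a; [apply HPa; lia|split; [assumption|apply Rmin_l]].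
Qed.

Lemma ln_le_2sqrt u : 0 < u -> ln u <= 2 * sqrt u.
Proof.
intros Hu; pose proof (sqrt_lt_R0 u Hu) as Hs.
rewrite <- (sqrt_sqrt u) at 1 by lra; rewrite ln_mult by assumption.
assert (ln (sqrt u) <= sqrt u); [|lra].
rewrite <- (ln_exp (sqrt u)) at 2; apply ln_le; [exact Hs|].
pose proof (exp_ineq1_le (sqrt u)); lra.
Qed.

Lemma Clog1m_bound v d : 0 < d <= 1 -> Cmod v <= 1 - d -> Cmod (Clog1m v) <= 3 + 2 * sqrt (/ d).
Proof.
intros Hd Hv; unfold Clog1m; eapply Rle_trans; [apply Cmod_le_ReIm|].
assert (Hm1 : d <= Cmod (1 - v)%C) by (pose proof (Cmod_one_minus_ge v _ Hv); lra).
assert (Hm2 : Cmod (1 - v)%C <= 2).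
{ eapply Rle_trans; [apply Cmod_triangle_minus|]; rewrite Cmod_1; lra. }
assert (Hln : Rabs (ln (Cmod (1 - v)%C)) <= 1 + 2 * sqrt (/ d)).
{ assert (H1 : ln d <= ln (Cmod (1 - v)%C)) by (apply ln_le; lra).
  assert (H2 : ln (Cmod (1 - v)%C) <= 1).
  { apply Rle_trans with (ln (exp 1)); [|rewrite ln_exp; lra]; apply ln_le; [lra|]; pose proof (exp_ineq1_le 1); lra. }
  assert (H3 : - ln d <= 2 * sqrt (/ d)).
  { rewrite <- ln_Rinv by lra; apply ln_le_2sqrt, Rinv_0_lt_compat; lra. }
  pose proof (sqrt_pos (/ d)); apply Rabs_le; lra. }
assert (Hat : forall u, Rabs (atan u) <= 2).
{ intros u; pose proof (atan_bound u); pose proof PI_4; apply Rabs_le; lra. }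
change (Rabs (ln (Cmod (1 - v)%C)) + Rabs (atan (Im (1 - v)%C / Re (1 - v)%C)) <= 3 + 2 * sqrt (/ d)).
specialize (Hat (Im (1 - v)%C / Re (1 - v)%C)); lra.
Qed.

Lemma Rsumn_le f g n : (forall i, (i < n)%nat -> f i <= g i) -> Rsumn f n <= Rsumn g n.
Proof.
induction n as [|n IH]; intros H; simpl; [lra|]; apply Rplus_le_compat; [apply IH; intros; apply H; lia|apply H; lia].
Qed.
Lemma Rsumn_const c n : Rsumn (fun _ => c) n = INR n * c.
Proof. induction n as [|n IH]; cbn [Rsumn]; [simpl; ring|rewrite IH, S_INR; ring]. Qed.

Lemma Clog1m_exp_bound w s : Cmod w <= 1 -> 0 < Re s <= 1 ->
  Cmod (Clog1m (w * Cexp (- s))) <= 3 + 2 * sqrt (2 / Re s).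
Proof.
intros Hw Hs; replace (2 / Re s) with (/ (Re s / 2)) by (field; lra).
apply Clog1m_bound; [lra|].
rewrite Cmod_mult, Cmod_Cexp, Re_opp.
assert (exp (- Re s) <= 1 - Re s / 2).
{ rewrite exp_Ropp; apply Rle_trans with (/ (1 + Re s)).
  - apply Rinv_le_contravar; [lra|apply exp_ineq1_le].
  - apply Rmult_le_reg_r with (1 + Re s); [lra|]; rewrite Rinv_l by lra; nra. }
pose proof (exp_pos (- Re s)); pose proof (Cmod_ge_0 w); nra.
Qed.

Definition arc_weight (z : C) (k : nat) : C := (Li2 (z ^ k) / RtoC (INR k ^ 2))%C.

(** Uniformity in [z] rules out any assumption that the factors stay away from 0. The logarithms may
    therefore grow, but only like [(Re t)^(-1/2)], which the factor [Re t] absorbs. *)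
Lemma loggen_near_rational k M eps : (0 < k)%nat -> 0 <= M -> 0 < eps ->
  exists e0, 0 < e0 /\ forall z h t, Cmod z <= 1 -> Z.gcd h (Z.of_nat k) = 1%Z ->
  0 < Re t < e0 -> Rabs (Im t) <= M * Re t ->
  Re t * Cmod (loggen_tail z 0 (unit_root k h * Cexp (- t)) - arc_weight z k / t)%C <= eps.
Proof.
intros Hk HM Heps.
assert (HK : 1 <= INR k) by (replace 1 with (INR 1) by reflexivity; apply le_INR; lia).
destruct (finite_uniform (fun j a => forall w s, Cmod w <= 1 -> 0 < Re s -> Rabs (Im s) <= M * Re s ->
   Cmod (sector_rem w (INR (S j) / INR k) s) <= / a) k) as (a & Ha & Hrem).
{ intros j a b H Hb w s H1 H2 H3; eapply Rle_trans; [apply H; assumption|apply Rinv_le_contravar; lra]. }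
{ intros j Hj; destruct (sector_rem_bounded (INR (S j) / INR k) M) as (K & HK0 & HKb); [|exact HM|].
  - pose proof (INR_S_pos j); split; [apply Rdiv_lt_0_compat; lra|].
    apply Rle_div_l; [lra|]; rewrite Rmult_1_l; apply le_INR; lia.
  - exists (/ K); split; [apply Rinv_0_lt_compat, HK0|]; rewrite Rinv_inv; exact HKb. }
assert (Hia : 0 < / a) by (apply Rinv_0_lt_compat, Ha).
(* With [u = sqrt (Re t) <= 1], remainders and logarithms together contribute at most
   [INR k * u * (/ a + 7)]; hence [Re t < c ^ 2] suffices. *)
set (c := eps / (INR k * (/ a + 7))).
assert (Hc : 0 < c) by (apply Rdiv_lt_0_compat; [exact Heps|apply Rmult_lt_0_compat; lra]).
exists (Rmin (/ INR k) (c ^ 2)); split.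
{ apply Rmin_glb_lt; [apply Rinv_0_lt_compat; lra|apply pow_lt, Hc]. }
intros z h t Hz Hg Ht1 Ht2.
assert (Hk1 : Re t < / INR k) by (eapply Rlt_le_trans; [apply Ht1|apply Rmin_l]).
assert (Hc2 : Re t < c ^ 2) by (eapply Rlt_le_trans; [apply Ht1|apply Rmin_r]).
assert (Hkt : INR k * Re t <= 1).
{ apply Rmult_lt_compat_l with (r := INR k) in Hk1; [|lra]; rewrite Rinv_r in Hk1 by lra; lra. }
set (e := Re t) in *.
assert (He0 : 0 < e) by lra.
rewrite loggen_major_rem by assumption.
unfold arc_weight.
match goal with |- _ * Cmod (?A + ?B - ?A)%C <= _ => replace (A + B - A)%C with B by ring end.
set (u := sqrt e).
assert (Hu : u * u = e) by (apply sqrt_sqrt; lra).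
assert (Hu0 : 0 < u) by (apply sqrt_lt_R0; lra).
assert (Huc : u < c).
{ apply Rnot_le_lt; intros H; assert (c * c <= u * u) by (apply Rmult_le_compat; lra).
  simpl in Hc2; lra. }
assert (Hu1 : u <= 1).
{ apply Rnot_lt_le; intros H; assert (1 < u * u) by nra. nra. }
assert (Hsq : sqrt (2 / (INR k * e)) <= 2 / u).
{ apply Rsqr_incr_0_var; [|apply Rmult_le_pos; [lra|left; apply Rinv_0_lt_compat, Hu0]].
  rewrite Rsqr_sqrt by (apply Rmult_le_pos; [lra|left; apply Rinv_0_lt_compat; nra]).
  unfold Rsqr. replace (2 / u * (2 / u)) with (4 / e) by (rewrite <- Hu; field; lra).
  apply Rmult_le_reg_r with (INR k * e); [nra|].
  replace (2 / (INR k * e) * (INR k * e)) with 2 by (field; lra).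
  replace (4 / e * (INR k * e)) with (4 * INR k) by (field; lra). lra. }
apply Rle_trans with (e * (INR k * (/ a + 1 / 2 * (3 + 2 * (2 / u))))).
- apply Rmult_le_compat_l; [lra|]; rewrite <- Rsumn_const; apply Cmod_Csumn_le; intros j Hj.
  assert (Hw : Cmod (z * unit_root k (h * Z.of_nat (S j)))%C <= 1) by (rewrite Cmod_mult, Cmod_unit_root; lra).
  assert (Hre : Re (RtoC (INR k) * t)%C = INR k * e) by (rewrite Re_mult, Re_RtoC, Im_RtoC; unfold e; ring).
  assert (Him : Im (RtoC (INR k) * t)%C = INR k * Im t) by (rewrite Im_mult, Re_RtoC, Im_RtoC; ring).
  apply Cmod_plus_le; [apply Hrem; try assumption|apply Cmod_mult_le].
  + rewrite Hre; nra.
  + rewrite Hre, Him, Rabs_mult, (Rabs_pos_eq (INR k)) by lra; nra.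
  + rewrite Cmod_R. assert (0 < INR (S j) / INR k <= 1); [|apply Rabs_le; lra].
    pose proof (INR_S_pos j); split; [apply Rdiv_lt_0_compat; lra|].
    apply Rle_div_l; [lra|]; rewrite Rmult_1_l; apply le_INR; lia.
  + eapply Rle_trans; [apply Clog1m_exp_bound; [exact Hw|rewrite Hre; split; nra]|]; rewrite Hre; lra.
- assert (E : e * (INR k * (/ a + 1 / 2 * (3 + 2 * (2 / u)))) = INR k * (u * (u * (/ a + 3 / 2) + 2))).
  { rewrite <- Hu; field; lra. }
  rewrite E.
  apply Rle_trans with (INR k * (c * (/ a + 7))).
  + apply Rmult_le_compat_l; [lra|]; apply Rmult_le_compat; nra.
  + right; unfold c; field; lra.
Qed.

(** * Covering the circle: neighbourhoods of finitely many roots of unity and their complement *)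

Lemma PI_bounds : 31415 / 10000 < PI < 31416 / 10000.
Proof.
pose proof (PI_2_3_7_ineq 4) as [H1 H2].
unfold tg_alt, PI_2_3_7_tg, Ratan_seq in H1, H2; simpl in H1, H2; lra.
Qed.

Lemma sin_ge_half u : 0 <= u <= PI / 2 -> u / 2 <= sin u.
Proof.
intros Hu; pose proof PI_bounds as HPI.
destruct (SIN u ltac:(lra) ltac:(lra)) as [H _].
eapply Rle_trans; [|exact H].
unfold sin_lb, sin_approx, sin_term; simpl.
set (v := u * u).
assert (Hv : 0 <= v <= 25 / 10) by (unfold v; nra).
match goal with |- _ <= ?r => replace r with (u * (1 - v / 6 + v * v / 120 - v * v * v / 5040)) by (unfold v; field) end.
assert (0 <= v * v) by nra.
assert (v * v * v <= v * v * 3) by nra.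
nra.
Qed.

Lemma is_Cseries_shift f l n : is_Cseries f l -> is_Cseries (fun r => f (n + r)%nat) (l - Csumn f n)%C.
Proof.
rewrite !is_Cseries_Csumn; intros H eps He; destruct (H eps He) as (N & HN); exists N; intros m Hm.
replace (Csumn (fun r => f (n + r)%nat) m - (l - Csumn f n))%C with (Csumn f (n + m) - l)%C
  by (rewrite Csumn_add; ring).
apply HN; lia.
Qed.

(** Since [|1 - q^r| >= 1 - e^(-r eta) >= r eta e^(-r eta)], the bound holds at every point of the
    circle; the tail of the series is thus negligible without knowledge of [x]. *)
Lemma loggen_term_circ_bound z eta x r : Cmod z <= 1 -> 0 < eta ->
  eta * Cmod (loggen_term z 0 (circ eta x) r) <= / INR (S r) ^ 2.
Proof.
intros Hz He; unfold loggen_term; rewrite Cpow_1_r.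
pose proof (INR_S_pos r) as Hr; set (k := INR (S r)) in *.
set (q := circ eta x); pose proof (Cmod_circ_lt1 eta x He) as Hq; fold q in Hq.
assert (Hqr : Cmod (q ^ S r)%C = exp (- (k * eta))).
{ rewrite Cmod_pow; unfold q; rewrite Cmod_circ.
  rewrite <- Rpower_pow by apply exp_pos; unfold Rpower; rewrite ln_exp; fold k; f_equal; ring. }
assert (Hke : 0 < k * eta) by (apply Rmult_lt_0_compat; assumption).
assert (Hd : exp (- (k * eta)) * (k * eta) <= Cmod (1 - q ^ S r)%C).
{ eapply Rle_trans; [|apply Cmod_one_minus_ge, Req_le, Hqr].
  assert (exp (- (k * eta)) * (1 + k * eta) <= 1); [|lra].
  rewrite exp_Ropp; apply Rmult_le_reg_l with (exp (k * eta)); [apply exp_pos|].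
  rewrite <- Rmult_assoc, Rinv_r by apply Rgt_not_eq, exp_pos.
  pose proof (exp_ineq1_le (k * eta)); lra. }
pose proof (exp_pos (- (k * eta))) as Hp.
assert (Hd0 : 0 < exp (- (k * eta)) * (k * eta)) by (apply Rmult_lt_0_compat; assumption).
rewrite Cmod_mult.
assert (H1 : Cmod (z ^ S r / RtoC k)%C <= / k).
{ eapply Rle_trans; [apply Cmod_div_le with (A := 1) (B := k)|unfold Rdiv; lra]; [apply Cmod_pow_le1, Hz|exact Hr|].
  rewrite Cmod_RtoC_pos; lra. }
assert (H2 : Cmod (q ^ S r / (1 - q ^ S r))%C <= / (k * eta)).
{ eapply Rle_trans; [apply Cmod_div_le with (A := exp (- (k * eta))); [lra|exact Hd0|exact Hd]|].
  right; field; repeat split; lra. }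
apply Rle_trans with (eta * (/ k * / (k * eta))).
- apply Rmult_le_compat_l; [lra|]; apply Rmult_le_compat; try apply Cmod_ge_0; assumption.
- right; field; split; lra.
Qed.

Lemma loggen_far eps : 0 < eps -> exists (Nr : nat) (B : R), (0 < Nr)%nat /\ 0 < B /\
  forall z eta x, Cmod z <= 1 -> 0 < eta ->
  (forall r, (r < Nr)%nat -> B * eta <= Cmod (1 - circ eta x ^ S r)%C) ->
  eta * Cmod (loggen_tail z 0 (circ eta x)) <= eps.
Proof.
(* The tail beyond [Nr] is at most [1 / Nr < eps / 2]. The choice [B = 2 Nr / eps] lets each of the
   [Nr] first terms contribute at most [eps / (2 Nr)]. *)
intros Heps; destruct (INR_unbounded (2 / eps)) as (Nr & HR).
assert (HR0 : 0 < 2 / eps) by (apply Rdiv_lt_0_compat; lra).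
assert (HRpos : 0 < INR Nr) by lra.
assert (HRn : (0 < Nr)%nat) by (apply INR_lt; simpl; lra).
exists Nr, (2 * INR Nr / eps); split; [exact HRn|split].
{ apply Rdiv_lt_0_compat; lra. }
intros z eta x Hz He Hfar.
pose proof (loggen_tail_correct z 0 (circ eta x) Hz (Cmod_circ_lt1 eta x He)) as HS.
pose proof (is_Cseries_shift _ _ Nr HS) as HT.
set (l := loggen_tail z 0 (circ eta x)) in *; set (f := loggen_term z 0 (circ eta x)) in *.
assert (H1 : eta * Cmod (Csumn f Nr) <= eps / 2).
{ apply Rle_trans with (eta * (INR Nr * (eps / (2 * INR Nr) / eta))); [|right; field; split; lra].
  apply Rmult_le_compat_l; [lra|]; rewrite <- Rsumn_const; apply Cmod_Csumn_le; intros r Hr.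
  specialize (Hfar r Hr); unfold f, loggen_term; rewrite Cpow_1_r.
  rewrite <- (Rmult_1_l (_ / _ / _)); apply Cmod_mult_le.
  - eapply Rle_trans; [apply Cmod_div_INR_le|]; apply Cmod_pow_le1, Hz.
  - eapply Rle_trans; [apply Cmod_div_le with (A := 1) (B := 2 * INR Nr / eps * eta)|].
    + apply Cmod_pow_le1, Rlt_le, Cmod_circ_lt1, He.
    + apply Rmult_lt_0_compat; [apply Rdiv_lt_0_compat; lra|exact He].
    + exact Hfar.
    + right; field; repeat split; lra. }
assert (H2 : eta * Cmod (l - Csumn f Nr)%C <= eps / 2).
{ apply Rle_trans with (/ INR Nr).
  2:{ left; apply Rmult_lt_reg_r with (INR Nr); [lra|]; rewrite Rinv_l by lra.
      apply Rmult_gt_compat_r with (r := eps / 2) in HR; [|lra].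
      replace (2 / eps * (eps / 2)) with 1 in HR by (field; lra); lra. }
  replace (eta * Cmod (l - Csumn f Nr)%C) with (Cmod (RtoC eta * (l - Csumn f Nr))%C)
    by (rewrite Cmod_mult, Cmod_RtoC_pos; lra).
  pose proof (is_series_telescope (fun n => / INR (Nr + n))) as HTel; cbv beta in HTel.
  rewrite Nat.add_0_r in HTel.
  apply (Cmod_Cseries_le (fun r => RtoC eta * f (Nr + r)%nat)%C _ (fun n => / INR (Nr + n) - / INR (Nr + S n))).
  - intros r; rewrite Cmod_mult, Cmod_RtoC_pos by lra.
    eapply Rle_trans; [apply loggen_term_circ_bound; assumption|].
    rewrite Nat.add_succ_r, S_INR.
    assert (0 < INR (Nr + r)) by (apply lt_0_INR; lia).
    replace (/ INR (Nr + r) - / (INR (Nr + r) + 1)) with (/ (INR (Nr + r) * (INR (Nr + r) + 1))) by (field; lra).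
    apply Rinv_le_contravar; [nra|]; simpl; nra.
  - apply is_Cseries_scal, HT.
  - apply HTel; intros e Hpe; destruct (inv_INR_lt 1 e Rlt_0_1 Hpe) as (N & HN).
    exists (S N); intros n Hn.
    assert (0 < INR (Nr + n)) by (apply lt_0_INR; lia).
    rewrite Rabs_pos_eq by (left; apply Rinv_0_lt_compat; assumption).
    specialize (HN (n - 1)%nat ltac:(lia)); rewrite Rmult_1_l in HN.
    eapply Rle_lt_trans; [|exact HN]; apply Rinv_le_contravar; [apply INR_S_pos|apply le_INR; lia]. }
apply Rle_trans with (eta * (Cmod (Csumn f Nr) + Cmod (l - Csumn f Nr)%C)); [|lra].
apply Rmult_le_compat_l; [lra|].
replace l with (Csumn f Nr + (l - Csumn f Nr))%C at 1 by ring; apply Cmod_triangle.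
Qed.

(** From [|1 - e^(-a + i psi)|^2 = (1 - e^(-a))^2 + 4 e^(-a) sin(psi/2)^2], with [e^(-a) >= 1/4] and
    [sin v >= v/2] on the relevant range. *)
Lemma one_minus_Cexp_angle a psi : 0 < a <= 1 -> Rabs psi <= PI ->
  Rabs psi <= 4 * Cmod (1 - Cexp (- a, psi)%R)%C.
Proof.
intros Ha Hp.
assert (E : Cmod (1 - Cexp (- a, psi)%R)%C * Cmod (1 - Cexp (- a, psi)%R)%C =
  (1 - exp (- a)) * (1 - exp (- a)) + 4 * exp (- a) * (sin (Rabs psi / 2) * sin (Rabs psi / 2))).
{ rewrite Cmod_sqr, Re_minus, Im_minus, Re_Cexp, Im_Cexp; simpl Re; simpl Im.
  replace (cos psi) with (1 - 2 * (sin (Rabs psi / 2) * sin (Rabs psi / 2))).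
  2:{ replace psi with (2 * (psi / 2)) at 3 by field; rewrite cos_2a_sin.
      unfold Rabs; destruct (Rcase_abs psi); [|ring].
      replace (- psi / 2) with (- (psi / 2)) by field; rewrite sin_neg; ring. }
  replace (sin psi) with (2 * sin (psi / 2) * cos (psi / 2)) by (rewrite <- sin_2a; f_equal; field).
  assert (Es : sin (Rabs psi / 2) * sin (Rabs psi / 2) = sin (psi / 2) * sin (psi / 2)).
  { unfold Rabs; destruct (Rcase_abs psi); [|ring].
    replace (- psi / 2) with (- (psi / 2)) by field; rewrite sin_neg; ring. }
  rewrite Es; pose proof (sin2_cos2 (psi / 2)) as H; unfold Rsqr in H.
  set (s := sin (psi / 2)) in *; set (c := cos (psi / 2)) in *; set (ea := exp (- a)).
  replace ((0 - ea * (2 * s * c)) * (0 - ea * (2 * s * c))) with (4 * ea * ea * (s * s) * (c * c)) by ring.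
  replace (c * c) with (1 - s * s) by lra; ring. }
assert (Hea : / 4 <= exp (- a)).
{ rewrite exp_Ropp; apply Rinv_le_contravar; [apply exp_pos|].
  apply Rle_trans with (exp 1); [apply exp_mono; lra|]. pose proof exp_le_3; lra. }
pose proof (Rabs_pos psi).
pose proof (sin_ge_half (Rabs psi / 2) ltac:(lra)) as Hs.
pose proof (Cmod_ge_0 (1 - Cexp (- a, psi)%R)%C).
apply Rsqr_incr_0_var; [unfold Rsqr|lra].
set (m := Cmod (1 - Cexp (- a, psi)%R)%C) in *; set (s := sin (Rabs psi / 2)) in *.
assert (Rabs psi * Rabs psi <= 16 * (s * s)) by nra.
assert (s * s <= 4 * exp (- a) * (s * s)) by (pose proof (Rle_0_sqr s) as Hss; unfold Rsqr in Hss; nra).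
replace (4 * m * (4 * m)) with (16 * (m * m)) by ring; rewrite E.
pose proof (Rle_0_sqr (1 - exp (- a))) as Hss; unfold Rsqr in Hss; lra.
Qed.

(** If some [q^m] with [m <= Nr] comes closer to 1 than [B eta], then [x] is within [O(eta)] of a
    rational angle of denominator [m], and the expansion at that root applies in a fixed sector.
    Otherwise [loggen_far] applies. *)
Lemma arcs_cover eps : 0 < eps -> exists (Nr : nat) (M e0 : R), 0 <= M /\ 0 < e0 /\
  forall z eta x, Cmod z <= 1 -> 0 < eta < e0 ->
  eta * Cmod (loggen_tail z 0 (circ eta x)) <= eps \/
  exists k h t, (0 < k <= Nr)%nat /\ Z.gcd h (Z.of_nat k) = 1%Z /\ Re t = eta /\ Rabs (Im t) <= M * eta /\
    x = 2 * PI * (IZR h / INR k) - Im t /\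
    eta * Cmod (loggen_tail z 0 (circ eta x) - arc_weight z k / t)%C <= eps.
Proof.
intros Heps; destruct (loggen_far eps Heps) as (Nr & B & HR & HB & Hfar).
destruct (finite_uniform (fun k a => (0 < k)%nat -> forall z h t, Cmod z <= 1 -> Z.gcd h (Z.of_nat k) = 1%Z ->
  0 < Re t < a -> Rabs (Im t) <= 4 * B * Re t ->
  Re t * Cmod (loggen_tail z 0 (unit_root k h * Cexp (- t)) - arc_weight z k / t)%C <= eps) (S Nr)) as (a & Ha & Hnear).
{ intros j a b H Hb Hj z h t H1 H2 H3 H4; apply H; try assumption; lra. }
{ intros [|k] Hk; [exists 1; split; [lra|intros; lia]|].
  destruct (loggen_near_rational (S k) (4 * B) eps) as (e0 & He0 & H); [lia|lra|exact Heps|].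
  exists e0; split; [exact He0|]; intros _; exact H. }
assert (HIR : 0 < INR Nr) by (apply lt_0_INR; exact HR).
exists Nr, (4 * B), (Rmin a (/ INR Nr)); split; [lra|split; [apply Rmin_glb_lt; [exact Ha|apply Rinv_0_lt_compat, HIR]|]].
intros z eta x Hz He.
assert (Hea : eta < a) by (eapply Rlt_le_trans; [apply He|apply Rmin_l]).
assert (HeR : eta < / INR Nr) by (eapply Rlt_le_trans; [apply He|apply Rmin_r]).
assert (Hdec : (forall r, (r < Nr)%nat -> B * eta <= Cmod (1 - circ eta x ^ S r)%C) \/
   exists r, (r < Nr)%nat /\ Cmod (1 - circ eta x ^ S r)%C < B * eta).
{ clear. induction Nr as [|Nr [IH|(r & Hr & IH)]].
  - left; intros; lia.
  - destruct (Rle_or_lt (B * eta) (Cmod (1 - circ eta x ^ S Nr)%C)) as [H|H].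
    + left; intros r Hr; destruct (Nat.eq_dec r Nr) as [->|]; [exact H|apply IH; lia].
    + right; exists Nr; split; [lia|exact H].
  - right; exists r; split; [lia|exact IH]. }
destruct Hdec as [H|(r & Hr & H)]; [left; apply Hfar; [exact Hz|apply He|exact H]|right].
set (m := S r) in *.
assert (Hm : 0 < INR m) by apply INR_S_pos.
assert (HmR : INR m <= INR Nr) by (apply le_INR; unfold m; lia).
pose proof PI_RGT_0 as Hpi.
(* [p] is the integer nearest to [m x / (2 PI)] and [psi] the remaining angle, of absolute value at
   most [PI]. *)
set (y := INR m * x / (2 * PI) + 1 / 2).
set (p := Int_part y).
assert (Hp : IZR p <= y < IZR p + 1).
{ destruct (base_Int_part y) as [H1 H2]; fold p in H1, H2; lra. }
set (psi := INR m * x - 2 * PI * IZR p).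
assert (Hpsi : Rabs psi <= PI).
{ assert (E : INR m * x = 2 * PI * (y - 1 / 2)) by (unfold y; field; lra).
  unfold psi; rewrite E; apply Rabs_le; split; nra. }
assert (Hq : (circ eta x ^ m)%C = Cexp (- (INR m * eta), psi)%R).
{ unfold circ; rewrite Cexp_pow, <- (Cexp_Im_period _ psi p); f_equal; unfold psi.
  apply Ceq_ReIm; [rewrite Re_mult|rewrite Im_mult]; rewrite Re_RtoC, Im_RtoC; unfold Re, Im; cbn [fst snd]; ring. }
assert (Hme : 0 < INR m * eta <= 1).
{ split; [apply Rmult_lt_0_compat; lra|].
  apply Rle_trans with (INR Nr * / INR Nr); [apply Rmult_le_compat; lra|rewrite Rinv_r; lra]. }
pose proof (one_minus_Cexp_angle (INR m * eta) psi Hme Hpsi) as Hang.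
rewrite <- Hq in Hang.
(* Reduction of [p / m] to lowest terms [h / k]; then [k <= m <= Nr]. *)
set (g := Z.gcd p (Z.of_nat m)).
assert (Hg : (0 < g)%Z) by (assert (0 <= g)%Z by apply Z.gcd_nonneg; assert (g <> 0)%Z by (intros E; apply Z.gcd_eq_0 in E; lia); lia).
destruct (Z.gcd_divide_l p (Z.of_nat m)) as (h & Hh); destruct (Z.gcd_divide_r p (Z.of_nat m)) as (k & Hk).
fold g in Hh, Hk.
assert (Hk0 : (0 < k)%Z) by nia.
exists (Z.to_nat k), h, (eta, - (psi / INR m))%R.
assert (HkR : INR (Z.to_nat k) = IZR k) by (rewrite INR_IZR_INZ, Z2Nat.id by lia; reflexivity).
assert (HIg : 0 < IZR g) by (apply IZR_lt; exact Hg).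
assert (HIk : 0 < IZR k) by (apply IZR_lt; exact Hk0).
assert (Hmg : INR m = IZR k * IZR g) by (rewrite INR_IZR_INZ, Hk, mult_IZR; reflexivity).
assert (Hx : x = 2 * PI * (IZR h / INR (Z.to_nat k)) - Im (eta, - (psi / INR m))%R).
{ unfold Im; cbn [snd]; unfold psi; rewrite HkR, Hh, mult_IZR, Hmg. field; split; lra. }
assert (Hgcd : Z.gcd h (Z.of_nat (Z.to_nat k)) = 1%Z).
{ rewrite Z2Nat.id by lia; assert (E : (g * Z.gcd h k = g * 1)%Z); [|nia].
  rewrite Z.mul_1_r; unfold g at 2; rewrite Hh, Hk, Z.gcd_mul_mono_r_nonneg by lia; ring. }
assert (HkR2 : (0 < Z.to_nat k <= Nr)%nat).
{ split; [lia|]; assert (k <= Z.of_nat m)%Z by nia; unfold m in *; lia. }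
assert (Him : Rabs (Im (eta, - (psi / INR m))%R) <= 4 * B * eta).
{ unfold Im; cbn [snd]; rewrite Rabs_Ropp; unfold Rdiv; rewrite Rabs_mult, (Rabs_pos_eq (/ INR m)) by (left; apply Rinv_0_lt_compat; exact Hm).
  assert (1 <= INR m) by apply INR_S_ge1.
  assert (/ INR m <= 1) by (rewrite <- Rinv_1; apply Rinv_le_contravar; lra).
  assert (0 < / INR m) by (apply Rinv_0_lt_compat; exact Hm).
  pose proof (Rabs_pos psi); nra. }
split; [exact HkR2|split; [exact Hgcd|split; [reflexivity|split; [exact Him|split; [exact Hx|]]]]].
assert (Hc : circ eta x = (unit_root (Z.to_nat k) h * Cexp (- (eta, - (psi / INR m))%R))%C).
{ unfold circ, unit_root; rewrite <- Cexp_plus; f_equal; rewrite Hx at 1; apply Ceq_ReIm; [rewrite Re_plus, Re_opp|rewrite Im_plus, Im_opp]; unfold Re, Im; cbn [fst snd]; ring. }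
rewrite Hc.
exact (Hnear (Z.to_nat k) ltac:(lia) ltac:(lia) z h (eta, - (psi / INR m))%R Hz Hgcd (conj (proj1 He) Hea) Him).
Qed.

Lemma is_derive_RInt_param_explicit (f df : R -> R -> R) a b x :
  (forall u t, is_derive (fun u => f u t) u (df u t)) ->
  (forall u t, continuity_2d_pt df u t) ->
  (forall u t, continuous (f u) t) ->
  is_derive (fun u => RInt (f u) a b) x (RInt (df x) a b).
Proof.
intros Hd Hc Hf.
assert (E : forall u t, Derive (fun z => f z t) u = df u t) by (intros; apply is_derive_unique, Hd).
rewrite (RInt_ext (df x) (fun t => Derive (fun u => f u t) x)) by (intros; symmetry; apply E).
apply (is_derive_RInt_param f a b x).
- exists (mkposreal 1 Rlt_0_1); intros y _ t _; exists (df y t); apply Hd.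
- intros t _; apply continuity_2d_pt_ext with (2 := Hc x t); intros u v; symmetry; apply E.
- exists (mkposreal 1 Rlt_0_1); intros y _; apply @ex_RInt_continuous; intros t _; apply Hf.
Qed.

(** * Gaussian integrals and Laplace's method *)

Definition gauss (c : C) (v : R) : C := Cexp (- (c * RtoC (v * v)))%C.
Definition gauss_int (c : C) (X : R) : C := CInt (gauss c) 0 X.
(** Integrand of the classical auxiliary function whose derivative cancels that of [c] times the
    squared Gaussian integral. *)
Definition gauss_rem_fun (c : C) (X s : R) : C :=
  (Cexp (- (c * RtoC (X * X * (1 + s * s)))) * RtoC (/ (1 + s * s)))%C.
Definition gauss_rem (c : C) (X : R) : C := CInt (gauss_rem_fun c X) 0 1.

Lemma one_plus_sqr_pos s : 0 < 1 + s * s.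
Proof. nra. Qed.

Lemma is_Cderive_sqr_scal (c : C) t : is_Cderive (fun v => - (c * RtoC (v * v)))%C t (- (RtoC (2 * t) * c))%C.
Proof.
apply is_Cderive_opp.
replace (RtoC (2 * t) * c)%C with (0 * RtoC (t * t) + c * RtoC (2 * t))%C by ring.
apply (is_Cderive_mult (fun _ => c) (fun v => RtoC (v * v))); [apply is_Cderive_const|].
apply is_Cderive_RtoC; auto_derive; [trivial|ring].
Qed.

Lemma gauss_continuous c t : Ccontinuous (gauss c) t.
Proof. eapply is_Cderive_continuous, is_Cderive_Cexp, is_Cderive_sqr_scal. Qed.

Lemma is_Cderive_CInt f a x : (forall t, Ccontinuous f t) -> is_Cderive (fun X => CInt f a X) x (f x).
Proof.
intros H; split; simpl.
- apply (is_derive_RInt (fun t => Re (f t)) _ a); [|apply (H x)].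
  exists (mkposreal 1 Rlt_0_1); intros y _; apply (@RInt_correct R_CompleteNormedModule), @ex_RInt_continuous; intros t _; apply (H t).
- apply (is_derive_RInt (fun t => Im (f t)) _ a); [|apply (H x)].
  exists (mkposreal 1 Rlt_0_1); intros y _; apply (@RInt_correct R_CompleteNormedModule), @ex_RInt_continuous; intros t _; apply (H t).
Qed.

Lemma gauss_rem_derive c X : is_Cderive (gauss_rem c) X
  (CInt (fun s => - (RtoC (2 * X) * c) * Cexp (- (c * RtoC (X * X * (1 + s * s)))))%C 0 1).
Proof.
destruct c as [a b].
set (f1 := fun X s => exp (- (a * (X * X * (1 + s * s)))) * cos (b * (X * X * (1 + s * s))) * / (1 + s * s)).
set (f2 := fun X s => - (exp (- (a * (X * X * (1 + s * s)))) * sin (b * (X * X * (1 + s * s))) * / (1 + s * s))).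
set (d1 := fun X s => - (2 * X) * (exp (- (a * (X * X * (1 + s * s)))) * (a * cos (b * (X * X * (1 + s * s))) + b * sin (b * (X * X * (1 + s * s)))))).
set (d2 := fun X s => - (2 * X) * (exp (- (a * (X * X * (1 + s * s)))) * (b * cos (b * (X * X * (1 + s * s))) - a * sin (b * (X * X * (1 + s * s)))))).
assert (H2d : forall k u t, continuity_2d_pt (fun X s => k * (X * X * (1 + s * s))) u t).
{ intros k u t; apply continuity_2d_pt_mult; [apply continuity_2d_pt_const|].
  apply continuity_2d_pt_mult; [apply continuity_2d_pt_mult; apply continuity_2d_pt_id1|].
  apply continuity_2d_pt_plus; [apply continuity_2d_pt_const|apply continuity_2d_pt_mult; apply continuity_2d_pt_id2]. }
assert (Hexp : forall u t, continuity_2d_pt (fun X s => exp (- (a * (X * X * (1 + s * s))))) u t).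
{ intros u t; apply (continuity_1d_2d_pt_comp exp (fun X s => - (a * (X * X * (1 + s * s))))).
  - apply derivable_continuous_pt, derivable_pt_exp.
  - apply continuity_2d_pt_opp, H2d. }
assert (Hcos : forall u t, continuity_2d_pt (fun X s => cos (b * (X * X * (1 + s * s)))) u t).
{ intros u t; apply (continuity_1d_2d_pt_comp cos (fun X s => b * (X * X * (1 + s * s)))); [|apply H2d].
  apply derivable_continuous_pt, derivable_pt_cos. }
assert (Hsin : forall u t, continuity_2d_pt (fun X s => sin (b * (X * X * (1 + s * s)))) u t).
{ intros u t; apply (continuity_1d_2d_pt_comp sin (fun X s => b * (X * X * (1 + s * s)))); [|apply H2d].
  apply derivable_continuous_pt, derivable_pt_sin. }
assert (H2X : forall u t, continuity_2d_pt (fun X _ => - (2 * X)) u t).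
{ intros u t; apply continuity_2d_pt_opp, continuity_2d_pt_mult; [apply continuity_2d_pt_const|apply continuity_2d_pt_id1]. }
split.
- apply is_derive_ext with (fun X => RInt (f1 X) 0 1).
  { intros t; apply RInt_ext; intros s _; unfold f1, gauss_rem_fun; rewrite Re_mult, Re_Cexp, Re_RtoC, Im_RtoC; unfold Re, Im; simpl.
    replace (- (a * (t * t * (1 + s * s)) - b * 0)) with (- (a * (t * t * (1 + s * s)))) by ring.
    replace (- (a * 0 + b * (t * t * (1 + s * s)))) with (- (b * (t * t * (1 + s * s)))) by ring.
    rewrite cos_neg; ring. }
  replace (Re (CInt (fun s => - (RtoC (2 * X) * (a, b)) * Cexp (- ((a, b) * RtoC (X * X * (1 + s * s)))))%C 0 1)) with (RInt (d1 X) 0 1).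
  + apply is_derive_RInt_param_explicit.
    * intros u t; unfold f1, d1; auto_derive; [trivial|]; pose proof (one_plus_sqr_pos t); field; lra.
    * intros u t; unfold d1; apply (continuity_2d_pt_mult (fun X _ => - (2 * X))); [apply H2X|].
      apply (continuity_2d_pt_mult (fun X s => exp (- (a * (X * X * (1 + s * s)))))); [apply Hexp|].
      exact (continuity_2d_pt_plus _ _ u t (continuity_2d_pt_mult _ _ u t (continuity_2d_pt_const u t a) (Hcos u t))
        (continuity_2d_pt_mult _ _ u t (continuity_2d_pt_const u t b) (Hsin u t))).
    * intros u t; apply @ex_derive_continuous; unfold f1; auto_derive; pose proof (one_plus_sqr_pos t); lra.
  + apply RInt_ext; intros s _; unfold d1.
    rewrite Re_mult, Re_Cexp, Im_Cexp; unfold Re, Im; simpl.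
    replace (- (a * (X * X * (1 + s * s)) - b * 0)) with (- (a * (X * X * (1 + s * s)))) by ring.
    replace (- (a * 0 + b * (X * X * (1 + s * s)))) with (- (b * (X * X * (1 + s * s)))) by ring.
    rewrite cos_neg, sin_neg; ring.
- apply is_derive_ext with (fun X => RInt (f2 X) 0 1).
  { intros t; apply RInt_ext; intros s _; unfold f2, gauss_rem_fun; rewrite Im_mult, Re_Cexp, Im_Cexp, Re_RtoC, Im_RtoC; unfold Re, Im; simpl.
    replace (- (a * (t * t * (1 + s * s)) - b * 0)) with (- (a * (t * t * (1 + s * s)))) by ring.
    replace (- (a * 0 + b * (t * t * (1 + s * s)))) with (- (b * (t * t * (1 + s * s)))) by ring.
    rewrite sin_neg; ring. }
  replace (Im (CInt (fun s => - (RtoC (2 * X) * (a, b)) * Cexp (- ((a, b) * RtoC (X * X * (1 + s * s)))))%C 0 1)) with (RInt (d2 X) 0 1).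
  + apply is_derive_RInt_param_explicit.
    * intros u t; unfold f2, d2; auto_derive; [trivial|]; pose proof (one_plus_sqr_pos t); field; lra.
    * intros u t; unfold d2; apply (continuity_2d_pt_mult (fun X _ => - (2 * X))); [apply H2X|].
      apply (continuity_2d_pt_mult (fun X s => exp (- (a * (X * X * (1 + s * s)))))); [apply Hexp|].
      exact (continuity_2d_pt_minus _ _ u t (continuity_2d_pt_mult _ _ u t (continuity_2d_pt_const u t b) (Hcos u t))
        (continuity_2d_pt_mult _ _ u t (continuity_2d_pt_const u t a) (Hsin u t))).
    * intros u t; apply @ex_derive_continuous; unfold f2; auto_derive; pose proof (one_plus_sqr_pos t); lra.
  + apply RInt_ext; intros s _; unfold d2.
    rewrite Im_mult, Re_Cexp, Im_Cexp; unfold Re, Im; simpl.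
    replace (- (a * (X * X * (1 + s * s)) - b * 0)) with (- (a * (X * X * (1 + s * s)))) by ring.
    replace (- (a * 0 + b * (X * X * (1 + s * s)))) with (- (b * (X * X * (1 + s * s)))) by ring.
    rewrite cos_neg, sin_neg; ring.
Qed.

Lemma CInt_point f a : CInt f a a = 0%C.
Proof.
apply Ceq_ReIm; [exact (RInt_point a (fun x => Re (f x)))|exact (RInt_point a (fun x => Im (f x)))].
Qed.

Lemma gauss_int_scale c X : gauss_int c X = (RtoC X * CInt (fun s => Cexp (- (c * RtoC (X * X * (s * s))))) 0 1)%C.
Proof.
unfold gauss_int.
pose proof (CInt_comp_lin (gauss c) X 0 0 1 (gauss_continuous c)) as H.
rewrite Rmult_0_r, Rmult_1_r, !Rplus_0_r in H; rewrite <- H.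
rewrite <- CInt_scal.
- apply CInt_ext; intros s; unfold gauss; rewrite Rplus_0_r.
  replace (X * s * (X * s)) with (X * X * (s * s)) by ring; reflexivity.
- apply ex_CInt_continuous; intros s.
  apply Ccontinuous_ext with (fun s => gauss (c * RtoC (X * X)) s).
  + intros u; unfold gauss; f_equal; rewrite (RtoC_mult (X * X)); ring.
  + apply gauss_continuous.
Qed.

Lemma continuous_inv_1_sqr t : continuous (fun s => / (1 + s * s)) t.
Proof.
apply @ex_derive_continuous; auto_derive; pose proof (one_plus_sqr_pos t); lra.
Qed.

Lemma RInt_inv_1_sqr : RInt (fun s => / (1 + s * s)) 0 1 = PI / 4.
Proof.
apply is_RInt_unique.
replace (PI / 4) with (minus (atan 1) (atan 0)) by (rewrite atan_0, atan_1; unfold minus, plus, opp; simpl; ring).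
apply (@is_RInt_derive R_CompleteNormedModule atan (fun s => / (1 + s * s))).
- intros s _; apply is_derive_Reals; pose proof (derivable_pt_lim_atan s) as H; replace (s ^ 2) with (s * s) in H by ring; exact H.
- intros s _; apply continuous_inv_1_sqr.
Qed.

(** The left side has derivative 0: differentiation under the integral removes the denominator
    [1 + s^2], and rescaling the Gaussian integral to [[0, 1]] exhibits the same product with
    opposite sign. At [X = 0] the value is the arctangent integral. *)
Lemma gauss_identity c X : 0 <= X ->
  (c * (gauss_int c X * gauss_int c X) + gauss_rem c X)%C = RtoC (PI / 4).
Proof.
intros HX.
set (D := fun X => (c * (gauss_int c X * gauss_int c X) + gauss_rem c X)%C).
assert (H0 : D 0 = RtoC (PI / 4)).
{ unfold D, gauss_int; rewrite CInt_point, !Cmult_0_r, Cplus_0_l.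
  unfold gauss_rem; rewrite (CInt_ext _ (fun s => RtoC (/ (1 + s * s)))).
  - apply Ceq_ReIm; unfold CInt.
    + exact RInt_inv_1_sqr.
    + change (RInt (fun _ => 0) 0 1 = 0); rewrite RInt_const; unfold scal; simpl; unfold mult; simpl; ring.
  - intros s; unfold gauss_rem_fun; replace (0 * 0 * (1 + s * s)) with 0 by ring.
    replace (- (c * RtoC 0))%C with (RtoC 0) by ring; rewrite Cexp_0; ring. }
pose proof (Cmvt D (fun _ => 0%C) 0 X 0 HX) as H.
rewrite H0, Rmult_0_l in H.
apply Ceq_minus, Cmod_eq_0, Rle_antisym; [|apply Cmod_ge_0].
apply H; [|intros; rewrite Cmod_0; lra].
intros t _; unfold D.
set (K := CInt (fun s => Cexp (- (c * RtoC (t * t * (s * s))))) 0 1).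
assert (HG : is_Cderive (gauss_int c) t (gauss c t)) by (apply is_Cderive_CInt; apply gauss_continuous).
pose proof (gauss_rem_derive c t) as HR.
assert (ER : CInt (fun s => - (RtoC (2 * t) * c) * Cexp (- (c * RtoC (t * t * (1 + s * s)))))%C 0 1
   = (- (RtoC (2 * t) * c) * gauss c t * K)%C).
{ unfold K; rewrite <- CInt_scal.
  - apply CInt_ext; intros s; unfold gauss; rewrite <- Cmult_assoc, <- Cexp_plus; do 2 f_equal.
    replace (t * t * (1 + s * s)) with (t * t + t * t * (s * s)) by ring. rewrite RtoC_plus; ring.
  - apply ex_CInt_continuous; intros s.
    apply Ccontinuous_ext with (fun s => gauss (c * RtoC (t * t)) s).
    + intros u; unfold gauss; f_equal; rewrite (RtoC_mult (t * t)); ring.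
    + apply gauss_continuous. }
rewrite ER in HR.
pose proof (is_Cderive_mult _ _ t _ _ (is_Cderive_const c t) (is_Cderive_mult _ _ t _ _ HG HG)) as HM.
pose proof (is_Cderive_plus _ _ t _ _ HM HR) as HF; cbv beta in HF.
rewrite (gauss_int_scale c t) in HF at 1 2 3 4; fold K in HF.
match type of HF with is_Cderive _ _ ?d => replace (RtoC 0) with d; [exact HF|] end.
rewrite (RtoC_mult 2 t); ring.
Qed.

Lemma gauss_rem_bound c X : Cmod (gauss_rem c X) <= exp (- (Re c * (X * X))) * (PI / 4) \/ Re c < 0.
Proof.
destruct (Rle_or_lt 0 (Re c)) as [Hc|Hc]; [left|right; exact Hc].
rewrite <- RInt_inv_1_sqr.
assert (Hex : ex_RInt (fun s => / (1 + s * s)) 0 1).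
{ apply @ex_RInt_continuous; intros s _; apply continuous_inv_1_sqr. }
rewrite <- RInt_Rscal by exact Hex.
apply Cmod_CInt_le; [lra| | |].
- apply ex_CInt_continuous; intros s; apply Ccontinuous_mult.
  + apply Ccontinuous_ext with (fun s => Cexp (- (c * RtoC (X * X))) * gauss (c * RtoC (X * X)) s)%C.
    * intros u; unfold gauss; rewrite <- Cexp_plus; f_equal.
      replace (X * X * (1 + u * u)) with (X * X + X * X * (u * u)) by ring.
      rewrite RtoC_plus, (RtoC_mult (X * X)); ring.
    * apply Ccontinuous_mult; [apply Ccontinuous_const|apply gauss_continuous].
  + split; [|apply continuous_const]; simpl; apply continuous_inv_1_sqr.
- exact (ex_RInt_scal _ 0 1 (exp (- (Re c * (X * X)))) Hex).
- intros s _; unfold gauss_rem_fun; pose proof (one_plus_sqr_pos s).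
  rewrite Cmod_mult, (Cmod_RtoC_pos (/ (1 + s * s))) by (left; apply Rinv_0_lt_compat; assumption).
  apply Rmult_le_compat_r; [left; apply Rinv_0_lt_compat; assumption|].
  rewrite Cmod_Cexp; apply exp_mono; rewrite Re_opp, Re_mult, Re_RtoC, Im_RtoC.
  assert (0 <= X * X) by nra. assert (0 <= s * s) by nra.
  assert (0 <= Re c * (X * X) * (s * s)) by (apply Rmult_le_pos; [apply Rmult_le_pos|]; assumption). nra.
Qed.

(* With [y = ka * gauss_int], [y^2 = PI/4 - gauss_rem] stays in the right half plane, so
   [Re y] keeps the sign it has for small [X]; this selects the square root. *)
Lemma gauss_limit_bound (c ka : C) X : (ka * ka)%C = c -> 0 < Re ka -> 0 < Re c -> 0 < X ->
  Cmod (ka * gauss_int c X - RtoC (sqrt PI / 2))%C <= sqrt PI / 2 * exp (- (Re c * (X * X))).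
Proof.
intros Hka Hk Hc HX; pose proof PI_RGT_0 as Hpi.
set (y := fun X => (ka * gauss_int c X)%C).
assert (Hy2 : forall X, 0 < X -> (y X * y X)%C = (RtoC (PI / 4) - gauss_rem c X)%C /\
   Cmod (gauss_rem c X) <= exp (- (Re c * (X * X))) * (PI / 4)).
{ intros Y HY; split.
  - rewrite <- (gauss_identity c Y) by lra; unfold y; rewrite <- Hka; ring.
  - destruct (gauss_rem_bound c Y); [assumption|lra]. }
assert (Hre2 : forall X, 0 < X -> Re (y X) <> 0).
{ intros Y HY E; destruct (Hy2 Y HY) as [E2 HB].
  assert (He : exp (- (Re c * (Y * Y))) < 1) by (rewrite <- exp_0; apply exp_increasing; assert (0 < Y * Y) by nra; nra).
  apply (f_equal Re) in E2; rewrite Re_mult, Re_minus, Re_RtoC, E in E2.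
  pose proof (Re_le (gauss_rem c Y)).
  assert (Re (gauss_rem c Y) < PI / 4) by nra.
  nra. }
assert (Hd : forall t, is_Cderive y t (ka * gauss c t)%C).
{ intros t; replace (ka * gauss c t)%C with (0 * gauss_int c t + ka * gauss c t)%C by ring.
  apply (is_Cderive_mult (fun _ => ka) (gauss_int c)); [apply is_Cderive_const|].
  apply is_Cderive_CInt, gauss_continuous. }
assert (Hcont : continuity (fun t => Re (y t))).
{ intros t; apply derivable_continuous_pt; exists (Re (ka * gauss c t)%C); apply is_derive_Reals; exact (proj1 (Hd t)). }
assert (Hpos : exists X1, 0 < X1 <= X /\ 0 < Re (y X1)).
{ assert (Hg : continuous (fun t => Re (ka * gauss c t)%C) 0).
  { exact (proj1 (Ccontinuous_mult (fun _ => ka) (gauss c) 0 (Ccontinuous_const ka 0) (gauss_continuous c 0))). }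
  assert (Hg0 : Re (ka * gauss c 0)%C = Re ka).
  { unfold gauss; rewrite Rmult_0_l; replace (- (c * RtoC 0))%C with (RtoC 0) by ring; rewrite Cexp_0; f_equal; ring. }
  destruct (proj1 (filterlim_locally _ _) Hg (mkposreal _ Hk)) as (d & Hdl).
  exists (Rmin (d / 2) X).
  assert (Hd0 : 0 < d) by apply cond_pos.
  assert (HX1 : 0 < Rmin (d / 2) X) by (apply Rmin_glb_lt; lra).
  split; [split; [exact HX1|apply Rmin_r]|].
  set (X1 := Rmin (d / 2) X) in *.
  assert (X1 < d) by (assert (X1 <= d / 2) by apply Rmin_l; lra).
  destruct (MVT_gen (fun t => Re (y t)) 0 X1 (fun t => Re (ka * gauss c t)%C)) as (xi & Hxi & E).
  - intros t _; exact (proj1 (Hd t)).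
  - intros t _; apply Hcont.
  - rewrite Rmin_left, Rmax_right in Hxi by lra.
    assert (Hy0 : Re (y 0) = 0) by (unfold y, gauss_int; rewrite CInt_point, Cmult_0_r; reflexivity).
    rewrite Hy0, !Rminus_0_r in E; rewrite E.
    apply Rmult_lt_0_compat; [|exact HX1].
    assert (Hb : ball 0 d xi).
    { change (Rabs (xi - 0) < d); rewrite Rminus_0_r, Rabs_pos_eq; lra. }
    specialize (Hdl xi Hb).
    change (Rabs (Re (ka * gauss c xi)%C - Re (ka * gauss c 0)%C) < Re ka) in Hdl.
    rewrite Hg0 in Hdl; apply Rabs_def2 in Hdl; lra. }
assert (Hyp : 0 < Re (y X)).
{ destruct Hpos as (X1 & HX1 & Hp1).
  destruct (Rtotal_order (Re (y X)) 0) as [H|[H|H]]; [exfalso|exfalso; apply (Hre2 X HX H)|exact H].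
  destruct (IVT_gen (fun t => Re (y t)) X1 X 0 Hcont) as (x0 & Hx0 & E).
  - rewrite Rmin_right, Rmax_left by lra; lra.
  - rewrite Rmin_left, Rmax_right in Hx0 by lra. apply (Hre2 x0); [lra|exact E]. }
destruct (Hy2 X HX) as [E2 HB]; fold (y X).
set (s := sqrt PI / 2).
assert (Hs0 : 0 < s) by (apply Rdiv_lt_0_compat; [apply sqrt_lt_R0; lra|lra]).
assert (Hs : s * s = PI / 4).
{ unfold s; replace (sqrt PI / 2 * (sqrt PI / 2)) with (sqrt PI * sqrt PI / 4) by field; rewrite sqrt_sqrt by lra; reflexivity. }
(* Once the sign of [Re (y X)] is known, [|y + s| >= s], and dividing the factored identity by it
   gives the bound. *)
assert (Hfac : ((y X - RtoC s) * (y X + RtoC s))%C = (- gauss_rem c X)%C).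
{ replace ((y X - RtoC s) * (y X + RtoC s))%C with (y X * y X - RtoC (s * s))%C by (rewrite RtoC_mult; ring).
  rewrite E2, Hs; ring. }
assert (Hge : s <= Cmod (y X + RtoC s)%C).
{ eapply Rle_trans; [|apply Re_le]; rewrite Re_plus, Re_RtoC; lra. }
apply (f_equal Cmod) in Hfac; rewrite Cmod_mult, Cmod_opp in Hfac.
pose proof (Cmod_ge_0 (y X - RtoC s)%C).
apply Rmult_le_reg_r with s; [exact Hs0|].
replace (s * exp (- (Re c * (X * X))) * s) with (exp (- (Re c * (X * X))) * (s * s)) by ring.
rewrite Hs; nra.
Qed.

Lemma gauss_real_limit (m X : R) : 0 < m -> 0 < X ->
  Rabs (sqrt m * RInt (fun v => exp (- (m * (v * v)))) 0 X - sqrt PI / 2) <= sqrt PI / 2 * exp (- (m * (X * X))).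
Proof.
intros Hm HX; pose proof (sqrt_lt_R0 m Hm) as Hs.
pose proof (gauss_limit_bound (RtoC m) (RtoC (sqrt m)) X) as H1.
rewrite <- RtoC_mult, sqrt_sqrt in H1 by lra.
specialize (H1 eq_refl Hs Hm HX).
assert (E : gauss_int (RtoC m) X = RtoC (RInt (fun v => exp (- (m * (v * v)))) 0 X)).
{ unfold gauss_int; apply Ceq_ReIm; unfold CInt.
  - apply RInt_ext; intros v _; unfold gauss; rewrite <- RtoC_mult, <- RtoC_opp, Cexp_RtoC; reflexivity.
  - change (RInt (fun v => Im (gauss (RtoC m) v)) 0 X = 0).
    rewrite (RInt_ext _ (fun _ => 0)).
    + rewrite RInt_const; unfold scal; simpl; unfold mult; simpl; ring.
    + intros v _; unfold gauss; rewrite <- RtoC_mult, <- RtoC_opp, Cexp_RtoC; reflexivity. }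
rewrite E, <- RtoC_mult, <- RtoC_minus, Cmod_R in H1; exact H1.
Qed.

Lemma gauss_real_bound (m X : R) : 0 < m -> 0 < X -> RInt (fun v => exp (- (m * (v * v)))) 0 X <= sqrt PI / sqrt m.
Proof.
intros Hm HX; pose proof (sqrt_lt_R0 m Hm) as Hs; pose proof PI_RGT_0.
pose proof (gauss_real_limit m X Hm HX) as H1; apply Rabs_le_between in H1.
assert (exp (- (m * (X * X))) <= 1) by (rewrite <- exp_0; apply exp_mono; assert (0 <= X * X) by nra; nra).
assert (0 < sqrt PI) by (apply sqrt_lt_R0; lra).
apply Rle_div_r; [exact Hs|].
assert (sqrt PI / 2 * exp (- (m * (X * X))) <= sqrt PI / 2) by nra.
lra.
Qed.

(** The segment from [b] to [a] stays in the half plane [Re <= m]. In contrast to [Cexp_diff_le]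
    there is no factor exponential in [|a - b|], which is unbounded in the application to Laplace's
    method. *)
Lemma Cexp_diff_max (a b : C) m : Re a <= m -> Re b <= m -> Cmod (Cexp a - Cexp b)%C <= Cmod (a - b)%C * exp m.
Proof.
intros Ha Hb.
pose proof (Cmvt (fun t => Cexp (b + RtoC t * (a - b))) (fun t => (a - b) * Cexp (b + RtoC t * (a - b)))%C 0 1
  (Cmod (a - b)%C * exp m) ltac:(lra)) as H; cbv beta in H.
replace (b + RtoC 1 * (a - b))%C with a in H by ring.
replace (b + RtoC 0 * (a - b))%C with b in H by ring.
rewrite Rminus_0_r, (Rmult_1_r (_ * _)) in H; apply H.
- intros t _; apply is_Cderive_Cexp, is_Cderive_line.
- intros t Ht; rewrite Cmod_mult, Cmod_Cexp; apply Rmult_le_compat_l; [apply Cmod_ge_0|].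
  apply exp_mono; rewrite Re_plus, Re_mult, Re_RtoC, Im_RtoC, Re_minus; nra.
Qed.

(** Half of the exponent absorbs the polynomial factors; the linear and cubic ones are those
    produced by the two error terms of [laplace]. *)
Lemma poly_gauss_bound m : 0 < m -> exists K, 0 < K /\ forall w, 0 <= w ->
  w * exp (- (m * (w * w))) <= K * exp (- (m / 2 * (w * w))) /\
  w * w * w * exp (- (m * (w * w))) <= K * exp (- (m / 2 * (w * w))).
Proof.
intros Hm; exists (1 + 16 / (m * m)).
assert (H16 : 0 < 16 / (m * m)) by (apply Rdiv_lt_0_compat; nra).
split; [lra|]; intros w Hw.
replace (- (m * (w * w))) with (- (m / 2 * (w * w)) + - (m / 2 * (w * w))) by field; rewrite exp_plus.
set (e := exp (- (m / 2 * (w * w)))).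
assert (He : 0 < e <= 1).
{ split; [apply exp_pos|]; unfold e; rewrite <- exp_0; apply exp_mono.
  assert (0 <= w * w) by nra; nra. }
assert (Hb : w * e <= 1 + 16 / (m * m) /\ w * w * w * e <= 1 + 16 / (m * m)).
{ destruct (Rle_or_lt w 1) as [H1|H1].
  - assert (w * w * w <= 1) by (assert (w * w <= 1) by nra; nra).
    assert (0 <= w * w * w) by (apply Rmult_le_pos; nra). split; nra.
  - assert (Hww : 1 < w * w) by nra.
    assert (Hv : 0 < m / 2 * (w * w)) by nra.
    assert (HE : e <= 16 / (m * m) / (w * w * w * w)).
    { unfold e; eapply Rle_trans; [apply exp_neg_le_inv_sqr, Hv|]; right; field; split; lra. }
    assert (Hw4 : w * w * w * w * e <= 16 / (m * m)).
    { apply Rmult_le_compat_l with (r := w * w * w * w) in HE; [|repeat apply Rmult_le_pos; lra].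
      eapply Rle_trans; [exact HE|]; right; field; split; lra. }
    assert (w <= w * w * w) by nra.
    assert (w * w * w <= w * w * w * w) by (assert (0 < w * w * w) by (apply Rmult_lt_0_compat; lra); nra).
    split; nra. }
destruct Hb as [Hb1 Hb2]; split.
- rewrite <- Rmult_assoc; apply Rmult_le_compat_r; lra.
- rewrite <- Rmult_assoc; apply Rmult_le_compat_r; lra.
Qed.

Lemma Cdiv_1p_Re (x q : R) : Re (RtoC x / (1, q)%R)%C = x / (1 + q * q).
Proof. unfold Re; simpl; field. nra. Qed.

Lemma Cmod_1p_ge1 (q : R) : 1 <= Cmod (1, q)%R.
Proof. pose proof (Re_le (1, q)%R) as H; exact H. Qed.

Lemma C_1p_neq0 (q : R) : ((1, q)%R : C) <> RtoC 0.
Proof. apply C_neq0_Re; simpl; lra. Qed.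

Lemma CInt_swap f a b : ex_CInt f b a -> CInt f a b = (- CInt f b a)%C.
Proof.
intros [H1 H2]; apply Ceq_ReIm.
- symmetry; exact (opp_RInt_swap (fun x => Re (f x)) b a H1).
- symmetry; exact (opp_RInt_swap (fun x => Im (f x)) b a H2).
Qed.

Lemma saddle_continuous Psi l p t :
  Ccontinuous (fun u => Cexp (- (RtoC (Psi * l * (u * u)) / (1, p + u)%R))%C) t.
Proof.
apply Ccontinuous_Cexp, Ccontinuous_opp, Ccontinuous_mult.
- split; [|apply continuous_const]; simpl.
  apply @ex_derive_continuous; auto_derive; trivial.
- apply (Ccontinuous_inv (fun u => (1, p + u)%R)); [|apply C_1p_neq0].
  apply Ccontinuous_pair; [apply continuous_const|].
  apply @ex_derive_continuous; auto_derive; trivial.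
Qed.

Lemma gauss_sym_int c l d : 0 < l ->
  (RtoC (sqrt l) * CInt (fun u => gauss (c * RtoC l) u) (- d) d)%C = (2 * gauss_int c (sqrt l * d))%C.
Proof.
intros Hl; pose proof (sqrt_sqrt l ltac:(lra)) as Hs.
rewrite <- CInt_scal by (apply ex_CInt_continuous; intros; apply gauss_continuous).
rewrite (CInt_ext _ (fun u => RtoC (sqrt l) * gauss c (sqrt l * u + 0)%R)%C).
2:{ intros u; f_equal; unfold gauss; f_equal; rewrite Rplus_0_r.
    replace (sqrt l * u * (sqrt l * u)) with (sqrt l * sqrt l * (u * u)) by ring.
    rewrite Hs, !RtoC_mult; ring. }
rewrite (CInt_comp_lin (gauss c)) by apply gauss_continuous.
rewrite !Rplus_0_r; set (X := sqrt l * d); replace (sqrt l * - d) with (- X) by (unfold X; ring).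
assert (Hex : forall a b, ex_CInt (gauss c) a b) by (intros; apply ex_CInt_continuous; intros; apply gauss_continuous).
rewrite <- (CInt_Chasles (gauss c) (- X) 0 X) by apply Hex.
unfold gauss_int; replace (CInt (gauss c) (- X) 0) with (CInt (gauss c) 0 X); [ring|].
rewrite (CInt_swap _ (- X) 0) by apply Hex.
pose proof (CInt_comp_lin (gauss c) (-1) 0 0 X (gauss_continuous c)) as H.
replace (-1 * 0 + 0) with 0 in H by ring; replace (-1 * X + 0) with (- X) in H by ring.
rewrite <- H, (CInt_ext (fun y => RtoC (-1) * gauss c (-1 * y + 0)%R)%C (fun y => RtoC (-1) * gauss c y)%C).
- rewrite CInt_scal by apply Hex; replace (RtoC (-1)) with (- RtoC 1)%C by (rewrite <- RtoC_opp; f_equal; ring); ring.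
- intros y; f_equal; unfold gauss; replace ((-1 * y + 0) * (-1 * y + 0)) with (y * y) by ring; reflexivity.
Qed.

(** An error [K |u|] is admissible because the Gaussian has width of order [1 / sqrt l]. The
    denominator [1 + i (p + u)] is frozen at [u = 0], leaving a Gaussian with coefficient
    [ka^2 = Psi / (1 + i p)]; the condition [0 < Re ka] selects the root. *)
Lemma laplace (p Psi : R) (ka A : C) (K d : R) (f : R -> R -> C) :
  0 < Psi -> 0 < Re ka -> (ka * ka * (1, p)%R)%C = RtoC Psi -> 0 <= K -> 0 < d <= 1 ->
  (forall l u, 0 < l -> Ccontinuous (f l) u) ->
  (forall eps, 0 < eps -> exists l0, forall l, l0 < l -> forall u, Rabs u <= d ->
     Cmod (f l u - A)%C <= eps + K * Rabs u) ->
  forall eps, 0 < eps -> exists l0, 0 < l0 /\ forall l, l0 < l ->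
   Cmod (RtoC (sqrt l) * CInt (fun u => f l u * Cexp (- (RtoC (Psi * l * (u * u)) / (1, p + u)%R)))%C (- d) d
     - A * RtoC (sqrt PI) / ka)%C <= eps.
Proof.
intros HPsi Hka Hka2 HK Hd Hfc Hf eps Heps.
pose proof PI_RGT_0 as Hpi; assert (HsPI : 0 < sqrt PI) by (apply sqrt_lt_R0; lra).
(* A lower bound for [Re (1 / (1 + i (p + u)))] on the window, since [|p + u| <= |p| + 1]; hence a
   common Gaussian majorant with parameter [m]. *)
set (mu := / (1 + (Rabs p + 1) * (Rabs p + 1))).
assert (Hmu : 0 < mu) by (apply Rinv_0_lt_compat; pose proof (Rabs_pos p); nra).
set (m := Psi * mu).
assert (Hm : 0 < m) by (apply Rmult_lt_0_compat; assumption).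
assert (Hmq : forall u, Rabs u <= d -> mu <= / (1 + (p + u) * (p + u))).
{ intros u Hu; apply Rinv_le_contravar; [apply one_plus_sqr_pos|].
  assert (Rabs (p + u) <= Rabs p + 1) by (eapply Rle_trans; [apply Rabs_triang|lra]).
  pose proof (Rabs_pos (p + u)); pose proof (Rsqr_abs (p + u)) as Hsq; unfold Rsqr in Hsq; rewrite Hsq; nra. }
set (c := (ka * ka)%C).
assert (Hc : c = (RtoC Psi / (1, p)%R)%C) by (unfold c; rewrite <- Hka2; field; apply C_1p_neq0).
assert (Hcre : 0 < Re c).
{ rewrite Hc, Cdiv_1p_Re; apply Rdiv_lt_0_compat; [exact HPsi|nra]. }
destruct (poly_gauss_bound m Hm) as (Kg & HKg & Hpg).
set (G := 2 * (sqrt PI / sqrt (m / 2))).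
assert (HG : 0 < G).
{ unfold G; apply Rmult_lt_0_compat; [lra|apply Rdiv_lt_0_compat; [exact HsPI|apply sqrt_lt_R0; lra]]. }
assert (Hka0 : 0 < Cmod ka) by (pose proof (Re_le ka); lra).
set (eps1 := eps / (3 * G)).
assert (Heps1 : 0 < eps1) by (apply Rdiv_lt_0_compat; lra).
destruct (Hf eps1 Heps1) as (l1 & Hl1).
(* [sqrt l >= L2] brings the errors of first and third order in [u] below [eps / 3]; [l >= L3] does
   the same for cutting the Gaussian off at [d]. *)
set (L2 := 3 * Kg * (K + Cmod A * Psi) * G / eps).
set (L3 := 3 * Cmod A * sqrt PI / Cmod ka / (Re c * (d * d)) / eps).
pose proof (Cmod_ge_0 A) as HA.
assert (HAP : 0 <= Cmod A * Psi) by (apply Rmult_le_pos; lra).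
assert (HKA : 0 <= Kg * (K + Cmod A * Psi)) by (apply Rmult_le_pos; lra).
assert (HL2 : 0 <= L2).
{ unfold L2; apply Rmult_le_pos; [|left; apply Rinv_0_lt_compat; lra].
  apply Rmult_le_pos; [apply Rmult_le_pos; nra|lra]. }
assert (Hcd : 0 < Re c * (d * d)) by (apply Rmult_lt_0_compat; nra).
assert (HL3 : 0 <= L3).
{ unfold L3, Rdiv; repeat apply Rmult_le_pos; try lra; left; apply Rinv_0_lt_compat; lra. }
exists (Rmax 1 (Rmax l1 (Rmax (L2 * L2) L3))).
split; [eapply Rlt_le_trans; [apply Rlt_0_1|apply Rmax_l]|].
intros l Hl.
assert (Hl_1 : 1 < l) by (eapply Rle_lt_trans; [apply Rmax_l|exact Hl]).
assert (Hl' : Rmax l1 (Rmax (L2 * L2) L3) < l) by (eapply Rle_lt_trans; [apply Rmax_r|exact Hl]).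
assert (Hll1 : l1 < l) by (eapply Rle_lt_trans; [apply Rmax_l|exact Hl']).
assert (Hl'' : Rmax (L2 * L2) L3 < l) by (eapply Rle_lt_trans; [apply Rmax_r|exact Hl']).
assert (Hll2 : L2 * L2 < l) by (eapply Rle_lt_trans; [apply Rmax_l|exact Hl'']).
assert (Hll3 : L3 < l) by (eapply Rle_lt_trans; [apply Rmax_r|exact Hl'']).
specialize (Hl1 l Hll1).
set (w := sqrt l); assert (Hww : w * w = l) by (apply sqrt_sqrt; lra).
assert (Hw0 : 0 < w) by (apply sqrt_lt_R0; lra).
assert (HwL2 : L2 <= w).
{ apply Rnot_lt_le; intros H; assert (w * w <= L2 * L2) by (apply Rmult_le_compat; lra); lra. }
set (g := fun u => Cexp (- (RtoC (Psi * l * (u * u)) / (1, p + u)%R))%C).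
set (g0 := gauss (c * RtoC l)).
assert (Hgc : forall u, Ccontinuous g u) by (intros; apply saddle_continuous).
assert (Hg0c : forall u, Ccontinuous g0 u) by (intros; apply gauss_continuous).
assert (Hfg : forall u, Ccontinuous (fun u => f l u * g u)%C u).
{ intros u; apply (Ccontinuous_mult (f l) g); [apply Hfc; lra|apply Hgc]. }
assert (HAg : forall u, Ccontinuous (fun u => A * g0 u)%C u).
{ intros u; apply (Ccontinuous_mult (fun _ => A) g0); [apply Ccontinuous_const|apply Hg0c]. }
set (main := (RtoC w * CInt (fun u => A * g0 u)%C (- d) d)%C).
assert (Hmain : main = (A * (2 * gauss_int c (w * d)))%C).
{ unfold main; rewrite (CInt_scal A g0) by (apply ex_CInt_continuous, Hg0c).
  pose proof (gauss_sym_int c l d ltac:(lra)) as E; fold w g0 in E; change (fun u => g0 u) with g0 in E; rewrite <- E; ring. }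
assert (Herr1 : Cmod (main - A * RtoC (sqrt PI) / ka)%C <= eps / 3).
{ assert (Hwd : 0 < w * d) by (apply Rmult_lt_0_compat; lra).
  pose proof (gauss_limit_bound c ka (w * d) eq_refl Hka Hcre Hwd) as Hb.
  rewrite Hmain.
  assert (Hkac : ka <> 0%C) by (apply Cmod_gt_0; exact Hka0).
  replace (A * (2 * gauss_int c (w * d)) - A * RtoC (sqrt PI) / ka)%C
    with (A * 2 / ka * (ka * gauss_int c (w * d) - RtoC (sqrt PI / 2)))%C.
  2:{ rewrite (RtoC_div (sqrt PI) 2) by lra; field; repeat split; try exact Hkac; apply RtoC_neq0; lra. }
  rewrite Cmod_mult, Cmod_div, Cmod_mult by exact Hkac.
  rewrite (Cmod_RtoC_pos 2) by lra.
  assert (Hex : exp (- (Re c * (w * d * (w * d)))) <= / (Re c * (d * d) * l)).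
  { rewrite exp_Ropp; apply Rinv_le_contravar; [apply Rmult_lt_0_compat; lra|].
    replace (Re c * (w * d * (w * d))) with (Re c * (d * d) * l) by (rewrite <- Hww; ring).
    pose proof (exp_ineq1_le (Re c * (d * d) * l)); lra. }
  apply Rle_trans with (Cmod A * 2 / Cmod ka * (sqrt PI / 2 * / (Re c * (d * d) * l))).
  - apply Rmult_le_compat_l; [apply Rmult_le_pos; [lra|left; apply Rinv_0_lt_compat; lra]|].
    eapply Rle_trans; [exact Hb|]; apply Rmult_le_compat_l; lra.
  - replace (Cmod A * 2 / Cmod ka * (sqrt PI / 2 * / (Re c * (d * d) * l)))
      with (L3 * (eps / 3) / l) by (unfold L3; field; repeat split; lra).
    apply Rle_div_l; [lra|]; rewrite (Rmult_comm (eps / 3)); apply Rmult_le_compat_r; lra. }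
set (h := fun u => (f l u * g u - A * g0 u)%C).
assert (Hh : Cmod (RtoC w * CInt h (- d) d)%C <= 2 * eps / 3).
{ rewrite Cmod_mult, Cmod_RtoC_pos by lra.
  set (C0 := eps1 + Kg * (K + Cmod A * Psi) / w).
  assert (HC0 : 0 <= C0).
  { unfold C0; apply Rplus_le_le_0_compat; [lra|apply Rmult_le_pos; [exact HKA|left; apply Rinv_0_lt_compat; lra]]. }
  set (env := fun u => exp (- (m / 2 * l * (u * u)))).
  assert (Henv : forall a b, ex_RInt env a b).
  { intros a b; apply @ex_RInt_continuous; intros u _; apply @ex_derive_continuous; unfold env; auto_derive; trivial. }
  assert (HhB : Cmod (CInt h (- d) d) <= RInt (fun u => C0 * env u) (- d) d).
  { apply Cmod_CInt_le; [lra| |exact (ex_RInt_scal env (- d) d C0 (Henv _ _))|].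
    - apply ex_CInt_continuous; intros u; apply (Ccontinuous_minus (fun u => f l u * g u)%C (fun u => A * g0 u)%C); [apply Hfg|apply HAg].
    - intros u Hu; assert (Hu' : Rabs u <= d) by (apply Rabs_le; lra).
      set (v := w * Rabs u).
      assert (Hv0 : 0 <= v) by (apply Rmult_le_pos; [lra|apply Rabs_pos]).
      assert (Hvv : v * v = l * (u * u)).
      { unfold v; replace (w * Rabs u * (w * Rabs u)) with (w * w * (Rabs u * Rabs u)) by ring.
        rewrite Hww; pose proof (Rsqr_abs u) as Hsq; unfold Rsqr in Hsq; rewrite <- Hsq; ring. }
      destruct (Hpg v Hv0) as [Hp1 Hp2].
      assert (Een : exp (- (m / 2 * (v * v))) = env u) by (unfold env; rewrite Hvv; f_equal; ring).
      rewrite Een in Hp1, Hp2.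
      set (em := exp (- (m * (v * v)))) in *.
      assert (Hlu : 0 <= Psi * l * (u * u)) by (apply Rmult_le_pos; nra).
      assert (Hre1 : Re (- (RtoC (Psi * l * (u * u)) / (1, p + u)%R))%C <= - (m * (v * v))).
      { rewrite Re_opp, Cdiv_1p_Re, Hvv. unfold m, Rdiv.
        pose proof (Hmq u Hu'); nra. }
      assert (Hre2 : Re (- (RtoC (Psi * l * (u * u)) / (1, p)%R))%C <= - (m * (v * v))).
      { rewrite Re_opp, Cdiv_1p_Re, Hvv. unfold m, Rdiv.
        pose proof (Hmq 0 ltac:(rewrite Rabs_R0; lra)) as H0; rewrite Rplus_0_r in H0; nra. }
      assert (Eg0 : g0 u = Cexp (- (RtoC (Psi * l * (u * u)) / (1, p)%R))).
      { unfold g0, gauss; f_equal; rewrite Hc, !RtoC_mult; field; apply C_1p_neq0. }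
      assert (Hg1 : Cmod (g u) <= em).
      { unfold g; rewrite Cmod_Cexp; apply exp_mono; exact Hre1. }
      assert (Hgg : Cmod (g u - g0 u)%C <= Psi * (l * (u * u)) * Rabs u * em).
      { rewrite Eg0; unfold g; eapply Rle_trans; [apply Cexp_diff_max; [exact Hre1|exact Hre2]|].
        apply Rmult_le_compat_r; [left; apply exp_pos|].
        replace (- (RtoC (Psi * l * (u * u)) / (1, p + u)%R) - - (RtoC (Psi * l * (u * u)) / (1, p)%R))%C
         with (RtoC (Psi * l * (u * u)) * ((0, u)%R / ((1, p)%R * (1, p + u)%R)))%C.
        - rewrite Cmod_mult, Cmod_RtoC_pos by exact Hlu.
          replace (Psi * (l * (u * u)) * Rabs u) with (Psi * l * (u * u) * Rabs u) by ring.
          apply Rmult_le_compat_l; [exact Hlu|].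
          replace (Rabs u) with (Rabs u / 1) by field.
          apply Cmod_div_le; [|lra|].
          + eapply Rle_trans; [apply Cmod_le_ReIm|]; simpl; rewrite Rabs_R0; lra.
          + rewrite Cmod_mult; pose proof (Cmod_1p_ge1 p); pose proof (Cmod_1p_ge1 (p + u)); nra.
        - replace ((0, u)%R : C) with ((1, p + u)%R - (1, p)%R)%C by (apply Ceq_ReIm; unfold Re, Im; simpl; ring).
          field; split; apply C_1p_neq0. }
      unfold h; replace (f l u * g u - A * g0 u)%C with ((f l u - A) * g u + A * (g u - g0 u))%C by ring.
      eapply Rle_trans; [apply Cmod_plus_le; apply Cmod_mult_le; [apply Hl1, Hu'|exact Hg1|apply Rle_refl|exact Hgg]|].
      assert (Eu : Rabs u = v / w) by (unfold v; field; lra).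
      rewrite Eu, <- Hvv.
      assert (Hem : em <= env u).
      { unfold em; rewrite <- Een; apply exp_mono; assert (0 <= v * v) by nra; nra. }
      replace ((eps1 + K * (v / w)) * em + Cmod A * (Psi * (v * v) * (v / w) * em))
        with (eps1 * em + K / w * (v * em) + Cmod A * Psi / w * (v * v * v * em)) by (field; lra).
      replace (C0 * env u) with (eps1 * env u + K / w * (Kg * env u) + Cmod A * Psi / w * (Kg * env u))
        by (unfold C0; field; lra).
      apply Rplus_le_compat; [apply Rplus_le_compat|]; apply Rmult_le_compat_l; try assumption; try lra.
      + apply Rmult_le_pos; [lra|left; apply Rinv_0_lt_compat; lra].
      + apply Rmult_le_pos; [exact HAP|left; apply Rinv_0_lt_compat; lra]. }
  rewrite RInt_Rscal in HhB by apply Henv.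
  assert (HenvI : w * RInt env (- d) d <= G).
  { assert (Hex : ex_RInt (fun v => exp (- (m / 2 * (v * v)))) (w * - d + 0) (w * d + 0)).
    { apply @ex_RInt_continuous; intros u _; apply @ex_derive_continuous; auto_derive; trivial. }
    pose proof (RInt_comp_lin (fun v => exp (- (m / 2 * (v * v)))) w 0 (- d) d Hex) as E.
    rewrite <- RInt_Rscal by apply Henv.
    replace (RInt (fun x => w * env x) (- d) d) with (RInt (fun v => exp (- (m / 2 * (v * v)))) (w * - d + 0) (w * d + 0)).
    2:{ rewrite <- E; apply RInt_ext; intros u _; unfold env, scal; simpl; unfold mult; simpl.
        f_equal; f_equal; rewrite <- Hww; ring. }
    rewrite !Rplus_0_r; set (X := w * d); replace (w * - d) with (- X) by (unfold X; ring).
    assert (HX : 0 < X) by (apply Rmult_lt_0_compat; lra).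
    assert (Hex2 : forall a b, ex_RInt (fun v => exp (- (m / 2 * (v * v)))) a b).
    { intros a b; apply @ex_RInt_continuous; intros u _; apply @ex_derive_continuous; auto_derive; trivial. }
    rewrite <- (RInt_Chasles (fun v => exp (- (m / 2 * (v * v)))) (- X) 0 X) by apply Hex2.
    pose proof (gauss_real_bound (m / 2) X ltac:(lra) HX) as Hb.
    assert (Esym : RInt (fun v => exp (- (m / 2 * (v * v)))) (- X) 0 = RInt (fun v => exp (- (m / 2 * (v * v)))) 0 X).
    { pose proof (RInt_comp_lin (fun v => exp (- (m / 2 * (v * v)))) (-1) 0 X 0 (Hex2 _ _)) as E2.
      replace (-1 * X + 0) with (- X) in E2 by ring; replace (-1 * 0 + 0) with 0 in E2 by ring.
      rewrite <- E2, <- (opp_RInt_swap _ X 0) by apply Hex2.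
      rewrite <- (RInt_opp (fun v => exp (- (m / 2 * (v * v))))) by apply Hex2.
      apply RInt_ext; intros u _; unfold scal, opp; simpl; unfold mult; simpl.
      replace ((-1 * u + 0) * (-1 * u + 0)) with (u * u) by ring; ring. }
    unfold plus; simpl; rewrite Esym; unfold G; lra. }
  apply Rle_trans with (C0 * (w * RInt env (- d) d)).
  { replace (C0 * (w * RInt env (- d) d)) with (w * (C0 * RInt env (- d) d)) by ring.
    apply Rmult_le_compat_l; lra. }
  apply Rle_trans with (C0 * G); [apply Rmult_le_compat_l; assumption|].
  unfold C0; rewrite Rmult_plus_distr_r.
  assert (E1 : eps1 * G = eps / 3) by (unfold eps1; field; lra).
  assert (E2 : Kg * (K + Cmod A * Psi) / w * G <= eps / 3); [|lra].
  replace (Kg * (K + Cmod A * Psi) / w * G) with (L2 * (eps / 3) / w) by (unfold L2; field; split; lra).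
  apply Rle_div_l; [lra|]; rewrite (Rmult_comm (eps / 3)); apply Rmult_le_compat_r; lra. }
match goal with |- Cmod ?X <= _ => replace X with (RtoC w * CInt h (- d) d + (main - A * RtoC (sqrt PI) / ka))%C end.
- eapply Rle_trans; [apply Cmod_plus_le; [exact Hh|exact Herr1]|lra].
- unfold h; rewrite (CInt_minus (fun u => f l u * g u)%C (fun u => A * g0 u)%C).
  + unfold main; fold w; unfold g; ring.
  + apply ex_CInt_continuous, Hfg.
  + apply ex_CInt_continuous, HAg.
Qed.

(** * Saddle points and the contributions of the arcs *)

Lemma Re_div_1p (W : C) q : Re (W / (1, q)%R)%C = (Re W + q * Im W) / (1 + q * q).
Proof. destruct W as [a b]; unfold Re, Im; simpl; field; nra. Qed.

(** After clearing denominators this is a quadratic in [q] with discriminant 0, so it reduces to a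
    square. The right side is the square of the real part of a square root of [W], which explains
    why [Psi] governs the growth. *)
Lemma Re_div_1p_le (W : C) q : Re (W / (1, q)%R)%C <= (Cmod W + Re W) / 2.
Proof.
rewrite Re_div_1p; pose proof (one_plus_sqr_pos q).
apply Rle_div_l; [assumption|].
pose proof (Cmod_sqr W) as Hs; pose proof (Re_le_Cmod W) as Hr; apply Rabs_le_between in Hr.
set (m := Cmod W) in *; set (a := Re W) in *; set (b := Im W) in *.
assert (Hmain : 0 <= (m - a) - 2 * q * b + (m + a) * (q * q)); [|lra].
destruct (Req_dec (m + a) 0) as [E|E].
- assert (b * b = 0) by nra. assert (b = 0) by nra. subst b; nra.
- apply Rmult_le_reg_l with (m + a); [lra|].
  rewrite Rmult_0_r; replace ((m + a) * (m - a - 2 * q * b + (m + a) * (q * q)))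
   with ((m * m - a * a) - 2 * (m + a) * q * b + (m + a) * q * ((m + a) * q)) by ring.
  replace (m * m - a * a) with (b * b) by lra.
  pose proof (Rle_0_sqr (b - (m + a) * q)) as Hq; unfold Rsqr in Hq; lra.
Qed.

(* [Psi_k^2] in terms of the weight of the arcs of denominator [k]. *)
Definition arc_height (z : C) (k : nat) : R := (Cmod (arc_weight z k) + Re (arc_weight z k)) / 2.

(** The loss [c] in the exponent has three sources: the gap [c1] to other denominators, the gap
    [Re sg ^ 2] to points near no root of unity, and the loss at distance [eta d] from the saddle on
    an arc of denominator [k0] itself. Half of each is kept against the error of [arcs_cover]. *)
Lemma genfun_far z k0 (sg : C) c1 d : Cmod z <= 1 -> (0 < k0)%nat -> (sg * sg)%C = arc_weight z k0 -> 0 < Re sg ->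
  0 < c1 -> (forall k, (0 < k)%nat -> k <> k0 -> arc_height z k <= Re sg ^ 2 - c1) -> 0 < d ->
  exists c e0, 0 < c /\ 0 < e0 /\ forall eta h0 x, 0 < eta < e0 -> Rabs (x - 2 * PI * (IZR h0 / INR k0)) <= PI / INR k0 ->
    (Z.gcd h0 (Z.of_nat k0) <> 1%Z \/ eta * d <= Rabs (x - (2 * PI * (IZR h0 / INR k0) - eta * (Im sg / Re sg)))) ->
    Cmod (genfun z (circ eta x)) <= exp ((Re sg ^ 2 - c) / eta).
Proof.
intros Hz Hk0 Hsg HPsi Hc1 Hdom Hd.
set (Psi := Re sg) in *; set (p := Im sg / Psi).
(* A lower bound for [u^2 / (1 + (p + u)^2)] over [|u| >= d], from [(p + u)^2 <= 2 p^2 + 2 u^2]. *)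
set (kd := d * d / (1 + 2 * (p * p) + 2 * (d * d))).
assert (Hden : 0 < 1 + 2 * (p * p) + 2 * (d * d)) by nra.
assert (Hkd : 0 < kd) by (apply Rdiv_lt_0_compat; nra).
assert (HP2 : 0 < Psi ^ 2) by (apply pow_lt; exact HPsi).
set (c := Rmin (c1 / 2) (Rmin (Psi ^ 2 / 2) (Psi ^ 2 * kd / 2))).
assert (Hc : 0 < c) by (repeat apply Rmin_glb_lt; try lra; assert (0 < Psi ^ 2 * kd) by (apply Rmult_lt_0_compat; assumption); lra).
assert (HcA : c <= c1 / 2) by apply Rmin_l.
assert (HcB : c <= Psi ^ 2 / 2) by (eapply Rle_trans; [apply Rmin_r|apply Rmin_l]).
assert (HcC : c <= Psi ^ 2 * kd / 2) by (eapply Rle_trans; [apply Rmin_r|apply Rmin_r]).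
destruct (arcs_cover c Hc) as (Nr & M & e0 & HM & He0 & Hcov).
assert (HIk0 : 0 < INR k0) by (apply lt_0_INR; lia).
pose proof PI_RGT_0 as Hpi.
assert (HpiM : 0 < PI / INR k0 / (M + 1)) by (apply Rdiv_lt_0_compat; [apply Rdiv_lt_0_compat|]; lra).
exists c, (Rmin e0 (PI / INR k0 / (M + 1))); split; [exact Hc|split; [apply Rmin_glb_lt; assumption|]].
intros eta h0 x Heta Hx Halt.
assert (Hee : eta < e0) by (eapply Rlt_le_trans; [apply Heta|apply Rmin_l]).
assert (HeM : eta < PI / INR k0 / (M + 1)) by (eapply Rlt_le_trans; [apply Heta|apply Rmin_r]).
unfold genfun; rewrite Cmod_Cexp; apply exp_mono; apply Rle_div_r; [lra|].
rewrite Rmult_comm.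
set (L := loggen_tail z 0 (circ eta x)).
destruct (Hcov z eta x Hz (conj (proj1 Heta) Hee)) as [H|(k & h & t & Hk & Hg & Ht & Hti & Hxt & H)]; fold L in H.
- assert (eta * Re L <= eta * Cmod L) by (apply Rmult_le_compat_l; [lra|apply Re_le]); lra.
- set (q := Im t / eta).
  assert (Hteq : t = (RtoC eta * (1, q)%R)%C).
  { destruct t as [t1 t2]; unfold Re in Ht; simpl in Ht; subst t1; unfold q, Im; apply Ceq_ReIm; unfold Re, Im; simpl; field; lra. }
  set (W := arc_weight z k) in *.
  assert (HL : eta * Re L <= c + Re (W / (1, q)%R)%C).
  { replace (Re (W / (1, q)%R)%C) with (eta * Re (W / t)%C).
    - assert (E : Re L = Re (L - W / t)%C + Re (W / t)%C) by (rewrite Re_minus; ring).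
      rewrite E, Rmult_plus_distr_l; apply Rplus_le_compat_r.
      eapply Rle_trans; [|exact H]; apply Rmult_le_compat_l; [lra|apply Re_le].
    - rewrite Hteq; replace (W / (1, q)%R)%C with (RtoC eta * (W / (RtoC eta * (1, q)%R)))%C.
      + rewrite (Re_mult (RtoC eta)), Re_RtoC, Im_RtoC; ring.
      + field; split; [apply C_1p_neq0|apply RtoC_neq0; lra]. }
  destruct (Nat.eq_dec k k0) as [->|Hkk].
  (* Both [2 PI h / k0] and [2 PI h0 / k0] are close to [x], and [eta] is small enough that their
     distance is below the spacing [2 PI / k0]. *)
  + assert (Hh : h = h0).
    { assert (Hm : M * eta < PI / INR k0).
      { apply Rlt_div_r in HeM; [|lra]. nra. }
      assert (Habs : Rabs (2 * PI * (IZR h / INR k0) - 2 * PI * (IZR h0 / INR k0)) < 2 * PI / INR k0).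
      { replace (2 * PI * (IZR h / INR k0) - 2 * PI * (IZR h0 / INR k0)) with ((x - 2 * PI * (IZR h0 / INR k0)) + Im t) by (rewrite Hxt; ring).
        eapply Rle_lt_trans; [apply Rabs_triang|]. unfold Rdiv in *; lra. }
      replace (2 * PI * (IZR h / INR k0) - 2 * PI * (IZR h0 / INR k0)) with (2 * PI / INR k0 * IZR (h - h0)) in Habs
        by (rewrite minus_IZR; field; lra).
      assert (H2 : 0 < 2 * PI / INR k0) by (apply Rdiv_lt_0_compat; lra).
      rewrite Rabs_mult, (Rabs_pos_eq (2 * PI / INR k0)) in Habs by lra.
      assert (Rabs (IZR (h - h0)) < 1) by nra.
      rewrite <- abs_IZR in *; apply lt_IZR in H0; lia. }
    subst h; destruct Halt as [Hn|Hfar]; [exfalso; exact (Hn Hg)|].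
    set (u := q - p).
    assert (Hu : d <= Rabs u).
    { apply Rmult_le_reg_l with eta; [lra|]; eapply Rle_trans; [exact Hfar|]; right.
      replace (x - (2 * PI * (IZR h0 / INR k0) - eta * p)) with (- (eta * u)) by (rewrite Hxt; unfold u, q; field; lra).
      rewrite Rabs_Ropp, Rabs_mult, (Rabs_pos_eq eta); lra. }
    (* With [sg = Psi (1 + i p)] the loss relative to the maximum [Psi ^ 2] is explicit and vanishes
       only at [q = p]. *)
    assert (HW : Re (W / (1, q)%R)%C = Psi ^ 2 - Psi ^ 2 * (u * u / (1 + q * q))).
    { rewrite Re_div_1p; unfold W; rewrite <- Hsg, Re_mult, Im_mult; fold Psi.
      replace (Im sg) with (Psi * p) by (unfold p; field; lra); unfold u; field; nra. }
    assert (Huu : d * d <= u * u).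
    { pose proof (Rsqr_abs u) as Hs; unfold Rsqr in Hs; rewrite Hs; apply Rmult_le_compat; lra. }
    assert (Hq : kd <= u * u / (1 + q * q)).
    { pose proof (one_plus_sqr_pos q); apply (proj1 (Rle_div_r kd (u * u) (1 + q * q) ltac:(lra))); unfold kd.
      replace q with (p + u) by (unfold u; ring).
      apply Rmult_le_reg_r with (1 + 2 * (p * p) + 2 * (d * d)); [exact Hden|].
      replace (d * d / (1 + 2 * (p * p) + 2 * (d * d)) * (1 + (p + u) * (p + u)) * (1 + 2 * (p * p) + 2 * (d * d)))
        with (d * d * (1 + (p + u) * (p + u))) by (field; lra).
      assert ((p + u) * (p + u) <= 2 * (p * p) + 2 * (u * u)) by (pose proof (Rle_0_sqr (p - u)) as Hpu; unfold Rsqr in Hpu; lra).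
      assert (0 <= d * d) by nra. assert (0 <= p * p) by nra. nra. }
    assert (Psi ^ 2 * kd <= Psi ^ 2 * (u * u / (1 + q * q))) by (apply Rmult_le_compat_l; lra).
    lra.
  + pose proof (Re_div_1p_le W q) as H1; pose proof (Hdom k (proj1 Hk) Hkk) as H2; unfold arc_height in H2; fold W in H2; lra.
Qed.

Definition arc_integrand (z : C) (eta : R) (n : nat) (x : R) : C :=
  (genfun z (circ eta x) * circ_negpow (Z.of_nat n) eta x)%C.

Definition arc_integral (z : C) (eta : R) (n k : nat) (h : Z) : C :=
  CInt (arc_integrand z eta n) (2 * PI * (IZR h / INR k) - PI / INR k) (2 * PI * (IZR h / INR k) + PI / INR k).

(* The reciprocal of the order of magnitude of the arc integrals, with [l = sqrt n];
   the saddle point has real part [Re sg / l]. *)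
Definition normalizer (sg : C) (ka l : R) : C :=
  (Cexp (- (2 * sg * RtoC l)) * RtoC (Rpower (Re sg / l) ka * (sqrt l * (l / Re sg))))%C.

Lemma arc_integrand_continuous z eta n x : Cmod z <= 1 -> 0 < eta -> Ccontinuous (arc_integrand z eta n) x.
Proof.
intros; apply (Ccontinuous_mult (fun x => genfun z (circ eta x)) (circ_negpow (Z.of_nat n) eta));
[apply genfun_circ_continuous; assumption|apply circ_negpow_continuous].
Qed.

Lemma exp_neg_le_inv_cube v : 0 < v -> exp (- v) <= 27 / v ^ 3.
Proof.
intros Hv; rewrite exp_Ropp.
assert (H : v ^ 3 / 27 <= exp v).
{ replace v with (v / 3 + (v / 3 + v / 3)) at 2 by field; rewrite !exp_plus.
  pose proof (exp_ineq1_le (v / 3)).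
  replace (v ^ 3 / 27) with (v / 3 * (v / 3 * (v / 3))) by field.
  assert (v / 3 <= exp (v / 3)) by lra. assert (0 < v / 3) by lra.
  apply Rmult_le_compat; try nra. }
replace (27 / v ^ 3) with (/ (v ^ 3 / 27)) by (field; lra).
apply Rinv_le_contravar; [|exact H]; apply Rdiv_lt_0_compat; [apply pow_lt|]; lra.
Qed.

Lemma Rpower_le_1 a k : 0 < a <= 1 -> 0 <= k -> 0 < Rpower a k <= 1.
Proof.
intros Ha Hk; split; [apply exp_pos|]; unfold Rpower; rewrite <- exp_0; apply exp_mono.
assert (ln a <= 0) by (rewrite <- ln_1; apply ln_le; lra). nra.
Qed.

(** Since [n eta = Re sg * sqrt n], the exponents combine to [- c sqrt n / Re sg]. A cubic bound on
    the exponential beats the factor of order [l^2] from the normalizer and leaves [1 / l]. *)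
Lemma far_negligible z (sg : C) ka c len eps : Cmod z <= 1 -> 0 < Re sg -> 0 <= ka -> 0 < c -> 0 < len -> 0 < eps ->
  exists l0, 0 < l0 /\ forall n a b, l0 < sqrt (INR n) -> a <= b -> b - a <= len ->
  (forall x, a <= x <= b -> Cmod (genfun z (circ (Re sg / sqrt (INR n)) x)) <= exp ((Re sg ^ 2 - c) / (Re sg / sqrt (INR n)))) ->
  Cmod (CInt (arc_integrand z (Re sg / sqrt (INR n)) n) a b * normalizer sg ka (sqrt (INR n)))%C <= eps.
Proof.
intros Hz HPsi Hka Hc Hlen Heps.
set (Psi := Re sg) in *.
set (L := len * 27 * Psi ^ 2 / c ^ 3 / eps).
exists (Rmax 1 (Rmax Psi L)); split; [eapply Rlt_le_trans; [apply Rlt_0_1|apply Rmax_l]|].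
intros n a b Hl Hab Hba HF.
set (l := sqrt (INR n)) in *.
assert (Hl1 : 1 < l) by (eapply Rle_lt_trans; [apply Rmax_l|exact Hl]).
assert (Hl' : Rmax Psi L < l) by (eapply Rle_lt_trans; [apply Rmax_r|exact Hl]).
assert (HlP : Psi < l) by (eapply Rle_lt_trans; [apply Rmax_l|exact Hl']).
assert (HlL : L < l) by (eapply Rle_lt_trans; [apply Rmax_r|exact Hl']).
assert (Hll : l * l = INR n) by (apply sqrt_sqrt, pos_INR).
set (eta := Psi / l) in *.
assert (Heta : 0 < eta <= 1) by (unfold eta; split; [apply Rdiv_lt_0_compat; lra|apply Rle_div_l; lra]).
assert (HI : Cmod (CInt (arc_integrand z eta n) a b) <= len * (exp ((Psi ^ 2 - c) / eta) * exp (INR n * eta))).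
{ apply Rle_trans with ((b - a) * (exp ((Psi ^ 2 - c) / eta) * exp (INR n * eta))).
  - apply Cmod_CInt_le_const; [exact Hab|apply ex_CInt_continuous; intros; apply arc_integrand_continuous; lra|].
    intros x Hx; apply Cmod_mult_le; [apply HF, Hx|].
    unfold circ_negpow; rewrite Cmod_Cexp, <- INR_IZR_INZ; apply Rle_refl.
  - apply Rmult_le_compat_r; [|exact Hba]; apply Rmult_le_pos; left; apply exp_pos. }
rewrite <- exp_plus in HI.
rewrite Cmod_mult; unfold normalizer; fold Psi; rewrite Cmod_mult, Cmod_Cexp.
assert (HR : Re (- (2 * sg * RtoC l))%C = - (2 * Psi * l)).
{ unfold Psi; rewrite Re_opp, !Re_mult, Im_mult, !Re_RtoC, !Im_RtoC; ring. }
rewrite HR.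
assert (Hsl : 0 < sqrt l <= l).
{ split; [apply sqrt_lt_R0; lra|]. rewrite <- (sqrt_Rsqr l) at 2 by lra; apply sqrt_le_1_alt; unfold Rsqr; nra. }
pose proof (Rpower_le_1 eta ka Heta Hka) as Hrp.
assert (Hlp : 0 < l / Psi) by (apply Rdiv_lt_0_compat; lra).
assert (Hsq : 0 < sqrt l * (l / Psi) <= l * (l / Psi)) by (split; [apply Rmult_lt_0_compat; lra|apply Rmult_le_compat_r; lra]).
fold eta; rewrite Cmod_RtoC_pos by (apply Rmult_le_pos; lra).
apply Rle_trans with (len * exp (- (c * l / Psi)) * (l * (l / Psi))).
- apply Rle_trans with (len * exp ((Psi ^ 2 - c) / eta + INR n * eta) * (exp (- (2 * Psi * l)) * (l * (l / Psi)))).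
  + apply Rmult_le_compat; [apply Cmod_ge_0| |exact HI|].
    * apply Rmult_le_pos; [left; apply exp_pos|apply Rmult_le_pos; lra].
    * apply Rmult_le_compat_l; [left; apply exp_pos|].
      rewrite <- (Rmult_1_l (l * (l / Psi))); apply Rmult_le_compat; lra.
  + right; rewrite <- !Rmult_assoc; do 2 f_equal; rewrite Rmult_assoc, <- exp_plus; do 2 f_equal.
    rewrite <- Hll; unfold eta; field; lra.
- assert (Hv : 0 < c * l / Psi) by (apply Rdiv_lt_0_compat; [apply Rmult_lt_0_compat|]; lra).
  apply Rle_trans with (len * (27 / (c * l / Psi) ^ 3) * (l * (l / Psi))).
  + apply Rmult_le_compat_r; [apply Rmult_le_pos; lra|]; apply Rmult_le_compat_l; [lra|]; apply exp_neg_le_inv_cube, Hv.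
  + replace (len * (27 / (c * l / Psi) ^ 3) * (l * (l / Psi))) with (L * eps / l) by (unfold L; field; repeat split; lra).
    apply Rle_div_l; [lra|]; rewrite (Rmult_comm eps); apply Rmult_le_compat_r; lra.
Qed.

Lemma Ccontinuous_comp_lin (f : R -> C) (a b t : R) : (forall x, Ccontinuous f x) ->
  Ccontinuous (fun u => f (a * u + b)) t.
Proof.
intros H; destruct (H (a * t + b)) as [H1 H2]; split.
- apply (continuous_comp (fun u => a * u + b) (fun x => Re (f x))); [apply continuous_lin|exact H1].
- apply (continuous_comp (fun u => a * u + b) (fun x => Im (f x))); [apply continuous_lin|exact H2].
Qed.

(** For [eta = Re sg / l] and [p = Im sg / Re sg] the value at [u = 0] is the saddle [sg / l]; [u]
    measures the deviation in units of [eta]. *)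
Definition arc_point (eta p u : R) : C := (eta, eta * (p + u))%R.

(* [sg^2] is the weight of the arc; [ka] is nonzero only if a factor [1 - z q^m]
   vanishes at the root of unity itself, that is in the case of [zeta 3]. *)
Definition arc_expansion (z : C) (k : nat) (h : Z) (sg : C) (ka : R) (A : C) : Prop :=
  exists d K, 0 < d <= 1 /\ 0 <= K /\ forall eps, 0 < eps -> exists e0, 0 < e0 /\
    forall eta u, 0 < eta < e0 -> Rabs u <= d ->
    Cmod (genfun z (unit_root k h * Cexp (- arc_point eta (Im sg / Re sg) u))
       * Cexp (- (sg * sg / arc_point eta (Im sg / Re sg) u)) * RtoC (Rpower eta ka) - A)%C <= eps + K * Rabs u.

(** The left side is the completed square [(sg - l t)^2 / t], and [sg - l t] equals [- i Psi u]. *)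
Lemma saddle_exponent (sg : C) (l u : R) : 0 < Re sg -> 0 < l ->
  let Psi := Re sg in let p := Im sg / Psi in let t := arc_point (Psi / l) p u in
  (sg * sg / t + RtoC (l * l) * t - 2 * sg * RtoC l)%C = (- (RtoC (Psi * l * (u * u)) / (1, p + u)%R))%C.
Proof.
intros HPsi Hl Psi p t.
assert (HP0 : RtoC Psi <> 0%C) by (apply RtoC_neq0; unfold Psi; lra).
assert (Hl0 : RtoC l <> 0%C) by (apply RtoC_neq0; lra).
pose proof (C_1p_neq0 (p + u)) as H1.
assert (Hsg : sg = (RtoC Psi * (1, p)%R)%C).
{ apply Ceq_ReIm; unfold p, Psi; unfold Re, Im in *; simpl; field; lra. }
assert (Ht : t = (RtoC Psi / RtoC l * (1, p + u)%R)%C).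
{ rewrite <- RtoC_div by lra; unfold t, arc_point; apply Ceq_ReIm; unfold Re, Im; simpl; ring. }
assert (Hu : RtoC (u * u) = (- (((1, p + u)%R - (1, p)%R) * ((1, p + u)%R - (1, p)%R)))%C).
{ apply Ceq_ReIm; unfold Re, Im; simpl; ring. }
rewrite Hsg, Ht, !RtoC_mult, <- (RtoC_mult u u), Hu.
field; repeat split; assumption.
Qed.

(** The arc is cut at [v - eta d] and [v + eta d] around the saddle angle [v]. The outer pieces are
    negligible by the gap, and in the middle the substitution [x = v - eta u] turns the integral
    into that of [laplace]. The root of unity comes from [q^(-n)] at the centre of the arc. *)
Lemma arc_main z k h (sg : C) ka A kp eps : Cmod z <= 1 -> (0 < k)%nat -> Z.gcd h (Z.of_nat k) = 1%Z ->
  (sg * sg)%C = arc_weight z k -> 0 < Re sg -> 0 <= ka ->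
  0 < Re kp -> (kp * kp * (1, Im sg / Re sg)%R)%C = RtoC (Re sg) ->
  (exists c1, 0 < c1 /\ forall j, (0 < j)%nat -> j <> k -> arc_height z j <= Re sg ^ 2 - c1) ->
  arc_expansion z k h sg ka A -> 0 < eps ->
  exists l0, 0 < l0 /\ forall n, l0 < sqrt (INR n) ->
  Cmod (arc_integral z (Re sg / sqrt (INR n)) n k h * normalizer sg ka (sqrt (INR n))
    - unit_root k (- (h * Z.of_nat n)) * (A * RtoC (sqrt PI) / kp))%C <= eps.
Proof.
intros Hz Hk Hg Hsg HPsi Hka Hkp Hkp2 (c1 & Hc1 & Hdom) (d & K & Hd & HK & Hexp) Heps.
destruct (genfun_far z k sg c1 d Hz Hk Hsg HPsi Hc1 Hdom (proj1 Hd)) as (c & e1 & Hc & He1 & Hfar).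
pose proof PI_RGT_0 as Hpi.
assert (HIk : 1 <= INR k) by (replace 1 with (INR 1) by reflexivity; apply le_INR; lia).
destruct (far_negligible z sg ka c (2 * PI) (eps / 3) Hz HPsi Hka Hc ltac:(lra) ltac:(lra)) as (l1 & Hl1 & Hneg).
set (Psi := Re sg) in *; set (p := Im sg / Psi) in *.
set (alpha := 2 * PI * (IZR h / INR k)) in *.
(* The amplitude left after the singular exponential is removed; [arc_expansion] says that it is [A]
   up to [eps + K |u|]. *)
set (F := fun l u => (genfun z (circ (Psi / l) (- (Psi / l) * u + (alpha - Psi / l * p)))
   * Cexp (- (sg * sg / arc_point (Psi / l) p u)) * RtoC (Rpower (Psi / l) ka))%C).
assert (Hcirc : forall eta u, circ eta (- eta * u + (alpha - eta * p)) = (unit_root k h * Cexp (- arc_point eta p u))%C).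
{ intros eta u; unfold circ, unit_root, arc_point; rewrite <- Cexp_plus; f_equal; unfold alpha.
  apply Ceq_ReIm; [rewrite Re_plus, Re_opp|rewrite Im_plus, Im_opp]; unfold Re, Im; cbn [fst snd]; ring. }
assert (HFc : forall l u, 0 < l -> Ccontinuous (F l) u).
{ intros l u Hl; assert (He : 0 < Psi / l) by (apply Rdiv_lt_0_compat; assumption).
  apply (Ccontinuous_mult (fun u => genfun z (circ (Psi / l) (- (Psi / l) * u + (alpha - Psi / l * p))) * Cexp (- (sg * sg / arc_point (Psi / l) p u)))%C (fun _ => RtoC (Rpower (Psi / l) ka))); [|apply Ccontinuous_const].
  apply (Ccontinuous_mult (fun u => genfun z (circ (Psi / l) (- (Psi / l) * u + (alpha - Psi / l * p)))) (fun u => Cexp (- (sg * sg / arc_point (Psi / l) p u)))).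
  - apply (Ccontinuous_comp_lin (fun x => genfun z (circ (Psi / l) x))); intros; apply genfun_circ_continuous; assumption.
  - apply (Ccontinuous_Cexp (fun u => - (sg * sg / arc_point (Psi / l) p u))%C), (Ccontinuous_opp (fun u => sg * sg / arc_point (Psi / l) p u)%C).
    apply (Ccontinuous_mult (fun _ => sg * sg)%C (fun u => / arc_point (Psi / l) p u)%C); [apply Ccontinuous_const|].
    apply (Ccontinuous_inv (fun u => arc_point (Psi / l) p u)); [|apply C_neq0_Re; unfold arc_point, Re; simpl; lra].
    apply Ccontinuous_pair; [apply continuous_const|]. apply @ex_derive_continuous; auto_derive; trivial. }
destruct (laplace p Psi kp A K d F HPsi Hkp Hkp2 HK Hd HFc) with (eps := eps / 3) as (l2 & Hl2 & Hlap); [|lra|].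
{ intros e He; destruct (Hexp e He) as (e0 & He0 & H).
  exists (Psi / e0); intros l Hl u Hu.
  assert (HPe : 0 < Psi / e0) by (apply Rdiv_lt_0_compat; assumption).
  unfold F; rewrite Hcirc; apply H; [|exact Hu].
  split; [apply Rdiv_lt_0_compat; lra|]. apply Rlt_div_l; [lra|].
  apply Rlt_div_l in Hl; [|exact He0]. lra. }
pose proof (Rabs_pos p) as Hap.
(* Beyond [l3] the window of half-width [eta d] around the displaced saddle angle lies inside the
   arc. *)
set (l3 := Psi * INR k * (Rabs p + 1) / PI).
exists (Rmax l1 (Rmax l2 (Rmax l3 (Psi / e1)))).
split; [eapply Rlt_le_trans; [exact Hl1|apply Rmax_l]|].
intros n Hl; set (l := sqrt (INR n)) in *.
assert (Hll1 : l1 < l) by (eapply Rle_lt_trans; [apply Rmax_l|exact Hl]).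
assert (Hl' : Rmax l2 (Rmax l3 (Psi / e1)) < l) by (eapply Rle_lt_trans; [apply Rmax_r|exact Hl]).
assert (Hll2 : l2 < l) by (eapply Rle_lt_trans; [apply Rmax_l|exact Hl']).
assert (Hl'' : Rmax l3 (Psi / e1) < l) by (eapply Rle_lt_trans; [apply Rmax_r|exact Hl']).
assert (Hll3 : l3 < l) by (eapply Rle_lt_trans; [apply Rmax_l|exact Hl'']).
assert (Hll4 : Psi / e1 < l) by (eapply Rle_lt_trans; [apply Rmax_r|exact Hl'']).
assert (Hl0 : 0 < l) by lra.
assert (Hlsq : l * l = INR n) by (apply sqrt_sqrt, pos_INR).
set (eta := Psi / l) in *.
assert (Heta : 0 < eta) by (apply Rdiv_lt_0_compat; assumption).
assert (Heta1 : eta < e1).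
{ unfold eta; apply Rlt_div_l; [lra|]; apply Rlt_div_l in Hll4; [|exact He1]; lra. }
assert (Hetak : eta * (Rabs p + 1) <= PI / INR k).
{ unfold l3 in Hll3; apply Rlt_div_l in Hll3; [|lra]. unfold eta.
  apply Rmult_le_reg_r with (INR k * l); [apply Rmult_lt_0_compat; lra|].
  replace (Psi / l * (Rabs p + 1) * (INR k * l)) with (Psi * INR k * (Rabs p + 1)) by (field; lra).
  replace (PI / INR k * (INR k * l)) with (l * PI) by (field; lra). lra. }
set (v := alpha - eta * p) in *.
assert (Hetad : eta * Rabs p + eta * d <= PI / INR k) by nra.
assert (Hed : 0 < eta * d) by (apply Rmult_lt_0_compat; lra).
assert (Hpik : 0 < PI / INR k <= PI).
{ split; [apply Rdiv_lt_0_compat; lra|]; apply Rle_div_l; [lra|nra]. }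
assert (Hpp : - (eta * Rabs p) <= eta * p <= eta * Rabs p).
{ pose proof (Rle_abs p); pose proof (Rle_abs (- p)) as Hn; rewrite Rabs_Ropp in Hn; split; nra. }
set (N := normalizer sg ka l) in *.
set (I := arc_integrand z eta n).
assert (HIc : forall x, Ccontinuous I x) by (intros; apply arc_integrand_continuous; assumption).
assert (HIex : forall a b, ex_CInt I a b) by (intros; apply ex_CInt_continuous, HIc).
assert (Hsplit : arc_integral z eta n k h = (CInt I (alpha - PI / INR k) (v - eta * d)
   + CInt I (v - eta * d) (v + eta * d) + CInt I (v + eta * d) (alpha + PI / INR k))%C).
{ unfold arc_integral; fold I alpha; rewrite !CInt_Chasles by apply HIex; reflexivity. }
assert (HA : Cmod (CInt I (alpha - PI / INR k) (v - eta * d) * N)%C <= eps / 3).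
{ apply (Hneg n _ _ Hll1); [unfold v; lra|unfold v; nra|].
  intros x Hx; apply (Hfar eta h x (conj Heta Heta1)).
  - fold alpha; apply Rabs_le; unfold v in Hx; lra.
  - right; fold alpha p; fold v; rewrite Rabs_left1; nra. }
assert (HB : Cmod (CInt I (v + eta * d) (alpha + PI / INR k) * N)%C <= eps / 3).
{ apply (Hneg n _ _ Hll1); [unfold v; lra|unfold v; nra|].
  intros x Hx; apply (Hfar eta h x (conj Heta Heta1)).
  - fold alpha; apply Rabs_le; unfold v in Hx; lra.
  - right; fold alpha p; fold v; rewrite Rabs_pos_eq; nra. }
assert (HM : (CInt I (v - eta * d) (v + eta * d) * N)%C = (unit_root k (- (h * Z.of_nat n)) *
   (RtoC (sqrt l) * CInt (fun u => F l u * Cexp (- (RtoC (Psi * l * (u * u)) / (1, p + u)%R)))%C (- d) d))%C).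
{ pose proof (CInt_comp_lin I (- eta) v d (- d) HIc) as E.
  replace (- eta * d + v) with (v - eta * d) in E by ring; replace (- eta * - d + v) with (v + eta * d) in E by ring.
  rewrite <- E.
  assert (HIc2 : forall u, Ccontinuous (fun u => I (- eta * u + v)) u) by (intros; apply Ccontinuous_comp_lin, HIc).
  rewrite (CInt_scal (RtoC (- eta)) (fun u => I (- eta * u + v))) by (apply ex_CInt_continuous, HIc2).
  rewrite (CInt_swap _ d (- d)) by (apply ex_CInt_continuous, HIc2).
  assert (HNf : forall u, (I (- eta * u + v)%R * Cexp (- (2 * sg * RtoC l)) * RtoC (Rpower eta ka))%C =
    (unit_root k (- (h * Z.of_nat n)) * (F l u * Cexp (- (RtoC (Psi * l * (u * u)) / (1, p + u)%R))))%C).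
  { intros u; pose proof (saddle_exponent sg l u HPsi Hl0) as Hse; cbv zeta in Hse; fold Psi p in Hse; fold eta in Hse; rewrite <- Hse.
    unfold I, arc_integrand, F; fold eta; fold v.
    assert (Hcn : circ_negpow (Z.of_nat n) eta (- eta * u + v) =
      (unit_root k (- (h * Z.of_nat n)) * Cexp (RtoC (l * l) * arc_point eta p u))%C).
    { unfold circ_negpow, unit_root, arc_point; rewrite <- Cexp_plus; f_equal.
      rewrite opp_IZR, mult_IZR, <- INR_IZR_INZ, <- Hlsq; unfold v, alpha; apply Ceq_ReIm.
      - rewrite Re_plus, Re_mult, Re_RtoC, Im_RtoC; unfold Re, Im; cbn [fst snd]; ring.
      - rewrite Im_plus, Im_mult, Re_RtoC, Im_RtoC; unfold Re, Im; cbn [fst snd]; field; lra. }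
    rewrite Hcn.
    set (t := arc_point eta p u).
    replace (sg * sg / t + RtoC (l * l) * t - 2 * sg * RtoC l)%C with (sg * sg / t + (RtoC (l * l) * t + - (2 * sg * RtoC l)))%C by ring.
    rewrite (Cexp_plus (sg * sg / t)), (Cexp_plus (RtoC (l * l) * t)), (Cexp_opp (sg * sg / t)).
    field; apply Cexp_neq0. }
  unfold N, normalizer; fold Psi; fold eta.
  assert (Hc1' : forall c1 c2 I0, (RtoC (- eta) * - I0 * (c1 * RtoC (c2 * (sqrt l * (l / Psi)))))%C = (RtoC (sqrt l) * ((c1 * RtoC c2) * I0))%C).
  { intros c0 c2 I0; rewrite RtoC_opp, !RtoC_mult, RtoC_div by (apply Rgt_not_eq; exact HPsi). unfold eta; rewrite RtoC_div by lra.
    field; split; apply RtoC_neq0; lra. }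
  rewrite Hc1'.
  rewrite <- (CInt_scal (Cexp (- (2 * sg * RtoC l)) * RtoC (Rpower eta ka)) (fun u => I (- eta * u + v))) by (apply ex_CInt_continuous, HIc2).
  rewrite (CInt_ext _ (fun u => unit_root k (- (h * Z.of_nat n)) * (F l u * Cexp (- (RtoC (Psi * l * (u * u)) / (1, p + u)%R))))%C).
  - rewrite CInt_scal; [ring|].
    apply ex_CInt_continuous; intros u; apply (Ccontinuous_mult (F l) (fun u => Cexp (- (RtoC (Psi * l * (u * u)) / (1, p + u)%R))%C)).
    + apply HFc, Hl0.
    + apply saddle_continuous.
  - intros u; rewrite <- HNf; ring. }
rewrite Hsplit.
match goal with |- Cmod (((?a + ?b + ?c) * N) - ?w * ?x)%C <= _ =>
  replace ((a + b + c) * N - w * x)%C with (a * N + (b * N - w * x) + c * N)%C by ring end.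
eapply Rle_trans; [apply Cmod_plus_le; [apply Cmod_plus_le; [exact HA|]|exact HB]|].
- rewrite HM.
  match goal with |- Cmod (?w * ?a - ?w * ?b)%C <= _ => replace (w * a - w * b)%C with (w * (a - b))%C by ring end.
  rewrite Cmod_mult, Cmod_unit_root, Rmult_1_l; apply Hlap, Hll2.
- lra.
Qed.

(** * Expansion at a root of unity where no factor vanishes *)

Lemma Clog1m_line_derive (a b : C) t : Re (a + RtoC t * b)%C < 1 ->
  is_Cderive (fun u => Clog1m (a + RtoC u * b)) t (- b / (1 - (a + RtoC t * b)))%C.
Proof.
intros H; destruct a as [a1 a2], b as [b1 b2].
assert (Hre : Re ((a1, a2) + RtoC t * (b1, b2))%C = a1 + t * b1) by (unfold Re; simpl; ring).
rewrite Hre in H.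
set (X := fun u => 1 - (a1 + u * b1)); set (Y := fun u => - (a2 + u * b2)).
assert (HX : 0 < X t) by (unfold X; lra).
assert (HN : 0 < X t * X t + Y t * Y t) by nra.
assert (E : (- (b1, b2) / (1 - ((a1, a2) + RtoC t * (b1, b2))))%C =
  ((- b1 * X t - b2 * Y t) / (X t * X t + Y t * Y t), (- b2 * X t + b1 * Y t) / (X t * X t + Y t * Y t))).
{ unfold X, Y in *; apply Ceq_ReIm; unfold Re, Im; simpl; field; repeat split; nra. }
rewrite E; split.
- apply is_derive_ext with (fun u => / 2 * ln (X u * X u + Y u * Y u)).
  { intros u; unfold Clog1m, Re; simpl fst; unfold Cmod; simpl; rewrite !Rmult_1_r.
    rewrite ln_sqrt_gen by (apply Rplus_le_le_0_compat; apply Rle_0_sqr).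
    unfold X, Y; f_equal; f_equal; ring. }
  unfold X, Y in *; auto_derive; [exact HN|]; unfold Re; simpl; field; lra.
- apply is_derive_ext with (fun u => atan (Y u / X u)).
  { intros u; unfold Clog1m, Re, Im, X, Y; simpl; f_equal; f_equal; ring. }
  unfold X, Y in *; auto_derive; [lra|]; unfold Im; simpl; field; repeat split; nra.
Qed.

Lemma Clog1m_lipschitz (v w : C) : Re w < 1 -> Cmod (v - w)%C <= (1 - Re w) / 2 ->
  Cmod (Clog1m v - Clog1m w)%C <= 2 / (1 - Re w) * Cmod (v - w)%C.
Proof.
intros Hw Hv.
pose proof (Cmvt (fun t => Clog1m (w + RtoC t * (v - w)))
  (fun t => - (v - w) / (1 - (w + RtoC t * (v - w))))%C 0 1 (2 / (1 - Re w) * Cmod (v - w)%C) ltac:(lra)) as H.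
cbv beta in H.
replace (w + RtoC 1 * (v - w))%C with v in H by ring.
replace (w + RtoC 0 * (v - w))%C with w in H by ring.
rewrite Rminus_0_r, (Rmult_1_r (_ * _)) in H; apply H.
- intros t Ht; apply Clog1m_line_derive.
  pose proof (Re_seg_le t (v - w) Ht); rewrite Re_plus; lra.
- intros t Ht; replace (2 / (1 - Re w) * Cmod (v - w)%C) with (Cmod (v - w)%C / ((1 - Re w) / 2)) by (field; lra).
  apply Cmod_div_le; [rewrite Cmod_opp; lra|lra|].
  eapply Rle_trans; [|apply Re_le]; rewrite Re_minus, Re_plus, Re_RtoC.
  pose proof (Re_seg_le t (v - w) Ht); lra.
Qed.

Lemma finite_small (P : nat -> R -> Prop) k :
  (forall j, (j < k)%nat -> exists e, 0 < e /\ forall x, 0 < x < e -> P j x) ->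
  exists e, 0 < e /\ forall x, 0 < x < e -> forall j, (j < k)%nat -> P j x.
Proof.
intros H; destruct (finite_uniform (fun j a => forall x, 0 < x < a -> P j x) k) as (a & Ha & HP).
- intros j a b HP Hb x Hx; apply HP; lra.
- exact H.
- exists a; split; [exact Ha|]; intros x Hx j Hj; apply HP; assumption.
Qed.

Definition arc_factor (z : C) (k : nat) (h : Z) (t : C) (j : nat) : C :=
  (sector_rem (z * unit_root k (h * Z.of_nat (S j))) (INR (S j) / INR k) (RtoC (INR k) * t)
   + RtoC (INR (S j) / INR k - 1 / 2) * Clog1m (z * unit_root k (h * Z.of_nat (S j)) * Cexp (- (RtoC (INR k) * t))))%C.

Lemma residue_weight_bounds j k : (j < k)%nat -> 0 < INR (S j) / INR k <= 1.
Proof.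
intros H; assert (HIk : 0 < INR k) by (apply lt_0_INR; lia); pose proof (INR_S_pos j).
split; [apply Rdiv_lt_0_compat; lra|]; apply Rle_div_l; [lra|]; rewrite Rmult_1_l; apply le_INR; lia.
Qed.

Lemma arc_point_sector eta p u : 0 < eta -> Rabs u <= 1 ->
  Re (arc_point eta p u) = eta /\ Rabs (Im (arc_point eta p u)) <= (Rabs p + 1) * eta /\
  Cmod (arc_point eta p u) <= (Rabs p + 2) * eta.
Proof.
intros He Hu; unfold arc_point; unfold Re, Im; cbn [fst snd].
assert (H : Rabs (eta * (p + u)) <= (Rabs p + 1) * eta).
{ rewrite Rabs_mult, (Rabs_pos_eq eta) by lra; pose proof (Rabs_triang p u); nra. }
split; [reflexivity|split; [exact H|]].
eapply Rle_trans; [apply Cmod_le_ReIm|]; unfold Re, Im; cbn [fst snd]; rewrite (Rabs_pos_eq eta) by lra; lra.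
Qed.

(** For a residue class with [w <> 1] the remainder tends to 0 by Abel summation, and the logarithm
    is Lipschitz near [w]; both estimates are uniform in [u]. *)
Lemma arc_factor_regular z k h j p eps : (j < k)%nat -> Cmod z = 1 ->
  (z * unit_root k (h * Z.of_nat (S j)))%C <> 1%C -> 0 < eps ->
  exists e0, 0 < e0 /\ forall eta, 0 < eta < e0 -> forall u, Rabs u <= 1 ->
  Cmod (arc_factor z k h (arc_point eta p u) j
    - RtoC (INR (S j) / INR k - 1 / 2) * Clog1m (z * unit_root k (h * Z.of_nat (S j))))%C <= eps.
Proof.
intros Hj Hz Hw Heps.
pose proof (residue_weight_bounds j k Hj) as Hx; set (x := INR (S j) / INR k) in *.
set (w := (z * unit_root k (h * Z.of_nat (S j)))%C) in *.
assert (Hwm : Cmod w = 1) by (unfold w; rewrite Cmod_mult, Cmod_unit_root, Hz; ring).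
assert (HIk : 1 <= INR k) by (replace 1 with (INR 1) by reflexivity; apply le_INR; lia).
pose proof (Cmod1_Re_lt w (Req_le _ _ Hwm) Hw) as Hre.
pose proof (Rabs_pos p) as Hp.
destruct (sector_rem_small x (Rabs p + 1) Hx ltac:(lra)) as (K & HK & Hrem).
set (D := Cmod (1 - w)%C).
assert (HD : 0 < D).
{ unfold D; apply Cmod_gt_0; intros E; apply Hw; replace w with (1 - (1 - w))%C by ring; rewrite E; ring. }
set (Q := INR k * (Rabs p + 2)).
assert (HQ : 0 < Q) by (apply Rmult_lt_0_compat; lra).
set (e1 := (eps * D / (2 * K)) ^ 2 / Q).
assert (He1 : 0 < e1) by (apply Rdiv_lt_0_compat; [apply pow_lt, Rdiv_lt_0_compat; [apply Rmult_lt_0_compat; lra|lra]|exact HQ]).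
set (e2 := Rmin ((1 - Re w) / 2) (eps * (1 - Re w) / 4) / (3 * Q)).
assert (He2 : 0 < e2).
{ apply Rdiv_lt_0_compat; [|lra]. apply Rmin_glb_lt; [lra|]. assert (0 < eps * (1 - Re w)) by (apply Rmult_lt_0_compat; lra). lra. }
exists (Rmin (/ Q) (Rmin e1 e2)); split; [repeat apply Rmin_glb_lt; try assumption; apply Rinv_0_lt_compat, HQ|].
intros eta He u Hu.
assert (HeQ : eta < / Q) by (eapply Rlt_le_trans; [apply He|apply Rmin_l]).
assert (Hee1 : eta < e1) by (eapply Rlt_le_trans; [apply He|eapply Rle_trans; [apply Rmin_r|apply Rmin_l]]).
assert (Hee2 : eta < e2) by (eapply Rlt_le_trans; [apply He|eapply Rle_trans; [apply Rmin_r|apply Rmin_r]]).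
destruct (arc_point_sector eta p u (proj1 He) Hu) as (Ht1 & Ht2 & Ht3).
set (t := arc_point eta p u) in *; set (s := (RtoC (INR k) * t)%C).
assert (Hs1 : Re s = INR k * eta) by (unfold s; rewrite Re_mult, Re_RtoC, Im_RtoC, Ht1; ring).
assert (Hs2 : Rabs (Im s) <= (Rabs p + 1) * Re s).
{ unfold s at 1; rewrite Im_mult, Re_RtoC, Im_RtoC, Hs1, Rmult_0_l, Rplus_0_r, Rabs_mult, (Rabs_pos_eq (INR k)) by lra.
  apply Rle_trans with (INR k * ((Rabs p + 1) * eta)); [apply Rmult_le_compat_l; lra|right; ring]. }
assert (Hs3 : Cmod s <= Q * eta).
{ unfold s; rewrite Cmod_mult, Cmod_RtoC_pos by lra; unfold Q; rewrite Rmult_assoc; apply Rmult_le_compat_l; lra. }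
assert (HQe : Q * eta < 1) by (apply Rmult_lt_compat_l with (r := Q) in HeQ; [|exact HQ]; rewrite Rinv_r in HeQ; lra).
assert (Hs0 : 0 < Re s) by (rewrite Hs1; apply Rmult_lt_0_compat; lra).
unfold arc_factor; fold x w s.
replace (sector_rem w x s + RtoC (x - 1 / 2) * Clog1m (w * Cexp (- s)) - RtoC (x - 1 / 2) * Clog1m w)%C
  with (sector_rem w x s + RtoC (x - 1 / 2) * (Clog1m (w * Cexp (- s)) - Clog1m w))%C by ring.
assert (HA : Cmod (sector_rem w x s) <= eps / 2).
{ pose proof (Hrem w s Hwm Hs0 Hs2 ltac:(lra)) as H; fold D in H.
  assert (Hsq : sqrt (Cmod s) <= eps * D / (2 * K)).
  { rewrite <- (sqrt_pow2 (eps * D / (2 * K))) by (left; apply Rdiv_lt_0_compat; [apply Rmult_lt_0_compat|]; lra).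
    apply sqrt_le_1_alt; eapply Rle_trans; [exact Hs3|].
    apply Rlt_le; unfold e1 in Hee1; apply Rlt_div_r in Hee1; [|exact HQ]; lra. }
  apply Rmult_le_reg_l with D; [exact HD|]; eapply Rle_trans; [exact H|].
  apply Rle_trans with (K * (eps * D / (2 * K))); [apply Rmult_le_compat_l; lra|right; field; lra]. }
assert (Hdv : Cmod (w * Cexp (- s) - w)%C <= 3 * (Q * eta)).
{ replace (w * Cexp (- s) - w)%C with (w * (Cexp (- s) - 1))%C by ring.
  rewrite Cmod_mult, Hwm, Rmult_1_l; eapply Rle_trans; [apply Cexp_bound1|]; rewrite Cmod_opp.
  assert (exp (Cmod s) <= 3) by (eapply Rle_trans; [apply exp_mono with (y := 1); lra|apply exp_le_3]).
  pose proof (Cmod_ge_0 s); pose proof (exp_pos (Cmod s)); nra. }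
assert (Hde : 3 * (Q * eta) <= Rmin ((1 - Re w) / 2) (eps * (1 - Re w) / 4)).
{ apply Rlt_le; unfold e2 in Hee2; apply Rlt_div_r in Hee2; [|lra]; lra. }
assert (HB : Cmod (RtoC (x - 1 / 2) * (Clog1m (w * Cexp (- s)) - Clog1m w))%C <= 1 * (eps / 2)).
{ apply Cmod_mult_le; [rewrite Cmod_R; apply Rabs_le; lra|].
  eapply Rle_trans; [apply Clog1m_lipschitz; [exact Hre|]|].
  - eapply Rle_trans; [exact Hdv|eapply Rle_trans; [exact Hde|apply Rmin_l]].
  - apply Rle_trans with (2 / (1 - Re w) * (eps * (1 - Re w) / 4)).
    + apply Rmult_le_compat_l; [left; apply Rdiv_lt_0_compat; lra|].
      eapply Rle_trans; [exact Hdv|eapply Rle_trans; [exact Hde|apply Rmin_r]].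
    + right; field; lra. }
eapply Rle_trans; [apply Cmod_plus_le; [exact HA|exact HB]|lra].
Qed.

Lemma genfun_arc z k h sg t : (0 < k)%nat -> Z.gcd h (Z.of_nat k) = 1%Z -> Cmod z <= 1 -> 0 < Re t ->
  (sg * sg)%C = arc_weight z k ->
  (genfun z (unit_root k h * Cexp (- t)) * Cexp (- (sg * sg / t)))%C = Cexp (Csumn (arc_factor z k h t) k).
Proof.
intros Hk Hg Hz Ht Hsg; unfold genfun; rewrite loggen_major_rem by assumption.
rewrite <- Cexp_plus; f_equal; rewrite Hsg; unfold arc_weight, arc_factor; ring.
Qed.

Lemma Csumn_minus f g n : (Csumn f n - Csumn g n)%C = Csumn (fun i => f i - g i)%C n.
Proof. induction n as [|n IH]; cbn [Csumn]; [|rewrite <- IH]; ring. Qed.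

(** The exponent converges uniformly on the window, so the expansion holds with [K = 0] and without
    a power of [eta]. *)
Lemma arc_expansion_regular z k h sg : (0 < k)%nat -> Z.gcd h (Z.of_nat k) = 1%Z -> Cmod z = 1 ->
  (sg * sg)%C = arc_weight z k ->
  (forall j, (j < k)%nat -> (z * unit_root k (h * Z.of_nat (S j)))%C <> 1%C) ->
  arc_expansion z k h sg 0
    (Cexp (Csumn (fun j => RtoC (INR (S j) / INR k - 1 / 2) * Clog1m (z * unit_root k (h * Z.of_nat (S j))))%C k)).
Proof.
intros Hk Hg Hz Hsg Hw.
exists 1, 0; split; [lra|split; [lra|]]; intros eps Heps.
set (p := Im sg / Re sg).
set (B0 := Csumn (fun j => RtoC (INR (S j) / INR k - 1 / 2) * Clog1m (z * unit_root k (h * Z.of_nat (S j))))%C k).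
assert (HIk : 0 < INR k) by (apply lt_0_INR; lia).
set (del := Rmin 1 (eps / (3 * exp (Re B0)))).
pose proof (exp_pos (Re B0)) as HeB.
assert (Hdel : 0 < del) by (apply Rmin_glb_lt; [lra|apply Rdiv_lt_0_compat; lra]).
destruct (finite_small (fun j eta => forall u, Rabs u <= 1 ->
  Cmod (arc_factor z k h (arc_point eta p u) j
    - RtoC (INR (S j) / INR k - 1 / 2) * Clog1m (z * unit_root k (h * Z.of_nat (S j))))%C <= del / INR k) k) as (e0 & He0 & H).
{ intros j Hj; apply (arc_factor_regular z k h j p (del / INR k) Hj Hz (Hw j Hj)); apply Rdiv_lt_0_compat; assumption. }
exists e0; split; [exact He0|]; intros eta u He Hu.
destruct (arc_point_sector eta p u (proj1 He) Hu) as (Ht1 & _ & _).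
rewrite genfun_arc by (try assumption; lra).
unfold Rpower; rewrite Rmult_0_l, exp_0, Cmult_1_r.
assert (Hd : Cmod (Csumn (arc_factor z k h (arc_point eta p u)) k - B0)%C <= del).
{ replace del with (INR k * (del / INR k)) by (field; lra).
  unfold B0; rewrite Csumn_minus, <- Rsumn_const; apply Cmod_Csumn_le; intros j Hj.
  exact (H eta He j Hj u Hu). }
rewrite Rmult_0_l, Rplus_0_r.
eapply Rle_trans; [apply Cexp_diff_le|].
assert (Hd1 : del <= 1) by apply Rmin_l.
assert (Hd2 : del <= eps / (3 * exp (Re B0))) by apply Rmin_r.
assert (He3 : exp (Cmod (Csumn (arc_factor z k h (arc_point eta p u)) k - B0)%C) <= 3).
{ eapply Rle_trans; [apply exp_mono with (y := 1); lra|apply exp_le_3]. }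
set (dd := Cmod (Csumn (arc_factor z k h (arc_point eta p u)) k - B0)%C) in *.
assert (0 <= dd) by apply Cmod_ge_0. pose proof (exp_pos dd).
apply Rle_trans with (exp (Re B0) * (eps / (3 * exp (Re B0)) * 3)).
- apply Rmult_le_compat_l; [lra|]; apply Rmult_le_compat; lra.
- right; field; lra.
Qed.

(** * The Gamma function and the real singular case *)

Definition gamma_fun (x t : R) : R := Rpower t (x - 1) * exp (- t).

(** The improper integral in [eps] form with independent endpoints, which allows comparison of
    truncated integrals for different [x]; [is_Gamma_correct] links it to [Gamma]. *)
Definition is_Gamma (x l : R) : Prop := forall eps, 0 < eps -> exists a0 b0, 0 < a0 /\ 0 < b0 /\
  forall a b, 0 < a < a0 -> b0 < b -> Rabs (RInt (gamma_fun x) a b - l) < eps.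

Lemma Rpower_derive x t : 0 < t -> is_derive (fun u => Rpower u x) t (x * Rpower t (x - 1)).
Proof.
intros Ht; apply is_derive_Reals.
pose proof (derivable_pt_lim_power t x Ht) as H; exact H.
Qed.

Lemma gamma_fun_continuous x t : 0 < t -> continuous (gamma_fun x) t.
Proof.
intros Ht; apply continuous_Rmult.
- apply @ex_derive_continuous; eexists; apply Rpower_derive, Ht.
- apply @ex_derive_continuous; auto_derive; trivial.
Qed.

Lemma gamma_fun_pos x t : 0 < gamma_fun x t.
Proof. apply Rmult_lt_0_compat; apply exp_pos. Qed.

Lemma ex_RInt_gamma x a b : 0 < a -> 0 < b -> ex_RInt (gamma_fun x) a b.
Proof.
intros Ha Hb; apply @ex_RInt_continuous; intros t Ht; apply gamma_fun_continuous.
assert (0 < Rmin a b) by (apply Rmin_glb_lt; assumption); lra.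
Qed.

Lemma is_Gamma_correct x l : is_Gamma x l -> Gamma x = l.
Proof.
intros H; unfold Gamma; apply is_RInt_gen_unique.
intros P (eps & HP); destruct (H eps (cond_pos eps)) as (a0 & b0 & Ha0 & Hb0 & Hab).
apply Filter_prod with (Q := fun a => 0 < a < a0) (R := fun b => b0 < b).
- exists (mkposreal a0 Ha0); intros y Hy Hy0; change (Rabs (y - 0) < a0) in Hy; rewrite Rminus_0_r in Hy.
  rewrite Rabs_pos_eq in Hy; lra.
- exists b0; intros y Hy; exact Hy.
- intros a b Ha Hb; simpl.
  exists (RInt (gamma_fun x) a b); split.
  + apply (@RInt_correct R_CompleteNormedModule), ex_RInt_gamma; lra.
  + apply HP, Hab; assumption.
Qed.

Lemma RInt_nonneg f a b : a <= b -> ex_RInt f a b -> (forall t, a < t < b -> 0 <= f t) -> 0 <= RInt f a b.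
Proof.
intros Hab Hf H; replace 0 with (RInt (fun _ => 0) a b) by (rewrite RInt_const; unfold scal; simpl; unfold mult; simpl; ring).
apply RInt_le; [exact Hab|apply ex_RInt_const|exact Hf|exact H].
Qed.

Lemma RInt_gamma_mono x a b a' b' : 0 < a' <= a -> a <= b -> b <= b' ->
  RInt (gamma_fun x) a b <= RInt (gamma_fun x) a' b'.
Proof.
intros H1 H2 H3.
assert (Hex : forall u v, 0 < u -> 0 < v -> ex_RInt (gamma_fun x) u v) by (intros; apply ex_RInt_gamma; assumption).
rewrite <- (RInt_Chasles (gamma_fun x) a' a b') by (apply Hex; lra).
rewrite <- (RInt_Chasles (gamma_fun x) a b b') by (apply Hex; lra).
unfold plus; simpl.
assert (0 <= RInt (gamma_fun x) a' a) by (apply RInt_nonneg; [lra|apply Hex; lra|intros; left; apply gamma_fun_pos]).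
assert (0 <= RInt (gamma_fun x) b b') by (apply RInt_nonneg; [lra|apply Hex; lra|intros; left; apply gamma_fun_pos]).
lra.
Qed.

Lemma RInt_derive_R (f df : R -> R) a b : (forall t, Rmin a b <= t <= Rmax a b -> is_derive f t (df t)) ->
  (forall t, Rmin a b <= t <= Rmax a b -> continuous df t) -> RInt df a b = f b - f a.
Proof.
intros H1 H2; apply is_RInt_unique; exact (@is_RInt_derive R_CompleteNormedModule f df a b H1 H2).
Qed.

Lemma RInt_gamma_bounded x a b : 0 < x <= 1 -> 0 < a < 1 -> 1 < b -> RInt (gamma_fun x) a b <= / x + 1.
Proof.
intros Hx Ha Hb.
rewrite <- (RInt_Chasles (gamma_fun x) a 1 b) by (apply ex_RInt_gamma; lra).
unfold plus; simpl; apply Rplus_le_compat.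
- assert (Hc : forall t, a <= t <= 1 -> continuous (fun t => Rpower t (x - 1)) t).
  { intros t Ht; apply @ex_derive_continuous; eexists; apply Rpower_derive; lra. }
  assert (E : RInt (fun t => Rpower t (x - 1)) a 1 = Rpower 1 x / x - Rpower a x / x).
  { apply (RInt_derive_R (fun t => Rpower t x / x)); intros t Ht; rewrite Rmin_left, Rmax_right in Ht by lra; [|apply Hc; exact Ht].
    replace (Rpower t (x - 1)) with (/ x * (x * Rpower t (x - 1))) by (field; lra).
    apply is_derive_ext with (fun t => / x * Rpower t x); [intros v; apply Rmult_comm|].
    apply is_derive_scal, Rpower_derive; lra. }
  apply Rle_trans with (RInt (fun t => Rpower t (x - 1)) a 1).
  + apply RInt_le; [lra|apply ex_RInt_gamma; lra| |].
    * apply @ex_RInt_continuous; intros t Ht; rewrite Rmin_left, Rmax_right in Ht by lra; apply Hc; exact Ht.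
    * intros t Ht; unfold gamma_fun; rewrite <- (Rmult_1_r (Rpower t (x - 1))) at 2.
      apply Rmult_le_compat_l; [left; apply exp_pos|]; rewrite <- exp_0; apply exp_mono; lra.
  + rewrite E; unfold Rpower at 1; rewrite ln_1, Rmult_0_r, exp_0.
    assert (0 < Rpower a x / x) by (apply Rdiv_lt_0_compat; [apply exp_pos|lra]). lra.
- assert (E : RInt (fun t => exp (- t)) 1 b = - exp (- b) - - exp (- 1)).
  { apply (RInt_derive_R (fun t => - exp (- t))); intros t _; [auto_derive; [trivial|ring]|].
    apply @ex_derive_continuous; auto_derive; trivial. }
  apply Rle_trans with (RInt (fun t => exp (- t)) 1 b).
  + apply RInt_le; [lra|apply ex_RInt_gamma; lra| |].
    * apply @ex_RInt_continuous; intros t _; apply @ex_derive_continuous; auto_derive; trivial.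
    * intros t Ht; unfold gamma_fun; rewrite <- (Rmult_1_l (exp (- t))) at 2.
      apply Rmult_le_compat_r; [left; apply exp_pos|]; apply Rle_trans with (exp 0); [apply exp_mono|rewrite exp_0; lra].
      assert (0 <= ln t) by (rewrite <- ln_1; apply ln_le; lra). nra.
  + rewrite E; pose proof (exp_pos (- b)); assert (exp (- 1) <= 1) by (rewrite <- exp_0; apply exp_mono; lra). lra.
Qed.

(** The integrand is positive, so truncated integrals grow with the interval; being bounded by
    [RInt_gamma_bounded], they converge to their supremum. *)
Lemma is_Gamma_exists x : 0 < x <= 1 -> exists l, 0 < l /\ is_Gamma x l.
Proof.
intros Hx.
set (E := fun v => exists a b, 0 < a < 1 /\ 1 < b /\ v = RInt (gamma_fun x) a b).
destruct (completeness E) as (l & Hub & Hlub).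
- exists (/ x + 1); intros v (a & b & Ha & Hb & ->); apply RInt_gamma_bounded; assumption.
- exists (RInt (gamma_fun x) (1 / 2) 2), (1 / 2), 2; repeat split; lra.
- exists l; split.
  + apply Rlt_le_trans with (RInt (gamma_fun x) (1 / 2) 2).
    * apply RInt_gt_0; [lra|intros; apply gamma_fun_pos|intros t Ht; apply gamma_fun_continuous; lra].
    * apply Hub; exists (1 / 2), 2; repeat split; lra.
  + intros eps He.
    assert (Hex : exists v, E v /\ l - eps < v).
    { apply Classical_Prop.NNPP; intros Hn.
      assert (l <= l - eps); [|lra]. apply Hlub; intros v Hv.
      apply Rnot_lt_le; intros Hlt; apply Hn; exists v; split; assumption. }
    destruct Hex as (v & (a0 & b0 & Ha0 & Hb0 & ->) & Hv).
    exists a0, b0; split; [lra|split; [lra|]]; intros a b Ha Hb.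
    pose proof (RInt_gamma_mono x a0 b0 a b ltac:(lra) ltac:(lra) ltac:(lra)) as H1.
    assert (H2 : RInt (gamma_fun x) a b <= l) by (apply Hub; exists a, b; repeat split; lra).
    apply Rabs_def1; lra.
Qed.

Lemma Rpower_at_0 x eps : 0 < x -> 0 < eps -> exists a0, 0 < a0 /\ forall a, 0 < a < a0 -> Rpower a x < eps.
Proof.
intros Hx He; exists (Rpower eps (/ x)); split; [apply exp_pos|]; intros a Ha.
replace eps with (Rpower (Rpower eps (/ x)) x).
- apply Rlt_Rpower_l; assumption.
- rewrite Rpower_mult, Rinv_l by lra; apply Rpower_1, He.
Qed.

Lemma Rpower_exp_at_infty x eps : 0 < x -> 0 < eps ->
  exists b0, 0 < b0 /\ forall b, b0 < b -> Rpower b x * exp (- b) < eps.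
Proof.
intros Hx He; exists (Rmax (16 * x * x) (2 / eps)).
assert (H2e : 0 < 2 / eps) by (apply Rdiv_lt_0_compat; lra).
split; [eapply Rlt_le_trans; [exact H2e|apply Rmax_r]|]; intros b Hb.
assert (Hb1 : 16 * x * x < b) by (eapply Rle_lt_trans; [apply Rmax_l|exact Hb]).
assert (Hb2 : 2 / eps < b) by (eapply Rle_lt_trans; [apply Rmax_r|exact Hb]).
assert (Hb0 : 0 < b) by lra.
unfold Rpower; rewrite <- exp_plus.
pose proof (ln_le_2sqrt b Hb0) as Hln; pose proof (sqrt_sqrt b ltac:(lra)) as Hs; pose proof (sqrt_lt_R0 b Hb0) as Hs0.
assert (H4 : 4 * x <= sqrt b).
{ apply Rnot_lt_le; intros H; assert (sqrt b * sqrt b < (4 * x) * (4 * x)) by (apply Rmult_le_0_lt_compat; lra). lra. }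
apply Rle_lt_trans with (exp (- (b / 2))); [apply exp_mono; nra|].
rewrite exp_Ropp; apply Rle_lt_trans with (/ (b / 2)).
- apply Rinv_le_contravar; [lra|]; pose proof (exp_ineq1_le (b / 2)); lra.
- replace (/ (b / 2)) with (2 / b) by (field; lra). apply Rlt_div_l; [lra|].
  apply Rlt_div_l in Hb2; lra.
Qed.

(** Integration by parts on a truncated interval; the boundary terms are [t^x e^(-t)] at the two
    ends. *)
Lemma is_Gamma_step x l : 0 < x -> is_Gamma x l -> is_Gamma (x + 1) (x * l).
Proof.
intros Hx H eps He.
destruct (H (eps / (3 * x))) as (a0 & b0 & Ha0 & Hb0 & Hab); [apply Rdiv_lt_0_compat; lra|].
destruct (Rpower_at_0 x (eps / 3) Hx ltac:(lra)) as (a1 & Ha1 & Hpa).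
destruct (Rpower_exp_at_infty x (eps / 3) Hx ltac:(lra)) as (b1 & Hb1 & Hpb).
exists (Rmin 1 (Rmin a0 a1)), (Rmax 1 (Rmax b0 b1)).
split; [repeat apply Rmin_glb_lt; lra|split; [eapply Rlt_le_trans; [apply Rlt_0_1|apply Rmax_l]|]].
intros a b Ha Hb.
assert (Ha1' : a < 1) by (eapply Rlt_le_trans; [apply Ha|apply Rmin_l]).
assert (Haa0 : a < a0) by (eapply Rlt_le_trans; [apply Ha|eapply Rle_trans; [apply Rmin_r|apply Rmin_l]]).
assert (Haa1 : a < a1) by (eapply Rlt_le_trans; [apply Ha|eapply Rle_trans; [apply Rmin_r|apply Rmin_r]]).
assert (Hb1' : 1 < b) by (eapply Rle_lt_trans; [apply Rmax_l|exact Hb]).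
assert (Hbb0 : b0 < b) by (eapply Rle_lt_trans; [|exact Hb]; eapply Rle_trans; [apply Rmax_l|apply Rmax_r]).
assert (Hbb1 : b1 < b) by (eapply Rle_lt_trans; [|exact Hb]; eapply Rle_trans; [apply Rmax_r|apply Rmax_r]).
assert (Eparts : x * RInt (gamma_fun x) a b - RInt (gamma_fun (x + 1)) a b = Rpower b x * exp (- b) - Rpower a x * exp (- a)).
{ rewrite <- (RInt_derive_R (fun t => Rpower t x * exp (- t)) (fun t => x * gamma_fun x t - gamma_fun (x + 1) t)).
  - rewrite <- RInt_Rscal by (apply ex_RInt_gamma; lra).
    symmetry; apply (RInt_minus (fun t => x * gamma_fun x t) (gamma_fun (x + 1))).
    + exact (ex_RInt_scal _ a b x (ex_RInt_gamma x a b ltac:(lra) ltac:(lra))).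
    + apply ex_RInt_gamma; lra.
  - intros t Ht; rewrite Rmin_left, Rmax_right in Ht by lra.
    replace (x * gamma_fun x t - gamma_fun (x + 1) t) with (x * Rpower t (x - 1) * exp (- t) + Rpower t x * - exp (- t)).
    + apply (is_derive_Rmult (fun t => Rpower t x) (fun t => exp (- t))); [apply Rpower_derive; lra|].
      auto_derive; [trivial|ring].
    + unfold gamma_fun; replace (x + 1 - 1) with x by ring; ring.
  - intros t Ht; rewrite Rmin_left, Rmax_right in Ht by lra.
    apply (continuous_minus (fun t => x * gamma_fun x t) (gamma_fun (x + 1))); [|apply gamma_fun_continuous; lra].
    apply (continuous_Rmult (fun _ => x) (gamma_fun x)); [apply continuous_const|apply gamma_fun_continuous; lra]. }
specialize (Hab a b ltac:(lra) Hbb0); specialize (Hpa a ltac:(lra)); specialize (Hpb b Hbb1).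
assert (Hpa0 : 0 < Rpower a x * exp (- a) <= Rpower a x).
{ split; [apply Rmult_lt_0_compat; apply exp_pos|]. rewrite <- (Rmult_1_r (Rpower a x)) at 2.
  apply Rmult_le_compat_l; [left; apply exp_pos|]; rewrite <- exp_0; apply exp_mono; lra. }
assert (Hpb0 : 0 < Rpower b x * exp (- b)) by (apply Rmult_lt_0_compat; apply exp_pos).
apply Rabs_def2 in Hab; destruct Hab as [Hab1 Hab2].
assert (Hm1 : x * (RInt (gamma_fun x) a b - l) < x * (eps / (3 * x))) by (apply Rmult_lt_compat_l; assumption).
assert (Hm2 : x * - (eps / (3 * x)) < x * (RInt (gamma_fun x) a b - l)) by (apply Rmult_lt_compat_l; assumption).
replace (x * (eps / (3 * x))) with (eps / 3) in Hm1 by (field; lra).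
replace (x * - (eps / (3 * x))) with (- (eps / 3)) in Hm2 by (field; lra).
apply Rabs_def1; lra.
Qed.

(* Bernoulli's inequality, the pointwise substitute for the log-convexity of Gamma. *)
Lemma exp_convex_le y v : 0 <= y <= 1 -> exp (y * v) <= (1 - y) + y * exp v.
Proof.
intros Hy.
assert (H1 : exp (y * v) * (1 - y * v) <= 1).
{ replace 1 with (exp (y * v) * exp (- (y * v))) at 2 by (rewrite <- exp_plus, Rplus_opp_r; apply exp_0).
  apply Rmult_le_compat_l; [left; apply exp_pos|]; pose proof (exp_ineq1_le (- (y * v))); lra. }
assert (H2 : exp (y * v) * (1 + (v - y * v)) <= exp v).
{ replace (exp v) with (exp (y * v) * exp (v - y * v)) by (rewrite <- exp_plus; f_equal; ring).
  apply Rmult_le_compat_l; [left; apply exp_pos|apply exp_ineq1_le]. }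
nra.
Qed.

Lemma Rpower_bernoulli y c t : 0 <= y <= 1 -> 0 < c -> 0 < t -> Rpower t y <= Rpower c y * ((1 - y) + y * (t / c)).
Proof.
intros Hy Hc Ht; pose proof (exp_convex_le y (ln (t / c)) Hy) as H.
rewrite exp_ln in H by (apply Rdiv_lt_0_compat; assumption).
rewrite ln_div in H by assumption.
unfold Rpower; replace (y * ln t) with (y * ln c + y * (ln t - ln c)) by ring; rewrite exp_plus.
apply Rmult_le_compat_l; [left; apply exp_pos|exact H].
Qed.

(** Integration of [Rpower_bernoulli] against the density of index [c]; its linear term gives
    [Gamma (c + 1) = c Gamma c], so the two parts recombine to one multiple of [l]. *)
Lemma is_Gamma_le c y l l' : 0 < c -> 0 <= y <= 1 -> is_Gamma c l -> is_Gamma (c + y) l' -> l' <= Rpower c y * l.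
Proof.
intros Hc Hy Hl Hl'.
pose proof (is_Gamma_step c l Hc Hl) as Hl1.
apply le_epsilon; intros eps He.
set (P := Rpower c y). assert (HP : 0 < P) by apply exp_pos.
assert (HPc : 0 < P / c) by (apply Rdiv_lt_0_compat; assumption).
set (e1 := eps / (1 + P + P / c)). assert (He1 : 0 < e1) by (apply Rdiv_lt_0_compat; lra).
destruct (Hl e1 He1) as (a0 & b0 & Ha0 & Hb0 & H0).
destruct (Hl1 e1 He1) as (a1 & b1 & Ha1 & Hb1 & H1).
destruct (Hl' e1 He1) as (a2 & b2 & Ha2 & Hb2 & H2).
set (am := Rmin 1 (Rmin a0 (Rmin a1 a2))). assert (Ham : 0 < am) by (repeat apply Rmin_glb_lt; lra).
set (a := am / 2); set (b := Rmax 1 (Rmax b0 (Rmax b1 b2)) + 1).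
assert (B1 : am <= 1) by apply Rmin_l.
assert (B2 : am <= a0) by (eapply Rle_trans; [apply Rmin_r|apply Rmin_l]).
assert (B3 : am <= a1) by (eapply Rle_trans; [apply Rmin_r|eapply Rle_trans; [apply Rmin_r|apply Rmin_l]]).
assert (B4 : am <= a2) by (eapply Rle_trans; [apply Rmin_r|eapply Rle_trans; [apply Rmin_r|apply Rmin_r]]).
assert (D1 : 1 < b) by (unfold b; pose proof (Rmax_l 1 (Rmax b0 (Rmax b1 b2))); lra).
assert (D2 : b0 < b) by (unfold b; pose proof (Rmax_r 1 (Rmax b0 (Rmax b1 b2))); pose proof (Rmax_l b0 (Rmax b1 b2)); lra).
assert (D3 : b1 < b) by (unfold b; pose proof (Rmax_r 1 (Rmax b0 (Rmax b1 b2))); pose proof (Rmax_r b0 (Rmax b1 b2)); pose proof (Rmax_l b1 b2); lra).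
assert (D4 : b2 < b) by (unfold b; pose proof (Rmax_r 1 (Rmax b0 (Rmax b1 b2))); pose proof (Rmax_r b0 (Rmax b1 b2)); pose proof (Rmax_r b1 b2); lra).
assert (Ha : 0 < a < am) by (unfold a; lra).
specialize (H0 a b ltac:(lra) D2); specialize (H1 a b ltac:(lra) D3); specialize (H2 a b ltac:(lra) D4).
assert (Hint : RInt (gamma_fun (c + y)) a b <= P * (1 - y) * RInt (gamma_fun c) a b + P * y / c * RInt (gamma_fun (c + 1)) a b).
{ assert (Hex : forall x, ex_RInt (gamma_fun x) a b) by (intros; apply ex_RInt_gamma; lra).
  rewrite <- (RInt_Rscal (gamma_fun c)), <- (RInt_Rscal (gamma_fun (c + 1))) by apply Hex.
  replace (RInt (fun x => P * (1 - y) * gamma_fun c x) a b + RInt (fun x => P * y / c * gamma_fun (c + 1) x) a b)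
   with (RInt (fun x => P * (1 - y) * gamma_fun c x + P * y / c * gamma_fun (c + 1) x) a b)
   by exact (RInt_plus _ _ a b (ex_RInt_scal _ a b (P * (1 - y)) (Hex c)) (ex_RInt_scal _ a b (P * y / c) (Hex (c + 1)))).
  apply RInt_le; [lra|apply Hex| |].
  - exact (ex_RInt_plus _ _ a b (ex_RInt_scal _ a b (P * (1 - y)) (Hex c)) (ex_RInt_scal _ a b (P * y / c) (Hex (c + 1)))).
  - intros t Ht; unfold gamma_fun.
    replace (c + y - 1) with ((c - 1) + y) by ring; replace (c + 1 - 1) with ((c - 1) + 1) by ring.
    rewrite !Rpower_plus, Rpower_1 by lra.
    pose proof (Rpower_bernoulli y c t Hy Hc ltac:(lra)) as Hb; fold P in Hb.
    replace (P * (1 - y) * (Rpower t (c - 1) * exp (- t)) + P * y / c * (Rpower t (c - 1) * t * exp (- t)))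
     with (Rpower t (c - 1) * (P * ((1 - y) + y * (t / c))) * exp (- t)) by (field; lra).
    apply Rmult_le_compat_r; [left; apply exp_pos|]; apply Rmult_le_compat_l; [left; apply exp_pos|exact Hb]. }
apply Rabs_def2 in H0; apply Rabs_def2 in H1; apply Rabs_def2 in H2.
assert (HPy : 0 <= P * (1 - y)) by (apply Rmult_le_pos; lra).
assert (HPy2 : 0 <= P * y / c) by (apply Rmult_le_pos; [apply Rmult_le_pos; lra|left; apply Rinv_0_lt_compat; lra]).
assert (G1 : P * (1 - y) * RInt (gamma_fun c) a b <= P * (1 - y) * (l + e1)) by (apply Rmult_le_compat_l; lra).
assert (G2 : P * y / c * RInt (gamma_fun (c + 1)) a b <= P * y / c * (c * l + e1)) by (apply Rmult_le_compat_l; lra).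
replace (P * y / c * (c * l + e1)) with (P * y * l + P / c * y * e1) in G2 by (field; lra).
assert (Ee : e1 * (1 + P + P / c) = eps) by (unfold e1; field; split; [lra|]; apply Rgt_not_eq; nra).
assert (P * (1 - y) * e1 <= P * e1) by (apply Rmult_le_compat_r; nra).
assert (P / c * y * e1 <= P / c * e1) by (apply Rmult_le_compat_r; nra).
lra.
Qed.

Lemma is_Gamma_1 : is_Gamma 1 1.
Proof.
intros eps He; exists (Rmin 1 (eps / 2)), (2 / eps + 1).
assert (H2e : 0 < 2 / eps) by (apply Rdiv_lt_0_compat; lra).
split; [apply Rmin_glb_lt; lra|split; [lra|]]; intros a b Ha Hb.
assert (Ha1 : a < 1) by (eapply Rlt_le_trans; [apply Ha|apply Rmin_l]).
assert (Ha2 : a < eps / 2) by (eapply Rlt_le_trans; [apply Ha|apply Rmin_r]).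
replace (RInt (gamma_fun 1) a b) with (- exp (- b) - - exp (- a)).
- assert (0 < exp (- b) < eps / 2).
  { split; [apply exp_pos|]; rewrite exp_Ropp; apply Rle_lt_trans with (/ b).
    - apply Rinv_le_contravar; [lra|]; pose proof (exp_ineq1_le b); lra.
    - apply Rmult_lt_reg_r with b; [lra|]; rewrite Rinv_l by lra.
      apply Rlt_le_trans with (eps / 2 * (2 / eps + 1)); [|apply Rmult_le_compat_l; lra].
      replace (eps / 2 * (2 / eps + 1)) with (1 + eps / 2) by (field; lra); lra. }
  assert (1 - a <= exp (- a)) by (pose proof (exp_ineq1_le (- a)); lra).
  assert (exp (- a) <= 1) by (rewrite <- exp_0; apply exp_mono; lra).
  apply Rabs_def1; lra.
- rewrite <- (RInt_derive_R (fun t => - exp (- t)) (fun t => exp (- t))).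
  + apply RInt_ext; intros t _; unfold gamma_fun, Rpower.
    replace ((1 - 1) * ln t) with 0 by ring; rewrite exp_0; lra.
  + intros t _; auto_derive; [trivial|ring].
  + intros t _; apply @ex_derive_continuous; auto_derive; trivial.
Qed.

(** The substitution [t = v^2] reduces it to the Gaussian integral. *)
Lemma is_Gamma_half : is_Gamma (1 / 2) (sqrt PI).
Proof.
intros eps He; pose proof PI_RGT_0 as Hpi; assert (HsP : 0 < sqrt PI) by (apply sqrt_lt_R0; lra).
exists (Rmin 1 (eps / 4 * (eps / 4))), (4 * sqrt PI / eps + 1).
assert (H4 : 0 < 4 * sqrt PI / eps) by (apply Rdiv_lt_0_compat; lra).
split; [apply Rmin_glb_lt; nra|split; [lra|]]; intros a b Ha Hb.
assert (Ha1 : a < 1) by (eapply Rlt_le_trans; [apply Ha|apply Rmin_l]).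
assert (Ha2 : a < eps / 4 * (eps / 4)) by (eapply Rlt_le_trans; [apply Ha|apply Rmin_r]).
set (f := fun v => exp (- (1 * (v * v)))).
assert (Hf : forall v, continuous f v) by (intros v; apply @ex_derive_continuous; unfold f; auto_derive; trivial).
assert (Hex : forall u v, ex_RInt f u v) by (intros; apply @ex_RInt_continuous; intros; apply Hf).
assert (Hsa : 0 < sqrt a) by (apply sqrt_lt_R0; lra).
assert (Hsb : 0 < sqrt b) by (apply sqrt_lt_R0; lra).
assert (E : RInt (gamma_fun (1 / 2)) a b = 2 * RInt f (sqrt a) (sqrt b)).
{ assert (Hcomp : is_RInt (fun t => scal (/ (2 * sqrt t)) (f (sqrt t))) a b (RInt f (sqrt a) (sqrt b))).
  { apply (is_RInt_comp f sqrt (fun t => / (2 * sqrt t))); intros t Ht; rewrite Rmin_left, Rmax_right in Ht by lra; [apply Hf|].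
    split.
    - apply is_derive_Reals, derivable_pt_lim_sqrt; lra.
    - apply @ex_derive_continuous; assert (0 < sqrt t) by (apply sqrt_lt_R0; lra); auto_derive; repeat split; lra. }
  rewrite <- (is_RInt_unique _ _ _ _ Hcomp).
  rewrite <- RInt_Rscal by (eexists; exact Hcomp).
  apply RInt_ext; intros t Ht; rewrite Rmin_left, Rmax_right in Ht by lra.
  assert (0 < sqrt t) by (apply sqrt_lt_R0; lra).
  unfold gamma_fun, f, scal; simpl; unfold mult; simpl; rewrite Rmult_1_l, sqrt_sqrt by lra.
  replace (1 / 2 - 1) with (- / 2) by field; rewrite Rpower_Ropp, Rpower_sqrt by lra; field; lra. }
rewrite E.
rewrite <- (RInt_Chasles f (sqrt a) 0 (sqrt b)) by apply Hex.
rewrite <- (opp_RInt_swap f 0 (sqrt a)) by apply Hex.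
unfold plus, opp; simpl.
pose proof (gauss_real_limit 1 (sqrt b) Rlt_0_1 Hsb) as HG; fold f in HG.
rewrite sqrt_1, Rmult_1_l, Rmult_1_l, sqrt_sqrt in HG by lra.
assert (HE : 0 <= RInt f 0 (sqrt a) <= sqrt a).
{ split; [apply RInt_nonneg; [lra|apply Hex|intros; left; apply exp_pos]|].
  replace (sqrt a) with (RInt (fun _ => 1) 0 (sqrt a)) at 2 by (rewrite RInt_const; unfold scal; simpl; unfold mult; simpl; ring).
  apply RInt_le; [lra|apply Hex|apply ex_RInt_const|].
  intros v _; unfold f; apply Rle_trans with (exp 0); [apply exp_mono; nra|rewrite exp_0; lra]. }
assert (Hsa2 : sqrt a < eps / 4).
{ rewrite <- (sqrt_Rsqr (eps / 4)) by lra; apply sqrt_lt_1_alt; unfold Rsqr; lra. }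
assert (Heb : sqrt PI / 2 * exp (- b) <= eps / 8).
{ assert (exp (- b) <= / b).
  { rewrite exp_Ropp; apply Rinv_le_contravar; [lra|]; pose proof (exp_ineq1_le b); lra. }
  apply Rle_trans with (sqrt PI / 2 * / b); [apply Rmult_le_compat_l; lra|].
  apply Rmult_le_reg_r with b; [lra|]; replace (sqrt PI / 2 * / b * b) with (sqrt PI / 2) by (field; lra).
  apply Rle_trans with (eps / 8 * (4 * sqrt PI / eps)); [right; field; lra|apply Rmult_le_compat_l; lra]. }
apply Rabs_le_between in HG; apply Rabs_def1; lra.
Qed.

(** * The logarithm at [w = 1] for real [s], a deformation of the logarithm of Gamma *)

Definition real_log (x s : R) : R := Re (sector_log 1 x (RtoC s)).

Definition real_term (x s : R) (r : nat) : R :=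
  exp (- (x * (INR (S r) * s))) / (INR (S r) * (1 - exp (- (INR (S r) * s)))).

Lemma one_minus_exp_pos v : 0 < v -> 0 < 1 - exp (- v).
Proof. intros H; assert (exp (- v) < 1) by (rewrite <- exp_0; apply exp_increasing; lra); lra. Qed.

Lemma sector_term_real x s r : 0 < s -> sector_term 1 x (RtoC s) r = RtoC (real_term x s r).
Proof.
intros Hs; unfold sector_term, real_term; pose proof (INR_S_pos r).
assert (0 < INR (S r) * s) by (apply Rmult_lt_0_compat; assumption).
pose proof (one_minus_exp_pos (INR (S r) * s) H0).
rewrite Cpow_1_l, <- !RtoC_mult, <- !RtoC_opp, !Cexp_RtoC, <- RtoC_minus.
rewrite <- !RtoC_div, <- RtoC_mult by lra; f_equal; field; split; lra.
Qed.

Lemma is_series_real_log x s : 0 < x -> 0 < s -> is_series (real_term x s) (real_log x s).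
Proof.
intros Hx Hs.
assert (H1 : Cmod 1 <= 1) by (rewrite Cmod_1; lra).
destruct (is_Cseries_sector_log 1 x (RtoC s) H1 Hx Hs) as [H _].
eapply is_series_ext; [|exact H]; intros r; cbv beta; rewrite sector_term_real by exact Hs; reflexivity.
Qed.

Lemma sector_log_real x s : 0 < x -> 0 < s -> sector_log 1 x (RtoC s) = RtoC (real_log x s).
Proof.
intros Hx Hs; apply is_Cseries_unique.
apply is_Cseries_ext with (fun r => RtoC (real_term x s r)); [intros r; symmetry; apply sector_term_real, Hs|].
apply is_Cseries_RtoC, is_series_real_log; assumption.
Qed.

Lemma Clog1m_real v : v < 1 -> Clog1m (RtoC v) = RtoC (ln (1 - v)).
Proof.
intros Hv; unfold Clog1m; rewrite <- RtoC_minus, Cmod_RtoC_pos by lra.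
rewrite Im_RtoC; unfold Rdiv; rewrite Rmult_0_l, atan_0; reflexivity.
Qed.

Lemma is_series_ln v : 0 <= v < 1 -> is_series (fun r => v ^ S r / INR (S r)) (- ln (1 - v)).
Proof.
intros Hv.
assert (H1 : Cmod (RtoC v) <= 1) by (rewrite Cmod_RtoC_pos; lra).
assert (H2 : RtoC v <> 1%C) by (intros E; apply RtoC_inj in E; lra).
destruct (is_Cseries_log (RtoC v) H1 H2) as [H _].
rewrite Clog1m_real in H by lra.
eapply is_series_ext; [|exact H]; intros r; unfold logterm.
rewrite <- RtoC_Cpow, <- RtoC_div by apply INR_S_neq0; reflexivity.
Qed.

Lemma is_series_unicity (a : nat -> R) l l' : is_series a l -> is_series a l' -> l = l'.
Proof. intros H1 H2; rewrite <- (is_series_unique _ _ H1); apply is_series_unique, H2. Qed.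

(** The analogue of [Gamma (c + 1) = c Gamma c], with [1 - e^(-c s)] in the role of [c]: the two
    series differ by a logarithm series. *)
Lemma real_log_step c s : 0 < c -> 0 < s -> real_log (c + 1) s = real_log c s + ln (1 - exp (- (c * s))).
Proof.
intros Hc Hs; assert (Hcs : 0 < c * s) by (apply Rmult_lt_0_compat; assumption).
pose proof (one_minus_exp_pos (c * s) Hcs) as Hp; pose proof (exp_pos (- (c * s))) as He.
apply (is_series_unicity (real_term (c + 1) s)); [apply is_series_real_log; lra|].
replace (real_log c s + ln (1 - exp (- (c * s)))) with (real_log c s - - ln (1 - exp (- (c * s)))) by ring.
apply is_series_ext with (fun r => real_term c s r - exp (- (c * s)) ^ S r / INR (S r)).
2:{ exact (is_series_minus _ _ _ _ (is_series_real_log c s Hc Hs) (is_series_ln (exp (- (c * s))) ltac:(lra))). }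
intros r; unfold real_term; pose proof (INR_S_pos r).
assert (H0 : 0 < INR (S r) * s) by (apply Rmult_lt_0_compat; assumption).
pose proof (one_minus_exp_pos (INR (S r) * s) H0) as Hd.
rewrite <- Rpower_pow by exact He; unfold Rpower; rewrite ln_exp.
replace (INR (S r) * - (c * s)) with (- (c * (INR (S r) * s))) by ring.
replace (- ((c + 1) * (INR (S r) * s))) with (- (c * (INR (S r) * s)) + - (INR (S r) * s)) by ring.
rewrite exp_plus.
change (exp (- (c * (INR (S r) * s))) / (INR (S r) * (1 - exp (- (INR (S r) * s)))) - exp (- (c * (INR (S r) * s))) / INR (S r) =
  exp (- (c * (INR (S r) * s))) * exp (- (INR (S r) * s)) / (INR (S r) * (1 - exp (- (INR (S r) * s))))).
field; split; lra.
Qed.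

(** The analogue of [is_Gamma_le]: each term is convex in its index, and the value at [c + 1] is
    known from [real_log_step]. *)
Lemma real_log_le c y s : 0 < c -> 0 <= y <= 1 -> 0 < s ->
  real_log (c + y) s <= real_log c s + y * ln (1 - exp (- (c * s))).
Proof.
intros Hc Hy Hs.
replace (real_log c s + y * ln (1 - exp (- (c * s)))) with ((1 - y) * real_log c s + y * real_log (c + 1) s)
  by (rewrite real_log_step by assumption; ring).
apply (is_series_le (real_term (c + y) s) (fun r => (1 - y) * real_term c s r + y * real_term (c + 1) s r)).
- intros r; unfold real_term; pose proof (INR_S_pos r).
  assert (H0 : 0 < INR (S r) * s) by (apply Rmult_lt_0_compat; assumption).
  pose proof (one_minus_exp_pos (INR (S r) * s) H0) as Hd.
  assert (Hden : 0 < / (INR (S r) * (1 - exp (- (INR (S r) * s))))) by (apply Rinv_0_lt_compat, Rmult_lt_0_compat; assumption).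
  set (v := INR (S r) * s) in *; set (d := INR (S r) * (1 - exp (- v))) in *.
  unfold Rdiv; replace ((1 - y) * (exp (- (c * v)) * / d) + y * (exp (- ((c + 1) * v)) * / d))
    with (((1 - y) * exp (- (c * v)) + y * exp (- ((c + 1) * v))) * / d) by ring.
  apply Rmult_le_compat_r; [lra|].
  replace (- ((c + y) * v)) with (- (c * v) + y * - v) by ring; rewrite exp_plus.
  replace (- ((c + 1) * v)) with (- (c * v) + - v) by ring; rewrite exp_plus.
  pose proof (exp_convex_le y (- v) Hy); pose proof (exp_pos (- (c * v))); nra.
- apply is_series_real_log; lra.
- exact (is_series_plus _ _ _ _ (is_series_scal (1 - y) _ _ (is_series_real_log c s Hc Hs))
    (is_series_scal y _ _ (is_series_real_log (c + 1) s ltac:(lra) Hs))).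
Qed.

(** The factors [1 - e^(-s m)], [m >= 1], are split into odd and even [m]. *)
Lemma real_log_duplication s : 0 < s -> real_log (1 / 2) (2 * s) + real_log 1 (2 * s) = real_log 1 s.
Proof.
intros Hs; apply (is_series_unicity (real_term 1 s)); [|apply is_series_real_log; lra].
apply is_series_ext with (fun r => real_term (1 / 2) (2 * s) r + real_term 1 (2 * s) r).
2:{ exact (is_series_plus _ _ _ _ (is_series_real_log (1 / 2) (2 * s) ltac:(lra) ltac:(lra)) (is_series_real_log 1 (2 * s) ltac:(lra) ltac:(lra))). }
intros r; unfold real_term; pose proof (INR_S_pos r); set (k := INR (S r)) in *.
assert (H0 : 0 < k * s) by (apply Rmult_lt_0_compat; assumption).
pose proof (one_minus_exp_pos (k * s) H0) as Hd; pose proof (exp_pos (- (k * s))) as He.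
replace (- (1 / 2 * (k * (2 * s)))) with (- (k * s)) by field.
replace (- (1 * (k * (2 * s)))) with (- (k * s) + - (k * s)) by ring.
replace (- (k * (2 * s))) with (- (k * s) + - (k * s)) by ring.
replace (- (1 * (k * s))) with (- (k * s)) by ring.
rewrite exp_plus; set (e := exp (- (k * s))) in *.
change (e / (k * (1 - e * e)) + e * e / (k * (1 - e * e)) = e / (k * (1 - e))).
field; repeat split; apply Rgt_not_eq; nra.
Qed.

Lemma ln_one_minus_exp s c : 0 < s -> 0 < c ->
  ln c - s * c <= ln ((1 - exp (- (c * s))) / s) <= ln c.
Proof.
intros Hs Hc; set (v := c * s).
assert (Hv : 0 < v) by (apply Rmult_lt_0_compat; assumption).
pose proof (one_minus_exp_pos v Hv) as Hp.
assert (H1 : 1 - exp (- v) <= v) by (pose proof (exp_ineq1_le (- v)); lra).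
assert (H2 : v / (1 + v) <= 1 - exp (- v)).
{ assert (exp (- v) <= / (1 + v)).
  { rewrite exp_Ropp; apply Rinv_le_contravar; [lra|apply exp_ineq1_le]. }
  replace (v / (1 + v)) with (1 - / (1 + v)) by (field; lra); lra. }
split.
- apply Rle_trans with (ln (c / (1 + v))).
  + rewrite ln_div by lra. assert (ln (1 + v) <= v); [|unfold v in *; lra].
    rewrite <- (ln_exp v) at 2; apply ln_le; [lra|apply exp_ineq1_le].
  + apply ln_le; [apply Rdiv_lt_0_compat; lra|].
    apply Rmult_le_reg_r with s; [exact Hs|]; replace ((1 - exp (- v)) / s * s) with (1 - exp (- v)) by (field; lra).
    replace (c / (1 + v) * s) with (v / (1 + v)) by (unfold v; field; unfold v in *; lra). exact H2.
- apply ln_le; [apply Rdiv_lt_0_compat; lra|]; apply Rmult_le_reg_r with s; [exact Hs|].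
  replace ((1 - exp (- v)) / s * s) with (1 - exp (- v)) by (field; lra); exact H1.
Qed.

Lemma real_log_iter c s N : 0 < c -> 0 < s ->
  real_log (c + INR N) s = real_log c s + Rsumn (fun l => ln ((1 - exp (- ((c + INR l) * s))) / s)) N + INR N * ln s.
Proof.
intros Hc Hs; induction N as [|N IH]; [simpl; rewrite Rplus_0_r; ring|].
pose proof (pos_INR N).
rewrite S_INR; replace (c + (INR N + 1)) with (c + INR N + 1) by ring.
rewrite real_log_step, IH by lra; cbn [Rsumn].
assert (Hv : 0 < (c + INR N) * s) by (apply Rmult_lt_0_compat; lra).
pose proof (one_minus_exp_pos _ Hv).
rewrite (ln_div (1 - exp (- ((c + INR N) * s)))) by lra; ring.
Qed.

Lemma is_Gamma_iter x l N : 0 < x -> 0 < l -> is_Gamma x l ->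
  exists lN, 0 < lN /\ is_Gamma (x + INR N) lN /\ ln lN = ln l + Rsumn (fun i => ln (x + INR i)) N.
Proof.
intros Hx Hl H; induction N as [|N (lN & H1 & H2 & H3)].
- exists l; simpl; rewrite !Rplus_0_r; repeat split; try assumption; ring.
- pose proof (pos_INR N); exists ((x + INR N) * lN).
  split; [apply Rmult_lt_0_compat; lra|split].
  + rewrite S_INR; replace (x + (INR N + 1)) with (x + INR N + 1) by ring; apply is_Gamma_step; [lra|exact H2].
  + cbn [Rsumn]; rewrite ln_mult, H3 by lra; ring.
Qed.

Lemma Rsumn_minus f g n : Rsumn f n - Rsumn g n = Rsumn (fun i => f i - g i) n.
Proof. induction n as [|n IH]; cbn [Rsumn]; [|rewrite <- IH]; ring. Qed.

Lemma ln_ratio_le a b : 0 < a -> a <= b -> ln b - ln a <= (b - a) / a.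
Proof.
intros Ha Hab; rewrite <- ln_div by lra.
replace (b / a) with (1 + (b - a) / a) by (field; lra).
rewrite <- (ln_exp ((b - a) / a)) at 2; apply ln_le; [|apply exp_ineq1_le].
assert (0 <= (b - a) / a); [|lra]; apply Rle_div_r; lra.
Qed.

(* As in the Bohr-Mollerup theorem, log-convexity in [x] together with the
   functional equation determines the limit. *)
Lemma real_log_gamma x l eps : 0 < x < 1 -> 0 < l -> is_Gamma x l -> 0 < eps ->
  exists s0, 0 < s0 /\ forall s, 0 < s < s0 ->
  Rabs (real_log x s - real_log 1 s - (x - 1) * ln s - ln l) <= eps.
Proof.
intros Hx Hl HG Heps.
(* The shift is fixed before [s]. It bounds [ln ((1 + m + x) / (1 + m))], the width of the squeeze
   between the two convexity inequalities, by [eps / 2]. *)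
destruct (INR_unbounded (2 / eps)) as (M & HM).
set (m := INR M) in *.
assert (H2e : 0 < 2 / eps) by (apply Rdiv_lt_0_compat; lra).
assert (Hm : 0 < m) by lra.
assert (Hme : / (m + 1) <= eps / 2).
{ replace (eps / 2) with (/ (2 / eps)) by (field; lra); apply Rinv_le_contravar; lra. }
set (P1 := Rsumn (fun i => ln (1 + INR i)) (S M)).
set (Px := Rsumn (fun i => ln (x + INR i)) (S M)).
destruct (is_Gamma_iter 1 1 M Rlt_0_1 Rlt_0_1 is_Gamma_1) as (g1 & Hg1 & HG1 & Hlg1).
destruct (is_Gamma_iter 1 1 (S M) Rlt_0_1 Rlt_0_1 is_Gamma_1) as (g2 & Hg2 & HG2 & Hlg2).
destruct (is_Gamma_iter x l (S M) (proj1 Hx) Hl HG) as (gx & Hgx & HGx & Hlgx).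
rewrite ln_1, Rplus_0_l in Hlg1, Hlg2; fold P1 in Hlg2; fold Px in Hlgx.
assert (Hlg1' : ln g1 = P1 - ln (1 + m)) by (unfold P1; cbn [Rsumn]; rewrite Hlg1; unfold m; ring).
rewrite S_INR in HG2, HGx; fold m in HG1, HG2, HGx.
pose proof (ln_ratio_le (1 + m) (1 + m + x) ltac:(lra) ltac:(lra)) as Hr.
assert (Hr2 : (1 - x) * (ln (1 + m + x) - ln (1 + m)) <= eps / 2).
{ assert (Hr3 : (1 + m + x - (1 + m)) / (1 + m) <= / (m + 1)).
  { replace ((1 + m + x - (1 + m)) / (1 + m)) with (x * / (m + 1)) by (field; lra).
    assert (0 < / (m + 1)) by (apply Rinv_0_lt_compat; lra); nra. }
  assert (0 <= ln (1 + m + x) - ln (1 + m)) by (assert (ln (1 + m) <= ln (1 + m + x)) by (apply ln_le; lra); lra).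
  nra. }
assert (HU : P1 - ln (1 + m) + x * ln (1 + m) - Px <= ln l + eps / 2).
{ assert (H := is_Gamma_le (1 + m + x) (1 - x) gx g2 ltac:(lra) ltac:(lra)).
  replace (1 + m + x + (1 - x)) with (1 + (m + 1)) in H by ring; replace (1 + m + x) with (x + (m + 1)) in H by ring.
  specialize (H HGx HG2); apply ln_le in H; [|exact Hg2].
  rewrite ln_mult, Hlg2, Hlgx in H by (try assumption; apply exp_pos).
  unfold Rpower in H; rewrite ln_exp in H; replace (x + (m + 1)) with (1 + m + x) in H by ring; lra. }
assert (HL : ln l - eps / 2 <= P1 - Px - (1 - x) * ln (1 + m + x)).
{ assert (H := is_Gamma_le (1 + m) x g1 gx ltac:(lra) ltac:(lra)).
  replace (1 + m + x) with (x + (m + 1)) in H by ring.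
  specialize (H HG1 HGx); apply ln_le in H; [|exact Hgx].
  rewrite ln_mult, Hlg1', Hlgx in H by (try assumption; apply exp_pos).
  unfold Rpower in H; rewrite ln_exp in H; lra. }
(* [Cn] collects the errors in replacing [(1 - e^(-c s)) / s] by [c] for the shifted arguments; all
   of them are linear in [s]. *)
set (Cn := (m + 1) * (1 + m) + 2 * (m + 2)).
assert (HCn : 0 < Cn) by (unfold Cn; nra).
exists (eps / 2 / Cn); split; [apply Rdiv_lt_0_compat; lra|]; intros s Hs.
assert (HsC : s * Cn <= eps / 2).
{ destruct Hs as (_ & Hs); apply Rlt_le, Rmult_lt_reg_r with (/ Cn); [apply Rinv_0_lt_compat, HCn|].
  replace (s * Cn * / Cn) with s by (field; lra); exact Hs. }
set (e := fun c => ln ((1 - exp (- (c * s))) / s)).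
assert (He : forall c, 0 < c -> ln c - s * c <= e c <= ln c) by (intros c Hc; apply ln_one_minus_exp; lra).
assert (Hle : forall c, 0 < c -> ln (1 - exp (- (c * s))) = e c + ln s).
{ intros c Hc; unfold e; assert (0 < c * s) by nra; rewrite ln_div by (try apply one_minus_exp_pos; lra); ring. }
set (E1 := Rsumn (fun i => e (1 + INR i)) (S M)); set (Ex := Rsumn (fun i => e (x + INR i)) (S M)).
assert (Hsum : forall c, 0 < c <= 1 ->
  0 <= Rsumn (fun i => ln (c + INR i)) (S M) - Rsumn (fun i => e (c + INR i)) (S M) <= s * ((m + 1) * (1 + m))).
{ intros c Hc; rewrite Rsumn_minus; split.
  - replace 0 with (INR (S M) * 0) by ring; rewrite <- Rsumn_const; apply Rsumn_le; intros i Hi.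
    pose proof (pos_INR i); destruct (He (c + INR i)); lra.
  - replace (s * ((m + 1) * (1 + m))) with (INR (S M) * (s * (1 + m))) by (rewrite S_INR; unfold m; ring).
    rewrite <- Rsumn_const; apply Rsumn_le; intros i Hi.
    assert (INR i <= m) by (apply le_INR; lia).
    pose proof (pos_INR i); destruct (He (c + INR i)); [lra|nra]. }
pose proof (Hsum 1 ltac:(lra)) as Hs1; pose proof (Hsum x ltac:(lra)) as Hsx; fold P1 E1 in Hs1; fold Px Ex in Hsx.
pose proof (real_log_iter 1 s M Rlt_0_1 (proj1 Hs)) as I1.
pose proof (real_log_iter 1 s (S M) Rlt_0_1 (proj1 Hs)) as I2.
pose proof (real_log_iter x s (S M) (proj1 Hx) (proj1 Hs)) as Ix.
change (Rsumn _ (S M)) with E1 in I2; change (Rsumn _ (S M)) with Ex in Ix.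
assert (EE1 : Rsumn (fun i => ln ((1 - exp (- ((1 + INR i) * s))) / s)) M = E1 - e (1 + m)).
{ unfold E1; cbn [Rsumn]; unfold e, m; ring. }
rewrite EE1 in I1.
rewrite S_INR in I2, Ix; fold m in I1, I2, Ix.
pose proof (real_log_le (1 + m) x s ltac:(lra) ltac:(lra) (proj1 Hs)) as LU.
pose proof (real_log_le (1 + m + x) (1 - x) s ltac:(lra) ltac:(lra) (proj1 Hs)) as LL.
rewrite Hle in LU, LL by lra.
replace (1 + m + x + (1 - x)) with (1 + (m + 1)) in LL by ring.
replace (1 + m + x) with (x + (m + 1)) in LU by ring.
replace (real_log (1 + m + x) s) with (real_log (x + (m + 1)) s) in LL by (f_equal; ring).
rewrite I1, Ix in LU; rewrite I2, Ix in LL.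
pose proof (He (1 + m) ltac:(lra)) as E1m; pose proof (He (1 + m + x) ltac:(lra)) as E2m.
assert (Hxe : x * e (1 + m) - e (1 + m) <= x * ln (1 + m) - ln (1 + m) + s * (1 + m)) by nra.
assert (Hxe2 : (1 - x) * e (1 + m + x) <= (1 - x) * ln (1 + m + x)) by (apply Rmult_le_compat_l; lra).
assert (HCs : s * Cn = s * ((m + 1) * (1 + m)) + 2 * (s * (m + 2))) by (unfold Cn; ring).
assert (0 <= s * (m + 2)) by nra. assert (0 <= s * ((m + 1) * (1 + m))) by nra.
assert (s * (1 + m) <= s * (m + 2)) by nra.
apply Rabs_le; split.
- clear LU; lra.
- clear LL; lra.
Qed.


Lemma Li2_1_real : Li2 1 = RtoC (Re (Li2 1)).
Proof.
assert (H1 : Cmod 1 <= 1) by (rewrite Cmod_1; lra).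
destruct (is_Cseries_Li2 1 H1) as [_ H].
apply Ceq_ReIm; [reflexivity|]; rewrite Im_RtoC.
apply (is_series_unicity (fun _ => 0)).
- eapply is_series_ext; [|exact H]; intros r; cbv beta; rewrite Cpow_1_l.
  rewrite <- RtoC_div by (apply pow_nonzero, INR_S_neq0); apply Im_RtoC.
- apply is_series_Rsumn; intros eps He; exists O; intros n _.
  rewrite Rsumn_const, Rmult_0_r, Rminus_0_r, Rabs_R0; exact He.
Qed.

Lemma sector_rem_real x s : 0 < x -> 0 < s ->
  sector_rem 1 x (RtoC s) = RtoC (real_log x s - Re (Li2 1) / s + (1 / 2 - x) * ln (1 - exp (- s))).
Proof.
intros Hx Hs; unfold sector_rem; rewrite sector_log_real, Cmult_1_l by assumption.
rewrite <- RtoC_opp, Cexp_RtoC, Clog1m_real by (pose proof (exp_pos (- s)); pose proof (one_minus_exp_pos s Hs); lra).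
rewrite Li2_1_real at 1; rewrite <- RtoC_div, <- RtoC_minus, <- !RtoC_mult, <- RtoC_plus by lra; reflexivity.
Qed.

Lemma ln_one_minus_exp1 s : 0 < s -> - s <= ln (1 - exp (- s)) - ln s <= 0.
Proof.
intros Hs; pose proof (ln_one_minus_exp s 1 Hs Rlt_0_1) as H.
rewrite Rmult_1_l, ln_1, Rmult_1_r, ln_div in H by (try apply one_minus_exp_pos; lra); lra.
Qed.

(* The defect [p] satisfies [p(s) = 2 p(2s) + o(1)] by the duplication formula
   and is bounded, hence tends to zero. *)
Lemma real_log_one eps : 0 < eps -> exists s0, 0 < s0 /\ forall s, 0 < s < s0 ->
  Rabs (real_log 1 s - Re (Li2 1) / s - ln (s / (2 * PI)) / 2) <= eps.
Proof.
intros Heps; pose proof PI_RGT_0 as Hpi.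
set (li := Re (Li2 1)).
set (p := fun s => real_log 1 s - li / s - ln (s / (2 * PI)) / 2).
assert (Hb : exists K, 0 < K /\ forall s, 0 < s < 1 -> Rabs (p s) <= K).
{ destruct (sector_rem_bounded 1 0 ltac:(lra) ltac:(lra)) as (K & HK & H).
  exists (K + 1 + Rabs (ln (2 * PI))); pose proof (Rabs_pos (ln (2 * PI))); split; [lra|]; intros s Hs.
  assert (H1 : Cmod 1 <= 1) by (rewrite Cmod_1; lra).
  specialize (H 1%C (RtoC s) H1 (proj1 Hs)).
  rewrite Im_RtoC, Rabs_R0, sector_rem_real in H by lra; specialize (H ltac:(lra)); fold li in H.
  rewrite Cmod_R in H; pose proof (ln_one_minus_exp1 s (proj1 Hs)) as H2.
  unfold p; rewrite ln_div by lra.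
  apply Rabs_le_between in H.
  pose proof (Rle_abs (ln (2 * PI))); pose proof (Rle_abs (- ln (2 * PI))); rewrite Rabs_Ropp in *.
  apply Rabs_le; lra. }
destruct Hb as (K & HK & Hb).
destruct (real_log_gamma (1 / 2) (sqrt PI) (eps / 2) ltac:(lra) (sqrt_lt_R0 _ Hpi) is_Gamma_half ltac:(lra)) as (s1 & Hs1 & H1).
set (s0 := Rmin 1 s1); assert (Hs0 : 0 < s0) by (apply Rmin_glb_lt; lra).
assert (Hstep : forall s, 0 < s < s0 -> Rabs (p s) <= Rabs (p (s / 2)) / 2 + eps / 4).
{ intros s Hs; assert (Hss : s < s1) by (eapply Rlt_le_trans; [apply Hs|apply Rmin_r]).
  specialize (H1 s ltac:(lra)).
  pose proof (real_log_duplication (s / 2) ltac:(lra)) as D.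
  replace (2 * (s / 2)) with s in D by field.
  assert (Hlnpi : ln (sqrt PI) = ln PI / 2).
  { rewrite <- (sqrt_sqrt PI) at 2 by lra; rewrite ln_mult by (apply sqrt_lt_R0; lra); lra. }
  rewrite Hlnpi in H1.
  assert (E : p s = p (s / 2) / 2 - (real_log (1 / 2) s - real_log 1 s - (1 / 2 - 1) * ln s - ln PI / 2) / 2).
  { unfold p; rewrite <- D, !ln_div, ln_mult by lra; field; lra. }
  rewrite E; eapply Rle_trans; [apply Rabs_triang|]; rewrite Rabs_Ropp.
  unfold Rdiv; rewrite !Rabs_mult, (Rabs_pos_eq (/ 2)) by lra; unfold Rdiv in H1; lra. }
assert (Hit : forall m s, 0 < s < s0 -> Rabs (p s) <= K / 2 ^ m + eps / 2).
{ induction m as [|m IH]; intros s Hs.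
  - simpl; assert (s < 1) by (eapply Rlt_le_trans; [apply Hs|apply Rmin_l]).
    specialize (Hb s ltac:(lra)); lra.
  - specialize (IH (s / 2) ltac:(lra)); specialize (Hstep s Hs).
    assert (K / 2 ^ S m = K / 2 ^ m / 2) by (simpl; field; apply pow_nonzero; lra); lra. }
destruct (INR_unbounded (2 * K / eps)) as (m & Hm).
exists s0; split; [exact Hs0|]; intros s Hs; fold (p s); specialize (Hit m s Hs).
assert (K / 2 ^ m <= eps / 2); [|lra].
pose proof (poly m 1 Rlt_0_1) as Hp; replace (1 + 1) with 2 in Hp by ring.
assert (0 < 2 ^ m) by (apply pow_lt; lra).
apply Rle_div_l; [assumption|].
assert (2 * K < eps * INR m).
{ apply Rmult_lt_reg_r with (/ eps); [apply Rinv_0_lt_compat, Heps|].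
  replace (eps * INR m * / eps) with (INR m) by (field; lra); exact Hm. }
nra.
Qed.

(** The coefficients of [ln s] cancel: [x - 1] from [real_log_gamma], [1/2] from [real_log_one] and
    [1/2 - x] from the logarithm subtracted in [sector_rem]. *)
Lemma sector_rem_real_limit x l eps : 0 < x < 1 -> 0 < l -> is_Gamma x l -> 0 < eps ->
  exists s0, 0 < s0 /\ forall s, 0 < s < s0 ->
  Cmod (sector_rem 1 x (RtoC s) - RtoC (ln l - ln (2 * PI) / 2))%C <= eps.
Proof.
intros Hx Hl HG Heps; pose proof PI_RGT_0 as Hpi.
destruct (real_log_gamma x l (eps / 3) Hx Hl HG ltac:(lra)) as (s1 & Hs1 & H1).
destruct (real_log_one (eps / 3) ltac:(lra)) as (s2 & Hs2 & H2).
exists (Rmin (eps / 3) (Rmin s1 s2)); split; [repeat apply Rmin_glb_lt; lra|]; intros s (Hs & Hss).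
assert (Ha : s < eps / 3) by (eapply Rlt_le_trans; [apply Hss|apply Rmin_l]).
assert (Hb : s < s1) by (eapply Rlt_le_trans; [apply Hss|eapply Rle_trans; [apply Rmin_r|apply Rmin_l]]).
assert (Hc : s < s2) by (eapply Rlt_le_trans; [apply Hss|eapply Rle_trans; [apply Rmin_r|apply Rmin_r]]).
rewrite sector_rem_real, <- RtoC_minus, Cmod_R by lra.
specialize (H1 s ltac:(lra)); specialize (H2 s ltac:(lra)); pose proof (ln_one_minus_exp1 s Hs) as H3.
rewrite ln_div in H2 by lra.
apply Rabs_le_between in H1; apply Rabs_le_between in H2.
assert (H4 : - s <= (1 / 2 - x) * (ln (1 - exp (- s)) - ln s) <= s) by nra.
apply Rabs_le; lra.
Qed.

(** * Expansion at a root of unity where one factor vanishes *)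

Lemma Clog1m_Cexp_real_part s : 0 < Re s <= 1 -> Rabs (Im s) <= Re s / 4 ->
  Cmod (Clog1m (Cexp (- s)) - RtoC (ln (1 - exp (- Re s))))%C <= 4 * (Rabs (Im s) / Re s).
Proof.
intros Hs Hi; pose proof (one_minus_exp_pos (Re s) (proj1 Hs)) as H1; set (a := Re s) in *; set (y := Im s) in *.
pose proof (exp_pos (- a)) as He; pose proof (Rabs_pos y) as Hy.
assert (H2 : a * exp (- a) <= 1 - exp (- a)).
{ apply Rmult_le_reg_r with (exp a); [apply exp_pos|].
  replace (a * exp (- a) * exp a) with (a * (exp (- a) * exp a)) by ring.
  replace ((1 - exp (- a)) * exp a) with (exp a - exp (- a) * exp a) by ring.
  rewrite <- exp_plus, Rplus_opp_l, exp_0; pose proof (exp_ineq1_le a); lra. }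
rewrite <- Clog1m_real by lra.
assert (Hd : Cmod (Cexp (- s) - RtoC (exp (- a)))%C <= 2 * (exp (- a) * Rabs y)).
{ rewrite <- Cexp_RtoC; eapply Rle_trans; [apply Cexp_diff_le|]; rewrite Re_RtoC.
  assert (E : Cmod (- s - RtoC (- a))%C <= Rabs y).
  { eapply Rle_trans; [apply Cmod_le_ReIm|]; rewrite Re_minus, Im_minus, Re_opp, Im_opp, Re_RtoC, Im_RtoC.
    fold a y; replace (- a - - a) with 0 by ring; rewrite Rabs_R0, Rminus_0_r, Rabs_Ropp; lra. }
  set (m := Cmod _) in *; assert (Hm : exp m <= 2).
  { assert (Hm1 : exp m * (1 - m) <= 1).
    { replace 1 with (exp m * exp (- m)) at 2 by (rewrite <- exp_plus, Rplus_opp_r; apply exp_0).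
      apply Rmult_le_compat_l; [left; apply exp_pos|pose proof (exp_ineq1_le (- m)); lra]. }
    pose proof (exp_pos m); nra. }
  assert (0 <= m) by apply Cmod_ge_0.
  apply Rle_trans with (exp (- a) * (Rabs y * 2)); [|right; ring].
  apply Rmult_le_compat_l; [lra|]; apply Rmult_le_compat; try lra; left; apply exp_pos. }
eapply Rle_trans; [apply Clog1m_lipschitz; rewrite Re_RtoC; [lra|]|].
- eapply Rle_trans; [exact Hd|]; apply Rle_trans with (exp (- a) * a / 2); [nra|lra].
- rewrite Re_RtoC; apply Rle_trans with (2 / (a * exp (- a)) * (2 * (exp (- a) * Rabs y))).
  + apply Rmult_le_compat; try exact Hd; [left; apply Rdiv_lt_0_compat; lra|apply Cmod_ge_0|].
    apply Rmult_le_compat_l; [lra|apply Rinv_le_contravar; [apply Rmult_lt_0_compat; lra|exact H2]].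
  + right; field; lra.
Qed.

Lemma Re_Im_arc_scaled k eta u : Re (RtoC k * arc_point eta 0 u)%C = k * eta /\ Im (RtoC k * arc_point eta 0 u)%C = k * eta * u.
Proof. rewrite Re_mult, Im_mult, Re_RtoC, Im_RtoC; unfold arc_point, Re, Im; cbn [fst snd]; split; ring. Qed.

(** Passing to the real part of the argument costs a multiple of [|u|], in the remainder and in the
    logarithm alike. On the real axis Gamma gives the constant, and [1 - e^(-a)] is replaced by [a],
    which leaves the logarithm of [eta]. *)
Lemma arc_factor_singular z k h j l : (S j < k)%nat -> 
  (z * unit_root k (h * Z.of_nat (S j)))%C = 1%C -> 0 < l -> is_Gamma (INR (S j) / INR k) l ->
  exists K, 0 < K /\ forall eps, 0 < eps -> exists e0, 0 < e0 /\ forall eta, 0 < eta < e0 -> forall u, Rabs u <= 1 / 4 ->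
  Cmod (arc_factor z k h (arc_point eta 0 u) j
    - RtoC (ln l - ln (2 * PI) / 2 + (INR (S j) / INR k - 1 / 2) * ln (INR k * eta)))%C <= eps + K * Rabs u.
Proof.
intros Hj Hw Hl HG.
assert (HIk : 0 < INR k) by (apply lt_0_INR; lia).
assert (Hx : 0 < INR (S j) / INR k < 1).
{ split; [apply Rdiv_lt_0_compat; [apply INR_S_pos|exact HIk]|].
  apply Rlt_div_l; [exact HIk|]; rewrite Rmult_1_l; apply lt_INR, Hj. }
set (x := INR (S j) / INR k) in *.
destruct (sector_rem_real_part x ltac:(lra)) as (K & HK & Hrem).
exists (K + 4); split; [lra|]; intros eps Heps.
destruct (sector_rem_real_limit x l (eps / 2) Hx Hl HG ltac:(lra)) as (s0 & Hs0 & Hlim).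
exists (Rmin 1 (Rmin s0 (eps / 2)) / INR k); split; [apply Rdiv_lt_0_compat; [repeat apply Rmin_glb_lt; lra|exact HIk]|].
intros eta He u Hu.
destruct (Re_Im_arc_scaled (INR k) eta u) as (HR & HI).
unfold arc_factor; rewrite Hw; fold x; set (s := (RtoC (INR k) * arc_point eta 0 u)%C) in *.
set (a := INR k * eta) in *.
assert (Ha0 : 0 < a) by (apply Rmult_lt_0_compat; lra).
assert (Ha : a < Rmin 1 (Rmin s0 (eps / 2))).
{ destruct He as (_ & He); apply Rlt_div_r in He; [|exact HIk]; unfold a; lra. }
assert (Ha1 : a < 1) by (eapply Rlt_le_trans; [exact Ha|apply Rmin_l]).
assert (Ha2 : a < s0) by (eapply Rlt_le_trans; [exact Ha|eapply Rle_trans; [apply Rmin_r|apply Rmin_l]]).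
assert (Ha3 : a < eps / 2) by (eapply Rlt_le_trans; [exact Ha|eapply Rle_trans; [apply Rmin_r|apply Rmin_r]]).
assert (HIs : Rabs (Im s) = a * Rabs u) by (rewrite HI, Rabs_mult, (Rabs_pos_eq a) by lra; reflexivity).
assert (HIr : Rabs (Im s) / Re s = Rabs u) by (rewrite HIs, HR; field; lra).
pose proof (Rabs_pos u) as Hup.
assert (H1 : Cmod 1 <= 1) by (rewrite Cmod_1; lra).
pose proof (Hrem 1%C s H1 ltac:(lra) ltac:(rewrite HIs, HR; nra)) as R1; rewrite HIr, HR in R1.
pose proof (Hlim a ltac:(lra)) as R2.
pose proof (Clog1m_Cexp_real_part s ltac:(lra) ltac:(rewrite HIs, HR; nra)) as R3; rewrite HIr, HR in R3.
pose proof (ln_one_minus_exp1 a Ha0) as R4.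
rewrite Cmult_1_l.
replace (sector_rem 1 x s + RtoC (x - 1 / 2) * Clog1m (Cexp (- s)) - RtoC (ln l - ln (2 * PI) / 2 + (x - 1 / 2) * ln a))%C
  with ((sector_rem 1 x s - sector_rem 1 x (RtoC a)) + (sector_rem 1 x (RtoC a) - RtoC (ln l - ln (2 * PI) / 2))
    + (RtoC (x - 1 / 2) * (Clog1m (Cexp (- s)) - RtoC (ln (1 - exp (- a)))) + RtoC ((x - 1 / 2) * (ln (1 - exp (- a)) - ln a))))%C
  by (rewrite ?RtoC_minus, ?RtoC_plus, ?RtoC_mult, ?RtoC_minus; ring).
assert (B1 : Cmod (RtoC (x - 1 / 2) * (Clog1m (Cexp (- s)) - RtoC (ln (1 - exp (- a)))))%C <= 1 * (4 * Rabs u)).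
{ apply Cmod_mult_le; [rewrite Cmod_R; apply Rabs_le; lra|exact R3]. }
assert (B2 : Cmod (RtoC ((x - 1 / 2) * (ln (1 - exp (- a)) - ln a))) <= a).
{ rewrite Cmod_R; apply Rabs_le; nra. }
eapply Rle_trans; [exact (Cmod_plus_le _ _ _ _ (Cmod_plus_le _ _ _ _ R1 R2) (Cmod_plus_le _ _ _ _ B1 B2))|lra].
Qed.

(** Rests on the default value [ln 0 = 0] and on a zero numerator inside [atan]. *)
Lemma Clog1m_1 : Clog1m 1 = 0%C.
Proof.
unfold Clog1m; replace (1 - 1)%C with (RtoC 0) by ring; rewrite Cmod_0, Im_RtoC; unfold Rdiv; rewrite Rmult_0_l, atan_0.
replace (ln 0) with 0; [reflexivity|]; unfold ln; destruct (Rlt_dec 0 0) as [H|H]; [elim (Rlt_irrefl _ H)|reflexivity].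
Qed.

Lemma Csumn_delta c j0 k : (j0 < k)%nat -> Csumn (fun j => if (j =? j0)%nat then c else RtoC 0) k = c.
Proof.
assert (H0 : forall k, (k <= j0)%nat -> Csumn (fun j => if (j =? j0)%nat then c else RtoC 0) k = RtoC 0).
{ induction k0 as [|k0 IH]; intros H; [reflexivity|]; cbn [Csumn]; rewrite IH by lia.
  destruct (Nat.eqb_spec k0 j0); [lia|ring]. }
induction k as [|k IH]; intros H; [lia|]; cbn [Csumn].
destruct (Nat.eqb_spec k j0); [subst; rewrite H0 by lia; ring|rewrite IH by lia; ring].
Qed.

(* The summand [j = j0] of the exponent of the limit vanishes, since [Clog1m 1] is the junk value 0. *)
Lemma arc_expansion_singular z k h sg j0 l : (S j0 < k)%nat -> Z.gcd h (Z.of_nat k) = 1%Z -> Cmod z = 1 ->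
  (sg * sg)%C = arc_weight z k -> Im sg = 0 ->
  (z * unit_root k (h * Z.of_nat (S j0)))%C = 1%C ->
  (forall j, (j < k)%nat -> j <> j0 -> (z * unit_root k (h * Z.of_nat (S j)))%C <> 1%C) ->
  0 < l -> is_Gamma (INR (S j0) / INR k) l ->
  arc_expansion z k h sg (1 / 2 - INR (S j0) / INR k)
    (Cexp (Csumn (fun j => RtoC (INR (S j) / INR k - 1 / 2) * Clog1m (z * unit_root k (h * Z.of_nat (S j))))%C k
      + RtoC (ln l - ln (2 * PI) / 2 + (INR (S j0) / INR k - 1 / 2) * ln (INR k)))).
Proof.
intros Hj0 Hg Hz Hsg Him Hw0 Hw Hl HG.
assert (HIk : 0 < INR k) by (apply lt_0_INR; lia).
assert (H1k : 1 <= INR k) by (replace 1 with (INR 1) by reflexivity; apply le_INR; lia).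
destruct (arc_factor_singular z k h j0 l Hj0 Hw0 Hl HG) as (K & HK & Hsing).
set (x0 := INR (S j0) / INR k) in *.
set (B := (Csumn (fun j => RtoC (INR (S j) / INR k - 1 / 2) * Clog1m (z * unit_root k (h * Z.of_nat (S j))))%C k
      + RtoC (ln l - ln (2 * PI) / 2 + (x0 - 1 / 2) * ln (INR k)))%C).
set (M := exp (1 + INR k * K)); pose proof (exp_pos (Re B)) as HeB; assert (HM : 0 < M) by apply exp_pos.
exists (1 / 4), (exp (Re B) * M * (INR k * K)); split; [lra|split].
{ repeat apply Rmult_le_pos; lra. }
intros eps Heps; replace (Im sg / Re sg) with 0 by (rewrite Him; unfold Rdiv; ring).
set (del := Rmin 1 (eps / (exp (Re B) * M))).
assert (HeM : 0 < exp (Re B) * M) by (apply Rmult_lt_0_compat; assumption).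
assert (Hdel : 0 < del) by (apply Rmin_glb_lt; [lra|apply Rdiv_lt_0_compat; lra]).
(* The targets depend on [eta] through the class [j0]; the contribution [(x0 - 1/2) ln eta] is
   compensated by the power [1/2 - x0] of [eta] in the expansion. *)
set (tgt := fun eta j => (RtoC (INR (S j) / INR k - 1 / 2) * Clog1m (z * unit_root k (h * Z.of_nat (S j)))
   + (if (j =? j0)%nat then RtoC (ln l - ln (2 * PI) / 2 + (x0 - 1 / 2) * ln (INR k * eta)) else RtoC 0))%C).
destruct (finite_small (fun j eta => forall u, Rabs u <= 1 / 4 ->
  Cmod (arc_factor z k h (arc_point eta 0 u) j - tgt eta j)%C <= del / INR k + K * Rabs u) k) as (e0 & He0 & H).
{ intros j Hj; assert (Hdk : 0 < del / INR k) by (apply Rdiv_lt_0_compat; assumption).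
  unfold tgt; destruct (Nat.eqb_spec j j0) as [->|Hne].
  - destruct (Hsing (del / INR k) Hdk) as (e & He & Hs); exists e; split; [exact He|]; intros eta Heta u Hu.
    rewrite Hw0, Clog1m_1, Cmult_0_r, Cplus_0_l; apply Hs; assumption.
  - destruct (arc_factor_regular z k h j 0 (del / INR k) Hj Hz (Hw j Hj Hne) Hdk) as (e & He & Hs).
    exists e; split; [exact He|]; intros eta Heta u Hu; rewrite Cplus_0_r.
    pose proof (Rabs_pos u); specialize (Hs eta Heta u ltac:(lra)); nra. }
exists e0; split; [exact He0|]; intros eta u He Hu.
assert (HRe : 0 < Re (arc_point eta 0 u)) by (unfold arc_point, Re; simpl; lra).
rewrite genfun_arc by (try assumption; first [lia|lra]).
unfold Rpower; rewrite <- Cexp_RtoC, <- Cexp_plus.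
set (X := (Csumn (arc_factor z k h (arc_point eta 0 u)) k + RtoC ((1 / 2 - x0) * ln eta))%C).
assert (Hd : Cmod (X - B)%C <= del + INR k * K * Rabs u).
{ replace (X - B)%C with (Csumn (fun j => arc_factor z k h (arc_point eta 0 u) j - tgt eta j)%C k).
  - replace (del + INR k * K * Rabs u) with (INR k * (del / INR k + K * Rabs u)) by (field; lra).
    rewrite <- Rsumn_const; apply Cmod_Csumn_le; intros j Hj; exact (H eta He j Hj u Hu).
  - rewrite <- Csumn_minus; unfold tgt; rewrite <- Csumn_plus, Csumn_delta by lia.
    unfold X, B; rewrite (ln_mult (INR k) eta) by lra; rewrite ?RtoC_plus, ?RtoC_minus, ?RtoC_mult, ?RtoC_plus, ?RtoC_minus; ring. }
pose proof (Rabs_pos u) as Hu0.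
assert (Hk1 : 0 < INR k * K) by (apply Rmult_lt_0_compat; assumption).
assert (Hd1 : del <= 1) by apply Rmin_l.
assert (Hd2 : del * (exp (Re B) * M) <= eps).
{ apply Rle_trans with (eps / (exp (Re B) * M) * (exp (Re B) * M)); [apply Rmult_le_compat_r; [lra|apply Rmin_r]|right; field; lra]. }
eapply Rle_trans; [apply Cexp_diff_le|].
set (dd := Cmod (X - B)%C) in *; assert (0 <= dd) by apply Cmod_ge_0.
assert (HdM : exp dd <= M) by (apply exp_mono; nra).
apply Rle_trans with (exp (Re B) * ((del + INR k * K * Rabs u) * M)); [|nra].
apply Rmult_le_compat_l; [lra|]; apply Rmult_le_compat; try lra; left; apply exp_pos.
Qed.

(** On the arc the amplitude grows like [eta^(-ka')], hence vanishes in the limit under the larger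
    power [ka]. Arcs of equal height but weaker singularity are discarded in this way. *)
Lemma arc_expansion_subordinate z k h sg ka' ka A : ka' < ka -> arc_expansion z k h sg ka' A -> arc_expansion z k h sg ka 0.
Proof.
intros Hka (d & K & Hd & HK & H).
exists d, K; split; [exact Hd|split; [exact HK|]]; intros eps Heps.
destruct (H 1 Rlt_0_1) as (e0 & He0 & H1).
pose proof (Cmod_ge_0 A) as HA.
destruct (Rpower_at_0 (ka - ka') (eps / (Cmod A + 1 + K)) ltac:(lra) ltac:(apply Rdiv_lt_0_compat; lra)) as (e1 & He1 & H2).
exists (Rmin e0 e1); split; [apply Rmin_glb_lt; assumption|]; intros eta u He Hu.
specialize (H1 eta u (conj (proj1 He) (Rlt_le_trans _ _ _ (proj2 He) (Rmin_l _ _))) Hu).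
specialize (H2 eta (conj (proj1 He) (Rlt_le_trans _ _ _ (proj2 He) (Rmin_r _ _)))).
set (G := (genfun _ _ * Cexp _)%C) in *.
replace ka with (ka' + (ka - ka')) by ring; rewrite Rpower_plus, RtoC_mult.
pose proof (Rabs_pos u) as Hu0.
assert (HX : Cmod (G * RtoC (Rpower eta ka'))%C <= Cmod A + 1 + K).
{ replace (G * RtoC (Rpower eta ka'))%C with ((G * RtoC (Rpower eta ka') - A) + A)%C by ring.
  eapply Rle_trans; [apply Cmod_triangle|]; assert (K * Rabs u <= K * 1) by (apply Rmult_le_compat_l; lra); lra. }
replace (G * (RtoC (Rpower eta ka') * RtoC (Rpower eta (ka - ka'))) - 0)%C
  with (G * RtoC (Rpower eta ka') * RtoC (Rpower eta (ka - ka')))%C by ring.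
rewrite Cmod_mult, (Cmod_RtoC_pos (Rpower eta (ka - ka'))) by (left; apply exp_pos).
apply Rle_trans with ((Cmod A + 1 + K) * (eps / (Cmod A + 1 + K))).
- apply Rmult_le_compat; [apply Cmod_ge_0|left; apply exp_pos|exact HX|lra].
- replace ((Cmod A + 1 + K) * (eps / (Cmod A + 1 + K))) with eps by (field; lra).
  assert (0 <= K * Rabs u) by (apply Rmult_le_pos; lra); lra.
Qed.

(** A fraction not in lowest terms has a smaller denominator after reduction, and the gap covers
    that denominator; the whole arc is then treated as far from every saddle. *)
Lemma arc_nonprimitive z k h (sg : C) ka eps : Cmod z <= 1 -> (0 < k)%nat -> Z.gcd h (Z.of_nat k) <> 1%Z ->
  (sg * sg)%C = arc_weight z k -> 0 < Re sg -> 0 <= ka ->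
  (exists c1, 0 < c1 /\ forall j, (0 < j)%nat -> j <> k -> arc_height z j <= Re sg ^ 2 - c1) -> 0 < eps ->
  exists l0, 0 < l0 /\ forall n, l0 < sqrt (INR n) ->
  Cmod (arc_integral z (Re sg / sqrt (INR n)) n k h * normalizer sg ka (sqrt (INR n)))%C <= eps.
Proof.
intros Hz Hk Hg Hsg HPsi Hka (c1 & Hc1 & Hdom) Heps.
destruct (genfun_far z k sg c1 1 Hz Hk Hsg HPsi Hc1 Hdom Rlt_0_1) as (c & e1 & Hc & He1 & Hfar).
pose proof PI_RGT_0 as Hpi.
destruct (far_negligible z sg ka c (2 * PI) eps Hz HPsi Hka Hc ltac:(lra) Heps) as (l1 & Hl1 & Hneg).
assert (HIk : 1 <= INR k) by (replace 1 with (INR 1) by reflexivity; apply le_INR; lia).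
assert (Hpk : 0 < PI / INR k <= PI).
{ split; [apply Rdiv_lt_0_compat; lra|]; apply Rle_div_l; [lra|nra]. }
exists (Rmax l1 (Re sg / e1)); split; [eapply Rlt_le_trans; [exact Hl1|apply Rmax_l]|].
intros n Hl; assert (Hll : l1 < sqrt (INR n)) by (eapply Rle_lt_trans; [apply Rmax_l|exact Hl]).
assert (Hle : Re sg / e1 < sqrt (INR n)) by (eapply Rle_lt_trans; [apply Rmax_r|exact Hl]).
apply (Hneg n _ _ Hll); [lra|lra|].
intros x Hx; apply (Hfar (Re sg / sqrt (INR n)) h x).
- split; [apply Rdiv_lt_0_compat; lra|]; apply Rlt_div_l; [lra|]; apply Rlt_div_l in Hle; [lra|exact He1].
- apply Rabs_le; lra.
- left; exact Hg.
Qed.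

(** * From the arcs to the coefficients *)

Lemma arc_integral_Csumn z eta n k N : Cmod z <= 1 -> 0 < eta ->
  Csumn (fun h => arc_integral z eta n k (Z.of_nat h)) N =
  CInt (arc_integrand z eta n) (- (PI / INR k)) (2 * PI * (INR N / INR k) - PI / INR k).
Proof.
intros Hz He; assert (Hex : forall a b, ex_CInt (arc_integrand z eta n) a b).
{ intros; apply ex_CInt_continuous; intros; apply arc_integrand_continuous; assumption. }
induction N as [|N IH]; cbn [Csumn].
- simpl INR; replace (2 * PI * (0 / INR k) - PI / INR k) with (- (PI / INR k)) by (unfold Rdiv; ring).
  unfold CInt; rewrite !RInt_point; reflexivity.
- rewrite IH; unfold arc_integral; rewrite <- INR_IZR_INZ, CInt_Chasles by apply Hex.
  f_equal; rewrite S_INR; unfold Rdiv; ring.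
Qed.

(** A period starting at [- PI / k] consists of [k] adjacent arcs centred at [2 PI h / k]; as [k] is
    fixed, each may be given an error [eps / k]. *)
Lemma coefficient_asymp z k sg ka (B : nat -> C) eps : Cmod z <= 1 -> (0 < k)%nat -> 0 < Re sg ->
  (forall h, (h < k)%nat -> forall eps, 0 < eps -> exists l0, 0 < l0 /\ forall n, l0 < sqrt (INR n) ->
    Cmod (arc_integral z (Re sg / sqrt (INR n)) n k (Z.of_nat h) * normalizer sg ka (sqrt (INR n))
      - unit_root k (- (Z.of_nat h * Z.of_nat n)) * B h)%C <= eps) -> 0 < eps ->
  exists l0, 0 < l0 /\ forall n, l0 < sqrt (INR n) ->
    Cmod (RtoC (2 * PI) * Q n z * normalizer sg ka (sqrt (INR n))
      - Csumn (fun h => unit_root k (- (Z.of_nat h * Z.of_nat n)) * B h) k)%C <= eps.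
Proof.
intros Hz Hk HPsi H Heps.
assert (HIk : 1 <= INR k) by (replace 1 with (INR 1) by reflexivity; apply le_INR; lia).
(* [finite_small] is stated for a parameter tending to 0, here [/ sqrt n]. *)
destruct (finite_small (fun h x => forall n, x = / sqrt (INR n) ->
    Cmod (arc_integral z (Re sg / sqrt (INR n)) n k (Z.of_nat h) * normalizer sg ka (sqrt (INR n))
      - unit_root k (- (Z.of_nat h * Z.of_nat n)) * B h)%C <= eps / INR k) k) as (e & He & Hf).
{ intros h Hh; destruct (H h Hh (eps / INR k)) as (l0 & Hl0 & Hn); [apply Rdiv_lt_0_compat; lra|].
  exists (/ l0); split; [apply Rinv_0_lt_compat, Hl0|]; intros x Hx n ->; apply Hn.
  destruct Hx as [Hx1 Hx2]; apply Rinv_lt_contravar in Hx2; [rewrite !Rinv_inv in Hx2; exact Hx2|].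
  apply Rmult_lt_0_compat; [exact Hx1|apply Rinv_0_lt_compat, Hl0]. }
exists (/ e); split; [apply Rinv_0_lt_compat, He|]; intros n Hn.
assert (Hie : 0 < / e) by (apply Rinv_0_lt_compat, He).
set (l := sqrt (INR n)) in *.
assert (Heta : 0 < Re sg / l) by (apply Rdiv_lt_0_compat; lra).
assert (Hx : 0 < / l < e).
{ split; [apply Rinv_0_lt_compat; lra|]; rewrite <- (Rinv_inv e); apply Rinv_lt_contravar; [apply Rmult_lt_0_compat; lra|exact Hn]. }
rewrite (Q_Cauchy z (Re sg / l) (- (PI / INR k)) n) by assumption.
change (fun x => (genfun z (circ (Re sg / l) x) * circ_negpow (Z.of_nat n) (Re sg / l) x)%C) with (arc_integrand z (Re sg / l) n).
replace (- (PI / INR k) + 2 * PI) with (2 * PI * (INR k / INR k) - PI / INR k) by (field; lra).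
rewrite <- arc_integral_Csumn by assumption.
rewrite Cmult_comm, <- Csumn_scal, Csumn_minus.
replace eps with (INR k * (eps / INR k)) by (field; lra); rewrite <- Rsumn_const.
apply Cmod_Csumn_le; intros h Hh; cbv beta.
rewrite Cmult_comm; exact (Hf (/ l) Hx h Hh n eq_refl).
Qed.

(** The normalized main term [S] may oscillate with [n] and need not converge. A lower bound on its
    modulus is enough to turn an absolute error into a relative one. *)
Lemma asymp_normalized (f g N S : nat -> C) c : 0 < c ->
  (forall n, (0 < n)%nat -> (RtoC (2 * PI) * g n * N n)%C = S n) -> (forall n, c <= Cmod (S n)) ->
  (forall eps, 0 < eps -> exists l0, 0 < l0 /\ forall n, l0 < sqrt (INR n) ->
    Cmod (RtoC (2 * PI) * f n * N n - S n)%C <= eps) -> asymp f g.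
Proof.
intros Hc HgS HS H; unfold asymp, is_equiv, is_domin; intros eps.
destruct (H (eps * c)) as (l0 & Hl0 & Hn); [apply Rmult_lt_0_compat; [apply cond_pos|exact Hc]|].
destruct (INR_unbounded (l0 * l0)) as (n0 & Hn0).
exists (Datatypes.S n0); intros n Hnn.
assert (Hln : l0 < sqrt (INR n)).
{ rewrite <- (sqrt_square l0) by lra; apply sqrt_lt_1_alt; split; [nra|].
  eapply Rlt_le_trans; [exact Hn0|apply le_INR; lia]. }
specialize (Hn n Hln); specialize (HgS n ltac:(lia)).
rewrite <- HgS in Hn; pose proof (HS n) as Hs; rewrite <- HgS in Hs.
change (Cmod (g n - f n)%C <= eps * Cmod (g n)).
rewrite Cmod_minus_sym.
set (X := (RtoC (2 * PI) * N n)%C).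
replace (RtoC (2 * PI) * f n * N n - RtoC (2 * PI) * g n * N n)%C with (X * (f n - g n))%C in Hn by (unfold X; ring).
replace (RtoC (2 * PI) * g n * N n)%C with (X * g n)%C in Hs by (unfold X; ring).
rewrite Cmod_mult in Hn, Hs; pose proof (Cmod_ge_0 X); pose proof (Cmod_ge_0 (g n)).
assert (0 < Cmod X) by (destruct (Rle_lt_or_eq_dec _ _ H0) as [|E]; [assumption|rewrite <- E, Rmult_0_l in Hs; lra]).
apply Rmult_le_reg_l with (Cmod X); [assumption|].
pose proof (cond_pos eps) as Hep; nra.
Qed.

(** * The dilogarithm on the unit circle *)

Definition expi (t : R) : C := Cexp (0, t).
Definition dilog (t : R) : C := Li2 (expi t).

Lemma Re_pair x y : Re (x, y) = x.
Proof. reflexivity. Qed.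
Lemma Im_pair x y : Im (x, y) = y.
Proof. reflexivity. Qed.

Lemma Re_expi t : Re (expi t) = cos t.
Proof. unfold expi; rewrite Re_Cexp; unfold Re, Im; cbn [fst snd]; rewrite exp_0; ring. Qed.
Lemma Im_expi t : Im (expi t) = sin t.
Proof. unfold expi; rewrite Im_Cexp; unfold Re, Im; cbn [fst snd]; rewrite exp_0; ring. Qed.
Lemma Cmod_expi t : Cmod (expi t) = 1.
Proof. unfold expi; rewrite Cmod_Cexp; unfold Re; cbn [fst]; apply exp_0. Qed.
Lemma expi_plus s t : expi (s + t) = (expi s * expi t)%C.
Proof. unfold expi; rewrite <- Cexp_plus; f_equal; unfold Cplus; cbn [fst snd]; f_equal; ring. Qed.
Lemma expi_pow t n : (expi t ^ n)%C = expi (INR n * t).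
Proof.
induction n as [|n IH].
- rewrite Rmult_0_l; unfold expi; simpl; symmetry; apply Cexp_0.
- rewrite S_INR, Rmult_plus_distr_r, Rmult_1_l, expi_plus, <- IH; simpl; ring.
Qed.

Lemma is_Cderive_expi c t : is_Cderive (fun u => expi (c * u)) t ((0, c)%R * expi (c * t))%C.
Proof.
apply (is_Cderive_Cexp (fun u => (0, c * u)%R)); split; unfold Re, Im; simpl.
- apply @is_derive_const.
- auto_derive; [trivial|ring].
Qed.

Lemma is_Cderive_Csumn (f df : nat -> R -> C) N t : (forall n, is_Cderive (f n) t (df n t)) ->
  is_Cderive (fun u => Csumn (fun n => f n u) N) t (Csumn (fun n => df n t) N).
Proof.
intros H; induction N as [|N IH]; cbn [Csumn]; [apply is_Cderive_const|].
apply (is_Cderive_plus (fun u => Csumn (fun n => f n u) N) (f N)); [exact IH|apply H].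
Qed.

Lemma one_minus_cos_lower m u t : 0 <= m < PI -> Rabs (u - PI) <= m -> 0 <= t <= 1 -> Rmin 1 (1 + cos m) <= 1 - t * cos u.
Proof.
intros Hm Hu Ht.
assert (H : - cos m >= cos u).
{ replace u with (u - PI + PI) by ring; rewrite neg_cos.
  assert (E : cos (u - PI) = cos (Rabs (u - PI))) by (unfold Rabs; destruct (Rcase_abs (u - PI)); [rewrite cos_neg|]; reflexivity).
  rewrite E; pose proof (Rabs_pos (u - PI)).
  assert (cos m <= cos (Rabs (u - PI))) by (apply cos_decr_1; lra); lra. }
pose proof (Rmin_l 1 (1 + cos m)); pose proof (Rmin_r 1 (1 + cos m)).
destruct (Rle_dec 0 (cos u)); nra.
Qed.

Lemma cos_gt_m1 m : 0 <= m < PI -> -1 < cos m.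
Proof. intros H; rewrite <- cos_PI; apply cos_decreasing_1; lra. Qed.

(* The partial sums of [dilog' = - i Clog1m] converge uniformly on compact subsets of [(0, 2 pi)]. *)
Lemma dilog_increment a b (l0 : C) M : 0 < a -> a <= b -> b < 2 * PI ->
  (forall t, a <= t <= b -> Cmod (Clog1m (expi t) - l0)%C <= M) ->
  Cmod (dilog b - dilog a + (0, b - a)%R * l0)%C <= M * (b - a).
Proof.
intros Ha Hab Hb HM; pose proof PI_RGT_0 as Hpi.
(* The largest distance of the interval from [PI]. It keeps [1 - t cos u] above [c], so that
   [log_partial_sum] is uniform on the interval. *)
set (m := Rmax (PI - a) (b - PI)).
assert (Hm1 : PI - a <= m) by apply Rmax_l.
assert (Hm2 : b - PI <= m) by apply Rmax_r.
assert (Hm : 0 <= m < PI) by (split; [lra|apply Rmax_lub_lt; lra]).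
set (c := Rmin 1 (1 + cos m)).
assert (Hc : 0 < c) by (apply Rmin_glb_lt; [lra|pose proof (cos_gt_m1 m Hm); lra]).
apply le_epsilon; intros eps Heps.
set (term := fun n u => (expi (INR (S n) * u) * RtoC (/ (INR (S n) ^ 2)))%C).
assert (Hser : forall u, is_Cseries (fun n => term n u) (dilog u)).
{ intros u; assert (H1 : Cmod (expi u) <= 1) by (rewrite Cmod_expi; lra).
  eapply is_Cseries_ext; [|exact (is_Cseries_Li2 _ H1)].
  intros n; unfold term; cbv beta; rewrite expi_pow; unfold Cdiv; rewrite RtoC_inv by (apply pow_nonzero, INR_S_neq0); reflexivity. }
assert (Hd : forall N u, a <= u <= b -> is_Cderive (fun u => Csumn (fun n => term n u) N + (0, u)%R * l0)%C u
   ((0, 1)%R * (Csumn (logterm (expi u)) N + l0))%C).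
{ intros N u Hu; rewrite Cmult_plus_distr_l.
  apply (is_Cderive_plus (fun u => Csumn (fun n => term n u) N) (fun u => (0, u)%R * l0)%C).
  - rewrite <- Csumn_scal.
    apply (is_Cderive_Csumn term (fun n u => (0, 1)%R * logterm (expi u) n)%C); intros n.
    replace ((0, 1)%R * logterm (expi u) n)%C with
      (((0, INR (S n))%R * expi (INR (S n) * u)) * RtoC (/ (INR (S n) ^ 2)) + expi (INR (S n) * u) * 0)%C.
    + apply (is_Cderive_mult (fun u => expi (INR (S n) * u)) (fun _ => RtoC (/ (INR (S n) ^ 2)))); [apply is_Cderive_expi|apply is_Cderive_const].
    + unfold logterm; rewrite expi_pow; unfold Cdiv; rewrite <- RtoC_inv by apply INR_S_neq0.
      replace (/ INR (S n) ^ 2) with (/ INR (S n) * / INR (S n)) by (field; apply INR_S_neq0).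
      replace (0, INR (S n))%R with ((0, 1)%R * RtoC (INR (S n)))%C by (unfold Cmult, RtoC; cbn [fst snd]; f_equal; ring).
      rewrite RtoC_mult, (RtoC_inv (INR (S n))) by apply INR_S_neq0; field; apply RtoC_neq0, INR_S_neq0.
  - replace ((0, 1)%R * l0)%C with ((0, 1)%R * l0 + (0, u)%R * 0)%C by ring.
    apply (is_Cderive_mult (fun u => (0, u)%R) (fun _ => l0)); [|apply is_Cderive_const].
    split; unfold Re, Im; simpl; [apply @is_derive_const|apply @is_derive_id]. }
destruct (proj1 (is_Cseries_Csumn _ _) (Hser a) (eps / 3) ltac:(lra)) as (N1 & HN1).
destruct (proj1 (is_Cseries_Csumn _ _) (Hser b) (eps / 3) ltac:(lra)) as (N2 & HN2).
destruct (inv_INR_lt c (eps / (3 * (b - a + 1))) Hc) as (N3 & HN3); [apply Rdiv_lt_0_compat; lra|].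
set (N := Nat.max N1 (Nat.max N2 N3)).
specialize (HN1 N ltac:(lia)); specialize (HN2 N ltac:(lia)); specialize (HN3 N ltac:(lia)).
set (del := eps / (3 * (b - a + 1))) in *.
assert (Hmv := Cmvt _ _ a b (M + del) Hab (Hd N)); cbv beta in Hmv.
assert (Hinc : Cmod ((Csumn (fun n => term n b) N + (0, b)%R * l0) - (Csumn (fun n => term n a) N + (0, a)%R * l0))%C <= (M + del) * (b - a)).
{ apply Hmv; intros t Ht.
  rewrite Cmod_mult; replace (Cmod (0, 1)%R) with 1.
  2:{ unfold Cmod; cbn [fst snd]; replace (0 ^ 2 + 1 ^ 2) with 1 by ring; symmetry; apply sqrt_1. }
  rewrite Rmult_1_l.
  replace (Csumn (logterm (expi t)) N + l0)%C with ((Csumn (logterm (expi t)) N + Clog1m (expi t)) - (Clog1m (expi t) - l0))%C by ring.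
  eapply Rle_trans; [apply Cmod_minus_le; [|exact (HM t Ht)]|apply Req_le, Rplus_comm].
  eapply Rle_trans; [apply (log_partial_sum (expi t) c N)|left; exact HN3].
  - rewrite Cmod_expi; lra.
  - exact Hc.
  - intros v Hv; rewrite Re_expi; apply (one_minus_cos_lower m t v Hm); [apply Rabs_le; lra|exact Hv]. }
replace (dilog b - dilog a + (0, b - a)%R * l0)%C with
  (((Csumn (fun n => term n b) N + (0, b)%R * l0) - (Csumn (fun n => term n a) N + (0, a)%R * l0))
   - (Csumn (fun n => term n b) N - dilog b) + (Csumn (fun n => term n a) N - dilog a))%C.
2:{ replace (0, b - a)%R with ((0, b)%R - (0, a)%R)%C by (unfold Cminus, Cplus, Copp; cbn [fst snd]; f_equal; ring); ring. }
assert (Hde : del * (b - a) <= eps / 3).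
{ unfold del; replace (eps / 3) with (eps / (3 * (b - a + 1)) * (b - a + 1)) by (field; lra).
  apply Rmult_le_compat_l; [left; apply Rdiv_lt_0_compat; lra|lra]. }
eapply Rle_trans; [apply Cmod_plus_le; [apply Cmod_minus_le; [exact Hinc|left; exact HN2]|left; exact HN1]|lra].
Qed.

Lemma sin_half_pos t : 0 < t < 2 * PI -> 0 < sin (t / 2).
Proof. intros H; apply sin_gt_0; lra. Qed.

Lemma Clog1m_expi t : 0 < t < 2 * PI -> Clog1m (expi t) = (ln (2 * sin (t / 2)), (t - PI) / 2).
Proof.
intros Ht; pose proof PI_RGT_0 as Hpi; pose proof (sin_half_pos t Ht) as Hs.
assert (Ec : 1 - cos t = 2 * sin (t / 2) * sin (t / 2)).
{ replace t with (2 * (t / 2)) at 1 by field; rewrite cos_2a_sin; ring. }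
assert (Es : sin t = 2 * sin (t / 2) * cos (t / 2)).
{ replace t with (2 * (t / 2)) at 1 by field; apply sin_2a. }
unfold Clog1m; f_equal.
- f_equal; unfold Cmod; rewrite <- (sqrt_Rsqr (2 * sin (t / 2))) by lra; f_equal.
  change (fst (1 - expi t)%C) with (Re (1 - expi t)%C); change (snd (1 - expi t)%C) with (Im (1 - expi t)%C).
  rewrite Re_minus, Im_minus, Re_expi, Im_expi, Re_RtoC, Im_RtoC, Ec, Es; unfold Rsqr.
  pose proof (sin2_cos2 (t / 2)) as H; unfold Rsqr in H; nra.
- rewrite Re_minus, Im_minus, Re_expi, Im_expi, Re_RtoC, Im_RtoC, Ec, Es.
  rewrite <- (atan_tan ((t - PI) / 2)) by lra; f_equal.
  replace ((t - PI) / 2) with (t / 2 - PI / 2) by field; unfold tan.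
  rewrite sin_minus, cos_minus, cos_PI2, sin_PI2; field; lra.
Qed.

(** [Clog1m (expi u)] varies little near [t], so [dilog_increment] bounds the difference quotient
    directly; the derivative is [- i] times the value in [Clog1m_expi]. *)
Lemma is_Cderive_dilog t : 0 < t < 2 * PI -> is_Cderive dilog t ((PI - t) / 2 * -1, - ln (2 * sin (t / 2)))%R.
Proof.
intros Ht; pose proof PI_RGT_0 as Hpi; pose proof (sin_half_pos t Ht) as Hs.
set (l0 := Clog1m (expi t)).
assert (Hcont : forall eps, 0 < eps -> exists d, 0 < d /\ forall u, Rabs (u - t) < d -> 0 < u < 2 * PI /\ Cmod (Clog1m (expi u) - l0)%C <= eps).
{ intros eps Heps.
  assert (Hl : continuous (fun u => ln (2 * sin (u / 2))) t).
  { apply @ex_derive_continuous; auto_derive; repeat split; lra. }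
  assert (Hq : 0 < eps / 2) by lra.
  assert (Hloc := proj1 (filterlim_locally (U := R_UniformSpace) _ _) Hl (mkposreal _ Hq)).
  destruct Hloc as (d1 & Hd1).
  exists (Rmin (Rmin d1 (eps / 2)) (Rmin t (2 * PI - t))); split.
  { repeat apply Rmin_glb_lt; try lra; apply cond_pos. }
  intros u Hu.
  assert (Hu1 : Rabs (u - t) < d1) by (eapply Rlt_le_trans; [exact Hu|eapply Rle_trans; [apply Rmin_l|apply Rmin_l]]).
  assert (Hu2 : Rabs (u - t) < eps / 2) by (eapply Rlt_le_trans; [exact Hu|eapply Rle_trans; [apply Rmin_l|apply Rmin_r]]).
  assert (Hu3 : Rabs (u - t) < t) by (eapply Rlt_le_trans; [exact Hu|eapply Rle_trans; [apply Rmin_r|apply Rmin_l]]).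
  assert (Hu4 : Rabs (u - t) < 2 * PI - t) by (eapply Rlt_le_trans; [exact Hu|eapply Rle_trans; [apply Rmin_r|apply Rmin_r]]).
  apply Rabs_def2 in Hu3; apply Rabs_def2 in Hu4.
  split; [lra|].
  unfold l0; rewrite !Clog1m_expi by lra.
  specialize (Hd1 u Hu1); change (Rabs (ln (2 * sin (u / 2)) - ln (2 * sin (t / 2))) < eps / 2) in Hd1.
  eapply Rle_trans; [apply Cmod_le_ReIm|]; unfold Re, Im; cbn [fst snd Cminus Cplus Copp].
  change (Rabs (ln (2 * sin (u / 2)) - ln (2 * sin (t / 2))) + Rabs ((u - PI) / 2 - (t - PI) / 2) <= eps).
  replace ((u - PI) / 2 - (t - PI) / 2) with ((u - t) / 2) by field.
  unfold Rdiv; rewrite Rabs_mult, (Rabs_pos_eq (/ 2)) by lra; unfold Rdiv in *; lra. }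
assert (Hd : forall eps, 0 < eps -> exists d : posreal, forall h, h <> 0 -> Rabs h < d ->
   Cmod (dilog (t + h) - dilog t + (0, h)%R * l0)%C <= eps * Rabs h).
{ intros eps Heps; destruct (Hcont eps Heps) as (d & Hd0 & Hd); exists (mkposreal d Hd0); simpl; intros h Hh0 Hh.
  assert (Hth : Rabs (t + h - t) < d) by (replace (t + h - t) with h by ring; exact Hh).
  destruct (Hd (t + h) Hth) as (Hb & _).
  apply Rabs_def2 in Hh.
  destruct (Rle_dec 0 h) as [H0|H0].
  - rewrite Rabs_pos_eq by lra; replace (0, h)%R with (0, t + h - t)%R by (f_equal; ring).
    replace h with (t + h - t) at 3 by ring.
    apply dilog_increment; try lra; intros u Hu; apply Hd, Rabs_def1; lra.
  - rewrite Rabs_left by lra.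
    replace (dilog (t + h) - dilog t + (0, h)%R * l0)%C with (- (dilog t - dilog (t + h) + (0, t - (t + h))%R * l0))%C.
    + rewrite Cmod_opp; replace (- h) with (t - (t + h)) by ring.
      apply dilog_increment; try lra; intros u Hu; apply Hd, Rabs_def1; lra.
    + replace (0, t - (t + h))%R with (- (0, h)%R)%C by (unfold Copp; cbn [fst snd]; f_equal; ring); ring. }
unfold l0 in Hd; rewrite Clog1m_expi in Hd by exact Ht.
split; apply is_derive_Reals; intros eps Heps; destruct (Hd (eps / 2) ltac:(lra)) as (d & H); exists d; intros h Hh0 Hh;
  specialize (H h Hh0 Hh); assert (Hah : 0 < Rabs h) by (apply Rabs_pos_lt, Hh0).
- set (X := (dilog (t + h) - dilog t + (0, h)%R * (ln (2 * sin (t / 2)), (t - PI) / 2)%R)%C) in *.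
  pose proof (Re_le_Cmod X) as HX.
  assert (E : (Re (dilog (t + h)) - Re (dilog t)) / h - Re ((PI - t) / 2 * -1, - ln (2 * sin (t / 2)))%R = Re X / h).
  { unfold X; rewrite Re_plus, Re_minus, Re_mult, !Re_pair, !Im_pair; field; exact Hh0. }
  rewrite E; unfold Rdiv; rewrite Rabs_mult, Rabs_inv.
  apply Rmult_lt_reg_r with (Rabs h); [exact Hah|]; rewrite Rmult_assoc, Rinv_l, Rmult_1_r by lra; nra.
- set (X := (dilog (t + h) - dilog t + (0, h)%R * (ln (2 * sin (t / 2)), (t - PI) / 2)%R)%C) in *.
  pose proof (Im_le_Cmod X) as HX.
  assert (E : (Im (dilog (t + h)) - Im (dilog t)) / h - Im ((PI - t) / 2 * -1, - ln (2 * sin (t / 2)))%R = Im X / h).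
  { unfold X; rewrite Im_plus, Im_minus, Im_mult, !Re_pair, !Im_pair; field; exact Hh0. }
  rewrite E; unfold Rdiv; rewrite Rabs_mult, Rabs_inv.
  apply Rmult_lt_reg_r with (Rabs h); [exact Hah|]; rewrite Rmult_assoc, Rinv_l, Rmult_1_r by lra; nra.
Qed.

Definition dilog_re (t : R) : R := Re (dilog t).
Definition dilog_im (t : R) : R := Im (dilog t).

Lemma is_derive_dilog_re t : 0 < t < 2 * PI -> is_derive dilog_re t ((t - PI) / 2).
Proof. intros H; destruct (is_Cderive_dilog t H) as [H1 _]; rewrite Re_pair in H1; replace ((t - PI) / 2) with ((PI - t) / 2 * -1) by field; exact H1. Qed.

Lemma is_derive_dilog_im t : 0 < t < 2 * PI -> is_derive dilog_im t (- ln (2 * sin (t / 2))).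
Proof. intros H; destruct (is_Cderive_dilog t H) as [_ H1]; exact H1. Qed.

Lemma expi_2PI : expi (2 * PI) = 1%C.
Proof. apply Ceq_ReIm; [rewrite Re_expi, cos_2PI|rewrite Im_expi, sin_2PI]; reflexivity. Qed.

Lemma dilog_period t : dilog (t + 2 * PI) = dilog t.
Proof. unfold dilog; rewrite expi_plus, expi_2PI, Cmult_1_r; reflexivity. Qed.

Lemma expi_opp t : expi (- t) = Cconj (expi t).
Proof.
apply Ceq_ReIm.
- rewrite Re_expi, cos_neg, <- Re_expi; reflexivity.
- rewrite Im_expi, sin_neg, <- Im_expi; reflexivity.
Qed.

Lemma Cconj_pow z n : (Cconj z ^ n)%C = Cconj (z ^ n)%C.
Proof.
induction n as [|n IH]; [simpl; unfold Cconj, RtoC; simpl; f_equal; ring|].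
simpl; rewrite IH; destruct z as [a b], ((a, b) ^ n)%C as [c d]; unfold Cconj, Cmult; simpl; f_equal; ring.
Qed.

Lemma is_Cseries_Cconj f l : is_Cseries f l -> is_Cseries (fun n => Cconj (f n)) (Cconj l).
Proof.
intros [H1 H2]; split; [exact H1|].
exact (is_series_opp _ _ H2).
Qed.

Lemma dilog_opp t : dilog (- t) = Cconj (dilog t).
Proof.
assert (H1 : Cmod (expi t) <= 1) by (rewrite Cmod_expi; lra).
assert (H2 : Cmod (expi (- t)) <= 1) by (rewrite Cmod_expi; lra).
rewrite <- (is_Cseries_unique _ _ (is_Cseries_Cconj _ (dilog t) (is_Cseries_Li2 _ H1))).
symmetry; apply is_Cseries_unique.
eapply is_Cseries_ext; [|exact (is_Cseries_Li2 _ H2)].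
intros n; cbv beta; rewrite expi_opp, Cconj_pow.
unfold Cdiv; rewrite <- RtoC_inv by (apply pow_nonzero, INR_S_neq0).
set (u := (expi t ^ S n)%C); destruct u as [a b]; unfold Cconj, Cmult, RtoC; simpl; f_equal; ring.
Qed.

Lemma dilog_duplication t : (dilog t + dilog (t + PI))%C = (dilog (2 * t) / 2)%C.
Proof.
assert (H1 : Cmod (expi t) <= 1) by (rewrite Cmod_expi; lra).
pose proof (Li2_distribution (expi t) 2 1 ltac:(lia) eq_refl H1) as H.
cbn [Csumn] in H.
replace (expi t * unit_root 2 (1 * Z.of_nat 1))%C with (expi (t + PI)) in H.
2:{ rewrite expi_plus; f_equal; unfold expi, unit_root; f_equal; f_equal; simpl; field. }
replace (expi t * unit_root 2 (1 * Z.of_nat 2))%C with (expi t) in H.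
2:{ rewrite unit_root_full by lia; ring. }
rewrite expi_pow in H; replace (INR 2) with 2 in H by reflexivity.
unfold dilog; rewrite <- H; ring.
Qed.

Lemma constant_of_derive f a b : a < b -> (forall t, a <= t <= b -> is_derive f t 0) -> f a = f b.
Proof. intros Hab H; exact (eq_is_derive f a b H Hab). Qed.

(** Differentiation inside [(0, 2 PI)] gives the formula up to a constant. Duplication at [PI / 2]
    determines the constant, and duplication at 0 yields the endpoint value; so neither Abel's
    theorem nor the value of the sum of inverse squares has to be supplied. *)
Lemma dilog_re_formula t : 0 <= t <= 2 * PI -> dilog_re t = PI * PI / 6 - t * (2 * PI - t) / 4.
Proof.
pose proof PI_RGT_0 as Hpi.
set (f := fun t => dilog_re t + t * (2 * PI - t) / 4).
assert (Hd : forall t, 0 < t < 2 * PI -> is_derive f t 0).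
{ intros u Hu; unfold f; replace 0 with ((u - PI) / 2 + (PI - u) / 2) by field.
  apply (is_derive_plus dilog_re (fun t => t * (2 * PI - t) / 4)); [apply is_derive_dilog_re, Hu|].
  auto_derive; [trivial|field]. }
assert (Hc : forall u v, 0 < u < 2 * PI -> 0 < v < 2 * PI -> f u = f v).
{ intros u v Hu Hv; destruct (Rtotal_order u v) as [H|[->|H]]; [|reflexivity|symmetry];
    apply constant_of_derive; try exact H; intros; apply Hd; lra. }
assert (D : forall t, dilog_re t + dilog_re (t + PI) = dilog_re (2 * t) / 2).
{ intros u; pose proof (dilog_duplication u) as E; apply (f_equal Re) in E; rewrite Re_plus in E.
  unfold dilog_re; rewrite E; unfold Cdiv; rewrite <- RtoC_inv by lra; rewrite Re_mult, Re_RtoC, Im_RtoC; field. }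
assert (Hpi2 : f PI = PI * PI / 6).
{ pose proof (D (PI / 2)) as E; replace (2 * (PI / 2)) with PI in E by field.
  pose proof (Hc (PI / 2) PI ltac:(lra) ltac:(lra)) as E1; pose proof (Hc (PI / 2 + PI) PI ltac:(lra) ltac:(lra)) as E2.
  unfold f in *; nra. }
assert (H0 : dilog_re 0 = PI * PI / 6).
{ pose proof (D 0) as E; rewrite Rplus_0_l, Rmult_0_r in E; unfold f in Hpi2; nra. }
intros Ht; destruct (Req_dec t 0) as [->|H1]; [rewrite H0; field|].
destruct (Req_dec t (2 * PI)) as [->|H2].
- unfold dilog_re; replace (2 * PI) with (0 + 2 * PI) at 1 by ring; rewrite dilog_period; fold (dilog_re 0); rewrite H0; field.
- pose proof (Hc t PI ltac:(lra) ltac:(lra)) as E; rewrite Hpi2 in E; unfold f in E; lra.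
Qed.

Lemma dilog_0 : dilog 0 = RtoC (PI * PI / 6).
Proof.
pose proof PI_RGT_0 as Hpi; apply Ceq_ReIm.
- fold (dilog_re 0); rewrite dilog_re_formula, Re_RtoC by lra; field.
- rewrite Im_RtoC; pose proof (dilog_opp 0) as E; rewrite Ropp_0 in E; apply (f_equal Im) in E.
  destruct (dilog 0) as [x y]; unfold Im, Cconj in *; cbn [fst snd] in *; lra.
Qed.

Lemma dilog_im_duplication t : dilog_im t + dilog_im (t + PI) = dilog_im (2 * t) / 2.
Proof.
pose proof (dilog_duplication t) as E; apply (f_equal Im) in E; rewrite Im_plus in E.
unfold dilog_im; rewrite E; unfold Cdiv; rewrite <- RtoC_inv by lra; rewrite Im_mult, Re_RtoC, Im_RtoC; field.
Qed.

Lemma dilog_im_0 : dilog_im 0 = 0.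
Proof. unfold dilog_im; rewrite dilog_0; apply Im_RtoC. Qed.

Lemma dilog_im_PI : dilog_im PI = 0.
Proof. pose proof (dilog_im_duplication 0) as E; rewrite Rplus_0_l, Rmult_0_r, dilog_im_0 in E; lra. Qed.

Lemma dilog_im_reflect t : dilog_im (2 * PI - t) = - dilog_im t.
Proof.
unfold dilog_im; replace (2 * PI - t) with (- t + 2 * PI) by ring; rewrite dilog_period, dilog_opp; reflexivity.
Qed.

Lemma Cmod_Li2_le w : Cmod w <= 1 -> Cmod (Li2 w) <= PI * PI / 6.
Proof.
intros Hw; assert (H1 : Cmod (expi 0) <= 1) by (rewrite Cmod_expi; lra).
destruct (is_Cseries_Li2 _ H1) as [H _]; fold (dilog 0) in H; rewrite dilog_0, Re_RtoC in H.
apply (Cmod_Cseries_le _ _ (fun n => / (INR (S n) ^ 2))) with (2 := is_Cseries_Li2 _ Hw).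
- intros n; pose proof (INR_S_pos n); assert (0 < INR (S n) ^ 2) by (apply pow_lt; assumption).
  rewrite <- (Rmult_1_l (/ _)); fold (1 / INR (S n) ^ 2); apply Cmod_div_le; [apply Cmod_pow_le1, Hw|assumption|].
  rewrite Cmod_RtoC_pos; lra.
- eapply is_series_ext; [|exact H]; intros n; cbv beta.
  rewrite expi_pow, Rmult_0_r; replace (expi 0) with (RtoC 1) by (symmetry; apply Cexp_0).
  rewrite <- RtoC_div by (apply pow_nonzero, INR_S_neq0); rewrite Re_RtoC; unfold Rdiv; apply Rmult_1_l.
Qed.

Lemma Cmod_dilog_le t : Cmod (dilog t) <= PI * PI / 6.
Proof. apply Cmod_Li2_le; rewrite Cmod_expi; lra. Qed.

Lemma dilog_sqr t : Cmod (dilog t) ^ 2 = dilog_re t ^ 2 + dilog_im t ^ 2.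
Proof. unfold Cmod; rewrite pow2_sqrt; [reflexivity|]; apply Rplus_le_le_0_compat; apply pow2_ge_0. Qed.

(* Continuity of [dilog_im] at 0 comes for free from [|dilog t| <= dilog 0] and the formula for [dilog_re]. *)
Lemma dilog_im_small t : 0 <= t <= 1 -> Rabs (dilog_im t) <= 3 * sqrt t.
Proof.
intros Ht; pose proof PI_bounds as Hpi.
pose proof (dilog_sqr t) as H; pose proof (Cmod_dilog_le t) as H1; pose proof (Cmod_ge_0 (dilog t)) as H2.
pose proof (dilog_re_formula t ltac:(lra)) as HA.
set (a := PI * PI / 6) in *.
assert (Ha : 1.6 < a < 1.7) by (unfold a; nra).
assert (Hq : 0 <= t * (2 * PI - t) / 4 <= 1.6 * t) by nra.
assert (HB : dilog_im t ^ 2 <= 9 * t) by nra.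
rewrite <- (Rabs_pos_eq (3 * sqrt t)) by (apply Rmult_le_pos; [lra|apply sqrt_pos]).
apply Rsqr_le_abs_0; unfold Rsqr; replace (3 * sqrt t * (3 * sqrt t)) with (9 * (sqrt t * sqrt t)) by ring.
rewrite sqrt_sqrt by lra; nra.
Qed.

(** * Explicit bounds for the imaginary part of the dilogarithm *)

Lemma le_of_derive (f df : R -> R) a b : a <= b -> (forall c, a <= c <= b -> is_derive f c (df c)) ->
  (forall c, a < c < b -> 0 <= df c) -> f a <= f b.
Proof.
intros Hab Hd Hp; destruct (Req_dec a b) as [->|Hne]; [lra|].
destruct (MVT_cor2 f df a b ltac:(lra)) as (c & E & Hc); [intros; apply is_derive_Reals, Hd; assumption|].
specialize (Hp c Hc); nra.
Qed.

Lemma lt_of_derive (f df : R -> R) a b : a < b -> (forall c, a <= c <= b -> is_derive f c (df c)) ->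
  (forall c, a < c < b -> 0 < df c) -> f a < f b.
Proof.
intros Hab Hd Hp.
destruct (MVT_cor2 f df a b Hab) as (c & E & Hc); [intros; apply is_derive_Reals, Hd; assumption|].
specialize (Hp c Hc); nra.
Qed.

(** The derivative of [dilog_im] has a logarithmic singularity at 0, so the comparison starts from a
    small [e], where a deficit of order [sqrt e] is tolerated. *)
Lemma nonneg_from_zero (f df : R -> R) K b : 0 < b -> 0 < K -> (forall c, 0 < c <= b -> is_derive f c (df c)) ->
  (forall c, 0 < c < b -> 0 <= df c) -> (forall e, 0 < e <= 1 -> - (K * sqrt e) <= f e) -> 0 <= f b.
Proof.
intros Hb HK Hd Hp Hf; apply le_epsilon; intros eps Heps.
set (e := Rmin (Rmin 1 b) ((eps / K) * (eps / K))).
assert (HeK : 0 < eps / K) by (apply Rdiv_lt_0_compat; assumption).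
assert (He : 0 < e) by (repeat apply Rmin_glb_lt; try lra; apply Rmult_lt_0_compat; assumption).
assert (He1 : e <= Rmin 1 b) by apply Rmin_l; pose proof (Rmin_l 1 b); pose proof (Rmin_r 1 b).
assert (He2 : sqrt e <= eps / K).
{ rewrite <- (sqrt_square (eps / K)) by lra; apply sqrt_le_1_alt, Rmin_r. }
specialize (Hf e ltac:(lra)).
assert (f e <= f b) by (apply (le_of_derive f df); [lra|intros; apply Hd; lra|intros; apply Hp; lra]).
assert (K * sqrt e <= eps).
{ apply Rle_trans with (K * (eps / K)); [apply Rmult_le_compat_l; lra|right; field; lra]. }
lra.
Qed.

Lemma sqrt_ge_self e : 0 < e <= 1 -> e <= sqrt e.
Proof. intros He; rewrite <- (sqrt_square e) at 1 by lra; apply sqrt_le_1_alt; nra. Qed.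

Lemma mul_ln_small e : 0 < e <= 1 -> - (2 * sqrt e) <= e * ln e <= 0.
Proof.
intros He; pose proof (ln_le_2sqrt (/ e) ltac:(apply Rinv_0_lt_compat; lra)) as H.
rewrite ln_Rinv, sqrt_inv in H by lra; assert (Hs : 0 < sqrt e) by (apply sqrt_lt_R0; lra).
assert (ln e <= 0) by (rewrite <- ln_1; apply ln_le; lra).
split; [|nra].
replace (2 * sqrt e) with (e * (2 * / sqrt e)); [nra|].
rewrite <- (sqrt_sqrt e) at 1 by lra; field; lra.
Qed.

(** From [2 sin (w/2) <= w]: the derivative is at least [- ln w], whose primitive vanishing at 0 is
    [w (1 - ln w)]. *)
Lemma dilog_im_lower w : 0 < w <= 2 -> w * (1 - ln w) <= dilog_im w.
Proof.
intros Hw; pose proof PI_bounds as Hpi.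
assert (H : 0 <= dilog_im w - w * (1 - ln w)); [|lra].
apply (nonneg_from_zero (fun w => dilog_im w - w * (1 - ln w)) (fun w => - ln (2 * sin (w / 2)) + ln w) 6); try lra.
- intros c Hc; replace (- ln (2 * sin (c / 2)) + ln c) with (- ln (2 * sin (c / 2)) - - ln c) by ring.
  apply (is_derive_minus dilog_im (fun w => w * (1 - ln w))); [apply is_derive_dilog_im; lra|].
  auto_derive; [lra|field; lra].
- intros c Hc; pose proof (sin_half_pos c ltac:(lra)); pose proof (sin_lt_x (c / 2) ltac:(lra)).
  assert (ln (2 * sin (c / 2)) <= ln c) by (apply ln_le; lra); lra.
- intros e He; pose proof (dilog_im_small e ltac:(lra)) as H; apply Rabs_le_between in H.
  pose proof (mul_ln_small e He); pose proof (sqrt_ge_self e He); lra.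
Qed.

Lemma sin_lower x : 0 <= x <= PI -> x - x * x * x / 6 <= sin x.
Proof.
intros Hx; destruct (sin_bound x 0 ltac:(lra) ltac:(lra)) as [H _].
unfold sin_approx, sin_term in H; simpl in H; lra.
Qed.

Lemma ln_nine_tenths : - ln (9 / 10) <= 1 / 9.
Proof.
rewrite <- ln_Rinv by lra; replace (/ (9 / 10)) with (1 + 1 / 9) by field.
rewrite <- (ln_exp (1 / 9)) at 2; apply ln_le; [lra|apply exp_ineq1_le].
Qed.

Lemma ln_2sin_lower w : 0 < w <= 1.5 -> ln w - 1 / 9 <= ln (2 * sin (w / 2)).
Proof.
intros Hw; pose proof PI_bounds as Hpi; pose proof ln_nine_tenths.
apply Rle_trans with (ln (9 / 10 * w)); [rewrite ln_mult by lra; lra|].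
apply ln_le; [lra|]; pose proof (sin_lower (w / 2) ltac:(lra)); nra.
Qed.

(** Up to 1.5 one has [2 sin (w/2) >= 9/10 w], and [1/9] bounds the resulting [- ln (9/10)]. *)
Lemma dilog_im_upper w : 0 < w <= 1.5 -> dilog_im w <= w * (1 - ln w + 1 / 9).
Proof.
intros Hw; pose proof PI_bounds as Hpi.
assert (H : 0 <= w * (1 - ln w + 1 / 9) - dilog_im w); [|lra].
apply (nonneg_from_zero (fun w => w * (1 - ln w + 1 / 9) - dilog_im w) (fun w => (- ln w + 1 / 9) - - ln (2 * sin (w / 2))) 6); try lra.
- intros c Hc; apply (is_derive_minus (fun w => w * (1 - ln w + 1 / 9)) dilog_im); [|apply is_derive_dilog_im; lra].
  auto_derive; [lra|field; lra].
- intros c Hc; pose proof (ln_2sin_lower c ltac:(lra)); lra.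
- intros e He; pose proof (dilog_im_small e ltac:(lra)) as H; apply Rabs_le_between in H.
  pose proof (mul_ln_small e He); pose proof (sqrt_ge_self e He); lra.
Qed.

Lemma x_cos_le_sin x : 0 <= x <= PI -> x * cos x <= sin x.
Proof.
intros Hx; assert (H : sin 0 - 0 * cos 0 <= sin x - x * cos x).
{ apply (le_of_derive (fun x => sin x - x * cos x) (fun x => x * sin x)); [lra| |].
  - intros c _; auto_derive; [trivial|ring].
  - intros c Hc; apply Rmult_le_pos; [lra|apply sin_ge_0; lra]. }
rewrite sin_0 in H; lra.
Qed.

Lemma ln_cos_le x : 0 <= x < PI / 2 -> ln (cos x) <= - (x * x / 2).
Proof.
intros Hx; pose proof PI_RGT_0.
assert (H1 : - (0 * 0 / 2) - ln (cos 0) <= - (x * x / 2) - ln (cos x)).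
{ apply (le_of_derive (fun x => - (x * x / 2) - ln (cos x)) (fun x => - x + sin x / cos x)); [lra| |].
  - intros c Hc; assert (0 < cos c) by (apply cos_gt_0; lra); auto_derive; [lra|field; lra].
  - intros c Hc; assert (0 < cos c) by (apply cos_gt_0; lra).
    pose proof (x_cos_le_sin c ltac:(lra)); assert (c <= sin c / cos c) by (apply Rle_div_r; lra); lra. }
rewrite cos_0, ln_1 in H1; lra.
Qed.

(** As a function of [v] the derivative is [ln (2 cos (v/2))], at most [ln 2 - v^2/8] by
    [ln_cos_le]; integration starts from [dilog_im PI = 0]. *)
Lemma dilog_im_near_PI v : 0 <= v < PI -> dilog_im (PI - v) <= v * ln 2 - v * v * v / 24.
Proof.
intros Hv.
set (f := fun v => v * ln 2 - v * v * v / 24 - dilog_im (PI - v)).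
assert (H1 : f 0 <= f v).
{ apply (le_of_derive f (fun v => ln 2 - v * v / 8 - ln (2 * sin ((PI - v) / 2)))); [lra| |].
  - intros c Hc; unfold f; apply (is_derive_minus (fun v => v * ln 2 - v * v * v / 24) (fun v => dilog_im (PI - v))).
    + auto_derive; [trivial|field].
    + replace (ln (2 * sin ((PI - c) / 2))) with (-1 * - ln (2 * sin ((PI - c) / 2))) by ring.
      apply (is_derive_comp dilog_im (fun v => PI - v)); [apply is_derive_dilog_im; lra|].
      auto_derive; [trivial|ring].
  - intros c Hc; replace ((PI - c) / 2) with (PI / 2 - c / 2) by field; rewrite sin_shift.
    assert (0 < cos (c / 2)) by (apply cos_gt_0; lra).
    rewrite ln_mult by lra; pose proof (ln_cos_le (c / 2) ltac:(lra)); lra. }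
unfold f in H1; rewrite Rminus_0_r, dilog_im_PI in H1; lra.
Qed.

Lemma ln2_bounds : 1 / 2 < ln 2 < 0.6935.
Proof.
split; [pose proof ln_lt_2; lra|].
rewrite <- (ln_exp 0.6935); apply ln_increasing; [lra|].
eapply Rlt_le_trans; [|apply (exp_ge_taylor 0.6935 5); lra]; simpl; lra.
Qed.

Lemma ln_le_minus_1 w : 0 < w -> ln w <= w - 1.
Proof. intros Hw; rewrite <- (ln_exp (w - 1)); apply ln_le; [exact Hw|]; pose proof (exp_ineq1_le (w - 1)); lra. Qed.

Lemma two_sin_gt_1 t : 1.5 <= t <= PI -> 1 < 2 * sin (t / 2).
Proof.
intros Ht; pose proof PI_bounds.
assert (sin (PI / 6) < sin (t / 2)) by (apply sin_increasing_1; lra); rewrite sin_PI6 in *; lra.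
Qed.

Lemma two_sin_ge_1 t : PI / 3 <= t <= PI -> 1 <= 2 * sin (t / 2).
Proof.
intros Ht; pose proof PI_bounds.
assert (sin (PI / 6) <= sin (t / 2)); [|rewrite sin_PI6 in *; lra].
destruct (Req_dec (PI / 6) (t / 2)) as [->|Hne]; [lra|]; left; apply sin_increasing_1; lra.
Qed.

Lemma dilog_im_pos t : 0 < t < PI -> 0 < dilog_im t.
Proof.
intros Ht; pose proof PI_bounds; destruct (Rle_dec t 1.5) as [H1|H1].
- pose proof (dilog_im_lower t ltac:(lra)); pose proof (ln_le_minus_1 t ltac:(lra)); nra.
- assert (H2 : - dilog_im t < - dilog_im PI); [|rewrite dilog_im_PI in H2; lra].
  apply (lt_of_derive (fun t => - dilog_im t) (fun t => ln (2 * sin (t / 2)))); [lra| |].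
  + intros c Hc; rewrite <- (Ropp_involutive (ln _)); apply (is_derive_opp dilog_im); apply is_derive_dilog_im; lra.
  + intros c Hc; rewrite <- ln_1; apply ln_increasing; [lra|apply two_sin_gt_1; lra].
Qed.

(* The square of the real part of the principal square root of [dilog t]. *)
Definition g2 (t : R) : R := (Cmod (dilog t) + dilog_re t) / 2.

Lemma g2_nonneg t : 0 <= g2 t.
Proof. unfold g2, dilog_re; pose proof (Re_le_Cmod (dilog t)) as H; apply Rabs_le_between in H; lra. Qed.

Lemma g2_period t : g2 (t + 2 * PI) = g2 t.
Proof. unfold g2, dilog_re; rewrite dilog_period; reflexivity. Qed.

Lemma g2_opp t : g2 (- t) = g2 t.
Proof. unfold g2, dilog_re; rewrite dilog_opp, Cmod_conj; reflexivity. Qed.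

Lemma g2_reflect t : g2 (2 * PI - t) = g2 t.
Proof. replace (2 * PI - t) with (- t + 2 * PI) by ring; rewrite g2_period; apply g2_opp. Qed.

Lemma g2_0 : g2 0 = PI * PI / 6.
Proof. pose proof PI_RGT_0; unfold g2, dilog_re; rewrite dilog_0, Cmod_RtoC_pos, Re_RtoC by nra; field. Qed.

Lemma g2_PI : g2 PI = 0.
Proof.
pose proof PI_RGT_0; pose proof (dilog_sqr PI) as H1; rewrite dilog_im_PI in H1.
pose proof (dilog_re_formula PI ltac:(lra)) as HA; pose proof (Cmod_ge_0 (dilog PI)).
assert (dilog_re PI < 0) by nra; unfold g2; nra.
Qed.

Lemma g2_max t : g2 t <= PI * PI / 6.
Proof. unfold g2, dilog_re; pose proof (Re_le_Cmod (dilog t)) as H; apply Rabs_le_between in H; pose proof (Cmod_dilog_le t); lra. Qed.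

(** Squaring [Cmod (dilog t) > 2 m - dilog_re t] eliminates the modulus, so that bounds on real and
    imaginary part suffice. *)
Lemma g2_gt t m : 0 <= m -> 4 * m * (m - dilog_re t) < dilog_im t ^ 2 -> m < g2 t.
Proof. intros Hm H; unfold g2; pose proof (dilog_sqr t); pose proof (Cmod_ge_0 (dilog t)); nra. Qed.

Lemma g2_le t m : 0 <= 2 * m - dilog_re t -> dilog_im t ^ 2 <= 4 * m * (m - dilog_re t) -> g2 t <= m.
Proof. intros Hm H; unfold g2; pose proof (dilog_sqr t); pose proof (Cmod_ge_0 (dilog t)); nra. Qed.

Lemma dilog_pos t : 0 < t <= PI -> 0 < Cmod (dilog t).
Proof.
intros Ht; pose proof (dilog_sqr t) as H1; pose proof (Cmod_ge_0 (dilog t)).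
destruct (Req_dec t PI) as [->|Hne].
- pose proof (dilog_re_formula PI ltac:(lra)) as HA; assert (dilog_re PI < 0) by nra; nra.
- pose proof (dilog_im_pos t ltac:(lra)); nra.
Qed.

Lemma is_derive_g2 t : 0 < t <= PI ->
  is_derive g2 t (((dilog_re t * ((t - PI) / 2) + dilog_im t * - ln (2 * sin (t / 2))) / Cmod (dilog t) + (t - PI) / 2) / 2).
Proof.
intros Ht; pose proof (dilog_pos t Ht) as HM; pose proof (dilog_sqr t) as Hsq.
pose proof (is_derive_dilog_re t ltac:(lra)) as H1; pose proof (is_derive_dilog_im t ltac:(lra)) as H2.
set (b' := - ln (2 * sin (t / 2))) in *; set (a' := (t - PI) / 2) in *.
assert (HS : is_derive (fun t => sqrt (dilog_re t * dilog_re t + dilog_im t * dilog_im t)) t ((dilog_re t * a' + dilog_im t * b') / Cmod (dilog t))).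
{ replace ((dilog_re t * a' + dilog_im t * b') / Cmod (dilog t))
    with (((a' * dilog_re t + dilog_re t * a') + (b' * dilog_im t + dilog_im t * b')) / (2 * sqrt (dilog_re t * dilog_re t + dilog_im t * dilog_im t))).
  - apply (is_derive_sqrt (fun t => dilog_re t * dilog_re t + dilog_im t * dilog_im t)); [|nra].
    apply (is_derive_plus (fun t => dilog_re t * dilog_re t) (fun t => dilog_im t * dilog_im t)); apply is_derive_Rmult; assumption.
  - replace (sqrt (dilog_re t * dilog_re t + dilog_im t * dilog_im t)) with (Cmod (dilog t)); [field; lra|].
    unfold Cmod; f_equal; unfold dilog_re, dilog_im, Re, Im; ring. }
apply is_derive_ext with (fun t => / 2 * (sqrt (dilog_re t * dilog_re t + dilog_im t * dilog_im t) + dilog_re t)).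
- intros u; unfold g2; replace (Cmod (dilog u)) with (sqrt (dilog_re u * dilog_re u + dilog_im u * dilog_im u)); [apply Rmult_comm|].
  unfold Cmod; f_equal; unfold dilog_re, dilog_im, Re, Im; ring.
- replace (((dilog_re t * a' + dilog_im t * b') / Cmod (dilog t) + a') / 2) with (/ 2 * ((dilog_re t * a' + dilog_im t * b') / Cmod (dilog t) + a')) by (field; lra).
  apply is_derive_scal; apply (is_derive_plus (fun t => sqrt (dilog_re t * dilog_re t + dilog_im t * dilog_im t)) dilog_re); assumption.
Qed.

(** The sign depends on [dilog_im t * b' < (PI - t)/2 * (Cmod + dilog_re)]. From [PI / 3] on,
    [b' <= 0]. Down to [1/2], [b' <= 1] while [(PI - t)/2 > 1]. Below that, the logarithmic growth
    of [b'] is offset by the factor [t] in [dilog_im]. *)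
Lemma g2_derive_neg t : 0 < t < PI ->
  ((dilog_re t * ((t - PI) / 2) + dilog_im t * - ln (2 * sin (t / 2))) / Cmod (dilog t) + (t - PI) / 2) / 2 < 0.
Proof.
intros Ht; pose proof (dilog_pos t ltac:(lra)) as HM; pose proof (dilog_sqr t) as Hsq; pose proof PI_bounds as Hpi.
pose proof (dilog_im_pos t Ht) as HB; set (b' := - ln (2 * sin (t / 2))).
assert (Hkey : dilog_im t * b' < (PI - t) / 2 * (Cmod (dilog t) + dilog_re t)).
{ assert (HMA : 0 < Cmod (dilog t) + dilog_re t) by nra.
  assert (HMB : dilog_im t < Cmod (dilog t) \/ dilog_re t = 0) by (destruct (Req_dec (dilog_re t) 0); [right; assumption|left; nra]).
  assert (HMB' : dilog_im t <= Cmod (dilog t)) by nra.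
  destruct (Rle_dec (PI / 3) t) as [H1|H1].
  - assert (b' <= 0); [|nra].
    assert (0 <= ln (2 * sin (t / 2))); [|unfold b'; lra].
    rewrite <- ln_1; apply ln_le; [lra|apply two_sin_ge_1; lra].
  - pose proof (dilog_re_formula t ltac:(lra)) as HA.
    assert (HA0 : 0 < dilog_re t) by nra.
    assert (Hb' : b' <= - ln t + 1 / 9) by (unfold b'; pose proof (ln_2sin_lower t ltac:(lra)); lra).
    destruct (Rle_dec (1 / 2) t) as [H2|H2].
    + assert (Hln : - ln 2 <= ln t) by (rewrite <- ln_Rinv by lra; apply ln_le; lra).
      pose proof ln2_bounds; assert (b' <= 1) by lra.
      assert (dilog_im t * b' <= dilog_im t) by nra.
      assert ((Cmod (dilog t) + dilog_re t) <= (PI - t) / 2 * (Cmod (dilog t) + dilog_re t)) by nra.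
      lra.
    + pose proof (dilog_im_upper t ltac:(lra)) as HBu.
      set (l := - ln t) in *; replace (1 - ln t + 1 / 9) with (10 / 9 + l) in HBu by (unfold l; lra).
      assert (Hl0 : 0 < l) by (unfold l; assert (ln t < ln 1) by (apply ln_increasing; lra); rewrite ln_1 in *; lra).
      (* As [t = e^(-l)], the Taylor polynomial of [e^l] bounds [t] times a quadratic in [l]; twice
         that polynomial dominates the product of the two logarithmic factors. *)
      assert (Htl : t * (1 + l + l * l / 2) <= 1).
      { replace 1 with (t * exp l) at 2 by (unfold l; rewrite exp_Ropp, exp_ln by lra; field; lra).
        apply Rmult_le_compat_l; [lra|].
        eapply Rle_trans; [|apply (exp_ge_taylor l 2); lra]; simpl; lra. }
      assert (H3 : dilog_im t * b' <= t * (10 / 9 + l) * (l + 1 / 9)).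
      { apply Rle_trans with (dilog_im t * (l + 1 / 9)); [apply Rmult_le_compat_l; lra|apply Rmult_le_compat_r; lra]. }
      assert (H4 : t * (10 / 9 + l) * (l + 1 / 9) <= 2).
      { apply Rle_trans with (2 * (t * (1 + l + l * l / 2))); [|lra].
        replace (2 * (t * (1 + l + l * l / 2))) with (t * (2 + 2 * l + l * l)) by field.
        rewrite Rmult_assoc; apply Rmult_le_compat_l; [lra|nra]. }
      assert (HA2 : 0.9 < dilog_re t) by nra.
      assert (dilog_re t <= Cmod (dilog t)) by nra.
      assert (2 < (PI - t) / 2 * (Cmod (dilog t) + dilog_re t)) by nra.
      lra. }
replace (((dilog_re t * ((t - PI) / 2) + dilog_im t * b') / Cmod (dilog t) + (t - PI) / 2) / 2)
  with (- (((PI - t) / 2 * (Cmod (dilog t) + dilog_re t) - dilog_im t * b') / (2 * Cmod (dilog t)))) by (field; lra).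
assert (0 < ((PI - t) / 2 * (Cmod (dilog t) + dilog_re t) - dilog_im t * b') / (2 * Cmod (dilog t))); [|lra].
apply Rdiv_lt_0_compat; lra.
Qed.

Lemma g2_decr s t : 0 <= s -> s < t -> t <= PI -> g2 t < g2 s.
Proof.
intros Hs Hst Ht; pose proof PI_RGT_0.
destruct (Req_dec s 0) as [->|Hs0].
- rewrite g2_0; unfold g2; pose proof (Cmod_dilog_le t); pose proof (dilog_re_formula t ltac:(lra)); nra.
- assert (- g2 s < - g2 t); [|lra].
  apply (lt_of_derive (fun t => - g2 t) (fun t => - (((dilog_re t * ((t - PI) / 2) + dilog_im t * - ln (2 * sin (t / 2))) / Cmod (dilog t) + (t - PI) / 2) / 2))); [exact Hst| |].
  + intros c Hc; apply (is_derive_opp g2), is_derive_g2; lra.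
  + intros c Hc; pose proof (g2_derive_neg c ltac:(lra)); lra.
Qed.

(** If [2 u] exceeds [PI], its reflection [2 PI - 2 u] is still larger than [u], exactly because
    [u < 2 PI / 3]. *)
Lemma g2_double_lt u : 0 < u < 2 * PI / 3 -> g2 (2 * u) < g2 u.
Proof.
intros Hu; pose proof PI_RGT_0; destruct (Rle_dec (2 * u) PI) as [H1|H1]; [apply g2_decr; lra|].
rewrite <- (g2_reflect (2 * u)); apply g2_decr; lra.
Qed.

(** The slope [77/200] is the [0.385] separating [Psi 1] from [Psi 3]. The range just covers
    [PI / 3] and [(PI + 1/20) / 3], the largest arguments needed. *)
Lemma g2_linear_upper v : 0 <= v <= 1.065 -> g2 (PI - v) <= ((77 / 200) * v) ^ 2.
Proof.
intros Hv; pose proof PI_bounds as Hpi; pose proof ln2_bounds as Hl2.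
pose proof (dilog_re_formula (PI - v) ltac:(lra)) as HA.
pose proof (dilog_im_near_PI v ltac:(lra)) as HB.
assert (HB0 : 0 <= dilog_im (PI - v)).
{ destruct (Req_dec v 0) as [->|H0]; [rewrite Rminus_0_r, dilog_im_PI; lra|left; apply dilog_im_pos; lra]. }
set (x := v * v); assert (Hx : 0 <= x <= 1.1343) by (unfold x; nra).
assert (HA' : dilog_re (PI - v) = x / 4 - PI * PI / 12) by (rewrite HA; unfold x; field).
assert (Hpp : 9.869 < PI * PI) by nra.
assert (HB' : dilog_im (PI - v) <= v * (0.6935 - x / 24)) by (unfold x; nra).
assert (HB2 : dilog_im (PI - v) ^ 2 <= x * (0.6935 - x / 24) ^ 2).
{ replace (x * (0.6935 - x / 24) ^ 2) with ((v * (0.6935 - x / 24)) ^ 2) by (unfold x; ring); apply pow_incr; lra. }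
replace (((77 / 200) * v) ^ 2) with ((5929 / 40000) * x) by (unfold x; field).
apply g2_le; rewrite HA'; [nra|].
eapply Rle_trans; [exact HB2|].
replace (4 * ((5929 / 40000) * x) * ((5929 / 40000) * x - (x / 4 - PI * PI / 12))) with (x * ((5929 / 10000) * (PI * PI / 12 - (4071 / 40000) * x))) by field.
apply Rmult_le_compat_l; [lra|]; nra.
Qed.

(** By [g2_gt] and [dilog_im u >= u (2 - u)] this becomes a polynomial inequality in [r = 1 - u],
    with [PI] replaced by decimal bounds. *)
Lemma g2_linear_lower u : 0 <= u <= 1 -> ((77 / 200) * (PI - u)) ^ 2 < g2 u.
Proof.
intros Hu; pose proof PI_bounds as Hpi.
destruct (Req_dec u 0) as [->|H0].
{ rewrite g2_0, Rminus_0_r; nra. }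
pose proof (dilog_re_formula u ltac:(lra)) as HA.
assert (HB : u * (2 - u) <= dilog_im u).
{ pose proof (dilog_im_lower u ltac:(lra)); pose proof (ln_le_minus_1 u ltac:(lra)); nra. }
set (y := PI - u).
assert (HA' : dilog_re u = y * y / 4 - PI * PI / 12) by (rewrite HA; unfold y; field).
apply g2_gt; [apply pow2_ge_0|]; rewrite HA'.
apply Rlt_le_trans with ((u * (2 - u)) ^ 2); [|apply pow_incr; split; [nra|exact HB]].
replace (4 * ((77 / 200) * y) ^ 2 * (((77 / 200) * y) ^ 2 - (y * y / 4 - PI * PI / 12)))
  with ((5929 / 10000) * (y * y) * (PI * PI / 12 - (4071 / 40000) * (y * y))) by field.
set (r := 1 - u); assert (Hr : 0 <= r < 1) by (unfold r; lra).
replace (u * (2 - u)) with (1 - r * r) by (unfold r; ring).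
assert (Hy : 2.1415 + r <= y) by (unfold r, y; lra).
set (Y := (2.1415 + r) * (2.1415 + r)).
assert (HY : Y <= y * y) by (apply Rmult_le_compat; lra).
assert (HY0 : 4.58 < Y) by (unfold Y; nra).
assert (Hpp : PI * PI / 12 < 0.82248) by nra.
(* The quadratic in [y * y] decreases beyond 4.58, so the smaller [Y] may replace [y * y]. *)
apply Rle_lt_trans with ((5929 / 10000) * Y * (0.82248 - (4071 / 40000) * Y)); [nra|].
assert (0 <= r * ((r - 0.4) * (r - 0.4))) by (apply Rmult_le_pos; [lra|apply Rle_0_sqr]).
assert (Hc : 0 <= 0.2819 - 0.8273 * r + 0.5168 * (r * r) + 1.06 * (r * r * r)) by nra.
assert (0 <= r * (0.2819 - 0.8273 * r + 0.5168 * (r * r) + 1.06 * (r * r * r))) by (apply Rmult_le_pos; lra).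
assert (0 <= r * r * r * r) by (repeat apply Rmult_le_pos; lra).
assert (0 <= r * r * r) by (repeat apply Rmult_le_pos; lra).
unfold Y; nra.
Qed.

(* Chosen so that [3 theta_c = 1] modulo [2 PI]; it lies slightly above [theta23]. *)
Definition theta_c : R := (2 * PI + 1) / 3.

Lemma sqrt_le_of x c : 0 <= c -> x <= c * c -> sqrt x <= c.
Proof. intros Hc H; rewrite <- (sqrt_square c) by exact Hc; apply sqrt_le_1_alt, H. Qed.

(** After reduction modulo [2 PI] and reflection this is [Psi 3 < Psi 2] at [theta_c]. The margin is
    large enough to replace the modulus by the sum of real and imaginary parts on the left and by
    the imaginary part alone on the right. *)
Lemma g2_theta_c : g2 1 / 9 < g2 (2 * (PI - 1) / 3) / 4.
Proof.
pose proof PI_bounds as Hpi; pose proof ln2_bounds as Hl2; set (w := 2 * (PI - 1) / 3).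
pose proof (dilog_re_formula 1 ltac:(lra)) as HA1; pose proof (dilog_re_formula w ltac:(unfold w; lra)) as HA2.
assert (HB1 : dilog_im 1 <= 1.08).
{ pose proof (dilog_im_near_PI (PI - 1) ltac:(lra)) as H; replace (PI - (PI - 1)) with 1 in H by ring.
  assert (2.1415 * 2.1415 * 2.1415 <= (PI - 1) * (PI - 1) * (PI - 1)).
  { apply Rmult_le_compat; try lra; apply Rmult_le_compat; lra. }
  nra. }
assert (Hw : 1.4276 < w < 1.4278) by (unfold w; lra).
assert (HB2 : 0.87 <= dilog_im w).
{ pose proof (dilog_im_lower w ltac:(lra)) as H.
  assert (Hln : ln w <= 0.39).
  { rewrite <- (sqrt_sqrt w) by lra; assert (Hs : 0 < sqrt w) by (apply sqrt_lt_R0; lra).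
    rewrite ln_mult by exact Hs; pose proof (ln_le_minus_1 (sqrt w) Hs).
    assert (sqrt w <= 1.195) by (apply sqrt_le_of; lra); lra. }
  nra. }
assert (H1 : g2 1 <= (2 * dilog_re 1 + dilog_im 1) / 2).
{ unfold g2; pose proof (Cmod_le_ReIm (dilog 1)) as H; fold (dilog_re 1) (dilog_im 1) in H.
  rewrite !Rabs_pos_eq in H; [lra|left; apply dilog_im_pos; lra|nra]. }
assert (H2 : (dilog_im w + dilog_re w) / 2 <= g2 w).
{ unfold g2; pose proof (Im_le_Cmod (dilog w)) as H; fold (dilog_im w) in H; pose proof (Rle_abs (dilog_im w)); lra. }
assert (Hpp : 9.869 < PI * PI < 9.8697) by nra.
assert (HA2' : -0.0885 <= dilog_re w) by (rewrite HA2; nra).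
lra.
Qed.

(** The lower bound places [Psi 1] at [2 PI / 3] above every [Psi k] with [k >= 4]. It uses
    [dilog_im (2 PI / 3) = 2/3 dilog_im (PI / 3)], a consequence of duplication and reflection. *)
Lemma g2_two_thirds : PI * PI / 6 / 16 < g2 (2 * PI / 3) < PI * PI / 6 / 9.
Proof.
pose proof PI_bounds as Hpi; assert (Hpp : 9.869 < PI * PI < 9.8697) by nra; split.
- pose proof (dilog_im_duplication (PI / 3)) as D.
  replace (2 * (PI / 3)) with (2 * PI / 3) in D by field.
  replace (PI / 3 + PI) with (2 * PI - 2 * PI / 3) in D by field; rewrite dilog_im_reflect in D.
  assert (HB : PI / 3 * (2 - PI / 3) <= dilog_im (PI / 3)).
  { pose proof (dilog_im_lower (PI / 3) ltac:(lra)); pose proof (ln_le_minus_1 (PI / 3) ltac:(lra)); nra. }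
  pose proof (dilog_re_formula (2 * PI / 3) ltac:(lra)) as HA.
  assert (HB2 : 0.66 <= dilog_im (2 * PI / 3)) by nra.
  apply g2_gt; [lra|]; rewrite HA; nra.
- pose proof (g2_linear_upper (PI / 3) ltac:(lra)) as H; replace (PI - PI / 3) with (2 * PI / 3) in H by field.
  eapply Rle_lt_trans; [exact H|]; nra.
Qed.

(** * Comparison of the growth rates *)

Lemma Carg_bound z : - PI <= Carg z <= PI.
Proof.
unfold Carg; pose proof (acos_bound (Re z / Cmod z)); destruct (Rle_dec 0 (Im z)); lra.
Qed.

Lemma Cpower_eq z w : z <> RtoC 0 -> Cpower z w = Cexp (w * Clog z)%C.
Proof. intros H; unfold Cpower; destruct (Ceq_dec z 0); [contradiction|reflexivity]. Qed.

Lemma Csqrt_0 : Csqrt 0 = 0%C.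
Proof.
unfold Csqrt, Cpower; destruct (Ceq_dec 0 0) as [_|H]; [|elim H; reflexivity].
destruct (Ceq_dec (1 / 2)%R 0) as [E|_]; [|reflexivity].
apply RtoC_inj in E; lra.
Qed.

Lemma Csqrt_sqr z : (Csqrt z * Csqrt z)%C = z.
Proof.
destruct (Ceq_dec z 0) as [->|Hz]; [rewrite Csqrt_0; ring|].
unfold Csqrt; rewrite Cpower_eq, <- Cexp_plus by exact Hz.
replace (RtoC (1 / 2) * Clog z + RtoC (1 / 2) * Clog z)%C with (Clog z); [apply Cexp_Clog, Hz|].
rewrite <- Cmult_plus_distr_r, <- RtoC_plus; replace (1 / 2 + 1 / 2) with 1 by field; ring.
Qed.

Lemma Re_Csqrt_nonneg z : 0 <= Re (Csqrt z).
Proof.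
destruct (Ceq_dec z 0) as [->|Hz]; [rewrite Csqrt_0, Re_RtoC; lra|].
unfold Csqrt; rewrite Cpower_eq, Re_Cexp by exact Hz.
apply Rmult_le_pos; [left; apply exp_pos|].
rewrite Im_mult, Re_RtoC, Im_RtoC; change (Im (Clog z)) with (Carg z).
pose proof (Carg_bound z); apply cos_ge_0; lra.
Qed.

Lemma Re_sqr_of_sqr s w : (s * s)%C = w -> Re s ^ 2 = (Cmod w + Re w) / 2.
Proof.
intros <-; rewrite Cmod_mult, Re_mult; pose proof (Cmod_sqr s); lra.
Qed.

Lemma Re_Csqrt z : Re (Csqrt z) = sqrt ((Cmod z + Re z) / 2).
Proof.
rewrite <- (Re_sqr_of_sqr _ _ (Csqrt_sqr z)); symmetry; apply sqrt_pow2, Re_Csqrt_nonneg.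
Qed.

(** The square of [Psi k]. Without roots, comparisons reduce to the monotonicity, period and
    reflection of [g2]. *)
Definition Psi2 (k : nat) (t : R) : R := g2 (INR k * t) / INR k ^ 2.

Lemma Psi2_nonneg k t : (0 < k)%nat -> 0 <= Psi2 k t.
Proof. intros Hk; apply Rdiv_le_0_compat; [apply g2_nonneg|apply pow_lt, lt_0_INR, Hk]. Qed.

Lemma Psi_sqrt k t : (0 < k)%nat -> Psi k t = sqrt (Psi2 k t).
Proof.
intros Hk; assert (0 < INR k) by (apply lt_0_INR, Hk).
unfold Psi; change (Cexp (0, INR k * t)%R) with (expi (INR k * t)); fold (dilog (INR k * t)).
unfold Cdiv; rewrite <- RtoC_inv, Re_mult, Re_RtoC, Im_RtoC, Re_Csqrt by lra.
unfold Psi2; rewrite (sqrt_div_alt _ (INR k ^ 2)) by (apply pow_lt; assumption).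
rewrite sqrt_pow2 by lra; unfold g2, dilog_re, Rdiv; ring.
Qed.

Lemma Psi_eq_iff j k t : (0 < j)%nat -> (0 < k)%nat -> (Psi j t = Psi k t <-> Psi2 j t = Psi2 k t).
Proof.
intros Hj Hk; rewrite !Psi_sqrt by assumption; split; [|congruence].
apply sqrt_inj; apply Psi2_nonneg; assumption.
Qed.

Lemma Psi2_1 t : Psi2 1 t = g2 t.
Proof. unfold Psi2; simpl; rewrite Rmult_1_l; field. Qed.

Lemma Psi2_2 t : Psi2 2 t = g2 (2 * PI - 2 * t) / 4.
Proof. unfold Psi2; rewrite g2_reflect; simpl; f_equal; ring. Qed.

Lemma Psi2_3 t : Psi2 3 t = g2 (3 * t) / 9.
Proof. unfold Psi2; replace (INR 3) with 3 by (simpl; ring); f_equal; ring. Qed.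

Lemma Psi2_3_left t : Psi2 3 t = g2 (2 * PI - 3 * t) / 9.
Proof. rewrite Psi2_3, g2_reflect; reflexivity. Qed.

Lemma Psi2_3_right t : Psi2 3 t = g2 (3 * t - 2 * PI) / 9.
Proof. rewrite Psi2_3; rewrite <- (g2_period (3 * t - 2 * PI)); f_equal; f_equal; ring. Qed.

(** Modulo reflection [3 t] stays farther from 0 than [t], since [2 PI - 3 t > t] below [PI / 2]. *)
Lemma Psi2_13_small t : 0 < t < PI / 2 -> Psi2 3 t < Psi2 1 t.
Proof.
intros Ht; rewrite Psi2_1; apply Rle_lt_trans with (g2 (3 * t)); [rewrite Psi2_3; pose proof (g2_nonneg (3 * t)); lra|].
destruct (Rle_dec (3 * t) PI) as [H|H]; [apply g2_decr; lra|].
rewrite <- (g2_reflect (3 * t)); apply g2_decr; lra.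
Qed.

(** On this range [2 PI - 3 t] runs through [[0, PI]] downwards while [t] increases, so both terms
    of the difference push upwards. *)
Lemma Psi2_13_incr s t : PI / 3 <= s -> s < t -> t <= 2 * PI / 3 -> Psi2 3 s - Psi2 1 s < Psi2 3 t - Psi2 1 t.
Proof.
intros Hs Hst Ht; rewrite !Psi2_1, !Psi2_3_left.
pose proof (g2_decr s t ltac:(lra) Hst ltac:(lra)); pose proof (g2_decr (2 * PI - 3 * t) (2 * PI - 3 * s) ltac:(lra) ltac:(lra) ltac:(lra)); lra.
Qed.

Lemma Psi2_23_incr s t : 2 * PI / 3 <= s -> s < t -> t <= PI -> Psi2 2 s - Psi2 3 s < Psi2 2 t - Psi2 3 t.
Proof.
intros Hs Hst Ht; rewrite !Psi2_2, !Psi2_3_right; pose proof PI_RGT_0.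
pose proof (g2_decr (2 * PI - 2 * t) (2 * PI - 2 * s) ltac:(lra) ltac:(lra) ltac:(lra)).
pose proof (g2_decr (3 * s - 2 * PI) (3 * t - 2 * PI) ltac:(lra) ltac:(lra) ltac:(lra)); lra.
Qed.

Lemma g2_comp_lin_continuity a b t : 0 < a * t + b <= PI -> continuity_pt (fun t => g2 (a * t + b)) t.
Proof.
intros H; apply derivable_continuous_pt.
pose proof (is_derive_g2 _ H) as Hd; set (l := ((_ / _ + _) / 2)) in Hd.
exists (a * l); apply is_derive_Reals, (is_derive_comp g2 (fun t => a * t + b)); [exact Hd|].
auto_derive; [trivial|ring].
Qed.

Lemma IVT_affine_g2 a b c d p q x y : x < y -> (forall t, x <= t <= y -> 0 < a * t + b <= PI /\ 0 < c * t + d <= PI) ->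
  p * g2 (a * x + b) - q * g2 (c * x + d) < 0 -> 0 < p * g2 (a * y + b) - q * g2 (c * y + d) ->
  exists t, x <= t <= y /\ p * g2 (a * t + b) = q * g2 (c * t + d).
Proof.
intros Hxy H Hx Hy.
destruct (IVT_interv (fun t => p * g2 (a * t + b) - q * g2 (c * t + d)) x y) as (t & Ht & E); try assumption.
- intros t Ht; destruct (H t Ht) as [H1 H2].
  apply continuity_pt_minus; apply continuity_pt_mult; try (apply continuity_pt_const; intros ? ?; reflexivity);
    apply g2_comp_lin_continuity; assumption.
- exists t; split; [exact Ht|lra].
Qed.

(** A crossing exists by the intermediate value theorem. It is unique because equality is impossible
    below [PI / 2] and the difference is strictly monotone beyond. *)
Lemma theta13_spec : PI / 3 < theta13 < 2 * PI / 3 /\ Psi2 1 theta13 = Psi2 3 theta13.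
Proof.
pose proof PI_bounds as Hpi.
(* The search stops [1/60] short of [2 PI / 3]: continuity of [g2] is available only for arguments
   in [(0, PI]], and [2 PI - 3 t] would reach 0. *)
assert (Hex : exists t, PI / 3 <= t <= (2 * PI - (1 / 20)) / 3 /\ Psi2 1 t = Psi2 3 t).
{ destruct (IVT_affine_g2 (-3) (2 * PI) 1 0 (/ 9) 1 (PI / 3) ((2 * PI - (1 / 20)) / 3)) as (t & Ht & E).
  - lra.
  - intros t Ht; lra.
  - replace (-3 * (PI / 3) + 2 * PI) with PI by field; rewrite g2_PI, Rplus_0_r, !Rmult_1_l.
    pose proof (g2_decr (PI / 3) PI ltac:(lra) ltac:(lra) ltac:(lra)) as H; rewrite g2_PI in H; lra.
  - replace (-3 * ((2 * PI - (1 / 20)) / 3) + 2 * PI) with (1 / 20) by field; rewrite Rplus_0_r.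
    assert (H1 : dilog_re (1 / 20) <= g2 (1 / 20)) by (unfold g2, dilog_re; pose proof (Re_le_Cmod (dilog (1 / 20))) as H; pose proof (Rle_abs (Re (dilog (1 / 20)))); lra).
    rewrite dilog_re_formula in H1 by lra.
    pose proof (g2_linear_upper ((PI + (1 / 20)) / 3) ltac:(lra)) as H2.
    replace (PI - (PI + (1 / 20)) / 3) with (1 * ((2 * PI - (1 / 20)) / 3)) in H2 by field; nra.
  - exists t; split; [exact Ht|]; rewrite Psi2_1, Psi2_3_left.
    replace (2 * PI - 3 * t) with (-3 * t + 2 * PI) by ring; replace t with (1 * t + 0) at 1 by ring; lra. }
destruct Hex as (t & Ht & E).
assert (Hu : forall u, 0 < u < 2 * PI / 3 /\ Psi 1 u = Psi 3 u -> u = t).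
{ intros u (Hu & Eu); apply Psi_eq_iff in Eu; try lia.
  destruct (Rlt_dec u (PI / 2)) as [H|H]; [pose proof (Psi2_13_small u ltac:(lra)); lra|].
  destruct (Rtotal_order u t) as [H'|[H'|H']]; [|exact H'|].
  - pose proof (Psi2_13_incr u t ltac:(lra) H' ltac:(lra)); lra.
  - pose proof (Psi2_13_incr t u ltac:(lra) H' ltac:(lra)); lra. }
assert (Ht2 : 0 < t < 2 * PI / 3 /\ Psi 1 t = Psi 3 t) by (split; [lra|apply Psi_eq_iff; [lia|lia|exact E]]).
assert (E13 : theta13 = t) by (apply iota_unique; assumption).
rewrite E13; split; [|exact E].
destruct (Req_dec t (PI / 3)) as [E3|]; [|lra].
rewrite E3 in E; pose proof (Psi2_13_small (PI / 3) ltac:(lra)); lra.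
Qed.

Lemma below_theta13 t : 0 < t < theta13 -> Psi2 3 t < Psi2 1 t.
Proof.
destruct theta13_spec as [H E]; pose proof PI_RGT_0; intros Ht.
destruct (Rlt_dec t (PI / 2)) as [H1|H1]; [apply Psi2_13_small; lra|].
pose proof (Psi2_13_incr t theta13 ltac:(lra) ltac:(lra) ltac:(lra)); lra.
Qed.

Lemma above_theta13 t : theta13 < t <= 2 * PI / 3 -> Psi2 1 t < Psi2 3 t.
Proof.
destruct theta13_spec as [H E]; intros Ht.
pose proof (Psi2_13_incr theta13 t ltac:(lra) ltac:(lra) ltac:(lra)); lra.
Qed.

(* The two linear bounds compare [Psi 1] and [Psi 3] to [0.385 (PI - t)] on the two sides. *)
Lemma Psi2_1_lt_3 t : 2 * PI / 3 <= t <= theta_c -> Psi2 1 t < Psi2 3 t.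
Proof.
intros Ht; unfold theta_c in Ht; pose proof PI_bounds as Hpi; rewrite Psi2_1, Psi2_3_right.
pose proof (g2_linear_upper (PI - t) ltac:(lra)) as H1; replace (PI - (PI - t)) with t in H1 by ring.
pose proof (g2_linear_lower (3 * t - 2 * PI) ltac:(lra)) as H2.
replace ((77 / 200 * (PI - (3 * t - 2 * PI))) ^ 2) with (9 * (77 / 200 * (PI - t)) ^ 2) in H2 by field; lra.
Qed.

Lemma Psi2_3_lt_2_at_c : Psi2 3 theta_c < Psi2 2 theta_c.
Proof.
rewrite Psi2_2, Psi2_3_right; unfold theta_c; pose proof g2_theta_c.
replace (3 * ((2 * PI + 1) / 3) - 2 * PI) with 1 by field.
replace (2 * PI - 2 * ((2 * PI + 1) / 3)) with (2 * (PI - 1) / 3) by field; assumption.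
Qed.

Lemma theta23_spec : 2 * PI / 3 < theta23 < theta_c /\ Psi2 2 theta23 = Psi2 3 theta23.
Proof.
pose proof PI_bounds as Hpi; pose proof Psi2_3_lt_2_at_c as Hc.
(* As for [theta13], the offset keeps the argument [3 t - 2 PI] of [g2] away from 0. *)
set (t0 := (2 * PI + (1 / 20)) / 3).
assert (Hex : exists t, t0 <= t <= theta_c /\ Psi2 2 t = Psi2 3 t).
{ destruct (IVT_affine_g2 (-2) (2 * PI) 3 (- 2 * PI) (/ 4) (/ 9) t0 theta_c) as (t & Ht & E).
  - unfold t0, theta_c; lra.
  - intros t Ht; unfold t0, theta_c in Ht; lra.
  - replace (-2 * t0 + 2 * PI) with (2 * PI / 3 - (1 / 10) / 3) by (unfold t0; field).
    replace (3 * t0 + - 2 * PI) with (1 / 20) by (unfold t0; field).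
    assert (H1 : dilog_re (1 / 20) <= g2 (1 / 20)) by (unfold g2, dilog_re; pose proof (Re_le_Cmod (dilog (1 / 20))) as H; pose proof (Rle_abs (Re (dilog (1 / 20)))); lra).
    rewrite dilog_re_formula in H1 by lra.
    pose proof (g2_decr (PI / 2) (2 * PI / 3 - (1 / 10) / 3) ltac:(lra) ltac:(lra) ltac:(lra)) as H2.
    assert (H3 : g2 (PI / 2) <= dilog_im (PI / 2) / 2).
    { unfold g2; pose proof (Cmod_le_ReIm (dilog (PI / 2))) as H; fold (dilog_re (PI / 2)) (dilog_im (PI / 2)) in H.
      rewrite (Rabs_pos_eq (dilog_im _)) in H by (left; apply dilog_im_pos; lra).
      rewrite (Rabs_left1 (dilog_re _)) in H by (rewrite dilog_re_formula by lra; nra); lra. }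
    pose proof (dilog_im_near_PI (PI / 2) ltac:(lra)) as H4; replace (PI - PI / 2) with (PI / 2) in H4 by field.
    pose proof ln2_bounds.
    assert (0 <= PI / 2 * (PI / 2) * (PI / 2)) by (apply Rmult_le_pos; [apply Rmult_le_pos|]; lra).
    assert (dilog_im (PI / 2) <= 1.1) by nra.
    assert (9.8 < PI * PI) by nra; lra.
  - rewrite Psi2_2, Psi2_3_right in Hc.
    replace (-2 * theta_c + 2 * PI) with (2 * PI - 2 * theta_c) by ring.
    replace (3 * theta_c + -2 * PI) with (3 * theta_c - 2 * PI) by ring; lra.
  - exists t; split; [exact Ht|]; rewrite Psi2_2, Psi2_3_right.
    replace (2 * PI - 2 * t) with (-2 * t + 2 * PI) by ring; replace (3 * t - 2 * PI) with (3 * t + -2 * PI) by ring; lra. }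
destruct Hex as (t & Ht & E).
assert (Htc : t < theta_c) by (destruct (Req_dec t theta_c) as [Et|]; [rewrite Et in E; lra|lra]).
assert (Hr : 2 * PI / 3 < t < PI) by (unfold t0, theta_c in *; lra).
assert (Hu : forall u, 2 * PI / 3 < u < PI /\ Psi 2 u = Psi 3 u -> u = t).
{ intros u (Hu & Eu); apply Psi_eq_iff in Eu; try lia.
  destruct (Rtotal_order u t) as [H'|[H'|H']]; [|exact H'|].
  - pose proof (Psi2_23_incr u t ltac:(lra) H' ltac:(lra)); lra.
  - pose proof (Psi2_23_incr t u ltac:(lra) H' ltac:(lra)); lra. }
assert (Ht2 : 2 * PI / 3 < t < PI /\ Psi 2 t = Psi 3 t) by (split; [lra|apply Psi_eq_iff; [lia|lia|exact E]]).
assert (E23 : theta23 = t) by (apply iota_unique; assumption).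
rewrite E23; split; [lra|exact E].
Qed.

Lemma below_theta23 t : 2 * PI / 3 <= t < theta23 -> Psi2 2 t < Psi2 3 t.
Proof.
destruct theta23_spec as [H E]; intros Ht; unfold theta_c in H; pose proof PI_bounds.
pose proof (Psi2_23_incr t theta23 ltac:(lra) ltac:(lra) ltac:(lra)); lra.
Qed.

Lemma above_theta23 t : theta23 < t <= PI -> Psi2 3 t < Psi2 2 t.
Proof.
destruct theta23_spec as [H E]; intros Ht; unfold theta_c in H; pose proof PI_bounds.
pose proof (Psi2_23_incr theta23 t ltac:(lra) ltac:(lra) ltac:(lra)); lra.
Qed.

Lemma Psi2_le_max k t : (0 < k)%nat -> Psi2 k t <= PI * PI / 6 / INR k ^ 2.
Proof.
intros Hk; unfold Psi2, Rdiv; apply Rmult_le_compat_r; [left; apply Rinv_0_lt_compat, pow_lt, lt_0_INR, Hk|].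
apply g2_max.
Qed.

(** Finitely many strict inequalities and the common bound [PI^2/6] on [g2], divided by [(m+1)^2],
    give a single positive gap for infinitely many [j]. *)
Lemma dominance_gap k m t : (0 < k)%nat -> (forall j, (0 < j <= m)%nat -> j <> k -> Psi2 j t < Psi2 k t) ->
  PI * PI / 6 / INR (S m) ^ 2 < Psi2 k t ->
  exists c, 0 < c /\ forall j, (0 < j)%nat -> j <> k -> Psi2 j t <= Psi2 k t - c.
Proof.
intros Hk Hj Hm; pose proof PI_RGT_0 as Hpi.
assert (Hfin : forall m', (m' <= m)%nat -> exists c, 0 < c /\ forall j, (0 < j <= m')%nat -> j <> k -> Psi2 j t <= Psi2 k t - c).
{ induction m' as [|m' IH]; intros Hm'; [exists 1; split; [lra|intros; lia]|].
  destruct (IH ltac:(lia)) as (c & Hc & H); destruct (Nat.eq_dec (S m') k) as [E|E].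
  - exists c; split; [exact Hc|]; intros j Hj' Hne; apply H; lia.
  - pose proof (Hj (S m') ltac:(lia) E) as H1; exists (Rmin c (Psi2 k t - Psi2 (S m') t)); split; [apply Rmin_glb_lt; lra|].
    pose proof (Rmin_l c (Psi2 k t - Psi2 (S m') t)); pose proof (Rmin_r c (Psi2 k t - Psi2 (S m') t)).
    intros j Hj' Hne; destruct (Nat.eq_dec j (S m')) as [->|Hj2]; [lra|].
    specialize (H j ltac:(lia) Hne); lra. }
destruct (Hfin m (Nat.le_refl m)) as (c & Hc & H).
set (d := Psi2 k t - PI * PI / 6 / INR (S m) ^ 2) in *.
exists (Rmin c d); split; [apply Rmin_glb_lt; [exact Hc|unfold d; lra]|].
pose proof (Rmin_l c d); pose proof (Rmin_r c d); intros j Hj0 Hne.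
destruct (Compare_dec.le_lt_dec j m) as [Hjm|Hjm]; [specialize (H j ltac:(lia) Hne); lra|].
assert (Psi2 j t <= PI * PI / 6 / INR (S m) ^ 2); [|unfold d in *; lra].
eapply Rle_trans; [apply Psi2_le_max, Hj0|]; unfold Rdiv; apply Rmult_le_compat_l; [nra|].
apply Rinv_le_contravar; [apply pow_lt, INR_S_pos|apply pow_incr; split; [apply pos_INR|apply le_INR; lia]].
Qed.

Definition dominates (k : nat) (t : R) : Prop :=
  exists c, 0 < c /\ forall j, (0 < j)%nat -> j <> k -> Psi2 j t <= Psi2 k t - c.

Lemma Psi2_2_lt_1 t : 0 < t < 2 * PI / 3 -> Psi2 2 t < Psi2 1 t.
Proof.
intros Ht; rewrite Psi2_1; unfold Psi2; replace (INR 2) with 2 by (simpl; ring).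
pose proof (g2_double_lt t Ht); pose proof (g2_nonneg (2 * t)); lra.
Qed.

(** With [u = 2 PI - 2 t], the argument [4 t] is [2 u] modulo sign and period, so [g2_double_lt]
    applies. *)
Lemma Psi2_4_lt_2 t : 2 * PI / 3 < t < PI -> Psi2 4 t < Psi2 2 t.
Proof.
intros Ht; rewrite Psi2_2; unfold Psi2; replace (INR 4) with 4 by (simpl; ring).
rewrite <- g2_opp, <- g2_period, <- g2_period; replace (- (4 * t) + 2 * PI + 2 * PI) with (2 * (2 * PI - 2 * t)) by ring.
pose proof (g2_double_lt (2 * PI - 2 * t) ltac:(lra)); pose proof (g2_nonneg (2 * (2 * PI - 2 * t))); lra.
Qed.

Lemma dominates_1 t : 0 < t < theta13 -> dominates 1 t.
Proof.
destruct theta13_spec as [H13 _]; intros Ht; pose proof PI_RGT_0; apply (dominance_gap 1 3); [lia| |].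
- intros j Hj Hne; assert (j = 2%nat \/ j = 3%nat) as [-> | ->] by lia; [apply Psi2_2_lt_1; lra|apply below_theta13, Ht].
- rewrite Psi2_1; replace (INR 4 ^ 2) with 16 by (simpl; ring).
  pose proof g2_two_thirds; pose proof (g2_decr t (2 * PI / 3) ltac:(lra) ltac:(lra) ltac:(lra)); lra.
Qed.

Lemma Psi2_3_c_lower : PI * PI / 6 / INR 5 ^ 2 < Psi2 3 theta_c.
Proof.
replace (INR 5 ^ 2) with 25 by (simpl; ring); rewrite Psi2_3_right; unfold theta_c; pose proof PI_bounds.
replace (3 * ((2 * PI + 1) / 3) - 2 * PI) with 1 by field.
pose proof (g2_linear_lower 1 ltac:(lra)); nra.
Qed.

Lemma Psi2_2_mono s t : 2 * PI / 3 <= s -> s <= t -> t <= PI -> Psi2 2 s <= Psi2 2 t.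
Proof.
intros Hs Hst Ht; pose proof PI_RGT_0; destruct (Req_dec s t) as [->|]; [lra|]; rewrite !Psi2_2.
pose proof (g2_decr (2 * PI - 2 * t) (2 * PI - 2 * s) ltac:(lra) ltac:(lra) ltac:(lra)); lra.
Qed.

Lemma Psi2_3_anti s t : 2 * PI / 3 <= s -> s <= t -> t <= PI -> Psi2 3 t <= Psi2 3 s.
Proof.
intros Hs Hst Ht; destruct (Req_dec s t) as [->|]; [lra|]; rewrite !Psi2_3_right.
pose proof (g2_decr (3 * s - 2 * PI) (3 * t - 2 * PI) ltac:(lra) ltac:(lra) ltac:(lra)); lra.
Qed.

(** Denominator 1 is compared through denominator 3 up to [theta_c]; beyond it [Psi 1] only
    decreases and [Psi 2] only increases. For denominators from 5 on, the value of [Psi 3] at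
    [theta_c] serves as a common threshold. *)
Lemma dominates_2 t : theta23 < t < PI -> dominates 2 t.
Proof.
destruct theta23_spec as [H23 E]; intros Ht; pose proof PI_bounds.
assert (Htc : 2 * PI / 3 < theta_c < PI) by (unfold theta_c; lra).
apply (dominance_gap 2 4); [lia| |].
- intros j Hj Hne; assert (j = 1%nat \/ j = 3%nat \/ j = 4%nat) as [-> | [-> | ->]] by lia.
  + destruct (Rle_dec t theta_c) as [H1|H1].
    * pose proof (Psi2_1_lt_3 t ltac:(lra)); pose proof (above_theta23 t ltac:(lra)); lra.
    * pose proof (Psi2_1_lt_3 theta_c ltac:(lra)); pose proof Psi2_3_lt_2_at_c.
      pose proof (Psi2_2_mono theta_c t ltac:(lra) ltac:(lra) ltac:(lra)).
      pose proof (g2_decr theta_c t ltac:(lra) ltac:(lra) ltac:(lra)); rewrite Psi2_1 in *; lra.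
  + apply above_theta23; lra.
  + apply Psi2_4_lt_2; lra.
- pose proof Psi2_3_c_lower; pose proof (Psi2_3_anti theta23 theta_c ltac:(lra) ltac:(lra) ltac:(lra)).
  pose proof (Psi2_2_mono theta23 t ltac:(lra) ltac:(lra) ltac:(lra)); lra.
Qed.

(** Left of [2 PI / 3] denominator 4 and the tail lie below [Psi 1], itself below [Psi 3]. To the
    right, denominator 4 is compared through [Psi 2], and the tail with the value of [Psi 3] at
    [theta_c]. *)
Lemma dominates_3 t : theta13 < t < theta23 -> dominates 3 t.
Proof.
destruct theta13_spec as [H13 _]; destruct theta23_spec as [H23 _]; intros Ht; pose proof PI_bounds.
assert (Htc : 2 * PI / 3 < theta_c < PI) by (unfold theta_c; lra).
assert (Hm5 : PI * PI / 6 / INR 5 ^ 2 <= PI * PI / 6 / 16).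
{ replace (INR 5 ^ 2) with 25 by (simpl; ring); nra. }
apply (dominance_gap 3 4); [lia| |]; destruct (Rle_dec t (2 * PI / 3)) as [H1|H1].
- pose proof (above_theta13 t ltac:(lra)) as H3.
  intros j Hj Hne; assert (j = 1%nat \/ j = 2%nat \/ j = 4%nat) as [-> | [-> | ->]] by lia.
  + exact H3.
  + destruct (Req_dec t (2 * PI / 3)) as [E|E].
    * apply Rle_lt_trans with (Psi2 1 t); [|exact H3]; rewrite Psi2_1, Psi2_2.
      replace (2 * PI - 2 * t) with t by lra; pose proof (g2_nonneg t); lra.
    * pose proof (Psi2_2_lt_1 t ltac:(lra)); lra.
  + pose proof (Psi2_le_max 4 t ltac:(lia)) as H4; replace (INR 4 ^ 2) with 16 in H4 by (simpl; ring).
    pose proof g2_two_thirds; rewrite Psi2_1 in H3.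
    destruct (Req_dec t (2 * PI / 3)) as [E|E]; [subst t; lra|].
    pose proof (g2_decr t (2 * PI / 3) ltac:(lra) ltac:(lra) ltac:(lra)); lra.
- intros j Hj Hne; assert (j = 1%nat \/ j = 2%nat \/ j = 4%nat) as [-> | [-> | ->]] by lia.
  + apply Psi2_1_lt_3; lra.
  + apply below_theta23; lra.
  + pose proof (Psi2_4_lt_2 t ltac:(lra)); pose proof (below_theta23 t ltac:(lra)); lra.
- pose proof (above_theta13 t ltac:(lra)) as H3; rewrite Psi2_1 in H3; pose proof g2_two_thirds.
  destruct (Req_dec t (2 * PI / 3)) as [E|E]; [subst t; lra|].
  pose proof (g2_decr t (2 * PI / 3) ltac:(lra) ltac:(lra) ltac:(lra)); lra.
- pose proof Psi2_3_c_lower; pose proof (Psi2_3_anti t theta_c ltac:(lra) ltac:(lra) ltac:(lra)); lra.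
Qed.

Lemma arc_height_Psi2 t k : (0 < k)%nat -> arc_height (expi t) k = Psi2 k t.
Proof.
intros Hk; assert (HI : 0 < INR k ^ 2) by (apply pow_lt, lt_0_INR, Hk).
unfold arc_height, arc_weight, Psi2, g2, dilog_re; rewrite expi_pow; fold (dilog (INR k * t)).
unfold Cdiv; rewrite <- RtoC_inv, Cmod_mult, Re_mult, Re_RtoC, Im_RtoC, Cmod_RtoC_pos by
  (first [lra|left; apply Rinv_0_lt_compat, HI]).
field; apply Rgt_not_eq, lt_0_INR, Hk.
Qed.

Lemma dominates_pos k t : (0 < k)%nat -> dominates k t -> 0 < Psi2 k t.
Proof.
intros Hk (c & Hc & H); specialize (H (S k) ltac:(lia) ltac:(lia)); pose proof (Psi2_nonneg (S k) t ltac:(lia)); lra.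
Qed.

Lemma dominates_arc_height k t sg : (0 < k)%nat -> dominates k t -> (sg * sg)%C = arc_weight (expi t) k ->
  exists c, 0 < c /\ forall j, (0 < j)%nat -> j <> k -> arc_height (expi t) j <= Re sg ^ 2 - c.
Proof.
intros Hk (c & Hc & H) Hsg; exists c; split; [exact Hc|]; intros j Hj Hne.
rewrite (Re_sqr_of_sqr sg _ Hsg); fold (arc_height (expi t) k); rewrite !arc_height_Psi2 by assumption.
apply H; assumption.
Qed.

(** * Assembling the asymptotics *)

Lemma Croot4_sqr W : W <> RtoC 0 -> (Croot4 W * Croot4 W)%C = Csqrt W.
Proof.
intros HW; unfold Croot4, Csqrt; rewrite !Cpower_eq, <- Cexp_plus by exact HW; f_equal.
rewrite <- Cmult_plus_distr_r, <- RtoC_plus; do 2 f_equal; field.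
Qed.

Lemma Re_Croot4_pos W : W <> RtoC 0 -> 0 < Re (Croot4 W).
Proof.
intros HW; unfold Croot4; rewrite Cpower_eq, Re_Cexp by exact HW.
apply Rmult_lt_0_compat; [apply exp_pos|].
rewrite Im_mult, Re_RtoC, Im_RtoC; change (Im (Clog W)) with (Carg W).
pose proof (Carg_bound W); pose proof PI_RGT_0; apply cos_gt_0; lra.
Qed.

Lemma Rpower_three_quarters x : 0 < x -> Rpower x (3 / 4) = sqrt (sqrt x) * sqrt x.
Proof.
intros Hx; assert (Hs : 0 < sqrt x) by (apply sqrt_lt_R0, Hx).
rewrite <- (Rpower_sqrt (sqrt x)), <- !(Rpower_sqrt x), Rpower_mult, <- Rpower_plus by assumption.
f_equal; field.
Qed.


(* [exp] of the constant term of the singular expansion at [exp(2 pi i h/k)];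
   it vanishes on fractions that are not in lowest terms. *)
Definition arc_coef (z : C) (k h : nat) : C :=
  if Z.eq_dec (Z.gcd (Z.of_nat h) (Z.of_nat k)) 1
  then Cexp (Csumn (fun j => RtoC (INR (S j) / INR k - 1 / 2) * Clog1m (z * unit_root k (Z.of_nat h * Z.of_nat (S j))))%C k)
  else RtoC 0.

Lemma unit_root_nonresonant z k m : (0 < k)%nat -> (z ^ k)%C <> RtoC 1 -> (z * unit_root k m)%C <> 1%C.
Proof.
intros Hk Hz E; apply Hz.
assert (E2 : ((z * unit_root k m) ^ k)%C = RtoC 1) by (rewrite E; apply Cpow_1_l).
rewrite Cpow_mult_l, unit_root_pow, unit_root_full in E2 by exact Hk; rewrite <- E2; ring.
Qed.

(** The lower bound on [T] is left as a hypothesis, since the reason for non-cancellation depends on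
    [k]. *)
Lemma regular_asymp k t : (0 < k)%nat -> dominates k t -> (expi t ^ k)%C <> RtoC 1 ->
  let W := dilog (INR k * t) in
  let T := fun n => Csumn (fun h => unit_root k (- (Z.of_nat h * Z.of_nat n)) * arc_coef (expi t) k h)%C k in
  (exists c, 0 < c /\ forall n, c <= Cmod (T n)) ->
  asymp (fun n => Q n (expi t)) (fun n => (T n * (Croot4 W / RtoC (2 * sqrt (INR k * PI) * Rpower (INR n) (3 / 4)))
     * Cexp (RtoC (2 / INR k) * Csqrt W * RtoC (sqrt (INR n))))%C).
Proof.
intros Hk Hdom Hz W T (c & Hc & HT).
pose proof PI_RGT_0 as Hpi; assert (HIk : 0 < INR k) by (apply lt_0_INR, Hk).
assert (Hz1 : Cmod (expi t) <= 1) by (rewrite Cmod_expi; lra).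
set (sg := (Csqrt W / RtoC (INR k))%C).
assert (Hkc : RtoC (INR k) <> 0%C) by (apply RtoC_neq0; lra).
assert (Hsg : (sg * sg)%C = arc_weight (expi t) k).
{ unfold sg, arc_weight; rewrite expi_pow; fold (dilog (INR k * t)); fold W; rewrite <- (Csqrt_sqr W) at 3.
  replace (INR k ^ 2) with (INR k * INR k) by ring; rewrite RtoC_mult; field; exact Hkc. }
assert (HPsi : 0 < Re sg).
{ assert (H0 : 0 <= Re sg).
  { unfold sg, Cdiv; rewrite <- RtoC_inv, Re_mult, Re_RtoC, Im_RtoC by lra; pose proof (Re_Csqrt_nonneg W).
    assert (0 < / INR k) by (apply Rinv_0_lt_compat, HIk); nra. }
  pose proof (dominates_pos k t Hk Hdom) as H1; rewrite <- arc_height_Psi2 in H1 by exact Hk.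
  unfold arc_height in H1; rewrite <- (Re_sqr_of_sqr _ _ Hsg) in H1; nra. }
assert (HW : W <> RtoC 0).
{ intros E; assert (E2 : (sg * sg)%C = RtoC 0) by (unfold sg; rewrite E, Csqrt_0; field; exact Hkc).
  assert (E3 : sg = RtoC 0) by (destruct (Ceq_dec sg 0) as [|Hn]; [assumption|elim (Cmult_neq_0 _ _ Hn Hn E2)]).
  rewrite E3, Re_RtoC in HPsi; lra. }
(* A square root of [sg] with positive real part; taking [kp = Re sg / w] makes the principal fourth
   root appear in the main term. *)
set (w := (Croot4 W / RtoC (sqrt (INR k)))%C).
assert (Hsk : 0 < sqrt (INR k)) by (apply sqrt_lt_R0, HIk).
assert (Hskc : RtoC (sqrt (INR k)) <> 0%C) by (apply RtoC_neq0; lra).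
assert (Hw : (w * w)%C = sg).
{ unfold w, sg; rewrite <- (Croot4_sqr W HW).
  replace (RtoC (INR k)) with (RtoC (sqrt (INR k)) * RtoC (sqrt (INR k)))%C by (rewrite <- RtoC_mult, sqrt_sqrt by lra; reflexivity).
  field; exact Hskc. }
assert (Hrw : 0 < Re w).
{ unfold w, Cdiv; rewrite <- RtoC_inv, Re_mult, Re_RtoC, Im_RtoC by lra; pose proof (Re_Croot4_pos W HW).
  assert (0 < / sqrt (INR k)) by (apply Rinv_0_lt_compat, Hsk); nra. }
assert (Hw0 : w <> RtoC 0) by (apply C_neq0_Re; lra).
assert (HPc : RtoC (Re sg) <> 0%C) by (apply RtoC_neq0; lra).
set (kp := (RtoC (Re sg) / w)%C).
assert (Hkp : 0 < Re kp).
(* The reciprocal of a number with positive real part has positive real part; this is the branch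
   condition required by [laplace]. *)
{ assert (Hm : 0 < Re w * Re w + Im w * Im w) by nra.
  replace (Re kp) with (Re sg * (Re w / (Re w * Re w + Im w * Im w))); [apply Rmult_lt_0_compat; [exact HPsi|apply Rdiv_lt_0_compat; assumption]|].
  unfold kp; destruct w as [x y]; unfold Re, Im in *; simpl in *; field; nra. }
assert (Hkp0 : kp <> RtoC 0) by (apply C_neq0_Re; lra).
assert (Hkp2 : (kp * kp * (1, Im sg / Re sg)%R)%C = RtoC (Re sg)).
{ replace (1, Im sg / Re sg)%R with (sg / RtoC (Re sg))%C.
  - rewrite <- Hw at 1; unfold kp; field; split; assumption.
  - apply Ceq_ReIm; unfold Cdiv; rewrite <- RtoC_inv by lra; rewrite ?Re_mult, ?Im_mult, Re_RtoC, Im_RtoC, ?Re_pair, ?Im_pair; field; lra. }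
pose proof (dominates_arc_height k t sg Hk Hdom Hsg) as Hgap.
set (B := fun h => (arc_coef (expi t) k h * RtoC (sqrt PI) / kp)%C).
assert (Hspi : 0 < sqrt PI) by (apply sqrt_lt_R0, Hpi).
set (X := (RtoC (sqrt PI) / kp)%C).
assert (HX : 0 < Cmod X).
{ unfold X; rewrite Cmod_div by exact Hkp0; apply Rdiv_lt_0_compat; [rewrite Cmod_RtoC_pos; lra|apply Cmod_gt_0, Hkp0]. }
apply (asymp_normalized _ _ (fun n => normalizer sg 0 (sqrt (INR n)))
  (fun n => Csumn (fun h => unit_root k (- (Z.of_nat h * Z.of_nat n)) * B h)%C k) (c * Cmod X)).
- apply Rmult_lt_0_compat; assumption.
- intros n Hn; assert (Hn0 : 0 < INR n) by (apply lt_0_INR, Hn).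
  set (l := sqrt (INR n)); assert (Hl : 0 < l) by (apply sqrt_lt_R0, Hn0).
  assert (Hsl : 0 < sqrt l) by (apply sqrt_lt_R0, Hl).
  replace (Csumn (fun h => unit_root k (- (Z.of_nat h * Z.of_nat n)) * B h)%C k) with (X * T n)%C.
  2:{ unfold T; rewrite <- Csumn_scal; apply Csumn_ext; intros h _; unfold B, X; field; exact Hkp0. }
  unfold normalizer; rewrite Rpower_three_quarters by exact Hn0; fold l.
  rewrite Rpower_O, Rmult_1_l by (apply Rdiv_lt_0_compat; assumption).
  rewrite sqrt_mult by lra.
  set (E := Cexp (RtoC (2 / INR k) * Csqrt W * RtoC l)).
  assert (HE : (E * Cexp (- (2 * sg * RtoC l)))%C = RtoC 1).
  { unfold E; rewrite <- Cexp_plus, <- Cexp_0; f_equal; unfold sg; rewrite RtoC_div by lra; field; exact Hkc. }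
  replace (RtoC (2 * PI)) with (2 * (RtoC (sqrt PI) * RtoC (sqrt PI)))%C by (rewrite <- RtoC_mult, sqrt_sqrt, <- RtoC_mult by lra; reflexivity).
  unfold X, kp, w.
  rewrite (RtoC_mult (sqrt l)), (RtoC_div l), !RtoC_mult by lra.
  assert (RtoC l <> 0%C) by (apply RtoC_neq0; lra). assert (RtoC (sqrt l) <> 0%C) by (apply RtoC_neq0; lra).
  assert (RtoC (sqrt PI) <> 0%C) by (apply RtoC_neq0; lra).
  assert (HR0 : Croot4 W <> RtoC 0) by (apply C_neq0_Re; pose proof (Re_Croot4_pos W HW); lra).
  transitivity (T n * (E * Cexp (- (2 * sg * RtoC l))) * (RtoC (sqrt PI) * Croot4 W / (RtoC (sqrt (INR k)) * RtoC (Re sg))))%C.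
  + field; repeat split; assumption.
  + rewrite HE; field; repeat split; assumption.
- intros n; replace (Csumn (fun h => unit_root k (- (Z.of_nat h * Z.of_nat n)) * B h)%C k) with (X * T n)%C.
  + rewrite Cmod_mult, Rmult_comm; apply Rmult_le_compat_l; [lra|apply HT].
  + unfold T; rewrite <- Csumn_scal; apply Csumn_ext; intros h _; unfold B, X; field; exact Hkp0.
- intros eps Heps; apply (coefficient_asymp (expi t) k sg 0 B eps Hz1 Hk HPsi); [|exact Heps].
  clear eps Heps; intros h Hh eps Heps; unfold B, arc_coef.
  destruct (Z.eq_dec (Z.gcd (Z.of_nat h) (Z.of_nat k)) 1) as [Hg|Hg].
  + apply arc_main; try assumption; try lra.
    apply arc_expansion_regular; try assumption; [apply Cmod_expi|].
    intros j _; apply unit_root_nonresonant; assumption.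
  + destruct (arc_nonprimitive (expi t) k (Z.of_nat h) sg 0 eps Hz1 Hk Hg Hsg HPsi (Rle_refl 0) Hgap Heps) as (l0 & Hl0 & H).
    exists l0; split; [exact Hl0|]; intros n Hn; specialize (H n Hn).
    eapply Rle_trans; [|exact H]; right; f_equal; field; exact Hkp0.
Qed.

Lemma asymp_ext f g g' : (forall n, g n = g' n) -> asymp f g -> asymp f g'.
Proof.
intros Hg H eps; specialize (H eps); revert H; apply filter_imp; intros n; rewrite Hg; trivial.
Qed.

Lemma zeta_expi b : zeta b = expi (2 * PI / INR b).
Proof. reflexivity. Qed.

Lemma zeta_unit_root k m : (zeta k ^ m)%C = unit_root k (Z.of_nat m).
Proof.
rewrite zeta_expi, expi_pow; unfold expi, unit_root; rewrite <- INR_IZR_INZ; do 2 f_equal; unfold Rdiv; ring.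
Qed.

Lemma unit_root_neg k m : unit_root k (- m) = (/ unit_root k m)%C.
Proof.
assert (H0 : unit_root k m <> RtoC 0) by apply Cexp_neq0.
assert (E : (unit_root k (- m) * unit_root k m)%C = RtoC 1).
{ rewrite unit_root_mult, Z.add_opp_diag_l; unfold unit_root, Rdiv; rewrite Rmult_0_l, Rmult_0_r; apply Cexp_0. }
replace (unit_root k (- m)) with (unit_root k (- m) * unit_root k m * / unit_root k m)%C by (field; exact H0).
rewrite E; ring.
Qed.

Lemma Cexp_Csumn f n : Cexp (Csumn f n) = Cprod (map (fun j => Cexp (f j)) (seq 0 n)).
Proof.
revert f; induction n as [|n IH]; intros f; [apply Cexp_0|].
rewrite Csumn_S_l, Cexp_plus, IH; cbn [seq map Cprod fold_right]; f_equal.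
rewrite <- seq_shift, map_map; reflexivity.
Qed.

(** On the unit circle away from 1 the number [1 - w] has positive real part, so [Clog1m] is the
    principal logarithm and each exponential is a principal power. *)
Lemma arc_coef_omega z k h : (0 < k)%nat -> Z.gcd (Z.of_nat h) (Z.of_nat k) = 1%Z -> Cmod z = 1 -> (z ^ k)%C <> RtoC 1 ->
  arc_coef z k h = omega h k z.
Proof.
intros Hk Hg Hz1 Hz; unfold arc_coef; destruct (Z.eq_dec _ _) as [_|Hne]; [|contradiction].
rewrite Cexp_Csumn; unfold omega; rewrite <- seq_shift, map_map; f_equal; apply map_ext; intros j.
rewrite zeta_unit_root, Nat2Z.inj_mul, (Z.mul_comm (Z.of_nat (S j))); cbv beta.
set (w := (z * unit_root k (Z.of_nat h * Z.of_nat (S j)))%C).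
assert (Hw : w <> 1%C) by (apply unit_root_nonresonant; assumption).
assert (Hwm : Cmod w = 1) by (unfold w; rewrite Cmod_mult, Cmod_unit_root, Hz1; ring).
assert (Hre : Re w < 1) by (apply (Cmod1_Re_lt w); [lra|exact Hw]).
rewrite (Clog1m_Clog w Hre), Cpower_eq; [reflexivity|].
intros E; apply Hw; replace w with (1 - (1 - w))%C by ring; rewrite E; ring.
Qed.

Lemma expi_neq_1 y : 0 < y < 2 * PI -> expi y <> RtoC 1.
Proof.
intros Hy E; apply (f_equal Re) in E; rewrite Re_expi, Re_RtoC in E.
replace y with (2 * (y / 2)) in E by field; rewrite cos_2a_sin in E.
pose proof (sin_half_pos y Hy); nra.
Qed.

Lemma arc_coef_pos z k h : Z.gcd (Z.of_nat h) (Z.of_nat k) = 1%Z -> 0 < Cmod (arc_coef z k h).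
Proof. intros Hg; unfold arc_coef; destruct (Z.eq_dec _ _) as [_|Hne]; [|contradiction]; rewrite Cmod_Cexp; apply exp_pos. Qed.

Lemma Csqrt_one_minus z : Cmod z = 1 -> z <> RtoC 1 -> Csqrt (1 - z) = Cexp (RtoC (1 / 2) * Clog1m z)%C.
Proof.
intros Hz1 Hz; assert (Hre : Re z < 1) by (apply (Cmod1_Re_lt z); [lra|exact Hz]).
unfold Csqrt; rewrite (Clog1m_Clog z Hre), Cpower_eq; [reflexivity|].
intros E; apply Hz; replace z with (1 - (1 - z))%C by ring; rewrite E; ring.
Qed.

Lemma unit_root_1 m : unit_root 1 m = 1%C.
Proof. rewrite <- (Z.mul_1_r m); apply (unit_root_full 1); lia. Qed.

Lemma Q_asymp_denominator_1 t : 0 < t < theta13 -> asymp (fun n => Q n (expi t))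
  (fun n => Csqrt (1 - expi t) * Croot4 (dilog t) / RtoC (2 * sqrt PI * Rpower (INR n) (3 / 4))
     * Cexp (2 * Csqrt (dilog t) * RtoC (sqrt (INR n))))%C.
Proof.
intros Ht; destruct theta13_spec as [H13 _]; pose proof PI_RGT_0.
assert (Hz : expi t <> RtoC 1) by (apply expi_neq_1; lra).
assert (HT : forall n, Csumn (fun h => unit_root 1 (- (Z.of_nat h * Z.of_nat n)) * arc_coef (expi t) 1 h)%C 1 = Csqrt (1 - expi t)).
{ intros n; cbn [Csumn]; rewrite unit_root_1, Csqrt_one_minus by (try apply Cmod_expi; exact Hz).
  rewrite Cplus_0_l, Cmult_1_l; unfold arc_coef; destruct (Z.eq_dec _ _) as [_|Hne]; [|elim Hne; reflexivity].
  cbn [Csumn]; rewrite unit_root_1, Cplus_0_l, Cmult_1_r; do 3 f_equal; simpl; field. }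
pose proof (regular_asymp 1 t ltac:(lia) (dominates_1 t Ht)) as R; cbv zeta in R.
replace (expi t ^ 1)%C with (expi t) in R by (simpl; ring).
change (INR 1) with 1 in R; rewrite !Rmult_1_l in R.
eapply asymp_ext; [|apply (R Hz)].
- intros n; cbv beta; rewrite HT; replace (2 / 1) with 2 by field; unfold Cdiv; rewrite Cmult_assoc; reflexivity.
- exists (Cmod (Csqrt (1 - expi t))); split; [|intros n; rewrite HT; lra].
  rewrite <- (HT O); cbn [Csumn]; rewrite Cplus_0_l, Cmod_mult, Cmod_unit_root, Rmult_1_l; apply arc_coef_pos; reflexivity.
Qed.

Lemma unit_root_2_neg n : unit_root 2 (- Z.of_nat n) = (RtoC (-1) ^ n)%C.
Proof.
replace (- Z.of_nat n)%Z with (-1 * Z.of_nat n)%Z by lia; rewrite <- unit_root_pow; f_equal.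
unfold unit_root; fold (expi (2 * PI * (IZR (-1) / INR 2))).
replace (2 * PI * (IZR (-1) / INR 2)) with (- PI) by (simpl; field).
apply Ceq_ReIm; [rewrite Re_expi, cos_neg, cos_PI, Re_RtoC|rewrite Im_expi, sin_neg, sin_PI, Im_RtoC]; ring.
Qed.

(** Only [h = 1] is in lowest terms. Its residue classes have exponents 0 and [1/2], which leaves
    the square root of [1 - expi t]. *)
Lemma Q_asymp_denominator_2 t : theta23 < t < PI -> asymp (fun n => Q n (expi t))
  (fun n => RtoC (-1) ^ n * Csqrt (1 - expi t) * Croot4 (dilog (2 * t)) / RtoC (2 * sqrt (2 * PI) * Rpower (INR n) (3 / 4))
     * Cexp (Csqrt (dilog (2 * t)) * RtoC (sqrt (INR n))))%C.
Proof.
intros Ht; destruct theta23_spec as [H23 _]; pose proof PI_RGT_0.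
assert (Hz : expi t <> RtoC 1) by (apply expi_neq_1; lra).
assert (Hz2 : (expi t ^ 2)%C <> RtoC 1) by (rewrite expi_pow; change (INR 2) with 2; apply expi_neq_1; lra).
assert (HA : arc_coef (expi t) 2 1 = Csqrt (1 - expi t)).
{ rewrite Csqrt_one_minus by (try apply Cmod_expi; exact Hz).
  unfold arc_coef; destruct (Z.eq_dec _ _) as [_|Hne]; [|elim Hne; reflexivity].
  cbn [Csumn]; rewrite (unit_root_full 2 (Z.of_nat 1)), Cplus_0_l, Cmult_1_r by lia.
  replace (INR 1 / INR 2 - 1 / 2) with 0 by (simpl; field); replace (INR 2 / INR 2 - 1 / 2) with (1 / 2) by (simpl; field).
  rewrite Cmult_0_l, Cplus_0_l; reflexivity. }
assert (HT : forall n, Csumn (fun h => unit_root 2 (- (Z.of_nat h * Z.of_nat n)) * arc_coef (expi t) 2 h)%C 2 = (RtoC (-1) ^ n * Csqrt (1 - expi t))%C).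
{ intros n; cbn [Csumn]; rewrite HA; replace (- (Z.of_nat 1 * Z.of_nat n))%Z with (- Z.of_nat n)%Z by lia.
  rewrite unit_root_2_neg; replace (arc_coef (expi t) 2 0) with (RtoC 0); [ring|reflexivity]. }
pose proof (regular_asymp 2 t ltac:(lia) (dominates_2 t Ht) Hz2) as R; cbv zeta in R.
change (INR 2) with 2 in R.
eapply asymp_ext; [|apply R].
- intros n; cbv beta; rewrite HT; replace (2 / 2) with 1 by field; rewrite Cmult_1_l; unfold Cdiv; rewrite !Cmult_assoc; reflexivity.
- exists (Cmod (Csqrt (1 - expi t))); split; [rewrite <- HA; apply arc_coef_pos; reflexivity|].
  intros n; rewrite HT, <- unit_root_2_neg, Cmod_mult, Cmod_unit_root; lra.
Qed.

Lemma Cmod_one_minus_expi y : Cmod (1 - expi y)%C ^ 2 = 2 - 2 * cos y.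
Proof.
replace (Cmod (1 - expi y)%C ^ 2) with (Cmod (1 - expi y)%C * Cmod (1 - expi y)%C) by ring.
pose proof (Cmod_sqr (1 - expi y)) as H; rewrite Re_minus, Im_minus, Re_expi, Im_expi, Re_RtoC, Im_RtoC in H.
pose proof (sin2_cos2 y) as H2; unfold Rsqr in H2; nra.
Qed.

Lemma unit_root_expi k h : unit_root k h = expi (2 * PI * (IZR h / INR k)).
Proof. reflexivity. Qed.

(* The factors of the two coefficients that could cancel have moduli
   [|1 - z zeta|] and [|1 - z zeta^2|], which differ because [z] is not real. *)
Lemma arc_coef_3_moduli t : 0 < t < PI -> (expi t ^ 3)%C <> RtoC 1 ->
  Cmod (arc_coef (expi t) 3 1) <> Cmod (arc_coef (expi t) 3 2).
Proof.
intros Ht Hz; unfold arc_coef.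
destruct (Z.eq_dec (Z.gcd (Z.of_nat 1) (Z.of_nat 3)) 1) as [_|Hne]; [|elim Hne; reflexivity].
destruct (Z.eq_dec (Z.gcd (Z.of_nat 2) (Z.of_nat 3)) 1) as [_|Hne]; [|elim Hne; reflexivity].
cbn [Csumn]; rewrite !Cmod_Cexp.
replace (Z.of_nat 2 * Z.of_nat 2)%Z with (1 + 1 * Z.of_nat 3)%Z by reflexivity.
replace (Z.of_nat 2 * Z.of_nat 1)%Z with 2%Z by reflexivity.
replace (Z.of_nat 1 * Z.of_nat 2)%Z with 2%Z by reflexivity.
replace (Z.of_nat 1 * Z.of_nat 1)%Z with 1%Z by reflexivity.
rewrite <- unit_root_mult, !unit_root_full, !Cmult_1_r by lia.
assert (H1 := unit_root_nonresonant (expi t) 3 1 ltac:(lia) Hz); assert (H2 := unit_root_nonresonant (expi t) 3 2 ltac:(lia) Hz).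
assert (E1 : (expi t * unit_root 3 1)%C = expi (t + 2 * PI / 3)).
{ rewrite expi_plus, unit_root_expi; do 2 f_equal; simpl; field. }
assert (E2 : (expi t * unit_root 3 2)%C = expi (t + 4 * PI / 3)).
{ rewrite expi_plus, unit_root_expi; do 2 f_equal; simpl; field. }
rewrite E1, E2 in *; set (y1 := t + 2 * PI / 3) in *; set (y2 := t + 4 * PI / 3) in *.
assert (P : forall y, expi y <> 1%C -> 0 < Cmod (1 - expi y)%C).
{ intros y Hy; apply Cmod_gt_0; intros E; apply Hy; replace (expi y) with (1 - (1 - expi y))%C by ring; rewrite E; ring. }
intros E; apply exp_inv in E; revert E.
replace (INR 1 / INR 3 - 1 / 2) with (- (1 / 6)) by (simpl; field).
replace (INR 2 / INR 3 - 1 / 2) with (1 / 6) by (simpl; field).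
replace (INR 3 / INR 3 - 1 / 2) with (1 / 2) by (simpl; field).
rewrite !Re_plus, !Re_mult, !Re_RtoC, !Im_RtoC.
change (Re (Clog1m (expi y1))) with (ln (Cmod (1 - expi y1)%C)); change (Re (Clog1m (expi y2))) with (ln (Cmod (1 - expi y2)%C)).
intros E; assert (E3 : ln (Cmod (1 - expi y1)%C) = ln (Cmod (1 - expi y2)%C)) by lra.
apply ln_inv in E3; try (apply P; assumption).
pose proof (Cmod_one_minus_expi y1) as C1; pose proof (Cmod_one_minus_expi y2) as C2; rewrite E3 in C1.
assert (Ec : cos y1 = cos y2) by lra; unfold y1, y2 in Ec.
replace (t + 2 * PI / 3) with (t + PI - PI / 3) in Ec by field; replace (t + 4 * PI / 3) with (t + PI + PI / 3) in Ec by field.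
rewrite (cos_minus (t + PI)), (cos_plus (t + PI)), neg_sin in Ec.
pose proof (sin_gt_0 t (proj1 Ht) (proj2 Ht)) as H; pose proof PI_RGT_0.
pose proof (sin_gt_0 (PI / 3) ltac:(lra) ltac:(lra)) as H3; pose proof (Rmult_lt_0_compat _ _ H H3); lra.
Qed.

Lemma Q_asymp_denominator_3 t : theta13 < t < theta23 -> t <> 2 * PI / 3 -> asymp (fun n => Q n (expi t))
  (fun n => (/ (zeta 3 ^ n) * omega 1 3 (expi t) + / (zeta 3 ^ (2 * n)) * omega 2 3 (expi t))
     * (Croot4 (dilog (3 * t)) / RtoC (2 * sqrt (3 * PI) * Rpower (INR n) (3 / 4)))
     * Cexp (RtoC (2 / 3) * Csqrt (dilog (3 * t)) * RtoC (sqrt (INR n))))%C.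
Proof.
intros Ht Hne; destruct theta13_spec as [H13 _]; destruct theta23_spec as [H23 _]; pose proof PI_bounds; unfold theta_c in H23.
assert (I3 : INR 3 = 3) by (simpl; ring).
assert (Hz3 : (expi t ^ 3)%C <> RtoC 1).
{ rewrite expi_pow, I3; destruct (Rlt_dec t (2 * PI / 3)); [apply expi_neq_1; lra|].
  replace (3 * t) with (3 * t - 2 * PI + 2 * PI) by ring; rewrite expi_plus, expi_2PI, Cmult_1_r; apply expi_neq_1; lra. }
assert (HT : forall n, Csumn (fun h => unit_root 3 (- (Z.of_nat h * Z.of_nat n)) * arc_coef (expi t) 3 h)%C 3 =
   (/ (zeta 3 ^ n) * arc_coef (expi t) 3 1 + / (zeta 3 ^ (2 * n)) * arc_coef (expi t) 3 2)%C).
{ intros n; cbn [Csumn]; rewrite !zeta_unit_root, <- !unit_root_neg.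
  replace (Z.of_nat (2 * n)) with (Z.of_nat 2 * Z.of_nat n)%Z by lia; replace (Z.of_nat 1 * Z.of_nat n)%Z with (Z.of_nat n) by lia.
  replace (arc_coef (expi t) 3 0) with (RtoC 0); [ring|reflexivity]. }
pose proof (regular_asymp 3 t ltac:(lia) (dominates_3 t Ht) Hz3) as R; cbv zeta in R.
rewrite I3 in R; eapply asymp_ext; [|apply R].
- intros n; cbv beta; rewrite HT, !arc_coef_omega by (first [lia|reflexivity|apply Cmod_expi|exact Hz3]); reflexivity.
- pose proof (arc_coef_3_moduli t ltac:(lra) Hz3) as Hm.
  (* By the reverse triangle inequality two terms of different moduli keep a distance from
     cancellation that does not depend on [n]. *)
  exists (Rabs (Cmod (arc_coef (expi t) 3 1) - Cmod (arc_coef (expi t) 3 2))); split; [apply Rabs_pos_lt; lra|].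
  intros n; rewrite HT, !zeta_unit_root, <- !unit_root_neg.
  set (u := unit_root 3 _); set (v := unit_root 3 _); set (A1 := arc_coef _ 3 1); set (A2 := arc_coef _ 3 2).
  assert (M1 : Cmod (u * A1)%C = Cmod A1) by (unfold u; rewrite Cmod_mult, Cmod_unit_root; ring).
  assert (M2 : Cmod (v * A2)%C = Cmod A2) by (unfold v; rewrite Cmod_mult, Cmod_unit_root; ring).
  pose proof (Cmod_triangle (u * A1 + v * A2) (- (v * A2))) as T1; pose proof (Cmod_triangle (u * A1 + v * A2) (- (u * A1))) as T2.
  replace (u * A1 + v * A2 + - (v * A2))%C with (u * A1)%C in T1 by ring.
  replace (u * A1 + v * A2 + - (u * A1))%C with (v * A2)%C in T2 by ring.
  rewrite Cmod_opp in T1, T2; apply Rabs_le; lra.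
Qed.

Lemma zeta3_unit_root : zeta 3 = unit_root 3 1.
Proof. rewrite <- (Cpow_1_r (zeta 3)); apply zeta_unit_root. Qed.

Lemma unit_root3_neq1 m : (m mod 3 <> 0)%Z -> unit_root 3 m <> 1%C.
Proof.
intros Hm E; unfold unit_root in E.
destruct (Cexp_eq1_int _ E) as (r & Hr).
assert (H3 : IZR m = IZR (r * 3)) by (rewrite mult_IZR, <- Hr; simpl; field).
apply eq_IZR in H3; apply Hm; rewrite H3; apply Z.mod_mul; lia.
Qed.

Lemma sqrt_exp_ln x : 0 < x -> sqrt x = exp (ln x / 2).
Proof. intros Hx; rewrite <- Rpower_sqrt by exact Hx; unfold Rpower; f_equal; field. Qed.

(** Every factor is written as the exponential of a combination of [ln 2], [ln 3], [ln PI] and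
    [ln n]. The power [1/6] of [eta] raises the decay [n^(-3/4)] to [n^(-2/3)]. *)
Lemma zeta3_constant g n : 0 < g -> 0 < n -> let P := PI / (3 * sqrt 6) in
  2 * PI * (g / (2 * Rpower (6 * PI * n) (2 / 3))) * (Rpower (P / sqrt n) (1 / 6) * (sqrt (sqrt n) * (sqrt n / P)))
  = exp (ln g - ln (2 * PI) / 2 + (1 / 3 - 1 / 2) * ln 3) * sqrt PI / sqrt P.
Proof.
intros Hg Hn P; pose proof PI_RGT_0 as Hpi.
assert (Hl : 0 < sqrt n) by (apply sqrt_lt_R0, Hn); assert (H6 : 0 < sqrt 6) by (apply sqrt_lt_R0; lra).
assert (HP : 0 < P) by (apply Rdiv_lt_0_compat; lra).
assert (Hq : ln P = ln PI - ln 3 - (ln 2 + ln 3) / 2).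
{ unfold P; rewrite ln_div, ln_mult, (sqrt_exp_ln 6), ln_exp by lra; replace 6 with (2 * 3) by ring; rewrite ln_mult by lra; lra. }
assert (HLn : ln n = 2 * ln (sqrt n)) by (rewrite <- (sqrt_sqrt n) at 1 by lra; rewrite ln_mult by lra; ring).
set (L := ln (sqrt n)) in *.
assert (F2 : Rpower (6 * PI * n) (2 / 3) = exp (2 / 3 * (ln 2 + ln 3 + ln PI + 2 * L))).
{ unfold Rpower; do 2 f_equal; rewrite ln_mult, ln_mult, HLn by lra; replace 6 with (2 * 3) by ring; rewrite ln_mult by lra; ring. }
assert (F3 : Rpower (P / sqrt n) (1 / 6) = exp (1 / 6 * (ln P - L))) by (unfold Rpower; rewrite ln_div by lra; reflexivity).
assert (F5 : sqrt n / P = exp (L - ln P)) by (unfold L; rewrite <- ln_div, exp_ln by (try apply Rdiv_lt_0_compat; lra); reflexivity).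
rewrite F2, F3, F5, !(sqrt_exp_ln (sqrt n)), (sqrt_exp_ln PI), (sqrt_exp_ln P) by lra; fold L.
rewrite <- (exp_ln PI) at 1 by lra.
rewrite (ln_mult 2 PI) by lra.
transitivity (exp (ln g + ln PI - 2 / 3 * (ln 2 + ln 3 + ln PI + 2 * L) + 1 / 6 * (ln P - L) + L / 2 + (L - ln P))).
- unfold Rminus; rewrite !exp_plus, !exp_Ropp, (exp_ln g) by exact Hg; field.
  repeat split; apply Rgt_not_eq, exp_pos.
- match goal with |- _ = ?a / exp ?c => replace (a / exp c) with (a * exp (- c)) by (rewrite exp_Ropp; reflexivity) end; rewrite <- !exp_plus; f_equal; rewrite Hq; field.
Qed.

(** Here [z^3 = 1], so one factor vanishes at each primitive root of order 3. For [h = 2] it sits in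
    the class of weight [1/3], giving [Gamma (1/3)] and growth [eta^(-1/6)]; for [h = 1] in the
    class of weight [2/3], giving decay [eta^(1/6)], hence no contribution. *)
Lemma Q_asymp_zeta3 : asymp (fun n => Q n (zeta 3))
  (fun n => / (zeta 3 ^ (2 * n)) * Cpower (1 - zeta 3 ^ 2) (RtoC (1 / 6)) * Cpower (1 - zeta 3) (RtoC (1 / 2))
     * RtoC (Gamma (1 / 3)) / RtoC (2 * Rpower (6 * PI * INR n) (2 / 3)) * Cexp (RtoC (2 * PI / 3 * sqrt (INR n / 6))))%C.
Proof.
destruct theta13_spec as [H13 _]; destruct theta23_spec as [H23 _]; pose proof PI_RGT_0 as Hpi.
destruct (is_Gamma_exists (1 / 3) ltac:(lra)) as (g & Hg & HG); destruct (is_Gamma_exists (2 / 3) ltac:(lra)) as (g' & Hg' & HG').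
rewrite (is_Gamma_correct _ _ HG).
set (z := zeta 3); assert (Hzu : z = unit_root 3 1) by apply zeta3_unit_root.
assert (Hzm : Cmod z = 1) by (rewrite Hzu; apply Cmod_unit_root).
assert (Hzt : z = expi (2 * PI / 3)) by (unfold z; rewrite zeta_expi; do 2 f_equal; simpl; ring).
(* [P ^ 2 = (PI^2 / 6) / 9] is the arc weight; the saddle is real, as the singular expansion
   requires. *)
set (P := PI / (3 * sqrt 6)); assert (H6 : 0 < sqrt 6) by (apply sqrt_lt_R0; lra).
assert (HP : 0 < P) by (apply Rdiv_lt_0_compat; lra).
set (sg := RtoC P).
assert (Hsg : (sg * sg)%C = arc_weight z 3).
{ unfold arc_weight; replace (z ^ 3)%C with (expi 0).
  - fold (dilog 0); rewrite dilog_0, <- RtoC_div by (simpl; lra); unfold sg; rewrite <- RtoC_mult; f_equal.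
    unfold P; replace (INR 3) with 3 by (simpl; ring); replace 6 with (sqrt 6 * sqrt 6) at 3 by (apply sqrt_sqrt; lra); field; lra.
  - rewrite Hzt, expi_pow; replace (INR 3 * (2 * PI / 3)) with (0 + 2 * PI) by (simpl; field); rewrite expi_plus, expi_2PI; ring. }
assert (HRe : Re sg = P) by apply Re_RtoC. assert (HIm : Im sg = 0) by apply Im_RtoC.
assert (Hdom : dominates 3 (2 * PI / 3)) by (apply dominates_3; lra).
assert (Hgap := dominates_arc_height 3 (2 * PI / 3) sg ltac:(lia) Hdom); rewrite <- Hzt in Hgap; specialize (Hgap Hsg).
set (kp := RtoC (sqrt P)); assert (HsP : 0 < sqrt P) by (apply sqrt_lt_R0, HP).
assert (Hkp : 0 < Re kp) by (unfold kp; rewrite Re_RtoC; exact HsP).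
assert (Hkp2 : (kp * kp * (1, Im sg / Re sg)%R)%C = RtoC (Re sg)).
{ rewrite HIm, HRe; unfold Rdiv; rewrite Rmult_0_l; change (1, 0)%R with (RtoC 1); unfold kp.
  rewrite <- RtoC_mult, sqrt_sqrt by lra; ring. }
assert (Hkp0 : kp <> RtoC 0) by (apply RtoC_neq0; lra).
set (r := ln g - ln (2 * PI) / 2 + (1 / 3 - 1 / 2) * ln 3).
set (Pz := (Cpower (1 - z ^ 2) (RtoC (1 / 6)) * Cpower (1 - z) (RtoC (1 / 2)))%C).
assert (Hw1 : z <> 1%C) by (rewrite Hzu; apply unit_root3_neq1; discriminate).
assert (Hw2 : (z ^ 2)%C <> 1%C) by (rewrite Hzu, unit_root_pow; apply unit_root3_neq1; discriminate).
assert (Hz1 : (1 - z)%C <> RtoC 0).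
{ intros E; apply Hw1; replace z with (1 - (1 - z))%C by ring; rewrite E; ring. }
assert (Hz2 : (1 - z ^ 2)%C <> RtoC 0).
{ intros E; apply Hw2; replace (z ^ 2)%C with (1 - (1 - z ^ 2))%C by ring; rewrite E; ring. }
assert (E2 : arc_expansion z 3 2 sg (1 / 6) (Pz * RtoC (exp r))%C).
{ assert (Hw0 : (z * unit_root 3 (2 * Z.of_nat 1))%C = 1%C).
  { rewrite Hzu, unit_root_mult; apply (unit_root_full 3 1); lia. }
  assert (X := arc_expansion_singular z 3 2 sg 0 g ltac:(lia) eq_refl Hzm Hsg HIm Hw0).
  replace (INR 1 / INR 3) with (1 / 3) in X by (simpl; field).
  replace (1 / 2 - 1 / 3) with (1 / 6) in X by field.
  replace (Pz * RtoC (exp r))%C with (Cexp (Csumn (fun j => RtoC (INR (S j) / INR 3 - 1 / 2) * Clog1m (z * unit_root 3 (2 * Z.of_nat (S j))))%C 3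
    + RtoC (ln g - ln (2 * PI) / 2 + (1 / 3 - 1 / 2) * ln (INR 3)))).
  - apply X; try assumption.
    intros j Hj Hne; rewrite Hzu, unit_root_mult; apply unit_root3_neq1.
    assert (j = 1%nat \/ j = 2%nat) as [-> | ->] by lia; vm_compute; discriminate.
  - cbn [Csumn]; rewrite Hw0, Clog1m_1.
    replace (z * unit_root 3 (2 * Z.of_nat 2))%C with (z ^ 2)%C.
    2:{ rewrite Hzu, unit_root_pow, unit_root_mult; replace (1 + 2 * Z.of_nat 2)%Z with (2 + 1 * Z.of_nat 3)%Z by reflexivity.
        rewrite <- unit_root_mult, unit_root_full, Cmult_1_r by lia; reflexivity. }
    rewrite unit_root_full, Cmult_1_r by lia.
    replace (INR 2 / INR 3 - 1 / 2) with (1 / 6) by (simpl; field); replace (INR 3 / INR 3 - 1 / 2) with (1 / 2) by (simpl; field).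
    replace (INR 3) with 3 by (simpl; ring); fold r.
    assert (Hm2 : Cmod (z ^ 2)%C <= 1) by (apply Cmod_pow_le1; lra).
    unfold Pz; rewrite !Cpower_eq, <- !Clog1m_Clog, !Cexp_plus, Cexp_RtoC by
      (first [assumption|apply (Cmod1_Re_lt z); [lra|assumption]|apply (Cmod1_Re_lt (z ^ 2)%C); assumption]).
    rewrite Cmult_0_r, Cexp_0, !Cexp_RtoC, exp_0; ring. }
assert (E1 : arc_expansion z 3 1 sg (1 / 6) 0).
{ apply arc_expansion_subordinate with (ka' := 1 / 2 - INR 2 / INR 3)
    (A := Cexp (Csumn (fun j => RtoC (INR (S j) / INR 3 - 1 / 2) * Clog1m (z * unit_root 3 (1 * Z.of_nat (S j))))%C 3
      + RtoC (ln g' - ln (2 * PI) / 2 + (INR 2 / INR 3 - 1 / 2) * ln (INR 3)))); [simpl; lra|].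
  apply (arc_expansion_singular z 3 1 sg 1 g'); try assumption; try reflexivity; try lia.
  - rewrite Hzu, unit_root_mult; apply (unit_root_full 3 1); lia.
  - intros j Hj Hne; rewrite Hzu, unit_root_mult; apply unit_root3_neq1.
    assert (j = 0%nat \/ j = 2%nat) as [-> | ->] by lia; vm_compute; discriminate.
  - replace (INR 2 / INR 3) with (2 / 3) by (simpl; field); exact HG'. }
set (B := fun h : nat => match h with 2%nat => (Pz * RtoC (exp r) * RtoC (sqrt PI) / kp)%C | _ => RtoC 0 end).
assert (HS : forall n, Csumn (fun h => unit_root 3 (- (Z.of_nat h * Z.of_nat n)) * B h)%C 3 = (/ (z ^ (2 * n)) * B 2%nat)%C).
{ intros n; cbn [Csumn]; unfold z; rewrite zeta_unit_root, <- unit_root_neg.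
  replace (Z.of_nat (2 * n)) with (Z.of_nat 2 * Z.of_nat n)%Z by lia.
  replace (B 0%nat) with (RtoC 0) by reflexivity; replace (B 1%nat) with (RtoC 0) by reflexivity; ring. }
assert (HB : 0 < Cmod (B 2%nat)).
{ unfold B, Pz; rewrite !Cpower_eq, Cmod_div, !Cmod_mult, !Cmod_Cexp by assumption.
  unfold kp; rewrite !Cmod_RtoC_pos by (left; first [apply exp_pos|apply sqrt_lt_R0; assumption]).
  apply Rdiv_lt_0_compat; [|exact HsP].
  repeat apply Rmult_lt_0_compat; first [apply exp_pos|apply sqrt_lt_R0; assumption]. }
apply (asymp_normalized _ _ (fun n => normalizer sg (1 / 6) (sqrt (INR n)))
  (fun n => Csumn (fun h => unit_root 3 (- (Z.of_nat h * Z.of_nat n)) * B h)%C 3) (Cmod (B 2%nat)) HB).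
- intros n Hn; assert (Hn0 : 0 < INR n) by (apply lt_0_INR, Hn).
  rewrite HS; pose proof (zeta3_constant g (INR n) Hg Hn0) as E; cbv zeta in E; fold P r in E.
  set (l := sqrt (INR n)) in *; assert (Hl : 0 < l) by (apply sqrt_lt_R0, Hn0).
  unfold normalizer; rewrite HRe.
  assert (HE : (Cexp (RtoC (2 * PI / 3 * sqrt (INR n / 6))) * Cexp (- (2 * sg * RtoC l)))%C = RtoC 1).
  { rewrite <- Cexp_plus, <- Cexp_0; f_equal; unfold sg; rewrite <- !RtoC_mult, <- RtoC_opp, <- RtoC_plus; f_equal.
    rewrite sqrt_div_alt by lra; fold l; unfold P; field; lra. }
  set (Ep := Cexp (RtoC (2 * PI / 3 * sqrt (INR n / 6)))) in *; set (En := Cexp (- (2 * sg * RtoC l))) in *.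
  set (D := 2 * Rpower (6 * PI * INR n) (2 / 3)) in *.
  assert (HD : 0 < D) by (unfold D; pose proof (exp_pos (2 / 3 * ln (6 * PI * INR n))); unfold Rpower; lra).
  unfold B; fold Pz.
  transitivity ((/ z ^ (2 * n) * Pz) * (Ep * En) * RtoC (2 * PI * (g / D) * (Rpower (P / l) (1 / 6) * (sqrt l * (l / P)))))%C.
  + rewrite !(RtoC_mult (2 * PI * (g / D))), (RtoC_mult (2 * PI)), (RtoC_div g) by lra; unfold Pz, Cdiv; ring.
  + rewrite E, HE; unfold kp; rewrite RtoC_div, RtoC_mult by lra; unfold Cdiv; ring.
- intros n; rewrite HS, Cmod_mult; unfold z; rewrite zeta_unit_root, <- unit_root_neg, Cmod_unit_root; lra.
- intros eps Heps; apply (coefficient_asymp z 3 sg (1 / 6) B eps); [lra|lia|lra| |exact Heps].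
  clear eps Heps; intros h Hh eps Heps; rewrite !HRe.
  assert (h = 0%nat \/ h = 1%nat \/ h = 2%nat) as [-> | [-> | ->]] by lia.
  + destruct (arc_nonprimitive z 3 (Z.of_nat 0) sg (1 / 6) eps ltac:(lra) ltac:(lia) ltac:(discriminate) Hsg ltac:(lra) ltac:(lra) Hgap Heps) as (l0 & Hl0 & H).
    exists l0; split; [exact Hl0|]; intros n Hn; specialize (H n Hn); rewrite HRe in H.
    eapply Rle_trans; [|exact H]; right; f_equal; unfold B; ring.
  + destruct (arc_main z 3 1 sg (1 / 6) 0 kp eps ltac:(lra) ltac:(lia) eq_refl Hsg ltac:(lra) ltac:(lra) Hkp Hkp2 Hgap E1 Heps) as (l0 & Hl0 & H).
    exists l0; split; [exact Hl0|]; intros n Hn; specialize (H n Hn); rewrite HRe in H.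
    eapply Rle_trans; [|exact H]; right; f_equal; unfold B; simpl Z.of_nat at 1; field; exact Hkp0.
  + destruct (arc_main z 3 2 sg (1 / 6) _ kp eps ltac:(lra) ltac:(lia) eq_refl Hsg ltac:(lra) ltac:(lra) Hkp Hkp2 Hgap E2 Heps) as (l0 & Hl0 & H).
    exists l0; split; [exact Hl0|]; intros n Hn; specialize (H n Hn); rewrite HRe in H; exact H.
Qed.

Open Scope C_scope.

Theorem theorem3p2 (a b : nat) (ha : (0 < a)%nat) (hb : (0 < b)%nat) :
  let x := (2 * PI * (INR a / INR b))%R in
  let z := zeta b ^ a in
  ((0 < x < theta13)%R ->
    asymp (fun n => Q n z)
      (fun n => Csqrt (1 - z) * Croot4 (Li2 z)
                / RtoC (2 * sqrt PI * Rpower (INR n) (3 / 4))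
                * Cexp (2 * Csqrt (Li2 z) * RtoC (sqrt (INR n)))))
  /\
  ((theta23 < x < PI)%R ->
    asymp (fun n => Q n z)
      (fun n => RtoC (-1) ^ n * Csqrt (1 - z) * Croot4 (Li2 (zeta b ^ (2 * a)))
                / RtoC (2 * sqrt (2 * PI) * Rpower (INR n) (3 / 4))
                * Cexp (Csqrt (Li2 (zeta b ^ (2 * a))) * RtoC (sqrt (INR n)))))
  /\
  ((theta13 < x < theta23)%R -> x <> (2 * PI / 3)%R ->
    asymp (fun n => Q n z)
      (fun n => (/ (zeta 3 ^ n) * omega 1 3 z + / (zeta 3 ^ (2 * n)) * omega 2 3 z)
                * (Croot4 (Li2 (zeta b ^ (3 * a)))
                   / RtoC (2 * sqrt (3 * PI) * Rpower (INR n) (3 / 4)))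
                * Cexp (RtoC (2 / 3) * Csqrt (Li2 (zeta b ^ (3 * a)))
                        * RtoC (sqrt (INR n)))))
  /\
  asymp (fun n => Q n (zeta 3))
    (fun n => / (zeta 3 ^ (2 * n)) * Cpower (1 - zeta 3 ^ 2) (RtoC (1 / 6))
              * Cpower (1 - zeta 3) (RtoC (1 / 2)) * RtoC (Gamma (1 / 3))
              / RtoC (2 * Rpower (6 * PI * INR n) (2 / 3))
              * Cexp (RtoC (2 * PI / 3 * sqrt (INR n / 6)))).
Proof.
intros x z.
assert (Hb : (INR b <> 0)%R) by (apply Rgt_not_eq, lt_0_INR; assumption).
assert (Hz : forall k : nat, zeta b ^ (k * a) = expi (INR k * x)).
{ intros k; rewrite zeta_expi, expi_pow, mult_INR; f_equal; unfold x; field; exact Hb. }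
assert (Hz1 : z = expi x).
{ unfold z; rewrite <- (Nat.mul_1_l a), Hz, Rmult_1_l; reflexivity. }
rewrite Hz1, !Hz; change (INR 2) with 2%R; replace (INR 3) with 3%R by (simpl; ring).
fold (dilog x) (dilog (2 * x)) (dilog (3 * x)).
split; [apply Q_asymp_denominator_1|split; [apply Q_asymp_denominator_2|split; [apply Q_asymp_denominator_3|exact Q_asymp_zeta3]]].
Qed.
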